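(* Let $\Lambda$ be a $k$-graph such that for each $p\in\mathbb N^k$ the restrictions of $r$ and $s$ to $\Lambda^p$ are surjective (onto $\Lambda^0$) and finite-to-one. Let $G_s$ be the stable groupoid of $\Lambda$, let $\Gamma_\Lambda$ be the groupoid of pairs of tail-equivalent one-sided infinite paths (with lag $0$), and let $$Z=\Lambda^\Delta\star\Gamma_\Lambda=\{(x,\gamma)\in\Lambda^\Delta\times\Gamma_\Lambda : \pi(x)=r(\gamma)\}$$ with the relative topology. Then $Z$ is a $(G_s,\Gamma_\Lambda)$-equivalence. In particular $G_s$ is amenable (in the sense of Anantharaman-Delaroche and Renault). Moreover, if $\Lambda$ is irreducible and $\Lambda^0$ is finite, then the stable algebra $S=C^*(G_s)$ is strongly Morita equivalent to the fixed point algebra $C^*(\Lambda)^\alpha$ of the gauge action, and therefore $S$ is an AF-algebra.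
   Context: **$k$-graphs.** Let $k\ge 1$; $\mathbb N=\{0,1,2,\dots\}$; $\mathbb N^k,\mathbb Z^k$ carry the coordinatewise order. A $k$-graph $(\Lambda,d)$ is a countable small category $\Lambda$ with a functor $d:\Lambda\to\mathbb N^k$ (degree) such that whenever $d(\lambda)=n_1+n_2$ there are unique $\nu_1,\nu_2\in\Lambda$ with $\lambda=\nu_1\nu_2$, $d(\nu_i)=n_i$. Put $\Lambda^n=d^{-1}(n)$; objects are identified with $\Lambda^0$; $r,s:\Lambda\to\Lambda^0$ are range and source; $\lambda\mu$ is defined when $s(\lambda)=r(\mu)$. $\Lambda$ is irreducible if for all $u,v\in\Lambda^0$ there is $\lambda$ with $d(\lambda)\neq0$, $r(\lambda)=u$, $s(\lambda)=v$. **Path spaces.** $\Delta=\{(m,n)\in\mathbb Z^k\times\mathbb Z^k:m\le n\}$ and $\Omega=\{(m,n)\in\mathbb N^k\times\mathbb N^k:m\le n\}$ are $k$-graphs with $r(m,n)=m$, $s(m,n)=n$, $(\ell,m)(m,n)=(\ell,n)$, $d(m,n)=n-m$. $\Lambda^\Delta$ (resp. $\Lambda^\Omega$) is the set of degree-preserving functors $\Delta\to\Lambda$ (resp. $\Omega\to\Lambda$); write $x(n)=x(n,n)$. $\Lambda^\Delta$ has the topology with basis the sets $Z(\lambda,n)=\{x:x(n,n+d(\lambda))=\lambda\}$ ($\lambda\in\Lambda$, $n\in\mathbb Z^k$); $\Lambda^\Omega$ the topology with basis $Z(\lambda)=\{x:x(0,d(\lambda))=\lambda\}$. The shift is $(\sigma^n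 x)(\ell,m)=x(\ell+n,m+n)$, for $n\in\mathbb Z^k$ on $\Lambda^\Delta$ and for $n\in\mathbb N^k$ on $\Lambda^\Omega$. $\pi:\Lambda^\Delta\to\Lambda^\Omega$ is restriction to $\Omega$, a continuous open surjection. **Groupoids.** $x\sim_s y$ in $\Lambda^\Delta$ iff there is $m\in\mathbb Z^k$ with $x(m,n)=y(m,n)$ for all $n\ge m$. $G_s=\{(x,y):x\sim_s y\}$ with structure maps $r(x,y)=x$, $s(x,y)=y$, $(x,y)(y,z)=(x,z)$; it is the union of the subgroupoids $G_{s,m}=\{(x,y):x(m,n)=y(m,n)\ \forall n\ge m\}$ ($m\in\mathbb Z^k$), each with the relative topology from $\Lambda^\Delta\times\Lambda^\Delta$, and $G_s$ has the inductive limit topology. $\mathcal G_\Lambda=\{(x,n,y):x,y\in\Lambda^\Omega,\ n\in\mathbb Z^k,\ \sigma^\ell x=\sigma^m y,\ n=\ell-m\text{ for some }\ell,m\in\mathbb N^k\}$ with $r(x,n,y)=x$, $s(x,n,y)=y$, $(x,m,y)(y,n,z)=(x,m+n,z)$, with topology having basis the sets $Z(\lambda,\mu)=\{(x,d(\lambda)-d(\mu),y): x\in Z(\lambda),y\in Z(\mu),\sigma^{d(\lambda)}x=\sigma^{d(\mu)}y\}$ for $s(\lambda)=s(\mu)$. $\Gamma_\Lambda=\{(x,0,y)\in\mathcal G_\Lambda:\sigma^m x=\sigma^m y\text{ for some }m\in\mathbb N^k\}$, an open subgroupoid. **Actions on $Z$.** $\Gamma_\Lambda$ acts on the right of $Z$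 with moment map $(x,\gamma)\mapsto s(\gamma)$ by $(x,\gamma)\gamma'=(x,\gamma\gamma')$; $G_s$ acts on the left with moment map $(x,\gamma)\mapsto x$ by $(w,x)\cdot(x,\gamma)=(w,(\pi(w),0,\pi(x))\gamma)$. **Equivalence.** For locally compact Hausdorff groupoids $G,H$, a $(G,H)$-equivalence is a locally compact Hausdorff space $Z$ that is a free and proper left $G$-space and a free and proper right $H$-space, with commuting actions and open moment maps $\rho:Z\to G^0$, $\sigma:Z\to H^0$, such that $\rho$ induces a bijection $Z/H\to G^0$ and $\sigma$ induces a bijection $G\backslash Z\to H^0$. **Amenability.** $G$ is amenable if there is a net $(m_i)$, each $m_i=\{m_i^x\}_{x\in G^0}$ a continuous system of probability measures $m_i^x$ on $r^{-1}(x)$, with $\|\gamma m_i^{s(\gamma)}-m_i^{r(\gamma)}\|_1\to0$ uniformly on compact subsets of $G$. **$C^*(\Lambda)$.** The universal $C^*$-algebra generated by partial isometries $\{s_\lambda:\lambda\in\Lambda\}$ such that $\{s_v:v\in\Lambda^0\}$ are mutually orthogonal projections; $s_{\lambda\mu}=s_\lambda s_\mu$ if $s(\lambda)=r(\mu)$; $s_\lambda^*s_\lambda=s_{s(\lambda)}$; and $s_v=\sum_{\lambda\in\Lambda^n,r(\lambda)=v}s_\lambda s_\lambda^*$ for $v\in\Lambda^0,n\in\mathbb N^k$. The gauge action $\alpha$ of $\mathbb T^k$ is $\alpha_z(s_\lambda)=z^{d(\lambda)}s_\lambda$. **Haar system on $G_s$** ($\Lambda$ irreducible, $\Lambda^0$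 finite). Let $|\Lambda^p|(u,v)$ be the number of $\lambda\in\Lambda^p$ with $r(\lambda)=u,s(\lambda)=v$. Fix (by Perron–Frobenius) $t\in(0,\infty)^k$ and $a,b:\Lambda^0\to(0,\infty)$ with $\sum_v a(v)b(v)=1$, $\sum_u a(u)|\Lambda^p|(u,v)=t^pa(v)$, $\sum_v|\Lambda^p|(u,v)b(v)=t^pb(u)$ for all $p\in\mathbb N^k$, where $t^p=\prod_i t_i^{p_i}$. For $x\in\Lambda^\Delta$ let $E_x=\{y:y(m,n)=x(m,n)\ \forall\,0\le m\le n\}$ and let $\mu_s^x$ be the measure on $E_x$ with $\mu_s^x(E_x\cap Z(\lambda,-d(\lambda)))=t^{-d(\lambda)}a(r(\lambda))$ for all $\lambda$ with $s(\lambda)=x(0)$. The stable class of $x$ is the increasing union over $p\in\mathbb N^k$ of the sets $\sigma^{-p}E_{\sigma^px}$; the measure on it whose restriction to $\sigma^{-p}E_{\sigma^px}$ is $B\mapsto t^p\mu_s^{\sigma^px}(\sigma^pB)$, multiplied by $\delta_x$, is $\tilde\mu_s^x$, and $\{\tilde\mu_s^x\}$ is the Haar system used to form $S=C^*(G_s)$. *)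

(* Defs.v *)
From HB Require Import structures.
From mathcomp Require Import all_boot all_order all_algebra.
From mathcomp Require Import all_classical all_reals all_analysis.
From mathcomp Require Import finmap complex.

Set Implicit Arguments.
Unset Strict Implicit.
Unset Printing Implicit Defensive.

Import Order.TTheory GRing.Theory Num.Theory.
Import numFieldNormedType.Exports.

Local Open Scope classical_set_scope.
Local Open Scope ring_scope.

Notation NN k := {ffun 'I_k -> nat}.
Notation ZZ k := {ffun 'I_k -> int}.

Definition nle k (m n : NN k) : bool := [forall i, (m i <= n i)%N].
Definition zle k (m n : ZZ k) : bool := [forall i, m i <= n i].
Definition zvec k (n : NN k) : ZZ k := [ffun i => (n i)%:Z].

Lemma zvecD k (m n : NN k) : zvec (m + n) = zvec m + zvec n.
Proof. by apply/ffunP => i; rewrite !ffunE PoszD. Qed.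

Lemma zle_zvec k (m n : NN k) : nle m n -> zle (zvec m) (zvec n).
Proof. by move/forallP=> h; apply/forallP => i; rewrite !ffunE lez_nat. Qed.

Lemma zle_add k (m n : ZZ k) (p : ZZ k) : zle m n -> zle (m + p) (n + p).
Proof. by move/forallP=> h; apply/forallP => i; rewrite !ffunE lerD2r. Qed.

Lemma nle_add k (m n : NN k) (p : NN k) : nle m n -> nle (m + p) (n + p).
Proof. by move/forallP=> h; apply/forallP => i; rewrite !ffunE leq_add2r. Qed.

Lemma zle_addr k (m : ZZ k) (p : NN k) : zle m (m + zvec p).
Proof. by apply/forallP => i; rewrite !ffunE lerDl. Qed.

Lemma nle0v k (m : NN k) : nle 0 m.
Proof. by apply/forallP => i; rewrite ffunE. Qed.

Lemma zle_trans k (m n p : ZZ k) : zle m n -> zle n p -> zle m p.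
Proof.
move=> /forallP h /forallP h'; apply/forallP => i; exact: le_trans (h' i).
Qed.

Definition zpos k (m : ZZ k) : NN k := [ffun i => `|m i|%N].

Lemma zle_zpos k (m : ZZ k) : zle m (zvec (zpos m)).
Proof. by apply/forallP => i; rewrite !ffunE abszE ler_norm. Qed.

(* Objects and the morphisms of degree 0 are kept apart; by unique factorization
   [kid] is a bijection between them. *)
Record kgraph (k : nat) := KGraph {
  kobj : countType;
  kmor : countType;
  kr : kmor -> kobj;
  ks : kmor -> kobj;
  kid : kobj -> kmor;
  kcomp : forall l m : kmor, ks l = kr m -> kmor;
  kdeg : kmor -> NN k;
  kr_id : forall v, kr (kid v) = v;
  ks_id : forall v, ks (kid v) = v;
  kr_comp : forall l m (h : ks l = kr m), kr (kcomp h) = kr l;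
  ks_comp : forall l m (h : ks l = kr m), ks (kcomp h) = ks m;
  kid_comp : forall l (h : ks (kid (kr l)) = kr l), kcomp h = l;
  kcomp_id : forall l (h : ks l = kr (kid (ks l))), kcomp h = l;
  kcompA : forall a b c (hab : ks a = kr b) (hbc : ks b = kr c)
             (h1 : ks (kcomp hab) = kr c) (h2 : ks a = kr (kcomp hbc)),
             kcomp h1 = kcomp h2;
  kdeg_id : forall v, kdeg (kid v) = 0;
  kdeg_comp : forall l m (h : ks l = kr m), kdeg (kcomp h) = kdeg l + kdeg m;
  kfact : forall l n1 n2, kdeg l = n1 + n2 ->
    exists! nu : kmor * kmor,
      (exists h : ks nu.1 = kr nu.2, l = kcomp h) /\
      kdeg nu.1 = n1 /\ kdeg nu.2 = n2
}.

Definition regular_kgraph k (L : kgraph k) : Prop :=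
  forall (p : NN k) (v : kobj L),
    [/\ (exists l : kmor L, kdeg l = p /\ kr l = v),
        (exists l : kmor L, kdeg l = p /\ ks l = v),
        finite_set [set l : kmor L | kdeg l = p /\ kr l = v] &
        finite_set [set l : kmor L | kdeg l = p /\ ks l = v]].

Definition irreducible_kgraph k (L : kgraph k) : Prop :=
  forall u v : kobj L, exists l : kmor L, [/\ kdeg l <> 0, kr l = u & ks l = v].

(* The order proofs are proofs of boolean statements, hence irrelevant. *)
Record dpath k (L : kgraph k) := DPath {
  dvert : ZZ k -> kobj L;
  darr : forall m n : ZZ k, zle m n -> kmor L;
  dpath_r : forall m n (h : zle m n), kr (darr h) = dvert m;
  dpath_s : forall m n (h : zle m n), ks (darr h) = dvert n;
  dpath_id : forall m (h : zle m m), darr h = kid (dvert m);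
  dpath_comp : forall l m n (hlm : zle l m) (hmn : zle m n) (hln : zle l n)
                 (h : ks (darr hlm) = kr (darr hmn)), darr hln = kcomp h;
  dpath_deg : forall m n (h : zle m n), zvec (kdeg (darr h)) = n - m
}.

Record opath k (L : kgraph k) := OPath {
  overt : NN k -> kobj L;
  oarr : forall m n : NN k, nle m n -> kmor L;
  opath_r : forall m n (h : nle m n), kr (oarr h) = overt m;
  opath_s : forall m n (h : nle m n), ks (oarr h) = overt n;
  opath_id : forall m (h : nle m m), oarr h = kid (overt m);
  opath_comp : forall l m n (hlm : nle l m) (hmn : nle m n) (hln : nle l n)
                 (h : ks (oarr hlm) = kr (oarr hmn)), oarr hln = kcomp h;
  opath_deg : forall m n (h : nle m n), m + kdeg (oarr h) = n
}.

HB.instance Definition _ k (L : kgraph k) := gen_eqMixin (dpath L).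
HB.instance Definition _ k (L : kgraph k) := gen_choiceMixin (dpath L).
HB.instance Definition _ k (L : kgraph k) := gen_eqMixin (opath L).
HB.instance Definition _ k (L : kgraph k) := gen_choiceMixin (opath L).

Definition dcyl k (L : kgraph k) (l : kmor L) (n : ZZ k) : set (dpath L) :=
  [set x | darr x (zle_addr n (kdeg l)) = l].

Definition ocyl k (L : kgraph k) (l : kmor L) : set (opath L) :=
  [set x | oarr x (nle0v (kdeg l)) = l].

(* The cylinder sets are a base; the topology they generate as a subbase is
   therefore the one having them as a base. *)
HB.instance Definition _ k (L : kgraph k) :=
  @isSubBaseTopological.Build (dpath L) (set (dpath L))
    [set A | exists l n, A = dcyl l n] idfun.
HB.instance Definition _ k (L : kgraph k) :=
  @isSubBaseTopological.Build (opath L) (set (opath L))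
    [set A | exists l, A = ocyl l] idfun.

Section Shifts.
Variables (k : nat) (L : kgraph k).

Program Definition dshift (p : ZZ k) (x : dpath L) : dpath L :=
  @DPath k L (fun m => dvert x (m + p)) (fun m n h => darr x (zle_add p h))
    _ _ _ _ _.
Next Obligation. by move=> p x m n h; exact: dpath_r. Qed.
Next Obligation. by move=> p x m n h; exact: dpath_s. Qed.
Next Obligation. by move=> p x m h; exact: dpath_id. Qed.
Next Obligation. by move=> p x l m n hlm hmn hln h; exact: dpath_comp. Qed.
Next Obligation.
by move=> p x m n h; rewrite dpath_deg opprD addrACA subrr addr0.
Qed.

Program Definition oshift (p : NN k) (x : opath L) : opath L :=
  @OPath k L (fun m => overt x (m + p)) (fun m n h => oarr x (nle_add p h))
    _ _ _ _ _.
Next Obligation. by move=> p x m n h; exact: opath_r. Qed.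
Next Obligation. by move=> p x m n h; exact: opath_s. Qed.
Next Obligation. by move=> p x m h; exact: opath_id. Qed.
Next Obligation. by move=> p x l m n hlm hmn hln h; exact: opath_comp. Qed.
Next Obligation.
move=> p x m n h; have /ffunP e := opath_deg x (nle_add p h).
apply/ffunP => i; have := e i; rewrite !ffunE.
by rewrite -addrA [p i + _]addrC addrA => /eqP; rewrite eqn_add2r => /eqP.
Qed.

Program Definition restr (x : dpath L) : opath L :=
  @OPath k L (fun m => dvert x (zvec m)) (fun m n h => darr x (zle_zvec h))
    _ _ _ _ _.
Next Obligation. by move=> x m n h; exact: dpath_r. Qed.
Next Obligation. by move=> x m n h; exact: dpath_s. Qed.
Next Obligation. by move=> x m h; exact: dpath_id. Qed.
Next Obligation. by move=> x l m n hlm hmn hln h; exact: dpath_comp. Qed.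
Next Obligation.
move=> x m n h; have /ffunP e := dpath_deg x (zle_zvec h).
apply/ffunP => i; have := e i; rewrite !ffunE => e'.
by apply/eqP; rewrite -eqz_nat PoszD e' addrC subrK.
Qed.

Lemma opath_eq (x y : opath L) :
  (forall m n (h : nle m n), oarr x h = oarr y h) -> x = y.
Proof.
case: x y => [xv xa xr xs xi xc xd] [yv ya yr ys yi yc yd] /= e.
have ea : xa = ya.
  by apply: functional_extensionality_dep => m;
     apply: functional_extensionality_dep => n;
     apply: functional_extensionality_dep => h; exact: e.
have ev : xv = yv.
  apply: funext => m; have h : nle m m by apply/forallP.
  by rewrite -(xr _ _ h) -(yr _ _ h) e.
subst ya yv; congr OPath; exact: Prop_irrelevance.
Qed.

Lemma oshiftD (p q : NN k) (x : opath L) :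
  oshift p (oshift q x) = oshift (p + q) x.
Proof.
apply: opath_eq => m n h /=.
move: (nle_add q (nle_add p h)) (nle_add (p + q) h); rewrite !addrA => h1 h2.
by rewrite (bool_irrelevance h1 h2).
Qed.

End Shifts.

Record groupoid := Groupoid {
  gobj : topologicalType;
  garr : topologicalType;
  gr : garr -> gobj;
  gs : garr -> gobj;
  gid : gobj -> garr;
  ginv : garr -> garr;
  gmul : forall a b : garr, gs a = gr b -> garr;
  gr_id : forall u, gr (gid u) = u;
  gs_id : forall u, gs (gid u) = u;
  gr_inv : forall a, gr (ginv a) = gs a;
  gs_inv : forall a, gs (ginv a) = gr a;
  gr_mul : forall a b (h : gs a = gr b), gr (gmul h) = gr a;
  gs_mul : forall a b (h : gs a = gr b), gs (gmul h) = gs b;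
  gmulA : forall a b c (hab : gs a = gr b) (hbc : gs b = gr c)
            (h1 : gs (gmul hab) = gr c) (h2 : gs a = gr (gmul hbc)),
            gmul h1 = gmul h2;
  gid_mul : forall a (h : gs (gid (gr a)) = gr a), gmul h = a;
  gmul_id : forall a (h : gs a = gr (gid (gs a))), gmul h = a;
  ginv_mul : forall a (h : gs (ginv a) = gr a), gmul h = gid (gs a);
  gmul_inv : forall a (h : gs a = gr (ginv a)), gmul h = gid (gr a)
}.

Definition composable (G : groupoid) : set (garr G * garr G) :=
  [set p | gs p.1 = gr p.2].
Arguments composable : clear implicits.

Definition gmul_composable (G : groupoid) (p : composable G) : garr G :=
  gmul (set_mem (valP p)).

Definition lc_hausdorff (T : topologicalType) : Prop :=
  hausdorff_space T /\ locally_compact [set: T].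

Record lc_hausdorff_groupoid (G : groupoid) : Prop := {
  lchg_arr : lc_hausdorff (garr G);
  lchg_obj : lc_hausdorff (gobj G);
  lchg_r : continuous (@gr G);
  lchg_s : continuous (@gs G);
  lchg_id : continuous (@gid G);
  lchg_inv : continuous (@ginv G);
  lchg_mul : continuous (@gmul_composable G)
}.

Definition proper_map (S T : topologicalType) (f : S -> T) : Prop :=
  continuous f /\ forall K : set T, compact K -> compact (f @^-1` K).

Section LeftAction.
Variables (G : groupoid) (Z : topologicalType) (rho : Z -> gobj G).
Variable act : forall g z, gs g = rho z -> Z.

Definition left_fib : set (garr G * Z) := [set p | gs p.1 = rho p.2].

Definition left_act_map (p : left_fib) : Z := act (set_mem (valP p)).

Record left_space : Prop := {
  ls_moment : continuous rho;
  ls_act : continuous left_act_map;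
  ls_rho : forall g z (h : gs g = rho z), rho (act h) = gr g;
  ls_id : forall z (h : gs (gid (rho z)) = rho z), act h = z;
  ls_mul : forall g1 g2 z (h12 : gs g1 = gr g2) (h2 : gs g2 = rho z)
             (h : gs (gmul h12) = rho z) (h1 : gs g1 = rho (act h2)),
             act h = act h1
}.

Definition left_free : Prop :=
  forall g z (h : gs g = rho z), act h = z -> g = gid (rho z).

Definition left_proper : Prop :=
  proper_map (fun p : left_fib => (left_act_map p, (val p).2)).

End LeftAction.

Section RightAction.
Variables (H : groupoid) (Z : topologicalType) (sig : Z -> gobj H).
Variable act : forall z g, sig z = gr g -> Z.

Definition right_fib : set (Z * garr H) := [set p | sig p.1 = gr p.2].

Definition right_act_map (p : right_fib) : Z := act (set_mem (valP p)).

Record right_space : Prop := {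
  rs_moment : continuous sig;
  rs_act : continuous right_act_map;
  rs_sig : forall z g (h : sig z = gr g), sig (act h) = gs g;
  rs_id : forall z (h : sig z = gr (gid (sig z))), act h = z;
  rs_mul : forall z g1 g2 (h12 : gs g1 = gr g2) (h1 : sig z = gr g1)
             (h : sig z = gr (gmul h12)) (h2 : sig (act h1) = gr g2),
             act h = act h2
}.

Definition right_free : Prop :=
  forall z g (h : sig z = gr g), act h = z -> g = gid (sig z).

Definition right_proper : Prop :=
  proper_map (fun p : right_fib => ((val p).1, right_act_map p)).

End RightAction.

Definition open_map (S T : topologicalType) (f : S -> T) : Prop :=
  forall U : set S, open U -> open (f @` U).

(* [ge_rho_surj] and [ge_rho_orbit] say that rho induces a bijection from the
   orbit space Z/H to the units of G; likewise for sig and the G-orbits. *)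
Record groupoid_equivalence (G H : groupoid) (Z : topologicalType)
    (rho : Z -> gobj G) (sig : Z -> gobj H)
    (lact : forall g z, gs g = rho z -> Z)
    (ract : forall z h, sig z = gr h -> Z) : Prop := {
  ge_left_lch : lc_hausdorff_groupoid G;
  ge_right_lch : lc_hausdorff_groupoid H;
  ge_lch : lc_hausdorff Z;
  ge_left : left_space lact;
  ge_left_free : left_free lact;
  ge_left_proper : left_proper lact;
  ge_right : right_space ract;
  ge_right_free : right_free ract;
  ge_right_proper : right_proper ract;
  ge_commute : forall g z h (hg : gs g = rho z) (hh : sig z = gr h)
                 (h1 : gs g = rho (ract z h hh)) (h2 : sig (lact g z hg) = gr h),
                 lact g _ h1 = ract _ h h2;
  ge_rho_open : open_map rho;
  ge_sig_open : open_map sig;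
  ge_rho_surj : forall u, exists z, rho z = u;
  ge_rho_orbit : forall z w,
    rho z = rho w <-> exists h (e : sig z = gr h), w = ract z h e;
  ge_sig_surj : forall u, exists z, sig z = u;
  ge_sig_orbit : forall z w,
    sig z = sig w <-> exists g (e : gs g = rho z), w = lact g z e
}.

Section StableGroupoid.
Variables (k : nat) (L : kgraph k).

Definition agree (m : ZZ k) (x y : dpath L) : Prop :=
  forall n (h : zle m n), darr x h = darr y h.

Record stab := Stab {
  stab_r : dpath L;
  stab_s : dpath L;
  stab_rel : exists m, agree m stab_r stab_s
}.

HB.instance Definition _ := gen_eqMixin stab.
HB.instance Definition _ := gen_choiceMixin stab.

(* The inductive limit topology is the final topology for the inclusions of the
   levels, each carrying the topology of a subspace of the product. *)
Definition stab_level (m : ZZ k) : set (dpath L * dpath L) :=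
  [set xy | agree m xy.1 xy.2].

Definition stab_incl (m : ZZ k) (p : stab_level m) : stab :=
  @Stab (val p).1 (val p).2 (ex_intro _ m (set_mem (valP p))).

Definition stab_open : set (set stab) :=
  [set U | forall m : ZZ k, open (@stab_incl m @^-1` U)].

Lemma stab_openT : stab_open setT.
Proof. by move=> m; rewrite preimage_setT; exact: openT. Qed.

Lemma stab_openI : setI_closed stab_open.
Proof. by move=> U V oU oV m; rewrite preimage_setI; exact: openI. Qed.

Lemma stab_open_bigU (I : Type) (f : I -> set stab) :
  (forall i, stab_open (f i)) -> stab_open (\bigcup_i f i).
Proof.
move=> of_ m; rewrite preimage_bigcup.
by apply: bigcup_open => i _; exact: of_.
Qed.

HB.instance Definition _ :=
  isOpenTopological.Build stab stab_openT stab_openI stab_open_bigU.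

Lemma stab_eq (a b : stab) :
  stab_r a = stab_r b -> stab_s a = stab_s b -> a = b.
Proof.
case: a b => [x y e] [x' y' e'] /= ? ?; subst.
by congr Stab; exact: Prop_irrelevance.
Qed.

Lemma agree_refl x : exists m, agree m x x.
Proof. by exists 0. Qed.

Lemma agree_sym x y : (exists m, agree m x y) -> exists m, agree m y x.
Proof. by case=> m e; exists m => n h; rewrite e. Qed.

Lemma dpath_suffix (x y : dpath L) (l m n : ZZ k)
    (hlm : zle l m) (hmn : zle m n) (hln : zle l n) :
  darr x hln = darr y hln -> darr x hmn = darr y hmn.
Proof.
move=> e.
have cx : ks (darr x hlm) = kr (darr x hmn) by rewrite dpath_s dpath_r.
have cy : ks (darr y hlm) = kr (darr y hmn) by rewrite dpath_s dpath_r.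
have dd (z z' : dpath L) a b (h : zle a b) : kdeg (darr z h) = kdeg (darr z' h).
  have /ffunP e1 := dpath_deg z h; have /ffunP e2 := dpath_deg z' h.
  apply/ffunP => i; have := e1 i; rewrite -(e2 i) !ffunE => /eqP.
  by rewrite eqz_nat => /eqP.
have ex := dpath_comp hln cx; have ey := dpath_comp hln cy.
have dx : kdeg (darr x hln) = kdeg (darr x hlm) + kdeg (darr x hmn).
  by rewrite ex kdeg_comp.
have [nu [_ un]] := kfact dx.
have u1 := un (darr x hlm, darr x hmn)
  (conj (ex_intro _ cx ex) (conj erefl erefl)).
have u2 := un (darr y hlm, darr y hmn)
  (conj (ex_intro _ cy (etrans e ey)) (conj (dd y x _ _ _) (dd y x _ _ _))).
by have [_ ->] : (darr x hlm, darr x hmn) = (darr y hlm, darr y hmn)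
  by rewrite -u1 -u2.
Qed.

Lemma agree_le m p x y : zle m p -> agree m x y -> agree p x y.
Proof.
move=> hmp e n hpn; have hmn := zle_trans hmp hpn.
by apply: (dpath_suffix hmp hpn (hln := hmn)); exact: e.
Qed.

Lemma agree_trans x y z : (exists m, agree m x y) -> (exists m, agree m y z) ->
  exists m, agree m x z.
Proof.
move=> [m e] [m' e']; pose p : ZZ k := [ffun i => Num.max (m i) (m' i)].
exists p => n h.
have hm : zle m p by apply/forallP => i; rewrite ffunE le_max lexx.
have hm' : zle m' p by apply/forallP => i; rewrite ffunE le_max lexx orbT.
by rewrite (agree_le hm e) (agree_le hm' e').
Qed.

Definition stab_id (x : dpath L) : stab := Stab (agree_refl x).
Definition stab_inv (a : stab) : stab := Stab (agree_sym (stab_rel a)).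

Lemma stab_mul_rel (a b : stab) : stab_s a = stab_r b ->
  exists m, agree m (stab_r a) (stab_s b).
Proof.
move=> h; apply: (agree_trans (stab_rel a)); rewrite h; exact: stab_rel.
Qed.

Definition stab_mul (a b : stab) (h : stab_s a = stab_r b) : stab :=
  Stab (stab_mul_rel h).

Definition stable_groupoid : groupoid.
Proof.
by refine (@Groupoid (dpath L) stab stab_r stab_s stab_id stab_inv stab_mul
  _ _ _ _ _ _ _ _ _ _ _) => //; move=> *; exact: stab_eq.
Defined.

End StableGroupoid.

Section PathGroupoid.
Variables (k : nat) (L : kgraph k).

Record pgpd := PGpd {
  pg_r : opath L;
  pg_lag : ZZ k;
  pg_s : opath L;
  pg_rel : exists l m : NN k,
    oshift l pg_r = oshift m pg_s /\ pg_lag = zvec l - zvec m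
}.

HB.instance Definition _ := gen_eqMixin pgpd.
HB.instance Definition _ := gen_choiceMixin pgpd.

Definition pgcyl (l m : kmor L) : set pgpd :=
  [set g | [/\ ocyl l (pg_r g), ocyl m (pg_s g),
               pg_lag g = zvec (kdeg l) - zvec (kdeg m) &
               oshift (kdeg l) (pg_r g) = oshift (kdeg m) (pg_s g)]].

HB.instance Definition _ :=
  @isSubBaseTopological.Build pgpd (set pgpd)
    [set A | exists l m, ks l = ks m /\ A = pgcyl l m] idfun.

Definition tail_eq (x y : opath L) : Prop :=
  exists m : NN k, oshift m x = oshift m y.

(* As a subset of [pgpd], it gets the relative topology. *)
Definition tail_set : set pgpd :=
  [set g | pg_lag g = 0 /\ tail_eq (pg_r g) (pg_s g)].

Definition tail_arr : topologicalType := set_type tail_set.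

Definition tail_r (g : tail_arr) : opath L := pg_r (val g).
Definition tail_s (g : tail_arr) : opath L := pg_s (val g).

Lemma tail_pg_rel (x y : opath L) : tail_eq x y ->
  exists l m : NN k, oshift l x = oshift m y /\ 0 = zvec l - zvec m.
Proof. by case=> m e; exists m, m; rewrite subrr. Qed.

Lemma tail_mkP (x y : opath L) (h : tail_eq x y) :
  PGpd (tail_pg_rel h) \in tail_set.
Proof. by apply/mem_set; split. Qed.

Definition tail_mk (x y : opath L) (h : tail_eq x y) : tail_arr :=
  exist _ (PGpd (tail_pg_rel h)) (tail_mkP h).

Lemma tail_rel (g : tail_arr) : tail_eq (tail_r g) (tail_s g).
Proof. exact: (proj2 (set_mem (valP g))). Qed.

Lemma tail_arr_eq (a b : tail_arr) :
  tail_r a = tail_r b -> tail_s a = tail_s b -> a = b.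
Proof.
case: a b => [[x n y e] p] [[x' n' y' e'] p'] er es; apply: val_inj => /=.
have hn : n = 0 by case: (set_mem p).
have hn' : n' = 0 by case: (set_mem p').
rewrite /tail_r /tail_s /= in er es; clear p p'.
by subst; congr PGpd; exact: Prop_irrelevance.
Qed.

Lemma tail_eq_refl x : tail_eq x x. Proof. by exists 0. Qed.

Lemma tail_eq_sym x y : tail_eq x y -> tail_eq y x.
Proof. by case=> m e; exists m. Qed.

Lemma tail_eq_trans x y z : tail_eq x y -> tail_eq y z -> tail_eq x z.
Proof.
move=> [m e] [n e']; exists (m + n).
by rewrite {1}addrC -!oshiftD e -e' !oshiftD addrC.
Qed.

Definition tail_id (x : opath L) : tail_arr := tail_mk (tail_eq_refl x).
Definition tail_inv (a : tail_arr) : tail_arr :=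
  tail_mk (tail_eq_sym (tail_rel a)).

Lemma tail_mul_rel (a b : tail_arr) : tail_s a = tail_r b ->
  tail_eq (tail_r a) (tail_s b).
Proof.
by move=> h; apply: (tail_eq_trans (tail_rel a)); rewrite h; exact: tail_rel.
Qed.

Definition tail_mul (a b : tail_arr) (h : tail_s a = tail_r b) : tail_arr :=
  tail_mk (tail_mul_rel h).

Definition tail_groupoid : groupoid.
Proof.
by refine (@Groupoid (opath L) tail_arr tail_r tail_s tail_id tail_inv tail_mul
  _ _ _ _ _ _ _ _ _ _ _) => //; move=> *; exact: tail_arr_eq.
Defined.

End PathGroupoid.

Section EquivalenceSpace.
Variables (k : nat) (L : kgraph k).

Let G := stable_groupoid L.
Let H := tail_groupoid L.

Definition zset : set (dpath L * tail_arr L) :=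
  [set p | restr p.1 = tail_r p.2].

Definition zspace : topologicalType := set_type zset.

Definition zrho (z : zspace) : gobj G := (val z).1.
Definition zsig (z : zspace) : gobj H := tail_s (val z).2.

Lemma restr_tail_eq (a : stab L) :
  tail_eq (restr (stab_r a)) (restr (stab_s a)).
Proof.
case: a => x y /= [m e]; exists (zpos m).
have e' := agree_le (zle_zpos m) e; apply: opath_eq => p q h /=.
have hmp : zle (zvec (zpos m)) (zvec (p + zpos m)).
  by rewrite zvecD addrC zle_addr.
have hpq := zle_zvec (nle_add (zpos m) h).
apply: (dpath_suffix hmp (zle_zvec (nle_add (zpos m) h))
  (hln := zle_trans hmp hpq)).
exact: e'.
Qed.

Lemma zlact_comp (a : stab L) (z : zspace) : stab_s a = zrho z ->
  tail_s (tail_mk (restr_tail_eq a)) = tail_r (val z).2.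
Proof.
by move=> h; rewrite /tail_s /= h; exact: (set_mem (valP z)).
Qed.

Lemma zlact_mem (a : stab L) (z : zspace) (h : stab_s a = zrho z) :
  (stab_r a, tail_mul (zlact_comp h)) \in zset.
Proof. exact/mem_set. Qed.

Definition zlact (a : garr G) (z : zspace) (h : gs a = zrho z) : zspace :=
  exist _ (stab_r a, tail_mul (zlact_comp h)) (zlact_mem h).

Lemma zract_mem (z : zspace) (g : tail_arr L) (h : tail_s (val z).2 = tail_r g) :
  ((val z).1, tail_mul h) \in zset.
Proof. by apply/mem_set; exact: (set_mem (valP z)). Qed.

Definition zract (z : zspace) (g : garr H) (h : zsig z = gr g) : zspace :=
  exist _ ((val z).1, tail_mul h) (zract_mem h).

End EquivalenceSpace.

(* Measurable types of the library are pointed; a point of the underlying space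
   is supplied explicitly, so that possibly empty spaces can be handled. *)
Definition pointed_at (T : topologicalType) (t0 : T) : Type := T.
HB.instance Definition _ (T : topologicalType) (t0 : T) :=
  Choice.on (pointed_at t0).
HB.instance Definition _ (T : topologicalType) (t0 : T) :=
  isPointed.Build (pointed_at t0) t0.

Notation borel t0 :=
  (g_sigma_algebraType (open : set (set (pointed_at t0)))).

Definition Cx (R : realType) : numClosedFieldType := R[i].

Definition Cre (R : realType) (z : Cx R) : R := complex.Re z.
Definition Cim (R : realType) (z : Cx R) : R := complex.Im z.
Definition Cmk (R : realType) (a b : R) : Cx R := (a +i* b)%C.

Definition cint (R : realType) (T : topologicalType) (t0 : T)
    (mu : {measure set (borel t0) -> \bar R}) (f : T -> Cx R) : Cx R :=
  Cmk (\int[mu]_x Cre (f x)) (\int[mu]_x Cim (f x)).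

Definition Cc (R : realType) (T : topologicalType) : set (T -> Cx R) :=
  [set f | continuous f /\
           exists K : set T, compact K /\ forall x, ~ K x -> f x = 0].

Definition variation_dist (R : realType) (T : topologicalType)
    (m1 m2 : set T -> \bar R) : \bar R :=
  ereal_sup [set v | exists n (B : 'I_n -> set T),
    [/\ forall i, <<s @open T >> (B i),
        forall i j, i != j -> B i `&` B j = set0 &
        v = (\sum_(i < n) `|m1 (B i) - m2 (B i)|)%E]].

Definition translate (R : realType) (G : groupoid) (g : garr G)
    (m : set (garr G) -> \bar R) : set (garr G) -> \bar R :=
  fun B => m [set e | exists h : gs g = gr e, B (gmul h)].

(* The probability measures are Borel measures: on a second countable locally
   compact Hausdorff space, such as the stable groupoid, they are Radon. *)
Definition amenable (R : realType) (G : groupoid) : Prop :=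
  exists (I : Type) (le : I -> I -> Prop)
         (m : I -> forall x : gobj G, probability (borel (gid x)) R),
    [/\ [/\ inhabited I, (forall i, le i i),
            (forall i j l, le i j -> le j l -> le i l) &
            (forall i j, exists l, le i l /\ le j l)],
        (forall i x, m i x [set g | gr g = x] = 1%E),
        (forall i f, Cc (R := R) f -> continuous (fun x => cint (m i x) f)) &
        forall (K : set (garr G)) (e : R), compact K -> 0 < e ->
          exists i0, forall i, le i0 i -> forall g, K g ->
            (variation_dist (translate g (m i (gs g))) (m i (gr g)) <= e%:E)%E].

Record cstar_algebra (R : realType) := CstarAlgebra {
  csort :> completeNormedModType (Cx R);
  cmul : csort -> csort -> csort;
  cstar : csort -> csort;
  cmulA : forall a b c, cmul a (cmul b c) = cmul (cmul a b) c;
  cmulDl : forall a b c, cmul (a + b) c = cmul a c + cmul b c;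
  cmulDr : forall a b c, cmul a (b + c) = cmul a b + cmul a c;
  cmulZl : forall z a b, cmul (z *: a) b = z *: cmul a b;
  cmulZr : forall z a b, cmul a (z *: b) = z *: cmul a b;
  cstarD : forall a b, cstar (a + b) = cstar a + cstar b;
  cstarZ : forall z a, cstar (z *: a) = z^* *: cstar a;
  cstarM : forall a b, cstar (cmul a b) = cmul (cstar b) (cstar a);
  cstarK : forall a, cstar (cstar a) = a;
  cnormM : forall a b, `|cmul a b| <= `|a| * `|b|;
  cnorm_star : forall a, `|cmul (cstar a) a| = `|a| ^+ 2
}.

Arguments cmul {R _}.
Arguments cstar {R _}.

Section CstarNotions.
Variable R : realType.
Implicit Types A B : cstar_algebra R.

Definition star_hom A B (f : A -> B) : Prop :=
  [/\ forall a b, f (a + b) = f a + f b,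
      forall z a, f (z *: a) = z *: f a,
      forall a b, f (cmul a b) = cmul (f a) (f b) &
      forall a, f (cstar a) = cstar (f a)].

Definition star_subalgebra A (D : set A) : Prop :=
  [/\ D 0,
      forall a b, D a -> D b -> D (a + b),
      forall z a, D a -> D (z *: a),
      forall a b, D a -> D b -> D (cmul a b) &
      forall a, D a -> D (cstar a)].

Definition generates A (X : set A) : Prop :=
  forall D : set A, closed D -> star_subalgebra D -> X `<=` D -> D = setT.

Definition positive A (a : A) : Prop := exists b : A, a = cmul (cstar b) b.

Definition finite_dim A (D : set A) : Prop :=
  exists n (e : 'I_n -> A), forall a, D a ->
    exists z : 'I_n -> Cx R, a = \sum_(i < n) z i *: e i.

Definition AF_algebra A : Prop :=
  exists F : nat -> set A,
    [/\ forall n, star_subalgebra (F n) /\ finite_dim (F n),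
        forall n, F n `<=` F n.+1 &
        closure (\bigcup_n F n) = setT].

Record imprimitivity_bimodule A B (X : completeNormedModType (Cx R))
    (la : A -> X -> X) (ra : X -> B -> X)
    (lip : X -> X -> A) (rip : X -> X -> B) : Prop := {
  ib_laDl : forall a a' x, la (a + a') x = la a x + la a' x;
  ib_laDr : forall a x x', la a (x + x') = la a x + la a x';
  ib_laZl : forall z a x, la (z *: a) x = z *: la a x;
  ib_laZr : forall z a x, la a (z *: x) = z *: la a x;
  ib_laM : forall a a' x, la (cmul a a') x = la a (la a' x);
  ib_raDl : forall x x' b, ra (x + x') b = ra x b + ra x' b;
  ib_raDr : forall x b b', ra x (b + b') = ra x b + ra x b';
  ib_raZl : forall z x b, ra (z *: x) b = z *: ra x b;
  ib_raZr : forall z x b, ra x (z *: b) = z *: ra x b;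
  ib_raM : forall x b b', ra x (cmul b b') = ra (ra x b) b';
  ib_assoc : forall a x b, ra (la a x) b = la a (ra x b);
  ib_lipD : forall x x' y, lip (x + x') y = lip x y + lip x' y;
  ib_lipZ : forall z x y, lip (z *: x) y = z *: lip x y;
  ib_lip_star : forall x y, cstar (lip x y) = lip y x;
  ib_lip_la : forall a x y, lip (la a x) y = cmul a (lip x y);
  ib_lip_pos : forall x, positive (lip x x);
  ib_lip_full : closure [set a | exists n (x y : 'I_n -> X),
                   a = \sum_(i < n) lip (x i) (y i)] = setT;
  ib_lip_norm : forall x, `|lip x x| = `|x| ^+ 2;
  ib_ripD : forall x y y', rip x (y + y') = rip x y + rip x y';
  ib_ripZ : forall z x y, rip x (z *: y) = z *: rip x y;
  ib_rip_star : forall x y, cstar (rip x y) = rip y x;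
  ib_rip_ra : forall x y b, rip x (ra y b) = cmul (rip x y) b;
  ib_rip_pos : forall x, positive (rip x x);
  ib_rip_full : closure [set b | exists n (x y : 'I_n -> X),
                   b = \sum_(i < n) rip (x i) (y i)] = setT;
  ib_rip_norm : forall x, `|rip x x| = `|x| ^+ 2;
  ib_rip_la : forall a x y, rip (la a x) y = rip x (la (cstar a) y);
  ib_lip_ra : forall x b y, lip (ra x b) y = lip x (ra y (cstar b));
  ib_compat : forall x y z, la (lip x y) z = ra x (rip y z)
}.

Definition strongly_morita_equivalent A B : Prop :=
  exists (X : completeNormedModType (Cx R)) la ra lip rip,
    @imprimitivity_bimodule A B X la ra lip rip.

End CstarNotions.

Section KGraphAlgebra.
Variables (R : realType) (k : nat) (L : kgraph k).

Record ck_family (A : cstar_algebra R) (s : kmor L -> A) : Prop := {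
  ck_pi : forall l, cmul (cmul (s l) (cstar (s l))) (s l) = s l;
  ck_proj : forall v, cstar (s (kid v)) = s (kid v) /\
                      cmul (s (kid v)) (s (kid v)) = s (kid v);
  ck_orth : forall u v, u <> v -> cmul (s (kid u)) (s (kid v)) = 0;
  ck_comp : forall l m (h : ks l = kr m), s (kcomp h) = cmul (s l) (s m);
  ck_source : forall l, cmul (cstar (s l)) (s l) = s (kid (ks l));
  ck_range : forall v n, s (kid v) =
    \sum_(l \in [set l | kdeg l = n /\ kr l = v]) cmul (s l) (cstar (s l))
}.

(* C*(L), characterized up to isomorphism by its universal property. *)
Definition is_kgraph_algebra (A : cstar_algebra R) (s : kmor L -> A) : Prop :=
  [/\ ck_family s, generates (range s) &
      forall (B : cstar_algebra R) (t : kmor L -> B), ck_family t ->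
        exists f : A -> B, star_hom f /\ forall l, f (s l) = t l].

Definition torus : set ('I_k -> Cx R) := [set z | forall i, `|z i| = 1].

Definition torus_pow (z : 'I_k -> Cx R) (n : NN k) : Cx R :=
  \prod_(i < k) z i ^+ n i.

(* As [s] generates [A], these conditions determine [alpha] on the torus and make
   it a continuous group action. *)
Definition is_gauge_action (A : cstar_algebra R) (s : kmor L -> A)
    (alpha : ('I_k -> Cx R) -> A -> A) : Prop :=
  forall z, torus z ->
    [/\ star_hom (alpha z), bijective (alpha z) &
        forall l, alpha z (s l) = torus_pow z (kdeg l) *: s l].

Definition fixed_points (A : cstar_algebra R)
    (alpha : ('I_k -> Cx R) -> A -> A) : set A :=
  [set a | forall z, torus z -> alpha z a = a].

(* F, embedded by j, is the fixed point algebra. *)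
Definition is_fixed_point_algebra (A : cstar_algebra R)
    (alpha : ('I_k -> Cx R) -> A -> A) (F : cstar_algebra R) (j : F -> A) :=
  [/\ star_hom j, injective j & range j = fixed_points alpha].

End KGraphAlgebra.

Section GroupoidAlgebra.
Variables (R : realType) (G : groupoid).
Variable haar : forall u : gobj G, {measure set (borel (gid u)) -> \bar R}.

(* The integrand is f(c e) g(e^-1) for e in the range fibre of s(c). *)
Definition convolution (f g : garr G -> Cx R) (c : garr G) : Cx R :=
  cint (haar (gs c)) (fun e : garr G =>
    if pselect (gs c = gr e) is left h then f (gmul h) * g (ginv e) else 0).

Definition involution (f : garr G -> Cx R) (c : garr G) : Cx R :=
  (f (ginv c))^*.

Definition Inorm (f : garr G -> Cx R) : \bar R :=
  Order.max
    (ereal_sup (range (fun u => \int[haar u]_c (Cre `|f c|)%:E)))%E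
    (ereal_sup (range (fun u => \int[haar u]_c (Cre `|f (ginv c)|)%:E)))%E.

(* I-norm bounded *-representations of C_c(G). Any C*-algebra is allowed as a
   target: it is faithfully represented on a Hilbert space. Values outside
   C_c(G) are irrelevant. *)
Definition Cc_representation (A : cstar_algebra R)
    (f : (garr G -> Cx R) -> A) : Prop :=
  [/\ forall a b, Cc (R := R) a -> Cc (R := R) b -> f (a \+ b) = f a + f b,
      forall (z : Cx R) a, Cc (R := R) a -> f (fun c => z * a c) = z *: f a,
      forall a b, Cc (R := R) a -> Cc (R := R) b ->
        f (convolution a b) = cmul (f a) (f b),
      forall a, Cc (R := R) a -> f (involution a) = cstar (f a) &
      forall a, Cc (R := R) a -> ((Cre `|f a|)%:E <= Inorm a)%E].

(* C*(G): the completion of C_c(G) in the largest norm coming from I-norm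
   bounded *-representations. *)
Definition is_groupoid_algebra (S : cstar_algebra R)
    (iota : (garr G -> Cx R) -> S) : Prop :=
  [/\ Cc_representation iota,
      closure (iota @` @Cc R (garr G)) = setT &
      forall (B : cstar_algebra R) (f : (garr G -> Cx R) -> B),
        Cc_representation f ->
        forall a, Cc (R := R) a -> `|f a| <= `|iota a|].

End GroupoidAlgebra.

Section HaarSystem.
Variables (R : realType) (k : nat) (L : kgraph k).

Definition npaths (p : NN k) (u v : kobj L) : nat :=
  #|` fset_set [set l : kmor L | [/\ kdeg l = p, kr l = u & ks l = v]]|%fset.

Definition tpow (t : 'I_k -> R) (p : NN k) : R := \prod_(i < k) t i ^+ p i.

Definition perron_frobenius (t : 'I_k -> R) (a b : kobj L -> R) : Prop :=
  [/\ (forall i, 0 < t i), (forall v, 0 < a v /\ 0 < b v),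
      \sum_(v \in [set: kobj L]) a v * b v = 1,
      (forall p v, \sum_(u \in [set: kobj L]) a u * (npaths p u v)%:R
                   = tpow t p * a v) &
      (forall p u, \sum_(v \in [set: kobj L]) (npaths p u v)%:R * b v
                   = tpow t p * b u)].

Definition future_set (x : dpath L) : set (dpath L) :=
  [set y | forall m n (h : zle m n), zle 0 m -> darr y h = darr x h].

(* A measure on [future_set x] is encoded as a Borel measure on the path space
   that vanishes off it. *)
Definition is_past_measure (t : 'I_k -> R) (a : kobj L -> R)
    (mu : forall x : dpath L, {measure set (borel x) -> \bar R}) : Prop :=
  forall x : dpath L,
    mu x (~` future_set x) = 0%E /\
    forall l : kmor L, ks l = dvert x 0 ->
      mu x (future_set x `&` dcyl l (- zvec (kdeg l)))
      = ((tpow t (kdeg l))^-1 * a (kr l))%:E.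

Definition stable_piece (x : dpath L) (p : NN k) : set (dpath L) :=
  dshift (- zvec p) @` future_set (dshift (zvec p) x).

(* haar x is the product of delta_x with the measure on the stable class of x;
   the latter is the union of the pieces stable_piece x p. *)
Definition is_stable_haar (t : 'I_k -> R)
    (mu : forall x : dpath L, {measure set (borel x) -> \bar R})
    (haar : forall x : gobj (stable_groupoid L),
              {measure set (borel (gid x)) -> \bar R}) : Prop :=
  forall x : gobj (stable_groupoid L),
    haar x [set g : garr (stable_groupoid L) | gr g <> x] = 0%E /\
    forall (p : NN k) (B : set (dpath L)),
      <<s @open (dpath L) >> B -> B `<=` stable_piece x p ->
      haar x [set g : garr (stable_groupoid L) | B (gs g)]
      = ((tpow t p)%:E * mu (dshift (zvec p) x) (dshift (zvec p) @` B))%E.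

End HaarSystem.

(* Main.v *)
Require Import Defs.
From HB Require Import structures.
From mathcomp Require Import all_boot all_order all_algebra.
From mathcomp Require Import all_classical all_reals all_analysis.
From mathcomp Require Import finmap complex zify measurable_realfun ring lra.

Set Implicit Arguments.
Unset Strict Implicit.
Unset Printing Implicit Defensive.

Import Order.TTheory GRing.Theory Num.Theory.
Import numFieldNormedType.Exports.

Local Open Scope classical_set_scope.
Local Open Scope ring_scope.

(** A point $(x,\gamma)$ of $Z$ is determined by the two-sided path $x$ and the one-sided path
    $s(\gamma)$, which is tail equivalent to $\pi(x)$. Two-sided paths are stably equivalent exactly
    when their restrictions are tail equivalent ([restr_tail_eq], [tail_agree]), so each groupoid
    acts freely on $Z$, and transitively on the fibres of the other moment map. Every space involved
    has a base of compact open balls described by finitely many steps of a path ([lbase]); they are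
    compact because $r$ and $s$ are finite-to-one. The moment maps are open because a new past or a
    new beginning can be glued to a tail, and the actions are proper because the limits of $z$ and
    of its translate determine the limit of the acting arrow ([equivalence_z]).

    Amenability is proved directly. Let $\rho_n(x)$ keep the future of $x$ from $(n,\dots,n)$ on and
    replace the past by one chosen from the vertex $x(n,\dots,n)$ alone. The arrow $(x,\rho_n(x))$
    depends continuously on $x$, and the point masses at these arrows are exactly invariant under
    the arrows of level $n$; every compact set of arrows lies in one level ([amenable_stable]).

    For finite $\Lambda^0$, the functions that live on the pairs agreeing from $(n,\dots,n)$ on and
    depend on finitely many steps before that time multiply like matrices, with weights given by the
    Haar measure ([convolution_mf]). They yield an increasing sequence of finite-dimensional
    $*$-subalgebras with dense union in $S$, so $S$ is AF ([groupoid_algebra_AF]), independently of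
    the Morita equivalence.

    Let $e\in S$ be the projection given by the function $1/a(x(0))$ on the pairs $(x,y)$ agreeing
    from 0 on. The normalized indicators of the pairs that agree from $(n,\dots,n)$ on and have
    pasts $\lambda$, $\mu$ back to 0 are matrix units, and the span of all of them is dense in
    $eSe$. They refine from level to level by the same rule as the elements $s_\lambda s_\mu^*$ with
    $d(\lambda)=d(\mu)=(n,\dots,n)$, whose span is dense in $C^*(\Lambda)^\alpha$ ([su_system],
    [ck_unit_system], [gauge_dense]). The norm of a combination of nonzero matrix units depends only
    on the coefficients ([mcomb_norm]), so the correspondence extends to an isomorphism of
    $C^*(\Lambda)^\alpha$ with $eSe$. The ideal generated by $e$ is dense ([rank_sum_full]), so $Se$
    is an imprimitivity bimodule ([corner_morita], [stable_morita_fixed]). The matrix units are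
    nonzero by two concrete representations: of $C^*(\Lambda)$ on functions of one-sided paths
    ([ck_neq0]) and of $C_c(G_s)$ by convolution ([um_delta_neq0]). The facts needed about
    $C^*$-algebras are derived from an iteration for square roots ([csqrt]). *)

(** * Coordinatewise arithmetic in $\mathbb N^k$ and $\mathbb Z^k$ *)

Section Coordinates.
Variable k : nat.
Implicit Types (p q : NN k) (m n : ZZ k).

Lemma NN_eqP p q : p = q <-> forall i : 'I_k, p i = q i.
Proof. by split=> [->//|h]; apply/ffunP. Qed.
Lemma ZZ_eqP m n : m = n <-> forall i : 'I_k, m i = n i.
Proof. by split=> [->//|h]; apply/ffunP. Qed.
Lemma NN_leP p q : nle p q <-> forall i : 'I_k, (p i <= q i)%N.
Proof. by split=> /forallP. Qed.
Lemma ZZ_leP m n : zle m n <-> forall i : 'I_k, m i <= n i.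
Proof. by split=> /forallP. Qed.
Lemma NN0E (i : 'I_k) : (0 : NN k) i = 0%N. Proof. by rewrite ffunE. Qed.
Lemma NNDE p q (i : 'I_k) : (p + q) i = (p i + q i)%N.
Proof. by rewrite ffunE. Qed.
Lemma ZZ0E (i : 'I_k) : (0 : ZZ k) i = 0. Proof. by rewrite ffunE. Qed.
Lemma ZZDE m n (i : 'I_k) : (m + n) i = m i + n i.
Proof. by rewrite ffunE. Qed.
Lemma ZZNE m (i : 'I_k) : (- m) i = - m i. Proof. by rewrite ffunE. Qed.
Lemma zvecE p (i : 'I_k) : zvec p i = (p i)%:Z. Proof. by rewrite ffunE. Qed.
Lemma zposE m (i : 'I_k) : zpos m i = `|m i|%N. Proof. by rewrite ffunE. Qed.
End Coordinates.

Definition coordE := (NN0E, NNDE, ZZ0E, ZZDE, ZZNE, zvecE, zposE).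

(** Identities and inequalities of vectors hold coordinatewise, so all hypotheses are specialized to
    one coordinate and linear arithmetic does the rest. *)
Ltac pw i := repeat match goal with
  | h : is_true (zle _ _) |- _ => move/ZZ_leP/(_ i): h; rewrite ?coordE => h
  | h : is_true (nle _ _) |- _ => move/NN_leP/(_ i): h; rewrite ?coordE => h
  | h : _ = _ |- _ => move/ZZ_eqP/(_ i): h; rewrite ?coordE => h
  | h : _ = _ |- _ => move/NN_eqP/(_ i): h; rewrite ?coordE => h
  end; rewrite ?coordE.
Ltac zz := let i := fresh "i" in
  (first [apply/ZZ_eqP; intro i | apply/NN_eqP; intro i |
          apply/ZZ_leP; intro i | apply/NN_leP; intro i]); pw i; lia.

(** * Unique factorization and sub-morphisms *)

Section Factorization.
Variables (k : nat) (L : kgraph k).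
Implicit Types a b l v : kmor L.
Implicit Types c m n : ZZ k.
Implicit Types p q r : NN k.

Lemma zvec0 : zvec (0 : NN k) = 0. Proof. zz. Qed.

Lemma zpos_zvec p : zpos (zvec p) = p. Proof. zz. Qed.

Lemma zvec_inj p q : zvec p = zvec q -> p = q.
Proof. move=> e; zz. Qed.

Lemma zle_sub m n : zle m n -> m + zvec (zpos (n - m)) = n.
Proof. move=> h; zz. Qed.

(* Composition made total, to be free of proofs of composability. *)
Definition cmp a b : kmor L :=
  if pselect (ks a = kr b) is left h then Defs.kcomp h else a.

Lemma cmpE a b (h : ks a = kr b) : cmp a b = Defs.kcomp h.
Proof.
by rewrite /cmp; case: pselect => // h'; congr Defs.kcomp; exact: Prop_irrelevance.
Qed.

Lemma cmp_r a b : kr (cmp a b) = kr a.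
Proof. by rewrite /cmp; case: pselect => // h; rewrite kr_comp. Qed.

Lemma cmp_s a b : ks a = kr b -> ks (cmp a b) = ks b.
Proof. by move=> h; rewrite (cmpE h) ks_comp. Qed.

Lemma cmp_deg a b : ks a = kr b -> kdeg (cmp a b) = kdeg a + kdeg b.
Proof. by move=> h; rewrite (cmpE h) kdeg_comp. Qed.

Lemma cmpA a b (c : kmor L) : ks a = kr b -> ks b = kr c ->
  cmp (cmp a b) c = cmp a (cmp b c).
Proof.
move=> hab hbc.
have h1 : ks (Defs.kcomp hab) = kr c by rewrite ks_comp.
have h2 : ks a = kr (Defs.kcomp hbc) by rewrite kr_comp.
by rewrite (cmpE hab) (cmpE hbc) (cmpE h1) (cmpE h2); exact: kcompA.
Qed.

Lemma cmp_idl a : cmp (kid (kr a)) a = a.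
Proof. by have h := ks_id (kr a); rewrite (cmpE h) kid_comp. Qed.

Lemma cmp_idr a : cmp a (kid (ks a)) = a.
Proof. by have h := esym (kr_id (ks a)); rewrite (cmpE h) kcomp_id. Qed.

(** Cancellation in $\mathbb N^k$ makes the degrees of the right factors agree as well, so both
    sides factor one morphism with the same pair of degrees. *)
Lemma cmp_inj a b a' b' : ks a = kr b -> ks a' = kr b' ->
  kdeg a = kdeg a' -> cmp a b = cmp a' b' -> a = a' /\ b = b'.
Proof.
move=> h h' ea e.
have eb : kdeg b = kdeg b'.
  have := cmp_deg h; rewrite e (cmp_deg h') -ea => ee; zz.
have [nu [_ un]] := kfact (cmp_deg h).
have u1 := un (a, b) (conj (ex_intro _ h (cmpE h)) (conj erefl erefl)).
have u2 := un (a', b') (conj (ex_intro _ h' (etrans e (cmpE h')))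
  (conj (esym ea) (esym eb))).
by move: u1; rewrite u2 => -[-> ->].
Qed.

Lemma cmp_inj2 a b a' b' : ks a = kr b -> ks a' = kr b' ->
  kdeg b = kdeg b' -> cmp a b = cmp a' b' -> a = a' /\ b = b'.
Proof.
move=> h h' eb e; apply: cmp_inj => //.
have := cmp_deg h; rewrite e (cmp_deg h') -eb => ee; zz.
Qed.

Lemma cmp_fact l p q : kdeg l = p + q ->
  exists a b, [/\ ks a = kr b, l = cmp a b, kdeg a = p & kdeg b = q].
Proof.
move=> h; have [[a b] [[[e1 e2] [da db]] _]] := kfact h.
by exists a, b; split => //; rewrite (cmpE e1).
Qed.

Lemma kdeg0 l : kdeg l = 0 -> l = kid (kr l).
Proof.
move=> d; have [||||//] := @cmp_inj l (kid (ks l)) (kid (kr l)) l.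
- by rewrite kr_id.
- by rewrite ks_id.
- by rewrite kdeg_id.
- by rewrite cmp_idl cmp_idr.
Qed.

(* [l] placed at position [c] has the morphism [v] of degree [p] at position
   [n]. *)
Definition issub l (c n : ZZ k) p v : Prop := exists a b,
  [/\ ks a = kr v, ks v = kr b, l = cmp a (cmp v b),
      c + zvec (kdeg a) = n & kdeg v = p].

Lemma issub_uniq l c n p v v' : issub l c n p v -> issub l c n p v' -> v = v'.
Proof.
move=> [a [b [h1 h2 e dn dv]]] [a' [b' [h1' h2' e' dn' dv']]].
have [||||_ ev] := @cmp_inj a (cmp v b) a' (cmp v' b'); rewrite ?cmp_r //.
- by apply: zvec_inj; apply: (addrI c); rewrite dn.
- by rewrite -e.
by have [||||//] := @cmp_inj v b v' b'; rewrite ?dv.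
Qed.

Lemma issub_ex l c n p : zle c n -> zle (n + zvec p) (c + zvec (kdeg l)) ->
  exists v, issub l c n p v.
Proof.
move=> h1 h2.
have [|a [b' [e1 el da db]]] := @cmp_fact l (zpos (n - c))
    (zpos (c + zvec (kdeg l) - n)); first by zz.
have [|v [b [e2 eb dv dbb]]] := @cmp_fact b' p
    (zpos (c + zvec (kdeg l) - n - zvec p)); first by rewrite db; zz.
exists v, a, b; split; rewrite ?da ?el ?eb // -?eb.
- by rewrite e1 eb cmp_r.
- exact: zle_sub.
Qed.

Lemma issub_trans l c l' c' n p v : issub l' c' c (kdeg l) l ->
  issub l c n p v -> issub l' c' n p v.
Proof.
move=> [a' [b' [h1' h2' e' dn' dv']]] [a [b [h1 h2 e dn dv]]].
have lr : kr l = kr a by rewrite e cmp_r.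
have ls : ks l = ks b by rewrite e cmp_s ?cmp_s ?cmp_r.
exists (cmp a' a), (cmp b b'); split; rewrite ?cmp_s ?cmp_r // -?lr //.
- rewrite e' e -(cmpA (a := v)) ?cmpA ?cmp_r ?cmp_s -?lr -?ls //.
- by rewrite cmp_deg -?lr // zvecD addrA dn'.
Qed.

Lemma issub_comp l c n p q v : issub l c n (p + q) v -> exists v1 v2,
  [/\ ks v1 = kr v2, v = cmp v1 v2, issub l c n p v1 &
      issub l c (n + zvec p) q v2].
Proof.
move=> [a [b [h1 h2 e dn dv]]]; have [v1 [v2 [h ev d1 d2]]] := cmp_fact dv.
have vs : ks v2 = kr b by rewrite -h2 ev cmp_s.
have vr : ks a = kr v1 by rewrite h1 ev cmp_r.
exists v1, v2; split => //.
- by exists a, (cmp v2 b); split; rewrite ?cmp_r // e ev cmpA.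
- exists (cmp a v1), b; split; rewrite ?cmp_s ?cmp_r //.
  + by rewrite e ev !cmpA // cmp_r.
  + by rewrite cmp_deg // zvecD addrA dn d1.
Qed.

Lemma issub_deg l c n p v : issub l c n p v -> kdeg v = p.
Proof. by move=> [a [b []]]. Qed.

Lemma issub_le l c n p v : issub l c n p v ->
  zle c n /\ zle (n + zvec p) (c + zvec (kdeg l)).
Proof.
move=> [a [b [h1 h2 e dn dv]]].
have el : kdeg l = kdeg a + (p + kdeg b).
  by rewrite e cmp_deg ?cmp_r // cmp_deg // dv.
by split; zz.
Qed.

Lemma issub_refl l c : issub l c c (kdeg l) l.
Proof.
exists (kid (kr l)), (kid (ks l)); split; rewrite ?kr_id ?ks_id ?kdeg_id //.
- by rewrite cmp_idr cmp_idl.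
- by rewrite zvec0 addr0.
Qed.

End Factorization.

(** * Two-sided paths and their segments *)

Section Paths.
Variables (k : nat) (L : kgraph k).
Implicit Types (l v : kmor L) (m n : ZZ k) (p q r : NN k).
Implicit Types (x y z : dpath L) (w : opath L).

(** Indexing a segment by its start and its length, rather than by two endpoints, removes the order
    proofs from all statements. *)
Definition sg x m p : kmor L := darr x (zle_addr m p).

Lemma darr_irr x m n m' n' (h : zle m n) (h' : zle m' n') :
  m = m' -> n = n' -> darr x h = darr x h'.
Proof. by move=> em en; subst; rewrite (bool_irrelevance h h'). Qed.

Lemma darr_sg x m n (h : zle m n) : darr x h = sg x m (zpos (n - m)).
Proof. by apply: darr_irr => //; rewrite zle_sub. Qed.

Lemma sg_r x m p : kr (sg x m p) = dvert x m.
Proof. exact: dpath_r. Qed.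

Lemma sg_s x m p : ks (sg x m p) = dvert x (m + zvec p).
Proof. exact: dpath_s. Qed.

Lemma sg_deg x m p : kdeg (sg x m p) = p.
Proof. by apply: zvec_inj; rewrite dpath_deg; zz. Qed.

Lemma sg0 x m : sg x m 0 = kid (dvert x m).
Proof. by rewrite (kdeg0 (sg_deg x m 0)) sg_r. Qed.

Lemma sgD x m p q : sg x m (p + q) = cmp (sg x m p) (sg x (m + zvec p) q).
Proof.
have h : ks (sg x m p) = kr (sg x (m + zvec p) q) by rewrite sg_s sg_r.
have e : m + zvec (p + q) = m + zvec p + zvec q by rewrite zvecD addrA.
have h' : zle m (m + zvec p + zvec q) by rewrite -e; exact: zle_addr.
by rewrite (cmpE h) -(dpath_comp h' h); exact: darr_irr.
Qed.

Lemma dpath_ext x y : (forall m p, sg x m p = sg y m p) -> x = y.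
Proof.
move=> e; have {}e m n (h : zle m n) : darr x h = darr y h by rewrite !darr_sg.
case: x y e => [xv xa xr xs xi xc xd] [yv ya yr ys yi yc yd] /= e.
have ea : xa = ya.
  by apply: functional_extensionality_dep => m;
     apply: functional_extensionality_dep => n;
     apply: functional_extensionality_dep => h; exact: e.
have ev : xv = yv.
  apply: funext => m; have h : zle m m by apply/forallP.
  by rewrite -(xr _ _ h) -(yr _ _ h) e.
by subst ya yv; congr DPath; exact: Prop_irrelevance.
Qed.

Lemma sg_issub x c p n q : zle c n -> zle (n + zvec q) (c + zvec p) ->
  issub (sg x c p) c n q (sg x n q).
Proof.
move=> h1 h2.
have e1 : c + zvec (zpos (n - c)) = n by exact: zle_sub.
exists (sg x c (zpos (n - c))),
  (sg x (n + zvec q) (zpos (c + zvec p - n - zvec q))).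
split; rewrite ?sg_deg ?sg_s ?sg_r ?e1 //.
rewrite -sgD -[X in cmp _ (sg x X _)]e1 -sgD; congr sg; zz.
Qed.

Lemma sg_sub x y c p n q : zle c n -> zle (n + zvec q) (c + zvec p) ->
  sg x c p = sg y c p -> sg x n q = sg y n q.
Proof.
move=> h1 h2 e; apply: (issub_uniq (sg_issub x h1 h2)); rewrite e.
exact: sg_issub.
Qed.

Lemma agreeP m x y : agree m x y <-> forall p, sg x m p = sg y m p.
Proof.
by split=> [e p|e n h]; [exact: e | rewrite !darr_sg; exact: e].
Qed.

Lemma sg_shift x n m p : sg (dshift n x) m p = sg x (m + n) p.
Proof. by rewrite /sg /=; apply: darr_irr => //; rewrite addrAC. Qed.

Lemma dshiftD x m n : dshift m (dshift n x) = dshift (m + n) x.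
Proof. by apply: dpath_ext => i p; rewrite !sg_shift addrA. Qed.

Lemma dshift0 x : dshift 0 x = x.
Proof. by apply: dpath_ext => i p; rewrite sg_shift addr0. Qed.

Lemma dshiftK n : cancel (dshift (L := L) n) (dshift (- n)).
Proof. by move=> x; rewrite dshiftD addNr dshift0. Qed.

Lemma dshiftNK n : cancel (dshift (L := L) (- n)) (dshift n).
Proof. by move=> x; rewrite dshiftD addrN dshift0. Qed.

(** A path amounts to a coherent family of segments; its vertices are recovered as the ranges of the
    segments of degree 0. *)
Lemma mk_dpath (f : ZZ k -> NN k -> kmor L) :
  (forall m p, kdeg (f m p) = p) ->
  (forall m p q, ks (f m p) = kr (f (m + zvec p) q)) ->
  (forall m p q, f m (p + q) = cmp (f m p) (f (m + zvec p) q)) ->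
  exists x : dpath L, forall m p, sg x m p = f m p.
Proof.
move=> fd fs fc.
have fr m p : kr (f m p) = kr (f m 0).
  by rewrite -[p in LHS]add0r fc cmp_r.
have fs' m n (h : zle m n) : ks (f m (zpos (n - m))) = kr (f n 0).
  by rewrite (fs _ _ 0) zle_sub.
unshelve eexists (@DPath k L (fun m => kr (f m 0))
  (fun m n h => f m (zpos (n - m))) _ _ _ _ _) => //=.
- move=> m h; rewrite [LHS]kdeg0 ?fr // fd; zz.
- move=> l m n hlm hmn hln h; rewrite -cmpE.
  by rewrite -[X in f X (zpos (n - m))](zle_sub hlm) -fc; congr f; zz.
- by move=> m n h; rewrite fd; zz.
- by move=> m p; rewrite /sg /=; congr f; zz.
Qed.

(** Segments that stabilize along a filter have limiting values, and these inherit every coherence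
    condition that holds along the filter. This produces the limits in the compactness proofs. *)
Lemma dpath_lim (T : Type) (F : set_system T) {FF : ProperFilter F}
    (f : T -> ZZ k -> NN k -> kmor L) :
  (forall m p, exists v, F [set t | f t m p = v]) ->
  (forall m p, F [set t | kdeg (f t m p) = p]) ->
  (forall m p q, F [set t | ks (f t m p) = kr (f t (m + zvec p) q)]) ->
  (forall m p q,
     F [set t | f t m (p + q) = cmp (f t m p) (f t (m + zvec p) q)]) ->
  exists x : dpath L, forall m p, F [set t | f t m p = sg x m p].
Proof.
move=> fv fd fs fc.
have [g gP] := choice (fun mp : ZZ k * NN k => fv mp.1 mp.2).
have gP' m p : F [set t | f t m p = g (m, p)] by exact: (gP (m, p)).
have [|||x xP] := @mk_dpath (fun m p => g (m, p)).
- move=> m p; have [t [/= <-]] := filter_ex (filterI (gP' m p) (fd m p)).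
  by [].
- move=> m p q.
  have [t [/= [<- <-]]] := filter_ex (filterI
    (filterI (gP' m p) (gP' (m + zvec p) q)) (fs m p q)).
  by [].
- move=> m p q.
  have [t [/= [[<- <-] <-]]] := filter_ex (filterI (filterI
    (filterI (gP' m p) (gP' (m + zvec p) q)) (gP' m (p + q))) (fc m p q)).
  by [].
by exists x => m p; rewrite xP.
Qed.

(** Nested morphisms that exhaust $\mathbb Z^k$ glue: a segment is read off from any of them that
    covers it, and uniqueness of sub-morphisms makes the reading independent of the choice. *)
Lemma dpath_seq (l : nat -> kmor L) (c : nat -> ZZ k) :
  (forall j, issub (l j.+1) (c j.+1) (c j) (kdeg (l j)) (l j)) ->
  (forall n p, exists j, zle (c j) n /\
                         zle (n + zvec p) (c j + zvec (kdeg (l j)))) ->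
  exists x : dpath L, forall j, sg x (c j) (kdeg (l j)) = l j.
Proof.
move=> lS lB.
have lM i j : issub (l (i + j)%N) (c (i + j)%N) (c j) (kdeg (l j)) (l j).
  elim: i => [|i IH]; first exact: issub_refl.
  exact: issub_trans (lS _) IH.
have lM' i j n p v : (i <= j)%N -> issub (l i) (c i) n p v ->
    issub (l j) (c j) n p v.
  by move=> ij; apply: issub_trans; rewrite -(subnK ij).
have ex n p : exists v, exists j, issub (l j) (c j) n p v.
  by have [j [h1 h2]] := lB n p; have [v] := issub_ex h1 h2; exists v, j.
have [f fP] := choice (fun mp : ZZ k * NN k => ex mp.1 mp.2).
have un i j n p v v' : issub (l i) (c i) n p v -> issub (l j) (c j) n p v' ->
    v = v'.
  move=> h h'; apply: (@issub_uniq _ _ (l (maxn i j)) (c (maxn i j)) n p).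
    exact: lM' (leq_maxl _ _) h.
  exact: lM' (leq_maxr _ _) h'.
have fc m p q : ks (f (m, p)) = kr (f (m + zvec p, q)) /\
    f (m, p + q) = cmp (f (m, p)) (f (m + zvec p, q)).
  have /= [j jP] := fP (m, p + q).
  have [v1 [v2 [e1 e2 s1 s2]]] := issub_comp jP.
  have /= [j1 j1P] := fP (m, p); have /= [j2 j2P] := fP (m + zvec p, q).
  by rewrite (un _ _ _ _ _ _ j1P s1) (un _ _ _ _ _ _ j2P s2).
have [|||x xP] := @mk_dpath (fun m p => f (m, p)).
- by move=> m p; have /= [j] := fP (m, p); apply: issub_deg.
- by move=> m p q; case: (fc m p q).
- by move=> m p q; case: (fc m p q).
exists x => j; rewrite xP; have /= [i iP] := fP (c j, kdeg (l j)).
exact: un iP (issub_refl _ _).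
Qed.

End Paths.

(** * One-sided paths, restriction and futures *)

Section OneSided.
Variables (k : nat) (L : kgraph k).
Implicit Types (l v mu : kmor L) (m n : ZZ k) (p q r : NN k).
Implicit Types (x y z : dpath L) (w : opath L).

Definition oi w p : kmor L := oarr w (nle0v p).

Lemma oarr_irr w p q p' q' (h : nle p q) (h' : nle p' q') :
  p = p' -> q = q' -> oarr w h = oarr w h'.
Proof. by move=> em en; subst; rewrite (bool_irrelevance h h'). Qed.

Lemma oi_deg w p : kdeg (oi w p) = p.
Proof. by have := opath_deg w (nle0v p); rewrite add0r. Qed.

Lemma oi_r w p : kr (oi w p) = overt w 0. Proof. exact: opath_r. Qed.
Lemma oi_s w p : ks (oi w p) = overt w p. Proof. exact: opath_s. Qed.

Lemma oi0 w : oi w 0 = kid (overt w 0).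
Proof. by rewrite (kdeg0 (oi_deg w 0)) oi_r. Qed.

Lemma oi_oarr w p q (h : nle p q) :
  ks (oi w p) = kr (oarr w h) /\ oi w q = cmp (oi w p) (oarr w h).
Proof.
have e : ks (oi w p) = kr (oarr w h) by rewrite oi_s opath_r.
by split=> //; rewrite (cmpE e); exact: opath_comp.
Qed.

(** The arrow from [p] to [q] is the right factor of the initial segment of degree [q], so the
    initial segments determine it. *)
Lemma opath_ext w w' : (forall p, oi w p = oi w' p) -> w = w'.
Proof.
move=> e; apply: opath_eq => p q h.
have [h1 e1] := oi_oarr w h; have [h2 e2] := oi_oarr w' h.
by have [||_ ->//] := @cmp_inj _ _ _ _ _ _ h1 h2; rewrite ?oi_deg // -e1 -e2.
Qed.

Lemma oarr_shift w p q (h : nle p (q + p)) : oarr w h = oi (oshift p w) q.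
Proof. by rewrite /oi /=; apply: oarr_irr => //; rewrite add0r. Qed.

Lemma oiD w p q : ks (oi w p) = kr (oi (oshift p w) q) /\
  oi w (p + q) = cmp (oi w p) (oi (oshift p w) q).
Proof.
have h : nle p (q + p) by zz.
by rewrite -(oarr_shift w h) (addrC p q); exact: oi_oarr.
Qed.

Lemma oi_le w w' p q : nle p q -> oi w q = oi w' q -> oi w p = oi w' p.
Proof.
move=> h; have [h1 ->] := oi_oarr w h; have [h2 ->] := oi_oarr w' h.
by move=> e; have [||->//] := cmp_inj h1 h2; rewrite ?oi_deg.
Qed.

Lemma oi_shift_eq w w' p q :
  oi w (p + q) = oi w' (p + q) -> oi (oshift p w) q = oi (oshift p w') q.
Proof.
have [h1 ->] := oiD w p q; have [h2 ->] := oiD w' p q => e.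
by have [||_ ->//] := cmp_inj h1 h2; rewrite ?oi_deg.
Qed.

Lemma opath_glue_eq w w' p : oi w p = oi w' p -> oshift p w = oshift p w' ->
  w = w'.
Proof.
move=> e1 e2; apply: opath_ext => q; apply: (@oi_le _ _ _ (p + q)); first zz.
by have [_ ->] := oiD w p q; have [_ ->] := oiD w' p q; rewrite e1 e2.
Qed.

Lemma oshift0 w : oshift 0 w = w.
Proof.
apply: opath_ext => p; have [h e] := oiD w 0 p; move: h e.
rewrite add0r oi0 ks_id => h ->.
by rewrite h cmp_idl.
Qed.

Lemma overt_shift w p q : overt (oshift p w) q = overt w (q + p).
Proof. by []. Qed.

Lemma oi_restr x p : oi (restr x) p = sg x 0 p.
Proof. by rewrite /oi /=; apply: darr_irr; rewrite ?zvec0 ?add0r. Qed.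

Lemma restr_shift p x : oshift p (restr x) = restr (dshift (zvec p) x).
Proof.
apply: opath_eq => m n h /=; apply: darr_irr; exact: zvecD.
Qed.

Lemma overt_restr x : overt (restr x) 0 = dvert x 0.
Proof. by rewrite /= zvec0. Qed.

(** The future of [x] from [m] on, moved to start at 0; [agree_fut] turns stable agreement into an
    equality of such paths. *)
Definition fut m x := restr (dshift m x).

Lemma oi_fut m x p : oi (fut m x) p = sg x m p.
Proof. by rewrite /fut oi_restr sg_shift add0r. Qed.

Lemma overt_fut m x : overt (fut m x) 0 = dvert x m.
Proof. by rewrite overt_restr /= add0r. Qed.

Lemma fut0 x : fut 0 x = restr x.
Proof. by rewrite /fut dshift0. Qed.

Lemma agree_fut m x y : agree m x y <-> fut m x = fut m y.
Proof.
rewrite agreeP; split=> [e|e p]; last by rewrite -!oi_fut e.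
by apply: opath_ext => p; rewrite !oi_fut.
Qed.

Lemma oshift_fut p m x : oshift p (fut m x) = fut (m + zvec p) x.
Proof. by rewrite /fut restr_shift dshiftD addrC. Qed.

(** The diagonal vectors are cofinal, so that balls and levels can be indexed by natural numbers. *)
Definition cstn j : NN k := [ffun => j].
Definition cz j : ZZ k := zvec (cstn j).

Lemma cstnE j (i : 'I_k) : cstn j i = j. Proof. by rewrite ffunE. Qed.

Lemma cstnD i j : cstn (i + j) = cstn i + cstn j.
Proof. by apply/NN_eqP => a; rewrite !coordE !cstnE. Qed.

Lemma czE j (i : 'I_k) : cz j i = j%:Z. Proof. by rewrite zvecE cstnE. Qed.

Lemma nle_bound p : exists j, nle p (cstn j).
Proof.
exists (\max_i p i)%N; apply/NN_leP => i; rewrite cstnE.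
exact: (@leq_bigmax _ (fun i => p i)).
Qed.

Lemma zle_bound m : exists j, zle m (cz j).
Proof.
have [j h] := nle_bound (zpos m); exists j.
exact: zle_trans (zle_zpos m) (zle_zvec h).
Qed.

End OneSided.

Ltac pw i ::= repeat match goal with
  | h : is_true (zle _ _) |- _ => move/ZZ_leP/(_ i): h;
      rewrite ?(coordE, cstnE, czE) => h
  | h : is_true (nle _ _) |- _ => move/NN_leP/(_ i): h;
      rewrite ?(coordE, cstnE, czE) => h
  | h : _ = _ |- _ => move/ZZ_eqP/(_ i): h; rewrite ?(coordE, cstnE, czE) => h
  | h : _ = _ |- _ => move/NN_eqP/(_ i): h; rewrite ?(coordE, cstnE, czE) => h
  end; rewrite ?(coordE, cstnE, czE).

(** * Gluing a past to a one-sided path *)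

Section Gluing.
Variables (k : nat) (L : kgraph k) (L_regular : regular_kgraph L).
Implicit Types (l v mu : kmor L) (m n : ZZ k) (p q r : NN k).
Implicit Types (x y z : dpath L) (w : opath L).
Local Notation cstn := (cstn k).
Local Notation cz := (cz k).

Lemma back_ex (v : kobj L) : exists l : kmor L, kdeg l = cstn 1 /\ ks l = v.
Proof. by have [] := L_regular (cstn 1) v. Qed.

Definition back (v : kobj L) : kmor L := sval (cid (back_ex v)).
Lemma back_deg (v : kobj L) : kdeg (back v) = cstn 1.
Proof. by rewrite /back; case: cid => l []. Qed.
Lemma back_s (v : kobj L) : ks (back v) = v.
Proof. by rewrite /back; case: cid => l []. Qed.

(** The steps backwards follow the fixed choice [back], so this past depends on [mu] alone; the
    continuity used for amenability rests on that. *)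
Definition past mu j : kmor L := iter j (fun l => cmp (back (kr l)) l) mu.

Lemma past_s mu j : ks (past mu j) = ks mu.
Proof. by elim: j => //= j IH; rewrite cmp_s ?back_s. Qed.

Lemma past_deg mu j : kdeg (past mu j) = kdeg mu + cstn j.
Proof.
elim: j => [|j IH] /=; first by zz.
by rewrite cmp_deg ?back_s // IH back_deg; zz.
Qed.

(** The morphisms made of [past mu j] followed by an initial segment of [w] are nested and exhaust
    $\mathbb Z^k$, hence glue to one path. *)
Lemma glue_ex w mu : ks mu = overt w 0 -> exists y, restr y = w /\
  forall j, sg y (- zvec (kdeg (past mu j))) (kdeg (past mu j)) = past mu j.
Proof.
move=> hmu.
pose l j := cmp (past mu j) (oi w (cstn j)).
pose c j := - zvec (kdeg (past mu j)).
have hl j p : ks (past mu j) = kr (oi w p) by rewrite past_s oi_r.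
have ld j : kdeg (l j) = kdeg (past mu j) + cstn j.
  by rewrite cmp_deg // oi_deg.
have [j|n p|y yP] := @dpath_seq k L l c.
- have [h2 e2] := oiD w (cstn j) (cstn 1).
  have h3 : ks (back (kr (past mu j))) = kr (past mu j) by rewrite back_s.
  exists (back (kr (past mu j))), (oi (oshift (cstn j) w) (cstn 1)).
  split; rewrite ?cmp_r ?cmp_s //.
  + rewrite /l /= -[j.+1]addn1 cstnD e2 !cmpA ?cmp_s ?cmp_r //.
  + by rewrite /c back_deg !past_deg; zz.
- have [i hi] := zle_bound (- n); have [j hj] := zle_bound (n + zvec p).
  exists (maxn i j); rewrite /c ld !past_deg; split; zz.
have yP' j : sg y (- zvec (kdeg (past mu j))) (kdeg (past mu j)) = past mu j /\
    sg y 0 (cstn j) = oi w (cstn j).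
  have := yP j; rewrite ld sgD.
  have -> : c j + zvec (kdeg (past mu j)) = 0 by rewrite /c addNr.
  move=> e; have [||-> ->] := cmp_inj _ (hl j (cstn j)) _ e => //.
    by rewrite sg_s sg_r addNr.
  by rewrite sg_deg.
exists y; split=> [|j]; last by case: (yP' j).
apply: opath_ext => p; have [j hj] := nle_bound p; apply: (oi_le hj).
by rewrite oi_restr; case: (yP' j).
Qed.

(* When [mu] does not end where [w] starts, [mu] is ignored. *)
Definition pglue w mu : dpath L :=
  if pselect (ks mu = overt w 0) is left h then sval (cid (glue_ex h))
  else sval (cid (glue_ex (ks_id (overt w 0)))).

Lemma glue_restr w mu : restr (pglue w mu) = w.
Proof. by rewrite /pglue; case: pselect => h; case: cid => y []. Qed.

Lemma glue_past w mu j : ks mu = overt w 0 ->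
  sg (pglue w mu) (- zvec (kdeg mu + cstn j)) (kdeg mu + cstn j) = past mu j.
Proof.
move=> h; rewrite /pglue; case: pselect => // h'; case: cid => y [_ e] /=.
by have := e j; rewrite past_deg.
Qed.

Lemma glue_sg w mu : ks mu = overt w 0 ->
  sg (pglue w mu) (- zvec (kdeg mu)) (kdeg mu) = mu.
Proof.
by move=> h; have := glue_past 0 h; have -> : kdeg mu + cstn 0 = kdeg mu by zz.
Qed.

Definition dglue m x mu : dpath L := dshift (- m) (pglue (fut m x) mu).

Lemma dglue_fut m x mu : fut m (dglue m x mu) = fut m x.
Proof. by rewrite /dglue /fut dshiftNK glue_restr. Qed.

Lemma dglue_agree m x mu : agree m (dglue m x mu) x.
Proof. by apply/agree_fut; rewrite dglue_fut. Qed.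

Lemma dglue_sg m x mu : ks mu = dvert x m ->
  sg (dglue m x mu) (m - zvec (kdeg mu)) (kdeg mu) = mu.
Proof.
move=> h; rewrite /dglue sg_shift addrAC subrr add0r glue_sg //.
by rewrite overt_fut.
Qed.

Lemma dglue_past m x mu j : ks mu = dvert x m ->
  sg (dglue m x mu) (m - zvec (kdeg mu + cstn j)) (kdeg mu + cstn j) = past mu j.
Proof.
move=> h; rewrite /dglue sg_shift addrAC subrr add0r glue_past //.
by rewrite overt_fut.
Qed.

Lemma dglue_eq m x y mu : agree m x y -> dglue m x mu = dglue m y mu.
Proof. by move=> /agree_fut; rewrite /dglue => ->. Qed.

Lemma fut_ex m w : exists x, fut m x = w.
Proof.
exists (dshift (- m) (pglue w (kid (overt w 0)))).
by rewrite /fut dshiftNK glue_restr.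
Qed.

End Gluing.

(** * Topologies given by sequences of balls *)

(* A topology given by a decreasing sequence of partial equivalence relations
   with growing domains: the classes of a point in the relations whose domains
   contain it are a neighbourhood base. *)
Record lbase (T : topologicalType) (B : nat -> T -> T -> Prop) : Prop := {
  lb_sym : forall j x y, B j x y -> B j y x;
  lb_trans : forall j x y z, B j x y -> B j y z -> B j x z;
  lb_up : forall i j x, (i <= j)%N -> B i x x -> B j x x;
  lb_mono : forall i j x y, (i <= j)%N -> B i x x -> B j x y -> B i x y;
  lb_ex : forall x, exists j, B j x x;
  lb_nbhs : forall x (A : set T),
    nbhs x A <-> exists j, B j x x /\ B j x `<=` A
}.

Section LocalBase.
Variables (T : topologicalType) (B : nat -> T -> T -> Prop) (lb : lbase B).

Lemma lb_ball j x : B j x x -> nbhs x (B j x).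
Proof. by move=> h; apply/(lb_nbhs lb); exists j; split=> // y. Qed.

Lemma lb_at x i : exists j, (i <= j)%N /\ B j x x.
Proof.
have [j h] := lb_ex lb x; exists (maxn i j); split; first exact: leq_maxl.
exact: lb_up (leq_maxr i j) h.
Qed.

Lemma lb_open j x : open (B j x).
Proof.
rewrite openE => y /= h; have hy := lb_trans lb (lb_sym lb h) h.
by apply/(lb_nbhs lb); exists j; split=> // z; exact: lb_trans.
Qed.

Lemma lb_nbhs_ge x A i : nbhs x A ->
  exists j, [/\ (i <= j)%N, B j x x & B j x `<=` A].
Proof.
move/(lb_nbhs lb) => [j [h s]]; exists (maxn i j); split.
- exact: leq_maxl.
- exact: lb_up (leq_maxr i j) h.
- by move=> y /(lb_mono lb (leq_maxr i j) h) /s.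
Qed.

Lemma lb_hausdorff :
  (forall x y, (forall j, B j x x -> B j y y -> B j x y) -> x = y) ->
  hausdorff_space T.
Proof.
move=> H x y c; apply: H => j hx hy.
have [z [xz yz]] := c _ _ (lb_ball hx) (lb_ball hy).
exact: lb_trans xz (lb_sym lb yz).
Qed.

Lemma lb_sub (A : set T) :
  lbase (fun j (a b : set_type A) => B j (val a) (val b)).
Proof.
split=> [j x y|j x y z|i j x|i j x y|x|x U].
- exact: lb_sym.
- exact: lb_trans.
- exact: lb_up.
- exact: lb_mono.
- exact: lb_ex.
split.
  rewrite nbhsE => -[V [[W oW <-] xW] sV].
  have /(lb_nbhs lb) [j [h s]] : nbhs (val x) W by exact: open_nbhs_nbhs.
  by exists j; split=> // y /s Wy; exact: sV.
move=> [j [h s]]; rewrite nbhsE /=; exists (val @^-1` B j (val x)).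
  by split=> //; exists (B j (val x)) => //; exact: lb_open.
by move=> y; exact: s.
Qed.

(** Finitely many subbasic neighbourhoods of a point each contain a ball around it, and the ball
    with the largest index lies in all of them. *)
Lemma lb_subcover (D : set (set T)) (C : nat -> T -> T -> Prop) :
  (forall A x, open A -> A x -> exists E : seq (set T),
     (forall a, a \in E -> D a /\ a x) /\
     forall y, (forall a, a \in E -> a y) -> A y) ->
  (forall j x, open (C j x)) ->
  (forall j x y, C j x y -> C j y x) ->
  (forall j x y z, C j x y -> C j y z -> C j x z) ->
  (forall i j x, (i <= j)%N -> C i x x -> C j x x) ->
  (forall i j x y, (i <= j)%N -> C i x x -> C j x y -> C i x y) ->
  (forall x, exists j, C j x x) ->
  (forall a x, D a -> a x -> exists j, C j x x /\ C j x `<=` a) -> lbase C.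
Proof.
move=> hE oC Cs Ct Cu Cm Ce Cn; split=> // x A; split; last first.
  move=> [j [h s]]; rewrite nbhsE; exists (C j x) => //.
rewrite nbhsE => -[V [oV xV] sV]; have [E [hE1 hE2]] := hE _ _ oV xV.
suff [j [h s]] : exists j, C j x x /\
    forall y, C j x y -> forall a, a \in E -> a y.
  by exists j; split=> // y /s /hE2 /sV.
elim: E hE1 {hE2} => [|a s IH] ha.
  by have [j h] := Ce x; exists j.
have [|i [hi si]] := IH; first by move=> b bs; apply: ha; rewrite inE bs orbT.
have [Da ax] := ha a (mem_head _ _); have [j [hj sj]] := Cn a x Da ax.
exists (maxn i j); split; first exact: Cu (leq_maxl _ _) hi.
move=> y hy b; rewrite inE => /predU1P [->|bs].
  exact: sj (Cm _ _ _ _ (leq_maxr i j) hj hy).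
exact: si (Cm _ _ _ _ (leq_maxl i j) hi hy) _ bs.
Qed.

End LocalBase.

Section LocalBase2.
Variables (T U : topologicalType).
Variables (B : nat -> T -> T -> Prop) (C : nat -> U -> U -> Prop).
Hypotheses (lB : lbase B) (lC : lbase C).

Lemma lb_continuous (f : T -> U) :
  (forall x j, C j (f x) (f x) ->
     exists i, B i x x /\ forall y, B i x y -> C j (f x) (f y)) ->
  continuous f.
Proof.
move=> H x A /(lb_nbhs lC) [j [h s]]; have [i [hi si]] := H x j h.
by apply/(lb_nbhs lB); exists i; split=> // y /si /s.
Qed.

Lemma lb_continuousP (f : T -> U) : continuous f -> forall x j,
  C j (f x) (f x) -> exists i, B i x x /\ forall y, B i x y -> C j (f x) (f y).
Proof.
move=> cf x j /(lb_ball lC) /cf /(lb_nbhs lB) [i [h s]].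
by exists i.
Qed.

Lemma lb_prod :
  lbase (fun j (a b : T * U) => B j a.1 b.1 /\ C j a.2 b.2).
Proof.
split=> [j x y|j x y z|i j x|i j x y|x|[x y] A].
- by move=> [/(lb_sym lB) ? /(lb_sym lC)].
- move=> [h1 h2] [h3 h4]; split; [exact: lb_trans h3|exact: lb_trans h4].
- by move=> h [/(lb_up lB h) ? /(lb_up lC h)].
- by move=> h [h1 h2] [/(lb_mono lB h h1) ? /(lb_mono lC h h2)].
- have [i hi] := lb_ex lB x.1; have [j hj] := lb_ex lC x.2.
  exists (maxn i j); split; first exact: lb_up (leq_maxl _ _) hi.
  exact: lb_up (leq_maxr _ _) hj.
split.
  move=> [[P Q] /= [/(lb_nbhs lB) [i [hi si]] /(lb_nbhs lC) [j [hj sj]]] s].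
  exists (maxn i j); split.
    split; first exact: lb_up (leq_maxl _ _) hi.
    exact: lb_up (leq_maxr _ _) hj.
  move=> [x' y'] [/= h1 h2]; apply: s; split.
    exact: si (lb_mono lB (leq_maxl _ _) hi h1).
  exact: sj (lb_mono lC (leq_maxr _ _) hj h2).
move=> [j [[/= hx hy] s]]; exists (B j x, C j y) => /=.
  by split; exact: lb_ball.
by move=> [x' y'] [/= ? ?]; exact: s.
Qed.

End LocalBase2.

Lemma continuous_lb (T U : topologicalType) (f : T -> U) (A : set U) :
  continuous f -> open A -> open (f @^-1` A).
Proof. by move=> /continuousP; apply. Qed.

(** For each of the finitely many fibres, the fibre or its complement belongs to the ultrafilter,
    and not all complements can. *)
Lemma ultra_finite (T V : Type) (F : set_system T) {FU : UltraFilter F}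
    (f : T -> V) (S : set V) :
  finite_set S -> F (f @^-1` S) -> exists v, S v /\ F (f @^-1` [set v]).
Proof.
move=> /(@finite_setP) [n]; elim: n S => [|n IH] S.
  rewrite II0 card_eq0 => /eqP -> h.
  have /filter_ex [x []] : F set0 by apply: filterS h.
move=> /eq_cardSP [v Sv hS] h.
have [h1|h1] := in_ultra_setVsetC (f @^-1` [set v]) FU; first by exists v.
have [|u [[Su _] hu]] := IH _ hS; last by exists u.
by apply: (filterS _ (filterI h h1)) => t /= [? ?]; split.
Qed.

(** * The topologies of the path spaces *)

Section PathTopology.
Variables (k : nat) (L : kgraph k).
Implicit Types (l v mu : kmor L) (m n : ZZ k) (p q r : NN k).
Implicit Types (x y z : dpath L) (w : opath L).
Local Notation cstn := (cstn k).
Local Notation cz := (cz k).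

(** Agreement on the window from $-(j,\dots,j)$ to $(j,\dots,j)$; every segment lies in such a
    window. *)
Definition DB (j : nat) x y := sg x (- cz j) (cstn (j + j)) = sg y (- cz j) (cstn (j + j)).

Lemma DB_refl j x : DB j x x. Proof. by []. Qed.

Lemma DB_mono i j x y : (i <= j)%N -> DB j x y -> DB i x y.
Proof. by move=> ij; apply: sg_sub; zz. Qed.

Lemma DB_sg j x y m p : zle (- cz j) m -> zle (m + zvec p) (cz j) ->
  DB j x y -> sg x m p = sg y m p.
Proof. by move=> h1 h2; apply: sg_sub => //; zz. Qed.

Lemma seg_bound m p : exists j, zle (- cz j) m /\ zle (m + zvec p) (cz j).
Proof.
have [i hi] := zle_bound (- m); have [j hj] := zle_bound (m + zvec p).
by exists (maxn i j); split; zz.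
Qed.

Lemma dpath_open_base (A : set (dpath L)) x : open A -> A x ->
  exists E : seq (set (dpath L)),
    (forall a, a \in E -> [set A | exists l n, A = dcyl l n] a /\ a x) /\
    forall y, (forall a, a \in E -> a y) -> A y.
Proof.
move=> [D' sD <-] [a D'a ax]; have [E sE eE] := sD _ D'a.
exists E; split=> [b bE|y hy].
  by split; [exact: set_mem (sE _ bE)|move: ax; rewrite -eE; exact].
exists a => //; change (a y).
by rewrite -eE => b; exact: hy.
Qed.

Lemma dcyl_open l n : open (dcyl l n).
Proof.
exists [set dcyl l n].
  move=> _ ->; exists [fset dcyl l n]%fset.
    by move=> a; rewrite inE => /eqP ->; apply/mem_set; exists l, n.
  by rewrite set_fset1 bigcap_set1.
by rewrite bigcup_set1.
Qed.

(** A ball is the cylinder of its window, and a cylinder contains the ball around each of its points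
    whose window covers the prescribed segment. *)
Lemma DB_lbase : lbase DB.
Proof.
apply: (lb_subcover dpath_open_base) => //.
- move=> j x.
  have -> : DB j x = dcyl (sg x (- cz j) (cstn (j + j))) (- cz j).
    apply/seteqP; split=> y; rewrite /DB /dcyl /= -/(sg _ _ _) sg_deg => //.
  exact: dcyl_open.
- by move=> j x y z; rewrite /DB => ->.
- by move=> i j x y ij _; exact: DB_mono.
- by move=> x; exists 0%N.
- move=> _ x [l [n ->]] /= e; have [j [h1 h2]] := seg_bound n (kdeg l).
  by exists j; split=> // y /(DB_sg h1 h2) h; exact: etrans (esym h) e.
Qed.

Definition OB (j : nat) w w' := oi w (cstn j) = oi w' (cstn j).

Lemma OB_mono i j w w' : (i <= j)%N -> OB j w w' -> OB i w w'.
Proof. by move=> ij; apply: oi_le; zz. Qed.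

Lemma OB_oi j w w' p : nle p (cstn j) -> OB j w w' -> oi w p = oi w' p.
Proof. by move=> h; exact: oi_le. Qed.

Lemma opath_open_base (A : set (opath L)) w : open A -> A w ->
  exists E : seq (set (opath L)),
    (forall a, a \in E -> [set A | exists l, A = ocyl l] a /\ a w) /\
    forall u, (forall a, a \in E -> a u) -> A u.
Proof.
move=> [D' sD <-] [a D'a ax]; have [E sE eE] := sD _ D'a.
exists E; split=> [b bE|y hy].
  by split; [exact: set_mem (sE _ bE)|move: ax; rewrite -eE; exact].
exists a => //; change (a y).
by rewrite -eE => b; exact: hy.
Qed.

Lemma ocyl_open l : open (ocyl l).
Proof.
exists [set ocyl l].
  move=> _ ->; exists [fset ocyl l]%fset.
    by move=> a; rewrite inE => /eqP ->; apply/mem_set; exists l.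
  by rewrite set_fset1 bigcap_set1.
by rewrite bigcup_set1.
Qed.

Lemma OB_lbase : lbase OB.
Proof.
apply: (lb_subcover opath_open_base) => //.
- move=> j w.
  have -> : OB j w = ocyl (oi w (cstn j)).
    by apply/seteqP; split=> y; rewrite /OB /ocyl /= -/(oi _ _) oi_deg.
  exact: ocyl_open.
- by move=> j x y z; rewrite /OB => ->.
- by move=> i j x y ij _; exact: OB_mono.
- by move=> x; exists 0%N.
- move=> _ x [l ->] /= e; have [j h1] := nle_bound (kdeg l).
  by exists j; split=> // y /(OB_oi h1) h; exact: etrans (esym h) e.
Qed.

Lemma dpath_hausdorff : hausdorff_space (dpath L).
Proof.
apply: (lb_hausdorff DB_lbase) => x y h; apply: dpath_ext => m p.
by have [j [h1 h2]] := seg_bound m p; apply: (DB_sg h1 h2); exact: h.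
Qed.

Lemma opath_hausdorff : hausdorff_space (opath L).
Proof.
apply: (lb_hausdorff OB_lbase) => x y h; apply: opath_ext => p.
by have [j h1] := nle_bound p; apply: (OB_oi h1); exact: h.
Qed.

Lemma fut_continuous m : continuous (@fut k L m).
Proof.
apply: (lb_continuous DB_lbase OB_lbase) => x j _.
have [i [h1 h2]] := seg_bound m (cstn j); exists i; split=> // y h.
by rewrite /OB !oi_fut; exact: DB_sg h.
Qed.

Lemma dshift_continuous m : continuous (@dshift k L m).
Proof.
apply: (lb_continuous DB_lbase DB_lbase) => x j _.
have [i [h1 h2]] := seg_bound (- cz j + m) (cstn (j + j)).
by exists i; split=> // y h; rewrite /DB !sg_shift; exact: DB_sg h.
Qed.

Lemma oshift_continuous p : continuous (@oshift k L p).
Proof.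
apply: (lb_continuous OB_lbase OB_lbase) => x j _.
have [i h1] := nle_bound (p + cstn j).
by exists i; split=> // y h; apply: oi_shift_eq; exact: OB_oi h.
Qed.

End PathTopology.

(** * Compactness by ultrafilters *)

Lemma ultra_fmap (T U : Type) (f : T -> U) (F : set_system T) :
  UltraFilter F -> UltraFilter (f @ F).
Proof.
move=> FU; split; first exact: fmap_proper_filter.
move=> G PG sFG; apply/seteqP; split=> // A GA.
have [//|h] := in_ultra_setVsetC (f @^-1` A) FU.
have GC : G (~` A) by exact: sFG.
have /filter_ex [x []] : G (A `&` ~` A) by exact: filterI.
by [].
Qed.

Lemma compact_lim (T U : topologicalType) (f : T -> U) (K : set U)
    (F : set_system T) : UltraFilter F -> compact K -> F (f @^-1` K) ->
  exists u, K u /\ f @ F --> u.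
Proof.
move=> FU; rewrite compact_ultra => cK FK.
by have [u [Ku hu]] := cK _ (ultra_fmap f FU) FK; exists u.
Qed.

Section LocalBaseLim.
Variables (T : topologicalType) (B : nat -> T -> T -> Prop) (lb : lbase B).

Lemma lb_cvg (F : set_system T) {FF : Filter F} x :
  (forall j, B j x x -> F (B j x)) -> F --> x.
Proof.
move=> h A /(lb_nbhs lb) [j [hj s]]; apply: filterS s _; exact: h.
Qed.

Lemma lb_cvgP (U : Type) (f : U -> T) (F : set_system U) x j :
  f @ F --> x -> B j x x -> F (fun u => B j x (f u)).
Proof. by move=> c /(lb_ball lb) /c. Qed.

Lemma lb_lch : hausdorff_space T ->
  (forall x, exists j, B j x x /\ compact (B j x)) -> lc_hausdorff T.
Proof.
move=> hT hK; split=> // x _; have [j [h K]] := hK x.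
exists (B j x); last by split=> //; exact: compact_closed.
by apply: filterS (lb_ball lb h) => y.
Qed.

End LocalBaseLim.

Lemma ultra_compactP (T : topologicalType) (K : set T) :
  (forall F : set_system T, UltraFilter F -> F K ->
     exists x, K x /\ F --> x) -> compact K.
Proof.
move=> h; rewrite compact_ultra => F FU FK; have [x [Kx Fx]] := h F FU FK.
by exists x.
Qed.

Section Compactness.
Variables (k : nat) (L : kgraph k) (L_regular : regular_kgraph L).
Implicit Types (l v mu : kmor L) (m n : ZZ k) (p q r : NN k).
Implicit Types (x y z : dpath L) (w : opath L).
Local Notation cstn := (cstn k).
Local Notation cz := (cz k).

(** As $r$ and $s$ are finite-to-one, the prescribed window has finitely many extensions to either
    side; an ultrafilter therefore fixes every segment, and the fixed segments form its limit. *)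
Lemma DB_compact j x : compact (DB j x).
Proof.
apply: ultra_compactP => F FU FK.
have [||||y yP] := @dpath_lim k L _ F (@ultra_proper _ _ FU) (@sg k L).
- move=> m p; have [i [h1 h2]] := seg_bound m p.
  (* The window is widened by [i] steps on both sides; the added pieces [a] and [b] are fixed along
     the ultrafilter. *)
  have hc : - cz (i + j) + zvec (cstn i) = - cz j by zz.
  have hc' : - cz j + zvec (cstn (j + j)) = cz j by zz.
  have [_ _ f1 _] := L_regular (cstn i) (dvert x (cz j)).
  have [_ _ _ f2] := L_regular (cstn i) (dvert x (- cz j)).
  have [|a [_ Fa]] := ultra_finite (F := F) (f := fun y => sg y (- cz (i + j)) (cstn i)) f2.
    apply: filterS FK => y /= e; rewrite sg_deg sg_s hc; split=> //.
    by rewrite -(sg_r y _ (cstn (j + j))) -e sg_r.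
  have [|b [_ Fb]] := ultra_finite (F := F) (f := fun y => sg y (cz j) (cstn i)) f1.
    apply: filterS FK => y /= e; rewrite sg_deg sg_r; split=> //.
    by rewrite -hc' -!sg_s e.
  have [y0 [[h0 a0] b0]] := filter_ex (filterI (filterI FK Fa) Fb).
  exists (sg y0 m p); apply: filterS (filterI (filterI FK Fa) Fb).
  move=> y [[h a'] b']; apply: (@sg_sub _ _ y y0 (- cz (i + j))
    (cstn i + (cstn (j + j) + cstn i))); try by zz.
  rewrite !sgD hc hc'; congr cmp; first by rewrite a' a0.
  by congr cmp; [rewrite -h -h0 | rewrite b' b0].
- by move=> m p; apply: filterS filterT => y _ /=; rewrite sg_deg.
- by move=> m p q; apply: filterS filterT => y _ /=; rewrite sg_s sg_r.
- by move=> m p q; apply: filterS filterT => y _ /=; rewrite sgD.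
exists y; split; last first.
  apply: (lb_cvg (DB_lbase L)) => i _; apply: filterS (yP (- cz i) (cstn (i + i))) => z /= e; exact: esym e.
have [z [/= h e]] := filter_ex (filterI FK (yP (- cz j) (cstn (j + j)))).
exact: etrans h e.
Qed.

(** It is the continuous image of a two-sided ball: every path of the ball acquires the last [j]
    diagonal steps of the past of a fixed [x0] by gluing. *)
Lemma OB_compact j w : compact (OB j w).
Proof.
have [x0 hx0] := fut_ex L_regular 0 w.
have -> : OB j w = @restr k L @` DB j x0.
  apply/seteqP; split=> [w' h|_ [x h <-]]; last first.
    rewrite /OB oi_restr -hx0 oi_fut; apply: DB_sg h; zz.
  have hs : ks (sg x0 (- cz j) (cstn j)) = overt w' 0.
    have -> : overt w' 0 = overt w 0 by rewrite -(oi_r w' (cstn j)) -h oi_r.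
    by rewrite sg_s -hx0 overt_fut; congr dvert; zz.
  exists (pglue L_regular w' (sg x0 (- cz j) (cstn j))); last exact: glue_restr.
  have := glue_sg L_regular hs; rewrite sg_deg /DB cstnD !sgD => ->.
  have -> : - cz j + zvec (cstn j) = 0 by zz.
  by congr cmp; rewrite -[LHS]oi_fut hx0 -[RHS]oi_restr glue_restr.
apply: continuous_compact (@DB_compact j x0).
apply: continuous_subspaceT => x.
rewrite (_ : @restr k L = @fut k L 0); last by apply/funext=> y; rewrite fut0.
exact: fut_continuous.
Qed.

End Compactness.

(** * The stable groupoid as a locally compact Hausdorff groupoid *)

Section StableTopology.
Variables (k : nat) (L : kgraph k) (L_regular : regular_kgraph L).
Implicit Types (l v mu : kmor L) (m n : ZZ k) (p q r : NN k).
Implicit Types (x y z : dpath L) (w : opath L) (g h : stab L).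
Local Notation cstn := (cstn k).
Local Notation cz := (cz k).

Lemma agree_ext m p x y :
  sg x m p = sg y m p -> agree (m + zvec p) x y -> agree m x y.
Proof.
move=> e /agree_fut h; apply/agree_fut; apply: (@opath_glue_eq _ _ _ _ p).
  by rewrite !oi_fut.
by rewrite !oshift_fut.
Qed.

Lemma cz_le i j : (i <= j)%N -> zle (cz i) (cz j).
Proof. by move=> ij; zz. Qed.

(* Agreement from an early time on is inherited by nearby pairs that agree
   from a later time on. *)
Lemma agree_near i j x y x' y' : (i <= j)%N -> DB j x x' -> DB j y y' ->
  agree (cz i) x y -> agree (cz j) x' y' -> agree (cz i) x' y'.
Proof.
move=> ij hx hy h h'; apply: (@agree_ext _ (cstn (j - i))); last first.
  by have -> : cz i + zvec (cstn (j - i)) = cz j by zz.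
have e1 : zle (- cz j) (cz i) by zz.
have e2 : zle (cz i + zvec (cstn (j - i))) (cz j) by zz.
by rewrite -(DB_sg e1 e2 hx) -(DB_sg e1 e2 hy); move/agreeP: h; apply.
Qed.

(** Both arrows have to lie in level [cz j], so the ball of an arrow is empty until [j] reaches its
    level; this is why the relations of [lbase] are only partial equivalences. *)
Definition SB (j : nat) g h := [/\ DB j (stab_r g) (stab_r h),
  DB j (stab_s g) (stab_s h), agree (cz j) (stab_r g) (stab_s g) &
  agree (cz j) (stab_r h) (stab_s h)].

Lemma SBP j g : SB j g g <-> agree (cz j) (stab_r g) (stab_s g).
Proof. by split=> [[]|]. Qed.

Lemma SB_sym j g h : SB j g h -> SB j h g. Proof. by case. Qed.

Lemma SB_trans j g h h' : SB j g h -> SB j h h' -> SB j g h'.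
Proof.
by move=> [a b c d] [a' b' c' d']; split; rewrite // /DB ?a ?b.
Qed.

Lemma SB_up i j g : (i <= j)%N -> SB i g g -> SB j g g.
Proof. by move=> ij /SBP h; apply/SBP; exact: agree_le (cz_le ij) h. Qed.

Lemma SB_mono i j g h : (i <= j)%N -> SB i g g -> SB j g h -> SB i g h.
Proof.
move=> ij /SBP a [b c d e]; split=> //; try exact: DB_mono ij _.
exact: agree_near b c a e.
Qed.

Lemma SB_ex g : exists j, SB j g g.
Proof.
have [m h] := stab_rel g; have [j hj] := zle_bound m.
by exists j; apply/SBP; exact: agree_le h.
Qed.

Lemma level_lbase m : lbase (fun j (a b : @stab_level k L m) =>
  DB j (val a).1 (val b).1 /\ DB j (val a).2 (val b).2).
Proof. exact: (lb_sub (lb_prod (DB_lbase L) (DB_lbase L))). Qed.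

Definition mk_stab m x y (h : agree m x y) : stab L :=
  Stab (ex_intro (fun m => agree m x y) m h).

Definition mk_level m x y (h : agree m x y) : @stab_level k L m :=
  exist _ (x, y) (mem_set (h : stab_level m (x, y))).

Lemma mk_level_incl m g (h : agree m (stab_r g) (stab_s g)) :
  stab_incl (mk_level h) = g.
Proof. exact: stab_eq. Qed.

(** In the inductive limit openness is tested in every level [m]; there, agreement from [cz j] on
    passes to nearby pairs by [agree_near], since they agree from [m] on. *)
Lemma SB_open j g : open (SB j g).
Proof.
change (stab_open (SB j g)) => m.
rewrite openE => a ha; apply/(lb_nbhs (@level_lbase m)) => /=.
have [i hi] := zle_bound m; exists (maxn i j); split=> // b [h1 h2].
have ij := leq_maxr i j.
apply: (SB_trans ha); split=> /=; try exact: DB_mono ij _.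
  by case: ha.
apply: (@agree_near _ (maxn i j)) h1 h2 _ _ => //; first by case: ha.
apply: agree_le (set_mem (valP b)); exact: zle_trans hi (cz_le (leq_maxl i j)).
Qed.

(** A small ball around an arrow of level [cz j] stays in that level, so the trace of an open set on
    this single level suffices. *)
Lemma SB_lbase : lbase SB.
Proof.
split=> [j x y|j x y z|i j x|i j x y|x|g A].
- exact: SB_sym.
- exact: SB_trans.
- exact: SB_up.
- exact: SB_mono.
- exact: SB_ex.
split; last first.
  by move=> [j [h s]]; rewrite nbhsE; exists (SB j g) => //; split=> //; exact: SB_open.
rewrite nbhsE => -[V [oV gV] sV].
have [j hj] := SB_ex g; have hj' := proj1 (SBP _ _) hj.
have oV' : open (@stab_incl k L (cz j) @^-1` V) by exact: oV.
have : nbhs (mk_level hj') (@stab_incl k L (cz j) @^-1` V).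
  by apply: open_nbhs_nbhs; split=> //=; rewrite mk_level_incl.
move/(lb_nbhs (@level_lbase (cz j))) => [i [_ si]].
exists (maxn i j); split; first exact: SB_up (leq_maxr i j) hj.
move=> h hh; apply: sV.
have [_ _ _ ah] := SB_mono (leq_maxr i j) hj hh.
rewrite -(mk_level_incl ah).
case: hh => h1 h2 _ _.
by apply: si; split; exact: DB_mono (leq_maxl i j) _.
Qed.

Lemma stab_r_continuous : continuous (@stab_r k L).
Proof.
by apply: (lb_continuous SB_lbase (DB_lbase L)) => g j _;
  have [i [ij h]] := lb_at SB_lbase g j; exists i; split=> // g' [h' _ _ _];
  exact: DB_mono h'.
Qed.

Lemma stab_s_continuous : continuous (@stab_s k L).
Proof.
by apply: (lb_continuous SB_lbase (DB_lbase L)) => g j _;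
  have [i [ij h]] := lb_at SB_lbase g j; exists i; split=> // g' [_ h' _ _];
  exact: DB_mono h'.
Qed.

Lemma stab_hausdorff : hausdorff_space (stab L).
Proof.
apply: (lb_hausdorff SB_lbase) => g h H.
have {}H m p : exists j, [/\ zle (- cz j) m, zle (m + zvec p) (cz j) & SB j g h].
  have [i [h1 h2]] := seg_bound m p.
  have [a [ia ha]] := lb_at SB_lbase g i; have [b [ab hb]] := lb_at SB_lbase h a.
  have ib := leq_trans ia ab.
  exists b; split; try by zz.
  by apply: H => //; exact: SB_up ha.
by apply: stab_eq; apply: dpath_ext => m p; have [j [h1 h2 [h3 h4 _ _]]] := H m p;
  [exact: DB_sg h3 | exact: DB_sg h4].
Qed.

(** Both coordinates converge by compactness of the path balls, and agreement from [cz j] on is a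
    closed condition. *)
Lemma SB_compact j g : compact (SB j g).
Proof.
apply: ultra_compactP => F FU FK.
have [||x [Kx Fx]] := @compact_lim _ _ (@stab_r k L) (DB j (stab_r g)) F.
- exact: DB_compact.
- by apply: filterS FK => h [].
have [||y [Ky Fy]] := @compact_lim _ _ (@stab_s k L) (DB j (stab_s g)) F.
- exact: DB_compact.
- by apply: filterS FK => h [].
have Fx' i := lb_cvgP (DB_lbase L) (j := i) Fx erefl.
have Fy' i := lb_cvgP (DB_lbase L) (j := i) Fy erefl.
have hxy : agree (cz j) x y.
  apply/agreeP => p; have [i [h1 h2]] := seg_bound (cz j) p.
  have [h [[[_ _ _ /agreeP h3] h4] h5]] :=
    filter_ex (filterI (filterI FK (Fx' i)) (Fy' i)).
  by rewrite (DB_sg h1 h2 h4) (DB_sg h1 h2 h5).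
have [h0 [_ _ ag _]] := filter_ex FK.
exists (mk_stab hxy); split; first by split.
apply: (lb_cvg SB_lbase) => i /SBP /= hi.
apply: (filterS _ (filterI (filterI FK (Fx' (maxn i j))) (Fy' (maxn i j)))).
move=> h [[[_ _ _ h3] h4] h5]; split=> //=; try exact: DB_mono (leq_maxl i j) _.
apply: (agree_near (leq_maxl i j) h4 h5 hi).
exact: agree_le (cz_le (leq_maxr i j)) h3.
Qed.

Lemma stab_lchg : lc_hausdorff_groupoid (stable_groupoid L).
Proof.
split.
- apply: (lb_lch SB_lbase stab_hausdorff) => g.
  by have [j h] := SB_ex g; exists j; split=> //; exact: SB_compact.
- apply: (lb_lch (DB_lbase L) (@dpath_hausdorff _ _)) => x.
  by exists 0%N; split=> //; exact: DB_compact.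
- exact: stab_r_continuous.
- exact: stab_s_continuous.
- apply: (lb_continuous (DB_lbase L) SB_lbase) => x j _.
  by exists j; split=> // y h; split.
- apply: (lb_continuous SB_lbase SB_lbase) => g j /SBP /= hj.
  have hj' : SB j g g by apply/SBP => n hn; rewrite hj.
  exists j; split=> // h [a b c d]; by split=> //= n hn; rewrite ?c ?d.
- apply: (@lb_continuous _ _ _ _ (@lb_sub _ _ (lb_prod SB_lbase SB_lbase)
    (composable (stable_groupoid L))) SB_lbase (@gmul_composable (stable_groupoid L))).
  move=> [[g h] gh] j hj /=.
  have [i [ji [h1 h2]]] := lb_at (lb_prod SB_lbase SB_lbase) (g, h) j.
  exists i; split=> // -[[g' h'] gh'] /= [[a b c d] [a' b' c' d']].
  apply: (SB_mono ji hj); split=> //=.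
    exact: (proj1 (SBP _ _) (SB_up ji hj)).
  have e : stab_s g' = stab_r h' := set_mem gh'.
  by move=> n hn; rewrite d // e; exact: d'.
Qed.

End StableTopology.

(** * The tail groupoid as a locally compact Hausdorff groupoid *)

Section TailTopology.
Variables (k : nat) (L : kgraph k) (L_regular : regular_kgraph L).
Implicit Types (l v mu : kmor L) (m n : ZZ k) (p q r : NN k).
Implicit Types (x y z : dpath L) (w u : opath L) (g h : tail_arr L).
Local Notation cstn := (cstn k).
Local Notation cz := (cz k).

Lemma oshift_le p q w u : nle p q -> oshift p w = oshift p u ->
  oshift q w = oshift q u.
Proof.
move=> pq e; have -> : q = zpos (zvec q - zvec p) + p by zz.
by rewrite -!oshiftD e.
Qed.

(** The one-sided counterpart of [agree_near]: the steps between [p] and [q] are inherited from the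
    nearby pair, the rest from the hypothesis at [q]. *)
Lemma oshift_near p q w u w' u' : nle p q -> oi w q = oi w' q ->
  oi u q = oi u' q -> oshift p w = oshift p u -> oshift q w' = oshift q u' ->
  oshift p w' = oshift p u'.
Proof.
move=> pq hw hu e e'; have eq : q = p + zpos (zvec q - zvec p) by zz.
apply: (@opath_glue_eq _ _ _ _ (zpos (zvec q - zvec p))); last first.
  by rewrite !oshiftD addrC -eq.
transitivity (oi (oshift p w) (zpos (zvec q - zvec p))).
  by apply: oi_shift_eq; rewrite -eq hw.
by rewrite e; apply: oi_shift_eq; rewrite -eq hu.
Qed.

Definition TB (j : nat) g h := [/\ OB j (tail_r g) (tail_r h),
  OB j (tail_s g) (tail_s h),
  oshift (cstn j) (tail_r g) = oshift (cstn j) (tail_s g) &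
  oshift (cstn j) (tail_r h) = oshift (cstn j) (tail_s h)].

Lemma cstn_le i j : (i <= j)%N -> nle (cstn i) (cstn j).
Proof. by move=> ij; zz. Qed.

Lemma TBP j g : TB j g g <->
  oshift (cstn j) (tail_r g) = oshift (cstn j) (tail_s g).
Proof. by split=> [[]|]. Qed.

Lemma tail_open_base (A : set (tail_arr L)) g : open A -> A g ->
  exists E : seq (set (tail_arr L)),
    (forall a, a \in E -> [set A | exists l mu : kmor L, ks l = ks mu /\
        A = val @^-1` (pgcyl l mu)] a /\ a g) /\
    forall h, (forall a, a \in E -> a h) -> A h.
Proof.
move=> [W [D' sD <-] <-] [a D'a ax]; have [E sE eE] := sD _ D'a.
exists [seq val @^-1` b | b <- (E : seq _)]; split=> [b /mapP [c cE ->]|u hu].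
  split; last by move: ax; rewrite -eE; exact.
  by have [l [m [e ->]]] := set_mem (sE _ cE); exists l, m.
exists a => //; change (a (val u)); rewrite -eE => b bE.
by apply: (hu (val @^-1` b)); apply/mapP; exists b.
Qed.

Lemma pgcyl_open l mu : ks l = ks mu ->
  open (val @^-1` (pgcyl l mu) : set (tail_arr L)).
Proof.
move=> e; exists (pgcyl l mu) => //; exists [set pgcyl l mu].
  move=> _ ->; exists [fset pgcyl l mu]%fset.
    by move=> a; rewrite inE => /eqP ->; apply/mem_set; exists l, mu.
  by rewrite set_fset1 bigcap_set1.
by rewrite bigcup_set1.
Qed.

Lemma tail_lag g : pg_lag (val g) = 0.
Proof. by case: (set_mem (valP g)). Qed.

(** A nonempty ball is a basic set $Z(\lambda,\mu)$ with $d(\lambda)=d(\mu)=(j,\dots,j)$.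
    Conversely, lag 0 forces equal degrees in any basic set that meets the subgroupoid. *)
Lemma TB_lbase : lbase TB.
Proof.
apply: (lb_subcover tail_open_base) => //.
- move=> j g; have [h|h] := pselect (TB j g g); last first.
    have -> : TB j g = set0; last exact: open0.
    by apply/seteqP; split=> // g' [h1 h2 h3 h4]; apply: h.
  have e := proj1 (TBP _ _) h.
  have -> : TB j g = val @^-1` (pgcyl (oi (tail_r g) (cstn j))
      (oi (tail_s g) (cstn j))).
    apply/seteqP; split=> g'; rewrite /TB /pgcyl /ocyl /OB /= -!/(oi _ _).
      by move=> [-> -> _ h4]; rewrite !oi_deg tail_lag subrr.
    by rewrite !oi_deg => -[h1 h2 _ h3].
  apply: pgcyl_open; rewrite !oi_s.
  by rewrite -[cstn j]add0r -!overt_shift e.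
- by move=> j g h [].
- by move=> j g h h' [a b c d] [a' b' c' d']; split; rewrite // /OB ?a ?b.
- by move=> i j g ij /TBP h; apply/TBP; exact: oshift_le (cstn_le ij) h.
- move=> i j g h ij /TBP a [b c d e]; split=> //; try exact: OB_mono ij _.
  exact: oshift_near (cstn_le ij) b c a e.
- move=> g; have [p e] := tail_rel g; have [j hj] := nle_bound p.
  by exists j; apply/TBP; exact: oshift_le e.
- move=> _ g [l [m [e ->]]] /= [h1 h2 h3 h4].
  have lm : kdeg m = kdeg l.
    by apply: zvec_inj; apply/esym/eqP; rewrite -subr_eq0 -h3 tail_lag.
  rewrite lm in h4; have [j hj] := nle_bound (kdeg l).
  exists j; split; first by apply/TBP; exact: oshift_le h4.
  move=> g' [a b c d]; split=> /=.
  + exact: etrans (esym (OB_oi hj a)) h1.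
  + by rewrite -lm in hj; exact: etrans (esym (OB_oi hj b)) h2.
  + by rewrite lm subrr tail_lag.
  + by rewrite lm; exact: oshift_near hj a b h4 d.
Qed.

Lemma tail_r_continuous : continuous (@tail_r k L).
Proof.
by apply: (lb_continuous TB_lbase (OB_lbase L)) => g j _;
  have [i [ij h]] := lb_at TB_lbase g j; exists i; split=> // g' [h' _ _ _];
  exact: OB_mono h'.
Qed.

Lemma tail_s_continuous : continuous (@tail_s k L).
Proof.
by apply: (lb_continuous TB_lbase (OB_lbase L)) => g j _;
  have [i [ij h]] := lb_at TB_lbase g j; exists i; split=> // g' [_ h' _ _];
  exact: OB_mono h'.
Qed.

Lemma tail_hausdorff : hausdorff_space (tail_arr L).
Proof.
apply: (lb_hausdorff TB_lbase) => g h H.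
have {}H p : exists j, nle p (cstn j) /\ TB j g h.
  have [i h1] := nle_bound p.
  have [a [ia ha]] := lb_at TB_lbase g i; have [b [ab hb]] := lb_at TB_lbase h a.
  have ib := leq_trans ia ab; exists b; split; first zz.
  by apply: H => //; exact: (lb_up TB_lbase) ha.
by apply: tail_arr_eq; apply: opath_ext => p; have [j [h1 [h3 h4 _ _]]] := H p;
  [exact: OB_oi h3 | exact: OB_oi h4].
Qed.

Lemma TB_compact j g : compact (TB j g).
Proof.
apply: ultra_compactP => F FU FK.
have [||x [Kx Fx]] := @compact_lim _ _ (@tail_r k L) (OB j (tail_r g)) F.
- exact: OB_compact.
- by apply: filterS FK => h [].
have [||y [Ky Fy]] := @compact_lim _ _ (@tail_s k L) (OB j (tail_s g)) F.
- exact: OB_compact.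
- by apply: filterS FK => h [].
have Fx' i := lb_cvgP (OB_lbase L) (j := i) Fx erefl.
have Fy' i := lb_cvgP (OB_lbase L) (j := i) Fy erefl.
have hxy : oshift (cstn j) x = oshift (cstn j) y.
  apply: opath_ext => p; have [i h1] := nle_bound (cstn j + p).
  have [h [[[_ _ _ h3] h4] h5]] :=
    filter_ex (filterI (filterI FK (Fx' i)) (Fy' i)).
  transitivity (oi (oshift (cstn j) (tail_r h)) p).
    by apply: oi_shift_eq; exact: OB_oi h4.
  by rewrite h3; apply/esym/oi_shift_eq; exact: OB_oi h5.
have [h0 [_ _ ag _]] := filter_ex FK.
have txy : tail_eq x y by exists (cstn j).
exists (tail_mk txy); split; first by split.
apply: (lb_cvg TB_lbase) => i /TBP hi.
apply: (filterS _ (filterI (filterI FK (Fx' (maxn i j))) (Fy' (maxn i j)))).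
move=> h [[[_ _ _ h3] h4] h5]; split=> //; try exact: OB_mono (leq_maxl i j) _.
apply: (oshift_near (cstn_le (leq_maxl i j)) h4 h5 hi).
exact: oshift_le (cstn_le (leq_maxr i j)) h3.
Qed.

Lemma tail_lchg : lc_hausdorff_groupoid (tail_groupoid L).
Proof.
split.
- apply: (lb_lch TB_lbase tail_hausdorff) => g.
  by have [j h] := lb_ex TB_lbase g; exists j; split=> //; exact: TB_compact.
- apply: (lb_lch (OB_lbase L) (@opath_hausdorff _ _)) => x.
  by exists 0%N; split=> //; exact: OB_compact.
- exact: tail_r_continuous.
- exact: tail_s_continuous.
- apply: (lb_continuous (OB_lbase L) TB_lbase) => x j _.
  by exists j; split=> // y h; split.
- apply: (lb_continuous TB_lbase TB_lbase) => g j /TBP hj.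
  have hj' : TB j g g by apply/TBP; exact: esym hj.
  exists j; split=> // h [a b c d]; split=> //.
- apply: (@lb_continuous _ _ _ _ (@lb_sub _ _ (lb_prod TB_lbase TB_lbase)
    (composable (tail_groupoid L))) TB_lbase
    (@gmul_composable (tail_groupoid L))).
  move=> [[g h] gh] j hj /=.
  have [i [ji [h1 h2]]] := lb_at (lb_prod TB_lbase TB_lbase) (g, h) j.
  exists i; split=> // -[[g' h'] gh'] /= [[a b c d] [a' b' c' d']].
  apply: (lb_mono TB_lbase ji hj); split=> //.
    exact: (proj1 (TBP _ _) (lb_up TB_lbase ji hj)).
  have e : tail_s g' = tail_r h' := set_mem gh'.
  by apply: etrans d _; rewrite e.
Qed.

(** Glue [mu] to [w] as a past and take the future from the beginning of [mu] on. *)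
Lemma oglue_ex w mu : ks mu = overt w 0 ->
  exists u, oi u (kdeg mu) = mu /\ oshift (kdeg mu) u = w.
Proof.
move=> h; exists (fut (- zvec (kdeg mu)) (pglue L_regular w mu)).
by rewrite oi_fut glue_sg // oshift_fut addNr fut0 glue_restr.
Qed.

End TailTopology.

(** * The equivalence space *)

Section Equivalence.
Variables (k : nat) (L : kgraph k) (L_regular : regular_kgraph L).
Implicit Types (l v mu : kmor L) (m n : ZZ k) (p q r : NN k).
Implicit Types (x y : dpath L) (w u : opath L).
Local Notation cstn := (cstn k).
Local Notation cz := (cz k).
Local Notation G := (stable_groupoid L).
Local Notation H := (tail_groupoid L).

Definition ZB (j : nat) (a b : zspace L) :=
  DB j (val a).1 (val b).1 /\ TB j (val a).2 (val b).2.

Lemma ZB_lbase : lbase ZB.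
Proof. exact: (lb_sub (lb_prod (DB_lbase L) (TB_lbase L))). Qed.

Lemma zspaceP (z : zspace L) : restr (val z).1 = tail_r (val z).2.
Proof. exact: (set_mem (valP z)). Qed.

(** The range of the arrow is the restriction of the path, and a lag 0 arrow is determined by its
    ends. All algebraic identities on [zspace] reduce to this. *)
Lemma zspace_eq (a b : zspace L) : (val a).1 = (val b).1 ->
  tail_s (val a).2 = tail_s (val b).2 -> a = b.
Proof.
move=> e1 e2; apply: val_inj; apply: injective_projections => //.
by apply: tail_arr_eq => //; rewrite -!zspaceP e1.
Qed.

Definition mk_z x w (h : tail_eq (restr x) w) : zspace L :=
  exist _ (x, tail_mk h) (mem_set (erefl : zset (x, tail_mk h))).

Lemma fut_cz j x : fut (cz j) x = oshift (cstn j) (restr x).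
Proof. by rewrite -fut0 oshift_fut add0r. Qed.

Lemma agree_cz j x y :
  agree (cz j) x y <-> oshift (cstn j) (restr x) = oshift (cstn j) (restr y).
Proof. by rewrite agree_fut !fut_cz. Qed.

Lemma DB_restr j x y : DB j x y -> OB j (restr x) (restr y).
Proof. by move=> h; rewrite /OB !oi_restr; apply: DB_sg h; zz. Qed.

Lemma zrho_continuous : continuous (@zrho k L).
Proof.
apply: (lb_continuous ZB_lbase (DB_lbase L)) => z j _.
have [i [ij h]] := lb_at ZB_lbase z j; exists i; split=> // z' [h' _].
exact: DB_mono ij h'.
Qed.

Lemma zsig_continuous : continuous (@zsig k L).
Proof.
apply: (lb_continuous ZB_lbase (OB_lbase L)) => z j _.
have [i [ij h]] := lb_at ZB_lbase z j; exists i; split=> // z' [_ [_ h' _ _]].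
exact: OB_mono ij h'.
Qed.

Lemma zspace_hausdorff : hausdorff_space (zspace L).
Proof.
apply: (lb_hausdorff ZB_lbase) => z z' h; apply: zspace_eq.
  apply: (@dpath_hausdorff _ L) => A B /zrho_continuous nA /zrho_continuous nB.
  have /(lb_nbhs_ge ZB_lbase 0%N) [i [_ hi si]] := nA.
  have /(lb_nbhs_ge ZB_lbase i) [j [ij hj sj]] := nB.
  have c := h _ (lb_up ZB_lbase ij hi) hj.
  exists (zrho z'); split; last exact: (sj z').
  by apply: (si z'); exact: (lb_mono ZB_lbase ij hi c).
apply: (@opath_hausdorff _ L) => A B /zsig_continuous nA /zsig_continuous nB.
have /(lb_nbhs_ge ZB_lbase 0%N) [i [_ hi si]] := nA.
have /(lb_nbhs_ge ZB_lbase i) [j [ij hj sj]] := nB.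
have c := h _ (lb_up ZB_lbase ij hi) hj.
exists (zsig z'); split; last exact: (sj z').
by apply: (si z'); exact: (lb_mono ZB_lbase ij hi c).
Qed.

(** Both components converge by compactness, and the condition that the restriction is the range of
    the arrow is closed. *)
Lemma ZB_compact j z : compact (ZB j z).
Proof.
apply: ultra_compactP => F FU FK.
have [||x [Kx Fx]] := @compact_lim _ _ (@zrho k L) (DB j (val z).1) F.
- exact: DB_compact.
- by apply: filterS FK => h [].
have [||g [Kg Fg]] :=
    @compact_lim _ _ (fun z : zspace L => (val z).2) (TB j (val z).2) F.
- exact: TB_compact.
- by apply: filterS FK => h [].
have Fx' i := lb_cvgP (DB_lbase L) (j := i) Fx erefl.
have xg : restr x = tail_r g.
  apply: opath_ext => p; have [i0 h0] := nle_bound p.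
  have [i [ij hi]] := lb_at (TB_lbase L) g i0.
  have [z' [h1 [h2 _ _ _]]] :=
    filter_ex (filterI (Fx' i) (lb_cvgP (TB_lbase L) Fg hi)).
  have hp : nle p (cstn i) by zz.
  by rewrite (OB_oi hp (DB_restr h1)) (OB_oi hp h2) zspaceP.
exists (exist _ (x, g) (mem_set (xg : zset (x, g)))); split => //.
apply: (lb_cvg ZB_lbase) => i [_ /= hi].
apply: (filterS _ (filterI (Fx' i) (lb_cvgP (TB_lbase L) Fg hi))).
by move=> z' [].
Qed.

Lemma zspace_lch : lc_hausdorff (zspace L).
Proof.
apply: (lb_lch ZB_lbase zspace_hausdorff) => z.
by have [j h] := lb_ex ZB_lbase z; exists j; split=> //; exact: ZB_compact.
Qed.

Lemma left_act_near i (a a' : stab L) (z z' : zspace L)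
    (h : stab_s a = zrho z) (h' : stab_s a' = zrho z') :
  SB i a a' -> ZB i z z' -> ZB i (zlact h) (zlact h').
Proof.
move=> [s1 s2 s3 s4] [t1 [t2 t3 t4 t5]]; split=> //; split=> //.
- exact: DB_restr.
- move/agree_cz: s3; rewrite h => s3; apply: etrans s3 _.
  by rewrite zspaceP.
- move/agree_cz: s4; rewrite h' => s4; apply: etrans s4 _.
  by rewrite zspaceP.
Qed.

Lemma left_act_continuous :
  continuous (@left_act_map G (zspace L) (@zrho k L) (@zlact k L)).
Proof.
apply: (@lb_continuous _ _ _ _ (@lb_sub _ _ (lb_prod (SB_lbase L) ZB_lbase)
  (@left_fib G (zspace L) (@zrho k L))) ZB_lbase).
move=> [[a z] az] j hj.
have [i [ji [h1 h2]]] := lb_at (lb_prod (SB_lbase L) ZB_lbase) (a, z) j.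
exists i; split=> // -[[a' z'] az'] /= [h3 h4].
by apply: (lb_mono ZB_lbase ji hj); exact: left_act_near.
Qed.

Lemma left_space_z : left_space (@zlact k L).
Proof.
split.
- exact: zrho_continuous.
- exact: left_act_continuous.
- by [].
- by move=> z h; apply: zspace_eq.
- by move=> g1 g2 z h12 h2 h h1; apply: zspace_eq.
Qed.

Lemma left_free_z : left_free (@zlact k L).
Proof.
move=> g z h e; have e' : stab_r g = zrho z := congr1 (@zrho k L) e.
by apply: (@stab_eq k L g (stab_id (zrho z))).
Qed.

Lemma right_act_near i (z z' : zspace L) (g g' : tail_arr L)
    (h : zsig z = tail_r g) (h' : zsig z' = tail_r g') :
  ZB i z z' -> TB i g g' -> ZB i (zract h) (zract h').
Proof.
move=> [t1 [t2 t3 t4 t5]] [s1 s2 s3 s4]; split=> //; split=> //.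
- by apply: etrans t4 _; rewrite -/(zsig z) h.
- by apply: etrans t5 _; rewrite -/(zsig z') h'.
Qed.

Lemma right_act_continuous :
  continuous (@right_act_map H (zspace L) (@zsig k L) (@zract k L)).
Proof.
apply: (@lb_continuous _ _ _ _ (@lb_sub _ _ (lb_prod ZB_lbase (TB_lbase L))
  (@right_fib H (zspace L) (@zsig k L))) ZB_lbase).
move=> [[z a] az] j hj.
have [i [ji [h1 h2]]] := lb_at (lb_prod ZB_lbase (TB_lbase L)) (z, a) j.
exists i; split=> // -[[z' a'] az'] /= [h3 h4].
by apply: (lb_mono ZB_lbase ji hj); exact: right_act_near.
Qed.

Lemma right_space_z : right_space (@zract k L).
Proof.
split.
- exact: zsig_continuous.
- exact: right_act_continuous.
- by [].
- by move=> z h; apply: zspace_eq.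
- by move=> z g1 g2 h12 h1 h h2; apply: zspace_eq.
Qed.

Lemma right_free_z : right_free (@zract k L).
Proof.
move=> z g h e; have e' : tail_s g = zsig z := congr1 (@zsig k L) e.
by apply: (@tail_arr_eq k L g (tail_id (zsig z))).
Qed.

(** The converse of [restr_tail_eq]; it makes the left action transitive on the fibres of [zsig]. *)
Lemma tail_agree x y : tail_eq (restr x) (restr y) -> exists m, agree m x y.
Proof.
move=> [p e]; exists (zvec p); apply/agree_fut.
by have := e; rewrite -!fut0 !oshift_fut add0r.
Qed.

Lemma pair_continuous (S T U : topologicalType) (f : S -> T) (g : S -> U) :
  continuous f -> continuous g -> continuous (fun s => (f s, g s)).
Proof. by move=> cf cg s; apply: cvg_pair; [exact: cf | exact: cg]. Qed.

(** Along an ultrafilter in the preimage of a compact set, [z] tends to some [z2] and its translate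
    to some [z1]. As [zsig] is invariant, the limits lie in one fibre, hence differ by an arrow, and
    this arrow is the limit of the acting arrows. *)
Lemma left_proper_z : left_proper (@zlact k L).
Proof.
split.
  apply: pair_continuous; first exact: left_act_continuous.
  move=> p; apply: (@cvg_comp _ _ _ (@set_val _ _) snd _ (nbhs (val p))).
    exact: initial_continuous.
  exact: cvg_snd.
move=> K cK; apply: ultra_compactP => F FU FK.
have [[z1 z2] [K12 F12]] := compact_lim FU cK FK.
have F1 j : ZB j z1 z1 -> F [set p | ZB j z1 (left_act_map (@zlact k L) p)].
  move=> h; apply: (F12 [set q | ZB j z1 q.1]).
  by exists (ZB j z1, setT) => [|q []//]; split; [exact: (lb_ball ZB_lbase h)|exact: filterT].
have F2 j : ZB j z2 z2 -> F [set p | ZB j z2 (val p).2].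
  move=> h; apply: (F12 [set q | ZB j z2 q.2]).
  by exists (setT, ZB j z2) => [|q []//]; split; [exact: filterT|exact: (lb_ball ZB_lbase h)].
have e12 : zsig z1 = zsig z2.
  apply: opath_ext => p; have [i0 h0] := nle_bound p.
  have [i [ij hi]] := lb_at ZB_lbase z1 i0.
  have [j [jj hj]] := lb_at ZB_lbase z2 i.
  have [[[a z] az] [h1 h2]] := filter_ex (filterI (F1 i hi) (F2 j hj)).
  have hp : nle p (cstn i) by zz.
  have hp' : nle p (cstn j) by zz.
  have [_ [_ /(OB_oi hp) h3 _ _]] := h1; have [_ [_ /(OB_oi hp') h4 _ _]] := h2.
  exact: etrans h3 (esym h4).
have rel : exists m, agree m (zrho z1) (zrho z2).
  apply: tail_agree; rewrite !zspaceP.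
  have := tail_rel (val z1).2; rewrite -/(zsig z1) e12 => h.
  exact: tail_eq_trans h (tail_eq_sym (tail_rel _)).
have hg : left_fib (G := G) (@zrho k L) (Stab rel, z2) by [].
exists (exist _ (Stab rel, z2) (mem_set hg)); split.
  rewrite /preimage /=; suff -> : left_act_map (@zlact k L)
    (exist _ (Stab rel, z2) (mem_set hg)) = z1 by [].
  exact: zspace_eq.
apply: (lb_cvg (@lb_sub _ _ (lb_prod (SB_lbase L) ZB_lbase)
  (@left_fib G (zspace L) (@zrho k L)))) => j [/= hj1 hj2].
have [i [ij hi]] := lb_at ZB_lbase z1 j.
have hi2 := lb_up ZB_lbase ij hj2.
apply: (filterS _ (filterI (F1 i hi) (F2 i hi2))) => -[[a z] az] /= [h1 h2].
have e : stab_s a = zrho z := set_mem az.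
split; last exact: (lb_mono ZB_lbase ij hj2 h2).
apply: (lb_mono (SB_lbase L) ij hj1).
(* Both points lie in balls of index [i], so the tails of their paths follow the common [zsig] from
   [cstn i] on; this puts the acting arrow in level [cz i]. *)
case: h1 => [h1 [_ _ _ h3]]; case: h2 => [h2 [_ _ _ h5]].
split=> /=.
- exact: h1.
- by rewrite e; exact: h2.
- exact: (proj1 (SBP _ _) (lb_up (SB_lbase L) ij hj1)).
- apply/agree_cz; rewrite e; apply: etrans h3 _; rewrite zspaceP h5; by [].
Qed.

(** As for the left action, with [zrho] as the invariant that identifies the two limits as points of
    one orbit. *)
Lemma right_proper_z : right_proper (@zract k L).
Proof.
split.
  apply: pair_continuous; last exact: right_act_continuous.
  move=> p; apply: (@cvg_comp _ _ _ (@set_val _ _) fst _ (nbhs (val p))).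
    exact: initial_continuous.
  exact: cvg_fst.
move=> K cK; apply: ultra_compactP => F FU FK.
have [[z1 z2] [K12 F12]] := compact_lim FU cK FK.
have F1 j : ZB j z1 z1 -> F [set p | ZB j z1 (val p).1].
  move=> h; apply: (F12 [set q | ZB j z1 q.1]).
  by exists (ZB j z1, setT) => [|q []//]; split; [exact: (lb_ball ZB_lbase h)|exact: filterT].
have F2 j : ZB j z2 z2 -> F [set p | ZB j z2 (right_act_map (@zract k L) p)].
  move=> h; apply: (F12 [set q | ZB j z2 q.2]).
  by exists (setT, ZB j z2) => [|q []//]; split; [exact: filterT|exact: (lb_ball ZB_lbase h)].
have e12 : zrho z1 = zrho z2.
  apply: dpath_ext => m p; have [i0 [h0 h0']] := seg_bound m p.
  have [i [ij hi]] := lb_at ZB_lbase z1 i0.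
  have [j [jj hj]] := lb_at ZB_lbase z2 i.
  have [[[z a] az] [[h1 _] [h2 _]]] := filter_ex (filterI (F1 i hi) (F2 j hj)).
  have hp : zle (- cz i) m by zz.
  have hp' : zle (m + zvec p) (cz i) by zz.
  have hq : zle (- cz j) m by zz.
  have hq' : zle (m + zvec p) (cz j) by zz.
  by apply: etrans (DB_sg hp hp' h1) _; apply/esym/(DB_sg hq hq' h2).
have rel : tail_eq (zsig z1) (zsig z2).
  apply: tail_eq_trans (tail_eq_sym (tail_rel (val z1).2)) _.
  by rewrite -zspaceP -/(zrho z1) e12 /zrho zspaceP; exact: tail_rel.
have hg : right_fib (H := H) (@zsig k L) (z1, tail_mk rel) by [].
exists (exist _ (z1, tail_mk rel) (mem_set hg)); split.
  rewrite /preimage /=; suff -> : right_act_map (@zract k L)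
    (exist _ (z1, tail_mk rel) (mem_set hg)) = z2 by [].
  exact: zspace_eq.
apply: (lb_cvg (@lb_sub _ _ (lb_prod ZB_lbase (TB_lbase L))
  (@right_fib H (zspace L) (@zsig k L)))) => j [/= hj1 hj2].
have [i [ij hi]] := lb_at ZB_lbase z2 j.
have hi1 := lb_up ZB_lbase ij hj1.
apply: (filterS _ (filterI (F1 i hi1) (F2 i hi))) => -[[z a] az] /= [h1 h2].
have e : zsig z = tail_r a := set_mem az.
split; first exact: (lb_mono ZB_lbase ij hj1 h1).
apply: (lb_mono (TB_lbase L) ij hj2).
case: h1 => [_ [_ h1 _ h3]]; case: h2 => [_ [_ h2 _ h5]].
split.
- by rewrite -e; exact: h1.
- exact: h2.
- exact: (proj1 (TBP _ _) (lb_up (TB_lbase L) ij hj2)).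
- by rewrite -e; apply: etrans (esym h3) _; exact: h5.
Qed.

(** A point over [x] near [zrho z] is obtained by keeping the first [i] diagonal steps of [zsig z]
    and continuing with the tail of [x]. *)
Lemma zrho_open : open_map (@zrho k L).
Proof.
move=> U oU; rewrite openE => _ [z Uz <-].
have /(lb_nbhs ZB_lbase) [i [hi si]] : nbhs z U by exact: open_nbhs_nbhs.
apply/(lb_nbhs (DB_lbase L)); exists i; split=> // x hx.
case: hi => _ /TBP hi.
have hs : ks (oi (zsig z) (cstn i)) = overt (oshift (cstn i) (restr x)) 0.
  rewrite oi_s -[cstn i in LHS]add0r -overt_shift -hi -zspaceP.
  by rewrite !overt_shift add0r -!oi_s (DB_restr hx).
have [u []] := oglue_ex L_regular hs; rewrite oi_deg => e1 e2.
have tx : tail_eq (restr x) u by exists (cstn i).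
exists (mk_z tx) => //; apply: si; split=> //; split=> //.
- by rewrite -zspaceP; exact: DB_restr.
Qed.

(** For [w] near [zsig z], the first [i] diagonal steps of the range of the arrow of [z] are put
    before the tail of [w], and the resulting path receives the past of [zrho z]. *)
Lemma zsig_open : open_map (@zsig k L).
Proof.
move=> U oU; rewrite openE => _ [z Uz <-].
have /(lb_nbhs ZB_lbase) [i [hi si]] : nbhs z U by exact: open_nbhs_nbhs.
apply/(lb_nbhs (OB_lbase L)); exists i; split=> // w hw.
case: hi => _ /TBP hi.
have hs : ks (oi (tail_r (val z).2) (cstn i)) = overt (oshift (cstn i) w) 0.
  rewrite oi_s -[cstn i in LHS]add0r -overt_shift hi.
  by rewrite !overt_shift add0r -!oi_s hw.
have [u []] := oglue_ex L_regular hs; rewrite oi_deg => e1 e2.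
have hs2 : ks (sg (zrho z) (- cz i) (cstn i)) = overt u 0.
  have -> : overt u 0 = overt (tail_r (val z).2) 0.
    by rewrite -(oi_r u (cstn i)) e1 oi_r.
  by rewrite -zspaceP overt_restr sg_s addNr.
pose x := pglue L_regular u (sg (zrho z) (- cz i) (cstn i)).
have xu : restr x = u by exact: glue_restr.
have tx : tail_eq (restr x) w by exists (cstn i); rewrite xu.
exists (mk_z tx) => //; apply: si; split=> /=; last first.
  split; [|exact: hw|exact: hi|by apply: etrans e2; rewrite -xu].
  by rewrite /OB -e1 -xu.
have := glue_sg L_regular hs2; rewrite sg_deg /DB cstnD !sgD -/x => ->.
have -> : - cz i + zvec (cstn i) = 0 by zz.
congr cmp; rewrite -[RHS]oi_restr xu e1 -zspaceP oi_restr; by [].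
Qed.

Lemma equivalence_z : @groupoid_equivalence G H (zspace L)
  (@zrho k L) (@zsig k L) (@zlact k L) (@zract k L).
Proof.
split.
- exact: stab_lchg.
- exact: tail_lchg.
- exact: zspace_lch.
- exact: left_space_z.
- exact: left_free_z.
- exact: left_proper_z.
- exact: right_space_z.
- exact: right_free_z.
- exact: right_proper_z.
- by move=> g z h hg hh h1 h2; apply: zspace_eq.
- exact: zrho_open.
- exact: zsig_open.
- by move=> x; exists (mk_z (tail_eq_refl (restr x))).
- move=> z z'; split=> [e|[h [e ->]]] //.
  have t : tail_eq (zsig z) (zsig z').
    apply: tail_eq_trans (tail_eq_sym (tail_rel (val z).2)) _.
    by rewrite -zspaceP -/(zrho z) e /zrho zspaceP; exact: tail_rel.
  by exists (tail_mk t), erefl; apply: zspace_eq.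
- move=> u; have [x hx] := fut_ex L_regular 0 u.
  by exists (mk_z (tail_eq_refl (restr x))); rewrite -hx fut0.
- move=> z z'; split=> [e|[g [h ->]]] //.
  have t : exists m, agree m (zrho z') (zrho z).
    apply: tail_agree; rewrite !zspaceP; apply: tail_eq_trans (tail_rel _) _.
    rewrite -/(zsig z') -e; exact: tail_eq_sym (tail_rel _).
  by exists (Stab t), erefl; apply: zspace_eq.
Qed.

End Equivalence.

(** * Real-valued norms and sequential limits *)

Section ComplexNorm.
Variable R : realType.
Local Notation C := (Cx R).

Definition rC (r : R) : C := Cmk r 0.

Lemma Cre_rC r : Cre (rC r) = r. Proof. by []. Qed.
Lemma Cim_rC r : Cim (rC r) = 0. Proof. by []. Qed.
Lemma rC0 : rC 0 = 0. Proof. by []. Qed.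
Lemma rC1 : rC 1 = 1. Proof. by []. Qed.
Lemma rCD a b : rC (a + b) = rC a + rC b.
Proof. exact: (rmorphD (real_complex R)). Qed.
Lemma rCN a : rC (- a) = - rC a.
Proof. exact: (rmorphN (real_complex R)). Qed.
Lemma rCB a b : rC (a - b) = rC a - rC b.
Proof. exact: (rmorphB (real_complex R)). Qed.
Lemma rCM a b : rC (a * b) = rC a * rC b.
Proof. exact: (rmorphM (real_complex R)). Qed.
Lemma rCX a n : rC (a ^+ n) = rC a ^+ n.
Proof. exact: (rmorphXn (real_complex R)). Qed.
Lemma rCV a : rC a^-1 = (rC a)^-1.
Proof. exact: (fmorphV (real_complex R)). Qed.
Lemma rC_sum I (s : seq I) (P : pred I) (f : I -> R) :
  rC (\sum_(i <- s | P i) f i) = \sum_(i <- s | P i) rC (f i).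
Proof. exact: (rmorph_sum (real_complex R)). Qed.
Lemma rC_le a b : (rC a <= rC b) = (a <= b). Proof. exact: lecR. Qed.
Lemma rC_lt a b : (rC a < rC b) = (a < b). Proof. exact: ltcR. Qed.
Lemma rC_inj : injective rC. Proof. by move=> a b []. Qed.
Lemma rC_eq0 a : (rC a == 0) = (a == 0).
Proof. by rewrite -rC0 (inj_eq rC_inj). Qed.
Lemma rC_conj a : (rC a)^* = rC a.
Proof. exact: conjc_real. Qed.
Lemma Cre_real (z : C) : 0 <= z -> rC (Cre z) = z.
Proof. by move=> h; apply: RRe_real; exact: ger0_real. Qed.

Lemma CreD (x y : C) : Cre (x + y) = Cre x + Cre y.
Proof. by case: x y => [? ?] [? ?]. Qed.
Lemma CimD (x y : C) : Cim (x + y) = Cim x + Cim y.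
Proof. by case: x y => [? ?] [? ?]. Qed.
Lemma CreN (x : C) : Cre (- x) = - Cre x. Proof. by case: x. Qed.
Lemma CimN (x : C) : Cim (- x) = - Cim x. Proof. by case: x. Qed.
Lemma Ceq (x y : C) : Cre x = Cre y -> Cim x = Cim y -> x = y.
Proof. by case: x y => [? ?] [? ?] /= -> ->. Qed.
Lemma CmkE (x : C) : Cmk (Cre x) (Cim x) = x. Proof. by case: x. Qed.

Section Norm.
Variable V : normedZmodType C.

(* Norms have values in the complex field; [nn] is the real number. *)
Definition nn (v : V) : R := Cre `|v|.

Lemma nnE v : `|v| = rC (nn v). Proof. by rewrite Cre_real. Qed.
Lemma nn_ge0 v : 0 <= nn v. Proof. by rewrite -rC_le -nnE rC0. Qed.
Lemma nn0 : nn 0 = 0. Proof. by rewrite /nn normr0. Qed.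
Lemma nn0_eq v : nn v = 0 -> v = 0.
Proof. by move=> h; apply: normr0_eq0; rewrite nnE h. Qed.
Lemma nnD v w : nn (v + w) <= nn v + nn w.
Proof. by rewrite -rC_le rCD -!nnE ler_normD. Qed.
Lemma nnN v : nn (- v) = nn v. Proof. by rewrite /nn normrN. Qed.
Lemma nnB v w : nn (v - w) = nn (w - v). Proof. by rewrite -nnN opprB. Qed.
Lemma nn_sub v w : nn (v - w) <= nn v + nn w.
Proof. by rewrite (le_trans (nnD _ _)) // nnN. Qed.
Lemma nn_tri w u v : nn (u - v) <= nn (u - w) + nn (w - v).
Proof. by rewrite -[u - v](subrKA w) nnD. Qed.
Lemma nn_le_tri v w : nn v <= nn w + nn (v - w).
Proof. by rewrite -{1}[v](subrK w) addrC nnD. Qed.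
Lemma nn_sum I (s : seq I) (P : pred I) (f : I -> V) :
  nn (\sum_(i <- s | P i) f i) <= \sum_(i <- s | P i) nn (f i).
Proof.
elim/big_ind2: _ => [|a b c d h1 h2|//]; first by rewrite nn0.
exact: le_trans (nnD _ _) (lerD h1 h2).
Qed.

End Norm.

Lemma nnM (x y : C) : nn (x * y) = nn x * nn y.
Proof. by apply: rC_inj; rewrite rCM -!nnE normrM. Qed.
Lemma nn_conj (x : C) : nn (x^*) = nn x.
Proof. by rewrite /nn norm_conjC. Qed.
Lemma nn_rC r : nn (rC r) = `|r|.
Proof.
rewrite /nn; have [h|h] := leP 0 r.
  by rewrite ger0_norm ?ger0_norm // -rC0 rC_le.
by rewrite ltr0_norm ?ltr0_norm // -rC0 rC_lt.
Qed.
Lemma nn1 : nn (1 : C) = 1. Proof. by rewrite -rC1 nn_rC normr1. Qed.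
Lemma nn_sqr (x : C) : x * x^* = rC (nn x ^+ 2).
Proof. by rewrite rCX -nnE normCK. Qed.
Lemma Cre_le_nn (x : C) : `|Cre x| <= nn x.
Proof. by rewrite -rC_le -nnE; exact: normc_ge_Re. Qed.
Lemma Cim_le_nn (x : C) : `|Cim x| <= nn x.
Proof.
have -> : Cim x = - Cre (x * 'i%C) by rewrite /Cre ReiNIm opprK.
rewrite normrN (le_trans (Cre_le_nn _)) // nnM.
suff -> : nn ('i%C : C) = 1 by rewrite mulr1.
apply: rC_inj; rewrite -nnE; have := normc_def ('i%C : R[i]) => ->.
by rewrite /= expr0n expr1n add0r sqrtr1.
Qed.
Lemma nn_le_ReIm (x : C) : nn x <= `|Cre x| + `|Cim x|.
Proof.
have {1}-> : x = rC (Cre x) + 'i%C * rC (Cim x) by exact: complexE.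
rewrite (le_trans (nnD _ _)) // nnM !nn_rC lerD2l ler_piMl //.
by have := Cre_le_nn 1; rewrite /nn normc_def /= expr0n expr1n add0r sqrtr1.
Qed.

Lemma nnZ (V : normedModType C) (z : C) (v : V) : nn (z *: v) = nn z * nn v.
Proof. by apply: rC_inj; rewrite rCM -!nnE normrZ. Qed.

Section NormTopology.
Variable V : normedModType C.

Lemma nbhs_nn (x : V) (A : set V) :
  nbhs x A <-> exists2 e : R, 0 < e & forall y, nn (x - y) < e -> A y.
Proof.
split.
  move=> /nbhs_normP [e /= e0 h]; exists (Cre e).
    by rewrite -rC_lt Cre_real // ltW.
  by move=> y hy; apply: h => /=; rewrite nnE -[e]Cre_real ?rC_lt // ltW.
move=> [e e0 h]; apply/nbhs_normP; exists (rC e) => /=.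
  by rewrite -rC0 rC_lt.
by move=> y /=; rewrite nnE rC_lt; exact: h.
Qed.

Lemma closure_nn (A : set V) x :
  closure A x <-> forall e : R, 0 < e -> exists2 a, A a & nn (x - a) < e.
Proof.
split=> [h e e0|h B /nbhs_nn [e e0 sB]].
  have [|a [Aa ha]] := h [set y | nn (x - y) < e]; last by exists a.
  by apply/nbhs_nn; exists e.
by have [a Aa ha] := h e e0; exists a; split=> //; exact: sB.
Qed.

Lemma continuous_nn (T : topologicalType) (f : T -> V) :
  continuous f <->
  forall t (e : R), 0 < e -> \forall s \near t, nn (f t - f s) < e.
Proof.
split=> [cf t e e0|h t A /nbhs_nn [e e0 sA]].
  by apply: (cf t [set y | nn (f t - y) < e]); apply/nbhs_nn; exists e.
by apply: filterS (h t e e0) => s; exact: sA.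
Qed.

End NormTopology.

Lemma Cre_continuous : continuous (@Cre R).
Proof.
move=> x A /nbhs_ballP [e /= e0 sA].
apply/(@nbhs_nn C^o); exists e => // y hy; apply: sA.
rewrite /ball /= -CreN -CreD; exact: le_lt_trans (Cre_le_nn _) hy.
Qed.

Lemma Cim_continuous : continuous (@Cim R).
Proof.
move=> x A /nbhs_ballP [e /= e0 sA].
apply/(@nbhs_nn C^o); exists e => // y hy; apply: sA.
rewrite /ball /= -CimN -CimD; exact: le_lt_trans (Cim_le_nn _) hy.
Qed.

Definition cauchy_nn (V : normedModType C) (u : nat -> V) := forall e : R,
  0 < e -> exists N, forall m n, (N <= m)%N -> (N <= n)%N -> nn (u m - u n) < e.

Definition lim_nn (V : normedModType C) (u : nat -> V) (l : V) := forall e : R,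
  0 < e -> exists N, forall n, (N <= n)%N -> nn (l - u n) < e.

Lemma complete_nn (V : completeNormedModType C) (u : nat -> V) :
  cauchy_nn u -> exists l, lim_nn u l.
Proof.
move=> cu; suff : cvg (u @ \oo).
  move/cvg_ex => [l hl]; exists l => e e0.
  have /hl [N _ hN] : nbhs l [set y | nn (l - y) < e] by apply/nbhs_nn; exists e.
  by exists N.
apply: cauchy_cvg; apply/cauchyP => e e0.
have e0' : 0 < Cre e by rewrite -rC_lt Cre_real // ltW.
have [N hN] := cu _ e0'; exists (u N); exists N => // n /= Nn.
rewrite -ball_normE /= nnE -[e]Cre_real ?rC_lt ?ltW //.
exact: hN.
Qed.

Lemma lim_nn_uniq (V : normedModType C) (u : nat -> V) l l' :
  lim_nn u l -> lim_nn u l' -> l = l'.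
Proof.
move=> h h'; apply/eqP; rewrite -subr_eq0; apply/eqP/nn0_eq/le_anti.
rewrite nn_ge0 andbT; apply/ler_addgt0Pr => e e0; rewrite add0r.
have e2 : 0 < e / 2 by rewrite divr_gt0.
have [N hN] := h _ e2; have [N' hN'] := h' _ e2.
have h1 := hN _ (leq_maxl N N'); have h2 := hN' _ (leq_maxr N N').
rewrite (le_trans (nn_tri (u (maxn N N')) _ _)) // [leRHS](splitr e).
by rewrite lerD // ltW // nnB.
Qed.

End ComplexNorm.

(** * Borel measurability and integration against Dirac measures *)

Section Cint.
Variables (R : realType) (T : topologicalType) (t0 : T).
Local Notation C := (Cx R).

Lemma borel_open (A : set T) : open A -> measurable (A : set (borel t0)).
Proof. by move=> oA; apply: sub_sigma_algebra. Qed.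

Lemma borel_continuous (f : T -> R) :
  continuous f -> measurable_fun setT (f : borel t0 -> R).
Proof.
move=> /continuousP cf.
apply: (measurability _ (measurable_realfun.RGenOpens.measurableE R)) => _ [_ [a [b ->] <-]].
rewrite setTI; apply: borel_open; apply: cf; exact: interval_open.
Qed.

Lemma Cint_dirac (a : borel t0) (f : T -> C) : continuous f ->
  cint (\d_a : {measure set (borel t0) -> \bar R}) f = f a.
Proof.
move=> cf; rewrite /cint /Rintegral !integral_dirac ?diracT ?mul1e /= ?CmkE //.
- apply/measurable_EFinP; apply: borel_continuous => x.
  exact: (continuous_comp (cf x) (@Cim_continuous R _)).
- apply/measurable_EFinP; apply: borel_continuous => x.
  exact: (continuous_comp (cf x) (@Cre_continuous R _)).
Qed.

End Cint.

(** * Amenability of the stable groupoid *)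

Section Amenable.
Variables (R : realType) (k : nat) (L : kgraph k).
Hypothesis L_regular : regular_kgraph L.
Local Notation G := (stable_groupoid L).
Local Notation cz := (cz k).
Local Notation cstn := (cstn k).
Implicit Types x y : dpath L.

(* The future of [x] from [cz n] on, preceded by a past that depends only on the
   vertex [x (cz n)]. *)
Definition repr n x : dpath L := dglue L_regular (cz n) x (kid (dvert x (cz n))).

Lemma repr_agree n x : agree (cz n) x (repr n x).
Proof. by move=> m h; rewrite dglue_agree. Qed.

Lemma repr_eq n x y : agree (cz n) x y -> repr n x = repr n y.
Proof.
move=> h; have e : dvert x (cz n) = dvert y (cz n).
  by move/agreeP: h => /(_ 0) h; rewrite -!(sg_r _ _ 0) h.
by rewrite /repr e; exact: dglue_eq.
Qed.

(** Before [cz n] both representatives follow the chosen past of one common vertex; after it they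
    follow [x] and [y], which agree on the window. *)
Lemma repr_near n j x y : (n <= j)%N -> DB j x y -> DB j (repr n x) (repr n y).
Proof.
(* With [a] steps the past of [cz n] reaches back exactly to [- cz j]. *)
move=> nj h; pose a := (n + j)%N.
have ev : dvert x (cz n) = dvert y (cz n).
  rewrite -!(sg_r _ _ 0); congr kr; apply: DB_sg h; zz.
have ks0 z : ks (kid (dvert z (cz n)) : kmor L) = dvert z (cz n).
  by rewrite ks_id.
have hp z : sg (repr n z) (cz n - zvec (0 + cstn a)) (0 + cstn a) =
    past L_regular (kid (dvert z (cz n))) a.
  by have := dglue_past L_regular a (ks0 z); rewrite kdeg_id.
apply: (@sg_sub _ _ _ _ (cz n - zvec (0 + cstn a)) ((0 + cstn a) + cstn (j - n))).
- by rewrite /a; zz.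
- by rewrite /a; zz.
rewrite !(sgD _ _ (0 + cstn a)) !hp ev subrK; congr cmp.
have /agreeP hx := @repr_agree n x; have /agreeP hy := @repr_agree n y.
by rewrite -hx -hy; apply: DB_sg h; zz.
Qed.

Definition repr_arr n x : stab L :=
  Stab (ex_intro (fun m => agree m x (repr n x)) (cz n) (@repr_agree n x)).

Lemma repr_arr_continuous n : continuous (repr_arr n).
Proof.
apply: (lb_continuous (DB_lbase L) (SB_lbase L)) => x j hj.
exists (maxn n j); split=> // y h; apply: (SB_mono (leq_maxr n j) hj).
have an z : agree (cz (maxn n j)) z (repr n z).
  exact: agree_le (cz_le k (leq_maxl n j)) (@repr_agree n z).
split=> //=; exact: repr_near (leq_maxl n j) h.
Qed.

(* Every compact set of arrows lies in a level: the levels are increasing and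
   open. *)
Lemma compact_level (K : set (stab L)) : compact K ->
  exists n, forall g, K g -> agree (cz n) (stab_r g) (stab_s g).
Proof.
move=> cK; pose P i (g : stab L) := agree (cz i) (stab_r g) (stab_s g).
have [|N _ hN] := (compact_near_coveringP K).1 cK nat \oo P _.
  move=> g _; have [j hj] := SB_ex g.
  exists (SB j g, [set i | (j <= i)%N]) => /=.
    by split; [exact: (lb_ball (SB_lbase L) hj) | exists j].
  move=> [h i] /= [[_ _ _ a] ji]; exact: agree_le (cz_le k ji) a.
exists N => g Kg; exact: (hN N (leqnn N) g Kg).
Qed.

Lemma variation_dist_refl (T : topologicalType) (m1 m2 : set T -> \bar R) :
  (forall B, (m1 B = m2 B /\ m1 B \is a fin_num)%E) ->
  (variation_dist m1 m2 <= 0)%E.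
Proof.
move=> e; apply: ge_ereal_sup => _ [n [B [_ _ ->]]].
rewrite big1 // => i _; have [<- f] := e (B i).
by rewrite subee // abse0.
Qed.

(** Paths that agree from [cz n] on have the same representative, so an arrow of level [cz n]
    carries [repr_arr n] of its source to that of its range. The Dirac masses are thus exactly
    invariant on each compact set once [n] is large. *)
Lemma amenable_stable : amenable R G.
Proof.
exists nat, (fun i j : nat => (i <= j)%N : Prop),
  (fun n x => \d_(repr_arr n x : borel (gid (x : gobj G))) :
     probability (borel (gid (x : gobj G))) R).
split.
- split; [by constructor|by []|by move=> i j l; exact: leq_trans|].
  by move=> i j; exists (maxn i j); rewrite leq_maxl leq_maxr.
- by move=> i x; rewrite /= diracE mem_set.
- move=> n f [cf _].
  have -> : (fun x : gobj G => cint (\d_(repr_arr n x : borel (gid (x : gobj G))) :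
     {measure set (borel (gid (x : gobj G))) -> \bar R}) f) = f \o repr_arr n.
    by apply/funext => x; rewrite (Cint_dirac _ cf).
  by move=> x; apply: continuous_comp; [exact: repr_arr_continuous|exact: cf].
- move=> K e /compact_level [n hn] e0; exists n => i ni g Kg.
  apply: (@le_trans _ _ 0%E); last by rewrite lee_fin ltW.
  apply: variation_dist_refl => B.
  have ag := agree_le (cz_le k ni) (hn g Kg).
  rewrite /translate /= !diracE; split=> //; congr ((_ : bool)%:R%:E).
  have e1 : stab_s g = stab_r (repr_arr i (stab_s g)) by [].
  have e2 (h : stab_s g = stab_r (repr_arr i (stab_s g))) :
      stab_mul h = repr_arr i (stab_r g).
    by apply: stab_eq => //=; apply/esym/repr_eq.
  apply/idP/idP => [/set_mem [h Bh]|/set_mem h]; apply/mem_set.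
    by rewrite -(e2 h).
  by exists e1; rewrite e2.
Qed.

End Amenable.

(** * Elementary tools: linear identities, scalar estimates, limits in $C^*$-algebras *)

(* Linear identities between atoms of a left module, decided by comparing
   coefficients. *)
Section LinearReflection.
Variables (K : comNzRingType) (V : lmodType K).

Inductive lexp := LVar of nat | LAdd of lexp & lexp | LOpp of lexp
  | LScale of K & lexp | LZero.

Fixpoint leval (s : seq V) (e : lexp) : V :=
  match e with
  | LVar n => nth 0 s n
  | LAdd a b => leval s a + leval s b
  | LOpp a => - leval s a
  | LScale c a => c *: leval s a
  | LZero => 0
  end.

Fixpoint lcoef (n : nat) (e : lexp) : K :=
  match e with
  | LVar m => (if Nat.eqb m n then 1 else 0)
  | LAdd a b => lcoef n a + lcoef n b
  | LOpp a => - lcoef n a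
  | LScale c a => c * lcoef n a
  | LZero => 0
  end.

Fixpoint lsum (s : seq V) (f : nat -> K) : V :=
  if s is v :: s' then f 0%N *: v + lsum s' (fun n => f n.+1) else 0.

Lemma lsumD s f g : lsum s (fun n => f n + g n) = lsum s f + lsum s g.
Proof.
elim: s f g => [|v s IH] f g /=; first by rewrite addr0.
by rewrite IH scalerDl addrACA.
Qed.

Lemma lsumZ s c f : lsum s (fun n => c * f n) = c *: lsum s f.
Proof.
elim: s f => [|v s IH] f /=; first by rewrite scaler0.
by rewrite IH scalerDr scalerA.
Qed.

Lemma lsumN s f : lsum s (fun n => - f n) = - lsum s f.
Proof.
elim: s f => [|v s IH] f /=; first by rewrite oppr0.
by rewrite IH scaleNr opprD.
Qed.

Lemma lsum0 s : lsum s (fun _ => 0) = 0.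
Proof. by elim: s => //= v s ->; rewrite scale0r addr0. Qed.

Lemma lsum_var s m :
  lsum s (fun n => if Nat.eqb m n then 1 else 0) = nth 0 s m.
Proof.
elim: s m => [|v s IH] [|m] //=; first by rewrite lsum0 scale1r addr0.
by rewrite IH scale0r add0r.
Qed.

Lemma leval_sum s e : leval s e = lsum s (fun n => lcoef n e).
Proof.
elim: e => [n|a IHa b IHb|a IHa|c a IHa|] /=.
- by rewrite lsum_var.
- by rewrite lsumD IHa IHb.
- by rewrite lsumN IHa.
- by rewrite lsumZ IHa.
- by rewrite lsum0.
Qed.

Fixpoint lsame (n : nat) (f g : nat -> K) : Prop :=
  if n is m.+1 then f 0%N = g 0%N /\ lsame m (fun i => f i.+1) (fun i => g i.+1)
  else True.

Lemma lexp_eq (s : seq V) a b :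
  lsame (size s) (fun n => lcoef n a) (fun n => lcoef n b) ->
  leval s a = leval s b.
Proof.
rewrite !leval_sum; move: (fun n => lcoef n a) (fun n => lcoef n b).
by elim: s => //= v s IH f g [-> h]; rewrite (IH _ _ h).
Qed.

End LinearReflection.
Arguments LVar {K}. Arguments LZero {K}.

Ltac l_mem x s := lazymatch s with
  | nil => constr:(false)
  | cons x _ => constr:(true)
  | cons _ ?s' => l_mem x s' end.
Ltac l_idx x s := lazymatch s with
  | cons x _ => constr:(0%N)
  | cons _ ?s' => let n := l_idx x s' in constr:(S n) end.
Ltac l_atoms e s := lazymatch e with
  | @Algebra.add _ ?a ?b => let s1 := l_atoms a s in l_atoms b s1
  | @Algebra.opp _ ?a => l_atoms a s
  | @GRing.scale _ _ ?c ?a => l_atoms a s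
  | @Algebra.zero _ => s
  | _ => let m := l_mem e s in
    lazymatch m with true => s | false => constr:(cons e s) end end.
Ltac l_quote K e s := lazymatch e with
  | @Algebra.add _ ?a ?b =>
      let a' := l_quote K a s in let b' := l_quote K b s in
      constr:(LAdd a' b')
  | @Algebra.opp _ ?a => let a' := l_quote K a s in constr:(LOpp a')
  | @GRing.scale _ _ ?c ?a =>
      let a' := l_quote K a s in constr:(@LScale K c a')
  | @Algebra.zero _ => constr:(@LZero K)
  | _ => let n := l_idx e s in constr:(@LVar K n) end.
Ltac lmod_sides K V :=
  match goal with |- @eq ?T ?l ?r =>
    let s := l_atoms l (@nil T) in let s := l_atoms r s in
    let a := l_quote K l s in let b := l_quote K r s in
    apply: (@lexp_eq K V s a b); rewrite /=; repeat split end.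

Ltac lmod K V := lmod_sides K V; first [by ring | by field].

Section RealFacts.
Variable R : realType.

(** The scalar model of the iteration in [csqrt]: it increases and stays below 1, hence is Cauchy,
    and its increments dominate those of the iteration. *)
Definition rseq : nat -> R := fun n => iter n (fun r => (1 + r ^+ 2) / 2) 0.

Lemma rseqS n : rseq n.+1 = (1 + rseq n ^+ 2) / 2. Proof. by []. Qed.

Lemma rseq01 n : 0 <= rseq n <= 1.
Proof.
by elim: n => [|n /andP[h1 h2]]; [rewrite lexx ler01 | rewrite rseqS; nra].
Qed.

Lemma rseq_mono m n : (m <= n)%N -> rseq m <= rseq n.
Proof.
move=> mn; rewrite -(subnK mn); elim: (n - m)%N => // d IH.
apply: (le_trans IH); have := rseq01 (d + m); rewrite ?addSn rseqS.
by move=> /andP[h1 h2]; nra.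
Qed.

Lemma rseq_cauchy (e : R) : 0 < e -> exists N, forall m n, (N <= m)%N ->
  (m <= n)%N -> rseq n - rseq m < e.
Proof.
move=> e0; pose S := range rseq.
have hS : has_sup S.
  split; first by exists (rseq 0), 0%N.
  by exists 1 => _ [n _ <-]; case/andP: (rseq01 n).
have [_ [N _ <-] hN] := sup_adherent e0 hS; exists N => m n Nm mn.
have h1 : rseq n <= sup S by apply: ub_le_sup; [case: hS | exists n].
have h2 := rseq_mono Nm; lra.
Qed.

Lemma bernoulli_ineq (c : R) n : 0 <= c -> 1 + n%:R * c <= (1 + c) ^+ n.
Proof.
move=> c0; elim: n => [|n IH]; first by rewrite mul0r addr0.
have : 0 <= (1 + c) * ((1 + c) ^+ n - (1 + n%:R * c)).
  by apply: mulr_ge0; [exact: addr_ge0 | rewrite subr_ge0].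
have : 0 <= n%:R * c * c by rewrite !mulr_ge0.
by rewrite -[n.+1]addn1 natrD exprD; nra.
Qed.

(** If $x>y>0$, the powers of $x/y$ grow at least linearly in the exponent by Bernoulli's inequality
    and exceed [K]. *)
Lemma power_trick (x y K : R) : 0 <= x -> 0 <= y ->
  (forall n, x ^+ (2 ^ n) <= K * y ^+ (2 ^ n)) -> x <= y.
Proof.
move=> x0 y0 h; rewrite leNgt; apply/negP => yx.
have xp : 0 < x by exact: le_lt_trans yx.
case: (ltgtP 0 y) y0 => // [yp|ye] _; last first.
  by have := h 0%N; rewrite -ye expr1 mulr0 leNgt xp.
pose c := x / y - 1; have c0 : 0 < c by rewrite subr_gt0 ltr_pdivlMr // mul1r.
have hc n : 1 + (2 ^ n)%:R * c <= K.
  apply: (le_trans (bernoulli_ineq _ (ltW c0))).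
  by rewrite /c addrC subrK expr_div_n ler_pdivrMr ?exprn_gt0.
have : exists n : nat, K / c < n%:R.
  exists (Num.bound `|K / c|).
  exact: le_lt_trans (ler_norm _) (archi_boundP (normr_ge0 _)).
move=> [n hn]; have := hc n; apply/negP; rewrite -ltNge.
have : K < n%:R * c by rewrite -ltr_pdivrMr.
have : n%:R * c <= (2 ^ n)%:R * c.
  by rewrite ler_wpM2r ?ler_nat ?(ltW c0) // ltnW // ltn_expl.
lra.
Qed.

End RealFacts.

Section CstarBasics.
Variable R : realType.
Local Notation C := (Cx R).
Section One.
Variable A : cstar_algebra R.
Implicit Types (a b c g h p q x y z : A).
Local Notation "a ** b" := (cmul a b) (at level 40, left associativity).
Local Notation "a ^#" := (cstar a) (at level 2, format "a ^#").
Ltac lm := lmod (Cx R) (csort A).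

Lemma cmul0l a : (0 : A) ** a = 0.
Proof. by apply: (addrI (0 ** a)); rewrite -cmulDl !addr0. Qed.
Lemma cmul0r a : a ** (0 : A) = 0.
Proof. by apply: (addrI (a ** 0)); rewrite -cmulDr !addr0. Qed.
Lemma cmulNl a b : (- a) ** b = - (a ** b).
Proof. by apply: (addrI (a ** b)); rewrite -cmulDl !subrr cmul0l. Qed.
Lemma cmulNr a b : a ** (- b) = - (a ** b).
Proof. by apply: (addrI (a ** b)); rewrite -cmulDr !subrr cmul0r. Qed.
Lemma cmulBl a b c : (a - b) ** c = a ** c - b ** c.
Proof. by rewrite cmulDl cmulNl. Qed.
Lemma cmulBr a b c : c ** (a - b) = c ** a - c ** b.
Proof. by rewrite cmulDr cmulNr. Qed.
Lemma cstar0 : cstar (0 : A) = 0.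
Proof. by apply: (addrI (cstar 0)); rewrite -cstarD !addr0. Qed.
Lemma cstarN a : cstar (- a) = - cstar a.
Proof. by apply: (addrI (cstar a)); rewrite -cstarD !subrr cstar0. Qed.
Lemma cstarB a b : cstar (a - b) = cstar a - cstar b.
Proof. by rewrite cstarD cstarN. Qed.
Lemma cmul_suml I (s : seq I) (P : pred I) (f : I -> A) a :
  (\sum_(i <- s | P i) f i) ** a = \sum_(i <- s | P i) (f i ** a).
Proof.
by apply: (big_morph (fun x => x ** a)) => [x y|]; rewrite ?cmulDl ?cmul0l.
Qed.
Lemma cmul_sumr I (s : seq I) (P : pred I) (f : I -> A) a :
  a ** (\sum_(i <- s | P i) f i) = \sum_(i <- s | P i) (a ** f i).
Proof.
by apply: (big_morph (fun x => a ** x)) => [x y|]; rewrite ?cmulDr ?cmul0r.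
Qed.
Lemma cstar_sum I (s : seq I) (P : pred I) (f : I -> A) :
  cstar (\sum_(i <- s | P i) f i) = \sum_(i <- s | P i) cstar (f i).
Proof. by apply: (big_morph cstar) => [x y|]; rewrite ?cstarD ?cstar0. Qed.

Definition cE := (@cmulDl R A, @cmulDr R A, @cmulA R A, @cmulZl R A, @cmulZr R A,
  cmulNl, cmulNr, cmul0l, cmul0r, @cstarD R A, cstarN, @cstarZ R A, @cstarM R A,
  @cstarK R A, cstar0).

Lemma nn_mul a b : nn (a ** b) <= nn a * nn b.
Proof. by rewrite -rC_le rCM -!nnE; exact: cnormM. Qed.

Lemma nn_starl a : nn (a^# ** a) = nn a ^+ 2.
Proof. by apply: rC_inj; rewrite rCX -!nnE; exact: cnorm_star. Qed.

(** From $\|b\|^2=\|b^*b\|\le\|b^*\|\|b\|$, applied to $b$ and to its adjoint. *)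
Lemma nn_cstar a : nn a^# = nn a.
Proof.
have le b : nn b <= nn b^#.
  have [->|h] := eqVneq (nn b) 0; first exact: nn_ge0.
  rewrite -(@ler_pM2r _ (nn b)) ?lt_neqAle ?(eq_sym 0) ?h ?nn_ge0 //.
  by rewrite -expr2 -nn_starl nn_mul.
by apply: le_anti; rewrite le andbT -{2}[a]cstarK le.
Qed.

Lemma nn_starr a : nn (a ** a^#) = nn a ^+ 2.
Proof. by rewrite -{1}[a]cstarK nn_starl nn_cstar. Qed.

Lemma nn_sqr_sa h : h^# = h -> nn (h ** h) = nn h ^+ 2.
Proof. by move=> e; rewrite -{1}e nn_starl. Qed.

Lemma star_eq0 a : a^# ** a = 0 -> a = 0.
Proof.
move=> e; apply: nn0_eq; have := nn_starl a; rewrite e nn0 => /esym/eqP.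
by rewrite sqrf_eq0 => /eqP.
Qed.

Lemma nn_proj p : p^# = p -> p ** p = p -> nn p <= 1.
Proof.
move=> e1 e2; have := nn_sqr_sa e1; rewrite e2; have := nn_ge0 p => h1 h2.
by have [->|] := eqVneq (nn p) 0; [rewrite ler01 | move=> h3; nra].
Qed.

Lemma lim_mul (u v : nat -> A) a b : lim_nn u a -> lim_nn v b ->
  lim_nn (fun n => u n ** v n) (a ** b).
Proof.
move=> hu hv e e0; pose M := nn a + nn b + 1.
have M0 : 0 < M by rewrite ltr_wpDl // addr_ge0 ?nn_ge0.
pose d := Num.min 1 (e / (2 * M)).
have d0 : 0 < d by rewrite lt_min ltr01 divr_gt0 // mulr_gt0.
have [N hN] := hu d d0; have [N' hN'] := hv d d0.
exists (maxn N N') => n; rewrite geq_max => /andP[/hN h1 /hN' h2].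
have -> : a ** b - u n ** v n = (a - u n) ** b + u n ** (b - v n).
  by rewrite !cE; lm.
apply: (le_lt_trans (nnD _ _)).
apply: (@le_lt_trans _ _ (nn (a - u n) * nn b + nn (u n) * nn (b - v n))).
  by rewrite lerD // nn_mul.
have hd1 : d <= 1 by rewrite ge_min lexx.
have hd2 : d * (2 * M) <= e.
  by rewrite -ler_pdivlMr ?mulr_gt0 // ge_min lexx orbT.
have hun : nn (u n) <= nn a + 1.
  by rewrite (le_trans (nn_le_tri _ a)) // lerD2l nnB ltW // (lt_le_trans h1).
have h3 := nn_ge0 (a - u n); have h4 := nn_ge0 (b - v n).
have h5 := nn_ge0 a; have h6 := nn_ge0 b; have h7 := nn_ge0 (u n).
rewrite /M in hd2; nra.
Qed.

Lemma lim_star (u : nat -> A) a : lim_nn u a ->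
  lim_nn (fun n => (u n)^#) (a^#).
Proof.
by move=> h e /h [N hN]; exists N => n /hN; rewrite -cstarB nn_cstar.
Qed.

End One.
End CstarBasics.

Section Limits.
Variables (R : realType) (V : normedModType (Cx R)).
Implicit Types (u v : nat -> V) (a b : V).

Lemma lim_const a : lim_nn (fun=> a) a.
Proof. by move=> e e0; exists 0%N => n _; rewrite subrr nn0. Qed.

Lemma lim_add u v a b : lim_nn u a -> lim_nn v b ->
  lim_nn (fun n => u n + v n) (a + b).
Proof.
move=> hu hv e e0; have e2 : 0 < e / 2 by rewrite divr_gt0.
have [N hN] := hu _ e2; have [N' hN'] := hv _ e2.
exists (maxn N N') => n; rewrite geq_max => /andP[/hN h1 /hN' h2].
have -> : a + b - (u n + v n) = (a - u n) + (b - v n) by rewrite opprD addrACA.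
by rewrite (le_lt_trans (nnD _ _)) // [ltRHS](splitr e) ltrD.
Qed.

Lemma lim_scale (z : Cx R) u a : lim_nn u a -> lim_nn (fun n => z *: u n) (z *: a).
Proof.
move=> hu e e0; have M0 : 0 < nn z + 1 by rewrite ltr_wpDl // nn_ge0.
have [N hN] := hu _ (divr_gt0 e0 M0); exists N => n /hN h.
move: h; rewrite -scalerBr nnZ ltr_pdivlMr // => h.
by apply: le_lt_trans h; rewrite mulrC ler_wpM2l ?nn_ge0 // lerDl ler01.
Qed.

Lemma lim_opp u a : lim_nn u a -> lim_nn (fun n => - u n) (- a).
Proof. by move=> h e /h [N hN]; exists N => n /hN; rewrite -opprD nnN. Qed.

Lemma lim_le u a (r : R) : lim_nn u a -> (forall n, nn (u n) <= r) -> nn a <= r.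
Proof.
move=> h hr; apply/ler_addgt0Pr => e e0; have [N hN] := h e e0.
rewrite (le_trans (nn_le_tri _ (u N))) // lerD // ltW //; exact: hN.
Qed.

Lemma closed_lim (D : set V) u a :
  closed D -> (forall n, D (u n)) -> lim_nn u a -> D a.
Proof.
move=> cD hu h; apply: cD; apply/closure_nn => e e0.
by have [N hN] := h e e0; exists (u N); [exact: hu | exact: hN].
Qed.

Lemma lim_ext u v a : (forall n, u n = v n) -> lim_nn u a -> lim_nn v a.
Proof. by move=> e h d /h [N hN]; exists N => n; rewrite -e; exact: hN. Qed.

Lemma lim_shift u a : lim_nn u a -> lim_nn (fun n => u n.+1) a.
Proof. by move=> h d /h [N hN]; exists N => n Nn; apply: hN; exact: leqW. Qed.

Lemma closed_limP (D : set V) :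
  (forall u a, (forall n, D (u n)) -> lim_nn u a -> D a) -> closed D.
Proof.
move=> h a /closure_nn hc.
have hc' n : exists b, D b /\ nn (a - b) < n.+1%:R^-1.
  by have [|b] := hc n.+1%:R^-1; [rewrite invr_gt0 | exists b].
have [u hu] := choice hc'; apply: (h u) => [n|e e0]; first by case: (hu n).
exists (Num.bound e^-1) => n hn; case: (hu n) => _ /lt_trans; apply.
rewrite -[ltRHS]invrK ltf_pV2 ?posrE ?invr_gt0 //.
apply: (lt_le_trans (archi_boundP _)); rewrite ?invr_ge0 ?(ltW e0) //.
by rewrite ler_nat leqW.
Qed.

End Limits.

(** * Square roots, projections and contractions in $C^*$-algebras *)

Section CstarAnalysis.
Variable R : realType.
Local Notation C := (Cx R).
Section One.
Variable A : cstar_algebra R.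
Implicit Types (a b c g h p q x y z e : A).
Local Notation "a ** b" := (cmul a b) (at level 40, left associativity).
Local Notation "a ^#" := (cstar a) (at level 2, format "a ^#").
Ltac lm := lmod (Cx R) (csort A).
Local Notation half := (2^-1 : C).

Lemma rC_nat n : rC n%:R = n%:R :> C.
Proof. exact: (rmorph_nat (real_complex R)). Qed.

Lemma nn_half : nn half = 2^-1 :> R.
Proof.
have -> : half = rC 2^-1 :> C by rewrite rCV -[2]/(1 + 1) rCD rC1.
by rewrite nn_rC ger0_norm // invr_ge0.
Qed.

(* Iterating g -> (y + g^2)/2 solves 2g - g^2 = y, i.e. (1 - g)^2 = 1 - y; the
   increments are dominated by those of the scalar iteration with y = 1. *)
Lemma csqrt (D : set A) y : nn y <= 1 -> closed D -> D 0 ->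
  (forall g, D g -> D (half *: (y + g ** g))) ->
  exists g, [/\ D g, nn g <= 1 & g + g - g ** g = y].
Proof.
move=> y1 cD D0 DS.
pose u n := iter n (fun g => half *: (y + g ** g)) (0 : A).
have uS n : u n.+1 = half *: (y + u n ** u n) by [].
have hD n : D (u n) by elim: n => // n IH; rewrite uS; exact: DS.
have hr n : nn (u n) <= rseq R n.
  elim: n => [|n IH]; first by rewrite nn0.
  rewrite uS rseqS nnZ nn_half mulrC ler_pM2r ?invr_gt0 //.
  apply: (le_trans (nnD _ _)); apply: lerD => //.
  apply: (le_trans (nn_mul _ _)); have := nn_ge0 (u n); nra.
have hd1 n : nn (u n.+1 - u n) <= rseq R n.+1 - rseq R n.
  elim: n => [|n IH].
    have -> : u 1%N - u 0%N = half *: y by rewrite uS cmul0l addr0 subr0.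
    by rewrite nnZ nn_half rseqS /rseq /=; nra.
  have -> : u n.+2 - u n.+1 =
      half *: ((u n.+1 - u n) ** u n.+1 + u n ** (u n.+1 - u n)).
    by rewrite (uS n.+1) [in LHS](uS n) !cE; lm.
  rewrite nnZ nn_half [rseq R n.+2]rseqS [in X in _ <= _ - X]rseqS.
  have h1 := le_trans (nnD _ _) (lerD (nn_mul (u n.+1 - u n) (u n.+1))
    (nn_mul (u n) (u n.+1 - u n))).
  have := hr n; have := hr n.+1; have := nn_ge0 (u n); have := nn_ge0 (u n.+1).
  have := nn_ge0 (u n.+1 - u n); move: h1 IH.
  move: (nn (u n.+1 - u n)) (nn (u n)) (nn (u n.+1)) (rseq R n) (rseq R n.+1).
  move=> d m m' r r' h1 IH d0 m'0 m0 hm' hm.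
  have : d * m' + m * d <= (r' - r) * (r' + r) by nra.
  by move: h1; lra.
have hd m n : (m <= n)%N -> nn (u n - u m) <= rseq R n - rseq R m.
  move=> mn; rewrite -(subnK mn); elim: (n - m)%N => [|d IH].
    by rewrite !subrr nn0.
  rewrite addSn; apply: (le_trans (nn_tri (u (d + m)%N) _ _)).
  by have := hd1 (d + m)%N; lra.
have [|g hg] := @complete_nn R A u.
  move=> e e0; have [N hN] := rseq_cauchy e0; exists N => m n Nm Nn.
  wlog mn : m n Nm Nn / (m <= n)%N.
    by move=> H; case: (leqP m n) => [|/ltnW] h; [|rewrite nnB]; exact: H.
  by rewrite nnB (le_lt_trans (hd _ _ mn)) // hN.
exists g; split.
- exact: closed_lim cD hD hg.
- by apply: (lim_le hg) => n; rewrite (le_trans (hr n)) //; case/andP: (rseq01 R n).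
- have h1 := lim_shift hg.
  have h2 := lim_scale half (lim_add (lim_const y) (lim_mul hg hg)).
  have {1 2}-> : g = half *: (y + g ** g) by exact: (lim_nn_uniq h1 h2).
  by lm.
Qed.

(** The hypotheses say $h^2+(1-g)^2=1$, so $h\pm i(1-g)$ behave like unitaries and preserve the norm
    of [b]. Up to a factor of modulus 1, $hb$ and $(1-g)b$ are half the sum and half the difference
    of the two images. The algebra may have no unit; applying everything to [b] avoids it. *)
Lemma unitary_l h g b : h^# = h -> g^# = g -> h ** g = g ** h ->
  g + g - g ** g = h ** h -> nn (h ** b) <= nn b /\ nn (b - g ** b) <= nn b.
Proof.
move=> hs gs hg e; pose c := b - g ** b.
have key (i : C) : i * i = -1 -> i^* = - i -> nn (h ** b + i *: c) = nn b.
  move=> i2 ic; apply/eqP; rewrite -(@eqrXn2 _ 2) ?nn_ge0 // -!nn_starl.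
  apply/eqP; congr nn; rewrite !cE hs ic.
  have e1 : b^# ** h ** g ** b = b^# ** g ** h ** b by rewrite -!(cmulA (b^#)) hg.
  have e2 : b^# ** h ** h ** b = b^# ** g ** b + b^# ** g ** b - b^# ** g ** g ** b.
    by rewrite -(cmulA (b^#) h h) -e !cE.
  have hi (v : A) : - i *: (i *: v) = v by rewrite scalerA mulNr i2 opprK scale1r.
  by rewrite -scalerBr hi gs e1 e2; lm.
have i2 : ('i%C : C) * 'i%C = -1 by exact: (@sqr_i R).
have ic : ('i%C : C)^* = - 'i%C.
  by apply: Ceq; rewrite ?CreN ?CimN /Cre /Cim /= ?oppr0.
have k1 := key _ i2 ic.
have k2 : nn (h ** b - ('i%C : C) *: c) = nn b.
  rewrite -scaleNr; apply: key; rewrite ?mulrNN //.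
  by apply: Ceq; rewrite ?CreN ?CimN /Cre /Cim /= ?oppr0.
split.
  have -> : h ** b = half *: ((h ** b + ('i%C : C) *: c)
                              + (h ** b - ('i%C : C) *: c)) by lm.
  rewrite nnZ nn_half; have := nnD (h ** b + ('i%C : C) *: c)
    (h ** b - ('i%C : C) *: c); rewrite k1 k2; lra.
have ec : - (half * 'i%C) *: ((h ** b + ('i%C : C) *: c) - (h ** b - ('i%C : C) *: c)) = c.
  have -> : (h ** b + ('i%C : C) *: c) - (h ** b - ('i%C : C) *: c) =
    (2 * 'i%C : C) *: c by lm.
  by rewrite scalerA mulNr mulrACA mulVf ?pnatr_eq0 // mul1r i2 opprK scale1r.
rewrite -/c -[X in nn X <= _]ec.
rewrite nnZ nnN nnM nn_half; have := nn_sub (h ** b + ('i%C : C) *: c)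
  (h ** b - ('i%C : C) *: c); rewrite k1 k2.
have -> : nn ('i%C : C) = 1.
  apply/eqP; rewrite -(@eqrXn2 _ 2) ?nn_ge0 // expr1n expr2 -nnM i2 nnN nn1.
  by [].
lra.
Qed.

(* 1 - b^2 is the square of the contraction 1 - g. *)
Lemma square_contr b x : b^# = b -> nn b <= 1 -> nn (x - b ** b ** x) <= nn x.
Proof.
move=> bs b1.
have [||||g [[gs gb] _ e]] := @csqrt [set g : A | g^# = g /\ b ** g = g ** b] (b ** b).
- by rewrite nn_sqr_sa // expr_le1 // nn_ge0.
- apply: closed_limP => u a hu hl; split.
    apply: (lim_nn_uniq (lim_star hl)); apply: lim_ext hl => n.
    by case: (hu n).
  apply: (lim_nn_uniq (lim_mul (lim_const b) hl)).
  apply: lim_ext (lim_mul hl (lim_const b)) => n.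
  by case: (hu n).
- by rewrite /= cstar0 cmul0l cmul0r.
- move=> g [/= gs gb]; split; rewrite !cE ?bs ?gs.
    by rewrite [half^*]rmorphV ?unitfE ?pnatr_eq0 // rmorph_nat.
  by congr (_ *: (_ + _)); rewrite gb -!cmulA gb.
have -> : x - b ** b ** x = (x - g ** x) - g ** (x - g ** x).
  by rewrite -e !cE; lm.
apply: le_trans (proj2 (unitary_l (x - g ** x) bs gs gb e)) _.
exact: (proj2 (unitary_l x bs gs gb e)).
Qed.

Lemma star_half : half^* = half.
Proof. by rewrite [half^*]rmorphV ?unitfE ?pnatr_eq0 // rmorph_nat. Qed.

(* The unit [e] of a corner plays the role of 1. *)
Lemma corner_sqrt (D : set A) e h : closed D -> D 0 -> D e -> D h ->
  (forall a b, D a -> D b -> D (a + b)) -> (forall (z : C) a, D a -> D (z *: a)) ->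
  (forall a b, D a -> D b -> D (a ** b)) ->
  e^# = e -> e ** e = e -> h^# = h -> e ** h = h -> nn (e - h) <= 1 ->
  exists d, [/\ D d, d^# = d & d ** d = h].
Proof.
move=> cD D0 De Dh DD DZ DM es ee hs eh h1.
have he : h ** e = h by rewrite -[LHS]cstarK cstarM es hs eh.
have [|||g [[Dg gs eg] _ eq]] := @csqrt [set g : A | [/\ D g, g^# = g & e ** g = g]] _ h1.
- apply: closed_limP => u a hu hl; split.
  + by apply: (closed_lim cD _ hl) => n; case: (hu n).
  + apply: (lim_nn_uniq (lim_star hl)); apply: lim_ext hl => n.
    by case: (hu n).
  + apply: (lim_nn_uniq (lim_mul (lim_const e) hl)); apply: lim_ext hl => n.
    by case: (hu n).
- by split; rewrite ?cstar0 ?cmul0r.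
- move=> g [Dg gs eg]; split; rewrite ?cE ?es ?hs ?gs ?star_half ?ee ?eh ?eg //.
  apply: (DZ); apply: (DD) (DM _ _ Dg Dg); apply: (DD) => //.
  by rewrite -scaleN1r; exact: DZ.
have ge : g ** e = g by rewrite -[LHS]cstarK cstarM es gs eg.
exists (e - g); split.
- by apply: (DD) => //; rewrite -scaleN1r; exact: DZ.
- by rewrite cstarB es gs.
- have -> : h = e - (e - h) by lm.
  by rewrite -eq !cE ee eg ge; lm.
Qed.

Lemma comm_closed z : closed [set d : A | z ** d = d ** z].
Proof.
apply: closed_limP => u a hu hl; apply: (lim_nn_uniq (lim_mul (lim_const z) hl)).
by apply: lim_ext (lim_mul hl (lim_const z)) => n; rewrite hu.
Qed.

(* The unit of a corner is an extreme point of the unit ball. *)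
Lemma unit_extreme e z : e^# = e -> e ** e = e -> z^# = z -> e ** z = z ->
  nn (e + z) <= 1 -> nn (e - z) <= 1 -> z = 0.
Proof.
move=> es ee zs ez h1 h2.
have ze : z ** e = z by rewrite -[LHS]cstarK cstarM es zs ez.
have h3 : nn (e - - (z ** z)) <= 1.
  have -> : e - - (z ** z) = half *: ((e + z) ** (e + z) + (e - z) ** (e - z)).
    by rewrite !cE ee ez ze; lm.
  rewrite nnZ nn_half.
  have := nnD ((e + z) ** (e + z)) ((e - z) ** (e - z)).
  have := nn_mul (e + z) (e + z); have := nn_mul (e - z) (e - z).
  have := nn_ge0 (e + z); have := nn_ge0 (e - z); nra.
have [||||||||d [Dd ds dd]] := @corner_sqrt [set d | z ** d = d ** z] e (- (z ** z))
   (@comm_closed z) _ _ _ _ _ _ es ee _ _ h3.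
- by rewrite /= cmul0l cmul0r.
- by rewrite /= ez ze.
- by rewrite /= !cE.
- by move=> a b /= ha hb; rewrite !cE ha hb.
- by move=> c a /= ha; rewrite !cE ha.
- by move=> a b /= ha hb; rewrite !cE ha -!cmulA hb.
- by rewrite !cE zs.
- by rewrite !cE ez.
(* Since $d^2=-z^2$ and $d$ commutes with $z$, the element $z+id$ times its adjoint is
   $z^2+d^2=0$. *)
have hu : z + ('i%C : C) *: d = 0.
  apply: star_eq0.
  have i2 : ('i%C : C) * 'i%C = -1 by exact: (@sqr_i R).
  have ic : ('i%C : C)^* = - 'i%C.
    by apply: Ceq; rewrite ?CreN ?CimN /Cre /Cim /= ?oppr0.
  rewrite !cE ic zs ds Dd !scalerA mulNr i2 opprK scale1r dd.
  by lm.
have hu' : z - ('i%C : C) *: d = 0.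
  by have := congr1 (@cstar R A) hu; rewrite cstarD cstarZ zs ds cstar0 =>
     <-; congr (_ + _); rewrite -scaleNr; congr (_ *: _);
     apply: Ceq; rewrite ?CreN ?CimN /Cre /Cim /= ?oppr0.
have -> : z = half *: ((z + ('i%C : C) *: d) + (z - ('i%C : C) *: d)) by lm.
by rewrite hu hu' addr0 scaler0.
Qed.

(** A projection satisfies the equation of [unitary_l] with $h=g=p$. *)
Lemma proj_contr p b : p^# = p -> p ** p = p -> nn (b - p ** b) <= nn b.
Proof.
move=> ps pp; have e : p + p - p ** p = p ** p by rewrite pp; lm.
exact: (proj2 (unitary_l b ps ps erefl e)).
Qed.

(** Compress to $p_j$: the elements $y_l=p_jp_lp_j$ with $l\ne j$ sum to 0 and satisfy
    $\|p_j-y_l\|\le1$. Averaging puts $p_j\pm Ny_i$ in the unit ball for some $N>0$, so $y_i=0$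
    because $p_j$ is an extreme point; hence $p_ip_j=0$. *)
Lemma proj_sum_orth (I : eqType) (s : seq I) (p : I -> A) q : uniq s ->
  (forall i, i \in s -> (p i)^# = p i /\ p i ** p i = p i) ->
  \sum_(i <- s) p i = q -> (forall i, i \in s -> p i ** q = p i) ->
  forall i j, i \in s -> j \in s -> i != j -> p i ** p j = 0.
Proof.
move=> us hp hq pq i j si sj ij.
have [is_ ii] := hp i si; have [js jj] := hp j sj.
pose y l := p j ** p l ** p j.
have y1 l : l \in s -> nn (p j - y l) <= 1.
  move=> /hp [ls ll].
  have -> : p j - y l = (p j - p l ** p j)^# ** (p j - p l ** p j).
    rewrite /y !cE ls js jj -[_ ** p l ** p l]cmulA ll; lm.
  rewrite nn_starl expr_le1 ?nn_ge0 //.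
  exact: le_trans (proj_contr (p j) ls ll) (nn_proj js jj).
have sy : \sum_(l <- rem j s) y l = 0.
  have : \sum_(l <- s) y l = p j.
    by rewrite /y -cmul_suml -cmul_sumr hq (pq j sj) jj.
  rewrite (perm_big _ (perm_to_rem sj)) big_cons /y jj jj.
  by move/(canRL (addKr _)) => ->; rewrite addNr.
have ri : i \in rem j s by rewrite mem_rem_uniq // inE ij.
pose t := rem i (rem j s).
have st : y i + \sum_(l <- t) y l = 0.
  by have := sy; rewrite (perm_big _ (perm_to_rem ri)) big_cons.
have h1 : nn ((size t)%:R *: p j + y i) <= (size t)%:R.
  have -> : (size t)%:R *: p j + y i = \sum_(l <- t) (p j - y l).
    rewrite sumrB (big_const_seq) count_predT iter_addr addr0 scaler_nat.
    by congr (_ + _); apply/eqP; rewrite -subr_eq0 opprK st.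
  apply: (le_trans (nn_sum _ _ _)).
  rewrite -[X in _ <= X%:R]count_predT -sum1_count natr_sum big_seq [leRHS]big_seq.
  apply: ler_sum => l /mem_rem /mem_rem; exact: y1.
(* With $N=1/(|t|+1)$, each of $p_j\pm Ny_i$ is $N$ times an element of norm at most $|t|+1$. *)
pose N : C := rC ((size t)%:R + 1)^-1.
have N0 : 0 < (size t)%:R + 1 :> R by rewrite ltr_wpDl.
have N1 : N * ((size t)%:R + 1) = 1.
  rewrite -rC_nat -rC1 -rCD.
  by rewrite -rCM mulVf ?gt_eqF.
have nN : nn N = ((size t)%:R + 1)^-1 by rewrite nn_rC ger0_norm // invr_ge0 ltW.
have pj1 := nn_proj js jj.
have npj (n : nat) : nn ((n%:R : C) *: p j) <= n%:R.
  by rewrite -rC_nat nnZ nn_rC normr_nat ler_piMr.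
have hz : N *: y i = 0.
  have ePj : p j = N *: ((size t)%:R *: p j + p j).
    by rewrite -{3}[p j]scale1r -scalerDl scalerA N1 scale1r.
  apply: (@unit_extreme (p j)) => //.
  - by rewrite /y !cE is_ js rC_conj.
  - by rewrite /y !cE jj.
  - rewrite {1}ePj -scalerDr nnZ nN mulrC ler_pdivrMr // mul1r.
    rewrite addrAC; apply: (le_trans (nnD _ _)); exact: lerD.
  - rewrite {1}ePj -scalerBr nnZ nN mulrC ler_pdivrMr // mul1r -addrA.
    apply: (le_trans (nnD _ _)); apply: lerD; [exact: npj | exact: y1].
have yi : y i = 0.
  have : (N^-1) *: (N *: y i) = 0 by rewrite hz scaler0.
  rewrite scalerA mulVf ?scale1r //; apply/eqP => N00.
  by have := oner_neq0 C; rewrite -N1 N00 mul0r eqxx.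
apply: star_eq0; rewrite cstarM is_ js -[RHS]yi /y.
by rewrite cmulA -[_ ** p i ** p i]cmulA ii.
Qed.

End One.

Section Hom.
Variables A B : cstar_algebra R.
Implicit Types D : set A.

(* If |h| <= 1 then h + i (1 - g) is unitary, and f preserves this. *)
Lemma star_hom_contr D (f : A -> B) : closed D -> star_subalgebra D ->
  (forall a b, D a -> D b -> f (a + b) = f a + f b) ->
  (forall (z : C) a, D a -> f (z *: a) = z *: f a) ->
  (forall a b, D a -> D b -> f (cmul a b) = cmul (f a) (f b)) ->
  (forall a, D a -> f (cstar a) = cstar (f a)) ->
  forall a, D a -> nn (f a) <= nn a.
Proof.
move=> cD [D0 DD DZ DM DS] fD fZ fM fS.
have sa h : D h -> cstar h = h -> nn h <= 1 -> nn (f h) <= 1.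
  move=> Dh hs h1.
  have [||||g [[Dg gs gh] _ e]] := @csqrt A
    [set g | [/\ D g, cstar g = g & cmul h g = cmul g h]] (cmul h h).
  - by rewrite nn_sqr_sa // expr_le1 // nn_ge0.
  - apply: closed_limP => u a hu hl; split.
    + by apply: (closed_lim cD _ hl) => n; case: (hu n).
    + apply: (lim_nn_uniq (lim_star hl)); apply: lim_ext hl => n.
      by case: (hu n).
    + by apply: (closed_lim (@comm_closed A h) _ hl) => n; case: (hu n).
  - by split; rewrite ?cstar0 ?cmul0l ?cmul0r.
  - move=> g [Dg gs gh]; split.
    + by apply: (DZ); apply: (DD); apply: (DM).
    + by rewrite cstarZ cstarD !cstarM hs gs star_half.
    + rewrite cmulZl cmulZr cmulDl cmulDr; congr (_ *: (_ + _)).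
        by rewrite cmulA.
      by rewrite cmulA gh -!cmulA gh.
  have fe : f g + f g - cmul (f g) (f g) = cmul (f h) (f h).
    rewrite -!fM // -e fD; [|exact: DD|].
      by rewrite fD // -scaleN1r -[- cmul g g]scaleN1r fZ //; exact: DM.
    by rewrite -scaleN1r; apply: (DZ); exact: DM.
  have [||||] := @unitary_l B (f h) (f g) (f h).
  - by rewrite -fS // hs.
  - by rewrite -fS // gs.
  - by rewrite -!fM // gh.
  - exact: fe.
  move=> + _; rewrite nn_sqr_sa -?fS ?hs // => h2; have := nn_ge0 (f h) => h3.
  by have [->|] := eqVneq (nn (f h)) 0; [rewrite ler01 | move=> h4; nra].
move=> a Da.
have [a0|a0] := eqVneq (nn a) 0.
  have -> : a = 0 *: a by rewrite scale0r; exact: nn0_eq.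
  by rewrite fZ // !scale0r !nn0.
have ap : 0 < nn a by rewrite lt_neqAle eq_sym a0 nn_ge0.
have := sa (rC (nn a ^- 2) *: cmul (cstar a) a).
rewrite fZ; last by apply: (DM) => //; exact: DS.
rewrite fM ?fS //; last exact: DS.
rewrite !nnZ !nn_starl cstarZ cstarM cstarK rC_conj nn_rC ger0_norm ?invr_ge0 ?exprn_ge0 ?nn_ge0 //.
rewrite mulVf ?expf_neq0 // => h; have := h (DZ _ _ (DM _ _ (DS _ Da) Da)) erefl (lexx _).
rewrite mulrC ler_pdivrMr ?exprn_gt0 // mul1r ler_pXn2r ?nnegrE ?nn_ge0 //.
Qed.

End Hom.

Section PowerTrick.
Variables (A B : cstar_algebra R) (P : Type).
Variables (mulP : P -> P -> P) (starP : P -> P) (f : P -> A) (f' : P -> B).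
Hypotheses (fM : forall a b, f (mulP a b) = cmul (f a) (f b))
  (fS : forall a, f (starP a) = cstar (f a))
  (fM' : forall a b, f' (mulP a b) = cmul (f' a) (f' b))
  (fS' : forall a, f' (starP a) = cstar (f' a)).

(** Apply the bound to the repeated squares of $a^*a$: by the $C^*$-identity their norms are powers
    of the norms of the images of $a$, and [power_trick] removes the constant. *)
Lemma bounded_contr (K : R) : (forall a, nn (f a) <= K * nn (f' a)) ->
  forall a, nn (f a) <= nn (f' a).
Proof.
move=> hK a; pose h n := iter n (fun b => mulP b b) (mulP (starP a) a).
have sa n : cstar (f (h n)) = f (h n) /\ cstar (f' (h n)) = f' (h n).
  elim: n => [|n [IH IH']]; first by rewrite /h /= fM fM' fS fS' !cstarM !cstarK.
  by rewrite /h /= -/(h n) fM fM' !cstarM IH IH'.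
have pw n : nn (f (h n)) = (nn (f a) ^+ 2) ^+ (2 ^ n) /\
    nn (f' (h n)) = (nn (f' a) ^+ 2) ^+ (2 ^ n).
  elim: n => [|n [IH IH']].
    by rewrite /h /= fM fM' fS fS' !nn_starl !expr1.
  have [s s'] := sa n.
  have -> : h n.+1 = mulP (h n) (h n) by [].
  rewrite fM fM' !nn_sqr_sa // IH IH' -!exprM.
  by rewrite !expnSr !mulnA.
rewrite -(@ler_pXn2r _ 2) ?nnegrE ?nn_ge0 //.
apply: (@power_trick _ _ _ K); rewrite ?exprn_ge0 ?nn_ge0 // => n.
by have [<- <-] := pw n; exact: hK.
Qed.

End PowerTrick.
End CstarAnalysis.

(** * Separated quotients of complete seminormed spaces *)

Section Seminormed.
Variable R : realType.
Local Notation C := (Cx R).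

(* A seminorm on a linear subspace, complete along sequences. *)
Record snspace := SNSpace {
  sn_car :> lmodType C;
  sn_dom : set sn_car;
  sn_p : sn_car -> R;
  sn_dom0 : sn_dom 0;
  sn_domD : forall x y, sn_dom x -> sn_dom y -> sn_dom (x + y);
  sn_domZ : forall (z : C) x, sn_dom x -> sn_dom (z *: x);
  sn_pD : forall x y, sn_dom x -> sn_dom y -> sn_p (x + y) <= sn_p x + sn_p y;
  sn_pZ : forall (z : C) x, sn_dom x -> sn_p (z *: x) = nn z * sn_p x;
  sn_complete : forall u : nat -> sn_car, (forall n, sn_dom (u n)) ->
    (forall e : R, 0 < e -> exists N, forall m n, (N <= m)%N -> (N <= n)%N ->
       sn_p (u m - u n) < e) ->
    exists2 l, sn_dom l & forall e : R, 0 < e -> exists N, forall n,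
      (N <= n)%N -> sn_p (l - u n) < e
}.

Section Quotient.
Variable S : snspace.
Local Notation D := (@sn_dom S).
Local Notation p := (@sn_p S).
Implicit Types x y : sn_car S.

Lemma sn_domN x : D x -> D (- x).
Proof. by move=> h; rewrite -scaleN1r; exact: sn_domZ. Qed.

Lemma sn_domB x y : D x -> D y -> D (x - y).
Proof. by move=> h h'; apply: sn_domD => //; exact: sn_domN. Qed.

Lemma sn_p0 : p 0 = 0.
Proof.
by rewrite -[in p 0](scale0r (0 : S)) sn_pZ ?nn0 ?mul0r //; exact: sn_dom0.
Qed.

Lemma sn_pN x : D x -> p (- x) = p x.
Proof. by move=> h; rewrite -scaleN1r sn_pZ // nnN nn1 mul1r. Qed.

Lemma sn_pB x y : D x -> D y -> p (x - y) = p (y - x).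
Proof. by move=> h h'; rewrite -sn_pN ?opprB //; exact: sn_domB. Qed.

Lemma sn_p_ge0 x : D x -> 0 <= p x.
Proof.
move=> h; have := sn_pD h (sn_domN h); rewrite subrr sn_p0 sn_pN //; lra.
Qed.

Definition sn_eq x y := [/\ D x, D y & p (x - y) = 0].

Lemma sn_eq_refl x : D x -> sn_eq x x.
Proof. by move=> h; split=> //; rewrite subrr sn_p0. Qed.

Lemma sn_eq_sym x y : sn_eq x y -> sn_eq y x.
Proof. by move=> [h h' e]; split=> //; rewrite sn_pB. Qed.

Lemma sn_eq_trans y x z : sn_eq x y -> sn_eq y z -> sn_eq x z.
Proof.
move=> [h h' e] [_ h'' e']; split=> //; apply: le_anti.
rewrite sn_p_ge0 ?andbT; last exact: sn_domB.
rewrite -[x - z](subrKA y); apply: (le_trans (sn_pD _ _)); try exact: sn_domB.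
by rewrite e e' addr0.
Qed.

Lemma sn_p_eq x y : sn_eq x y -> p x = p y.
Proof.
move=> [h h' e]; apply: le_anti; apply/andP; split.
  rewrite -{1}[x](subrK y); apply: (le_trans (sn_pD _ _)) => //; first exact: sn_domB.
  by rewrite e add0r.
rewrite -{1}[y](subrK x); apply: (le_trans (sn_pD _ _)) => //; first exact: sn_domB.
by rewrite sn_pB // e add0r.
Qed.

(* Canonical representatives; elements outside the domain are sent to the
   class of [0]. *)
Definition sn_nf x : sn_car S :=
  if pselect (D x) then xget 0 (sn_eq x) else xget 0 (sn_eq 0).

Lemma sn_nfE x : D x -> sn_nf x = xget 0 (sn_eq x).
Proof. by rewrite /sn_nf; case: pselect. Qed.

Lemma sn_nfE0 x : ~ D x -> sn_nf x = xget 0 (sn_eq 0).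
Proof. by rewrite /sn_nf; case: pselect. Qed.

Lemma sn_nfP x : D x -> sn_eq x (sn_nf x).
Proof.
move=> h; rewrite sn_nfE //.
by apply: (xgetPex 0 (ex_intro (sn_eq x) x _)); exact: sn_eq_refl.
Qed.

Lemma sn_nfP0 x : ~ D x -> sn_eq 0 (sn_nf x).
Proof.
move=> h; rewrite sn_nfE0 //.
by apply: (xgetPex 0 (ex_intro (sn_eq 0) 0 _)); apply: sn_eq_refl; exact: sn_dom0.
Qed.

Lemma sn_nf_eq x y : sn_eq x y -> sn_nf x = sn_nf y.
Proof.
move=> h; have [h1 h2 _] := h; rewrite !sn_nfE //.
congr xget; apply/seteqP; split=> z hz; first exact: sn_eq_trans (sn_eq_sym h) hz.
exact: sn_eq_trans h hz.
Qed.

Lemma sn_nf_dom x : D (sn_nf x).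
Proof.
have [h|h] := pselect (D x); first by case: (sn_nfP h).
by case: (sn_nfP0 h).
Qed.

Lemma sn_nfK x : sn_nf (sn_nf x) = sn_nf x.
Proof.
have [h|h] := pselect (D x); first by apply/esym/sn_nf_eq; exact: sn_nfP.
by rewrite -(sn_nf_eq (sn_nfP0 h)) (sn_nfE0 h) sn_nfE //; exact: sn_dom0.
Qed.

Definition quo : Type := {x : sn_car S | `[< sn_nf x = x >]}.
HB.instance Definition _ := Choice.on quo.

Definition quo_pi x : quo := exist _ (sn_nf x) (asboolT (sn_nfK x)).
Definition quo_rep (a : quo) : sn_car S := val a.

Lemma quo_repK a : quo_pi (quo_rep a) = a.
Proof. by apply: val_inj => /=; apply/asboolP; exact: (valP a). Qed.

Lemma quo_rep_dom a : D (quo_rep a).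
Proof. by rewrite /quo_rep -(asboolW (valP a)); exact: sn_nf_dom. Qed.

Lemma quo_pi_eq x y : D x -> D y -> p (x - y) = 0 -> quo_pi x = quo_pi y.
Proof. by move=> h h' e; apply: val_inj; apply: sn_nf_eq. Qed.

Lemma quo_pi_sn x y : sn_eq x y -> quo_pi x = quo_pi y.
Proof. by case; exact: quo_pi_eq. Qed.

Lemma quo_rep_pi x : D x -> sn_eq x (quo_rep (quo_pi x)).
Proof. exact: sn_nfP. Qed.

Lemma sn_eqD x y x' y' : sn_eq x x' -> sn_eq y y' -> sn_eq (x + y) (x' + y').
Proof.
move=> [h1 h2 e] [h3 h4 e']; split; try exact: sn_domD.
apply: le_anti; rewrite sn_p_ge0 ?andbT; last by apply: sn_domB; exact: sn_domD.
rewrite opprD addrACA; apply: (le_trans (sn_pD _ _)); try exact: sn_domB.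
by rewrite e e' addr0.
Qed.

Lemma sn_eqZ (z : C) x x' : sn_eq x x' -> sn_eq (z *: x) (z *: x').
Proof.
move=> [h1 h2 e]; split; try exact: sn_domZ.
by rewrite -scalerBr sn_pZ ?e ?mulr0 //; exact: sn_domB.
Qed.

Definition qadd (a b : quo) := quo_pi (quo_rep a + quo_rep b).
Definition qopp (a : quo) := quo_pi (- quo_rep a).
Definition qscale (z : C) (a : quo) := quo_pi (z *: quo_rep a).
Definition qnorm (a : quo) : C := rC (p (quo_rep a)).

Lemma qaddE x y : D x -> D y -> qadd (quo_pi x) (quo_pi y) = quo_pi (x + y).
Proof.
by move=> h h'; apply/esym/quo_pi_sn; apply: sn_eqD; exact: quo_rep_pi.
Qed.

Lemma qscaleE z x : D x -> qscale z (quo_pi x) = quo_pi (z *: x).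
Proof. by move=> h; apply/esym/quo_pi_sn; apply: sn_eqZ; exact: quo_rep_pi. Qed.

Lemma quo_elim (P : quo -> Prop) : (forall x, D x -> P (quo_pi x)) -> forall a, P a.
Proof. by move=> h a; rewrite -(quo_repK a); apply: h; exact: quo_rep_dom. Qed.

Lemma qaddA : associative qadd.
Proof.
elim/quo_elim=> x hx; elim/quo_elim=> y hy; elim/quo_elim=> z hz.
by rewrite !qaddE ?addrA //; exact: sn_domD.
Qed.

Lemma qaddC : commutative qadd.
Proof.
by elim/quo_elim=> x hx; elim/quo_elim=> y hy; rewrite !qaddE // addrC.
Qed.

Lemma qadd0 : left_id (quo_pi 0) qadd.
Proof.
by elim/quo_elim=> x hx; rewrite qaddE // ?add0r //; exact: sn_dom0.
Qed.

Lemma qaddN : left_inverse (quo_pi 0) qopp qadd.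
Proof.
move=> a; rewrite -{2}(quo_repK a) /qopp qaddE ?addNr //; last exact: quo_rep_dom.
by apply: sn_domN; exact: quo_rep_dom.
Qed.

HB.instance Definition _ := GRing.isZmodule.Build quo qaddA qaddC qadd0 qaddN.

Lemma qscaleA (a b : C) v : qscale a (qscale b v) = qscale (a * b) v.
Proof.
by elim/quo_elim: v => x hx; rewrite !qscaleE ?scalerA //; exact: sn_domZ.
Qed.

Lemma qscale1 : left_id 1 qscale.
Proof. by elim/quo_elim=> x hx; rewrite qscaleE // scale1r. Qed.

Lemma qscaleDr : right_distributive qscale qadd.
Proof.
move=> z; elim/quo_elim=> x hx; elim/quo_elim=> y hy.
by rewrite !(qaddE, qscaleE) ?scalerDr //; (exact: sn_domD || exact: sn_domZ).
Qed.

Lemma qscaleDl v : {morph qscale^~ v : a b / a + b >-> qadd a b}.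
Proof.
move=> a b /=; elim/quo_elim: v => x hx.
by rewrite !qscaleE // qaddE ?scalerDl //; exact: sn_domZ.
Qed.

HB.instance Definition _ := GRing.Zmodule_isLmodule.Build C quo
  qscaleA qscale1 qscaleDr qscaleDl.

Lemma quo_piD x y : D x -> D y -> quo_pi (x + y) = quo_pi x + quo_pi y.
Proof. by move=> h h'; rewrite -qaddE. Qed.

Lemma quo_piZ (z : C) x : D x -> quo_pi (z *: x) = z *: quo_pi x.
Proof. by move=> h; rewrite -qscaleE. Qed.

Lemma quo_piB x y : D x -> D y -> quo_pi (x - y) = quo_pi x - quo_pi y.
Proof.
move=> h h'; rewrite quo_piD //; last exact: sn_domN.
by rewrite -scaleN1r quo_piZ // scaleN1r.
Qed.

Lemma qnormE x : D x -> qnorm (quo_pi x) = rC (p x).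
Proof. by move=> h; rewrite /qnorm -(sn_p_eq (quo_rep_pi h)). Qed.

Lemma qnormD a b : qnorm (a + b) <= qnorm a + qnorm b.
Proof.
elim/quo_elim: a => x hx; elim/quo_elim: b => y hy.
rewrite -quo_piD // !qnormE //; last exact: sn_domD.
by rewrite -rCD rC_le; exact: sn_pD.
Qed.

Lemma qnormZ (z : C) a : qnorm (z *: a) = `|z| * qnorm a.
Proof.
elim/quo_elim: a => x hx; rewrite -quo_piZ // !qnormE //; last exact: sn_domZ.
by rewrite sn_pZ // rCM -nnE.
Qed.

Lemma qnorm0_eq0 a : qnorm a = 0 -> a = 0.
Proof.
elim/quo_elim: a => x hx; rewrite qnormE // => /eqP; rewrite rC_eq0 => /eqP e.
by apply: quo_pi_eq => //; rewrite ?subr0 //; exact: sn_dom0.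
Qed.

HB.instance Definition _ :=
  Lmodule_isNormed.Build C quo qnormD qnormZ qnorm0_eq0.

Lemma nn_quo_pi x : D x -> nn (quo_pi x) = p x.
Proof. by move=> h; apply: rC_inj; rewrite -nnE -qnormE. Qed.

(** A Cauchy filter is followed by centres $a_n$ of balls of radius $1/(n+1)$ belonging to it; their
    representatives form a Cauchy sequence, whose limit is the limit of the filter. *)
Lemma quo_complete (F : set_system quo) :
  ProperFilter F -> cauchy F -> cvg F.
Proof.
move=> FF /cauchyP cF.
have hn n : 0 < rC n.+1%:R^-1 :> C by rewrite -rC0 rC_lt invr_gt0.
have [a ha] := choice (fun n => cF _ (hn n)).
have dn m n : nn (a m - a n) <= m.+1%:R^-1 + n.+1%:R^-1.
  have [b [bm bn]] := filter_ex (filterI (ha m) (ha n)).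
  move: bm bn; rewrite -ball_normE /= !nnE !rC_lt => bm bn.
  apply: (le_trans (nn_tri b _ _)); rewrite lerD ?ltW // nnB //.
have small (e : R) : 0 < e -> exists N, forall n, (N <= n)%N -> n.+1%:R^-1 < e.
  move=> e0; exists (Num.bound e^-1) => n hn'.
  rewrite -[ltRHS]invrK ltf_pV2 ?posrE ?invr_gt0 //.
  apply: (lt_le_trans (archi_boundP _)); rewrite ?invr_ge0 ?(ltW e0) //.
  by rewrite ler_nat leqW.
have [n|e e0|l hl hlim] := @sn_complete S (fun n => quo_rep (a n)).
- exact: quo_rep_dom.
- have [N hN] := small (e / 2) (divr_gt0 e0 (ltr0Sn _ _)).
  exists N => m n /hN h1 /hN h2; rewrite -nn_quo_pi ?quo_piB ?quo_repK; try exact: quo_rep_dom.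
    by apply: (le_lt_trans (dn m n)); rewrite [ltRHS](splitr e) ltrD.
  by apply: sn_domB; exact: quo_rep_dom.
apply/cvg_ex; exists (quo_pi l) => B /nbhs_nn [e e0 sB].
have e2 : 0 < e / 2 by rewrite divr_gt0.
have [N hN] := small _ e2; have [M hM] := hlim _ e2.
have h1 := hN _ (leq_maxl N M); have h2 := hM _ (leq_maxr N M).
apply: (filterS _ (ha (maxn N M))) => b.
rewrite -ball_normE /= nnE rC_lt => hb; apply: sB.
apply: (le_lt_trans (nn_tri (a (maxn N M)) _ _)).
move: h2; rewrite -nn_quo_pi ?quo_piB ?quo_repK //; try exact: quo_rep_dom.
  by move=> h2; rewrite [ltRHS](splitr e) ltrD // (lt_trans hb).
by apply: sn_domB => //; exact: quo_rep_dom.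
Qed.

HB.instance Definition _ := isPointed.Build quo 0.
HB.instance Definition _ := Uniform_isComplete.Build quo quo_complete.

(* Opaque on purpose: unfolding the construction makes unification diverge. *)
Record quotient := Quotient {
  quotient_space : completeNormedModType C;
  quotient_pi : S -> quotient_space;
  quotient_rep : quotient_space -> S;
  quotient_repK : forall a, quotient_pi (quotient_rep a) = a;
  quotient_rep_dom : forall a, D (quotient_rep a);
  quotient_piD : forall x y, D x -> D y ->
    quotient_pi (x + y) = quotient_pi x + quotient_pi y;
  quotient_piZ : forall (z : C) x, D x ->
    quotient_pi (z *: x) = z *: quotient_pi x;
  quotient_pi_nn : forall x, D x -> nn (quotient_pi x) = p x
}.

Lemma quotient_ex : quotient.
Proof. exact: (@Quotient quo _ _ quo_repK quo_rep_dom quo_piD quo_piZ nn_quo_pi). Qed.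

End Quotient.

Section QuotientFacade.
Variable S : snspace.
Local Notation D := (@sn_dom S).
Local Notation p := (@sn_p S).

Definition quo_space : completeNormedModType C := quotient_space (quotient_ex S).
Definition qpi : S -> quo_space := @quotient_pi S _.
Definition qrep : quo_space -> S := @quotient_rep S _.

Lemma qrepK a : qpi (qrep a) = a. Proof. exact: quotient_repK. Qed.

Lemma qrep_dom a : D (qrep a). Proof. exact: quotient_rep_dom. Qed.

Lemma qpiD x y : D x -> D y -> qpi (x + y) = qpi x + qpi y.
Proof. exact: quotient_piD. Qed.

Lemma qpiZ (z : C) x : D x -> qpi (z *: x) = z *: qpi x.
Proof. exact: quotient_piZ. Qed.

Lemma nn_qpi x : D x -> nn (qpi x) = p x.
Proof. exact: quotient_pi_nn. Qed.

Lemma qpiB x y : D x -> D y -> qpi (x - y) = qpi x - qpi y.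
Proof.
move=> h h'; rewrite qpiD //; last exact: sn_domN.
by rewrite -scaleN1r qpiZ // scaleN1r.
Qed.

Lemma qpi_eq x y : D x -> D y -> p (x - y) = 0 -> qpi x = qpi y.
Proof.
move=> h h' e; apply/eqP; rewrite -subr_eq0; apply/eqP/nn0_eq.
by rewrite -qpiB // nn_qpi //; exact: sn_domB.
Qed.

Lemma quo_ind (P : quo_space -> Prop) : (forall x, D x -> P (qpi x)) -> forall a, P a.
Proof. by move=> h a; rewrite -(qrepK a); apply: (h); exact: qrep_dom. Qed.

Lemma qrep_pi x : D x -> sn_eq x (qrep (qpi x)).
Proof.
move=> h; have h' := qrep_dom (qpi x); split=> //.
by rewrite -nn_qpi ?qpiB ?qrepK ?subrr ?nn0 //; exact: sn_domB.
Qed.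

End QuotientFacade.
End Seminormed.

(** * Limits of real sequences and complex conjugation *)

Section RealLimit.
Variable R : realType.

Definition rlim (f : nat -> R) (l : R) := forall e : R, 0 < e ->
  exists N, forall n, (N <= n)%N -> `|l - f n| < e.

Lemma rlim_ex (f : nat -> R) :
  (forall e : R, 0 < e -> exists N, forall m n, (N <= m)%N -> (N <= n)%N ->
     `|f m - f n| < e) -> exists l, rlim f l.
Proof.
move=> cf; have : cvg ((f : nat -> R^o) @ \oo).
  apply: cauchy_cvg; apply/cauchyP => e e0.
  have [N hN] := cf e e0; exists (f N); exists N => // n /= Nn.
  exact: hN.
move/cvg_ex => [l hl]; exists l => e e0.
have /hl [N _ hN] : nbhs (l : R^o) (ball (l : R^o) e) by exact: nbhsx_ballx.
by exists N => n /hN.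
Qed.

Lemma rlim_le f g l l' : rlim f l -> rlim g l' ->
  (exists K, forall n, (K <= n)%N -> f n <= g n) -> l <= l'.
Proof.
move=> hf hg [K fg]; apply/ler_addgt0Pr => e e0.
have e2 : 0 < e / 2 by rewrite divr_gt0.
have [N hN] := hf _ e2; have [N' hN'] := hg _ e2.
pose n := maxn K (maxn N N').
have Kn : (K <= n)%N by rewrite leq_maxl.
have Nn : (N <= n)%N by rewrite !leq_max leqnn orbT.
have Nn' : (N' <= n)%N by rewrite !leq_max leqnn !orbT.
have := fg n Kn; have := hN n Nn; have := hN' n Nn'.
rewrite !ltr_norml => /andP[h1 h2] /andP[h3 h4] h5.
by move: h1 h2 h3 h4 h5; lra.
Qed.

Lemma rlim_uniq f l l' : rlim f l -> rlim f l' -> l = l'.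
Proof.
by move=> h h'; apply: le_anti; rewrite (rlim_le h h') ?(rlim_le h' h) //;
  exists 0%N.
Qed.

Lemma rlim_const c : rlim (fun=> c) c.
Proof. by move=> e e0; exists 0%N => n _; rewrite subrr normr0. Qed.

Lemma rlimD f g l l' : rlim f l -> rlim g l' -> rlim (fun n => f n + g n) (l + l').
Proof.
move=> hf hg e e0; have e2 : 0 < e / 2 by rewrite divr_gt0.
have [N hN] := hf _ e2; have [N' hN'] := hg _ e2.
exists (maxn N N') => n; rewrite geq_max => /andP[/hN h1 /hN' h2].
rewrite opprD addrACA (le_lt_trans (ler_normD _ _)) // [ltRHS](splitr e).
exact: ltrD.
Qed.

Lemma rlimM f g l l' : rlim f l -> rlim g l' -> rlim (fun n => f n * g n) (l * l').
Proof.
move=> hf hg e e0; pose M := `|l| + `|l'| + 1.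
have M0 : 0 < M by rewrite ltr_wpDl.
pose d := Num.min 1 (e / (2 * M)).
have d0 : 0 < d by rewrite lt_min ltr01 divr_gt0 // mulr_gt0.
have [N hN] := hf d d0; have [N' hN'] := hg d d0.
exists (maxn N N') => n; rewrite geq_max => /andP[/hN h1 /hN' h2].
have -> : l * l' - f n * g n = (l - f n) * l' + f n * (l' - g n) by ring.
apply: (le_lt_trans (ler_normD _ _)); rewrite !normrM.
have hd1 : d <= 1 by rewrite ge_min lexx.
have hd2 : d * (2 * M) <= e.
  by rewrite -ler_pdivlMr ?mulr_gt0 // ge_min lexx orbT.
have hun : `|f n| <= `|l| + 1.
  have -> : f n = l - (l - f n) by ring.
  by rewrite (le_trans (ler_normB _ _)) // lerD2l ltW // (lt_le_trans h1).
move: (normr_ge0 (l - f n)) (normr_ge0 (l' - g n)) (normr_ge0 l) (normr_ge0 l')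
  (normr_ge0 (f n)) => h3 h4 h5 h6 h7.
rewrite /M in hd2; nra.
Qed.

End RealLimit.

Section Conj.
Variable R : realType.
Local Notation C := (Cx R).
Implicit Types x y : C.
Lemma conjM x y : (x * y)^* = x^* * y^*. Proof. exact: rmorphM. Qed.
Lemma conjD x y : (x + y)^* = x^* + y^*. Proof. exact: rmorphD. Qed.
Lemma conjN x : (- x)^* = - x^*. Proof. exact: rmorphN. Qed.
Lemma conj0 : (0 : C)^* = 0. Proof. exact: rmorph0. Qed.
Lemma conj1 : (1 : C)^* = 1. Proof. exact: rmorph1. Qed.
Lemma conj_sum I (s : seq I) (P : pred I) (f : I -> C) :
  (\sum_(i <- s | P i) f i)^* = \sum_(i <- s | P i) (f i)^*.
Proof. exact: rmorph_sum. Qed.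
End Conj.

(** * Bounded adjointable operators on a pre-Hilbert space *)

Section PreHilbert.
Variable R : realType.
Local Notation C := (Cx R).

(** The form may be degenerate and the space incomplete: the completion is carried out on operators,
    so no Hilbert space has to be constructed. *)
Record prehilbert := PreHilbert {
  ph_car :> lmodType C;
  ph_dom : set ph_car;
  ph_form : ph_car -> ph_car -> C;
  ph_dom0 : ph_dom 0;
  ph_domD : forall x y, ph_dom x -> ph_dom y -> ph_dom (x + y);
  ph_domZ : forall (z : C) x, ph_dom x -> ph_dom (z *: x);
  ph_formD : forall x y z, ph_dom x -> ph_dom y -> ph_dom z ->
    ph_form (x + y) z = ph_form x z + ph_form y z;
  ph_formZ : forall (c : C) x z, ph_dom x -> ph_dom z ->
    ph_form (c *: x) z = c * ph_form x z;
  ph_herm : forall x y, ph_dom x -> ph_dom y ->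
    ph_form y x = (ph_form x y)^*;
  ph_pos : forall x, ph_dom x -> 0 <= ph_form x x
}.

Variable V : prehilbert.
Local Notation D := (@ph_dom V).
Local Notation "<< x , y >>" := (@ph_form V x y).
Implicit Types (x y z : ph_car V) (S T : ph_car V -> ph_car V).

Lemma ph_domN x : D x -> D (- x).
Proof. by move=> h; rewrite -scaleN1r; exact: ph_domZ. Qed.

Lemma ph_domB x y : D x -> D y -> D (x - y).
Proof. by move=> h h'; apply: ph_domD => //; exact: ph_domN. Qed.

Lemma ph_formN x z : D x -> D z -> << - x, z >> = - << x, z >>.
Proof. by move=> h h'; rewrite -scaleN1r ph_formZ // mulN1r. Qed.

Lemma ph_formB x y z : D x -> D y -> D z ->
  << x - y, z >> = << x, z >> - << y, z >>.
Proof.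
by move=> *; rewrite ph_formD ?ph_formN //; exact: ph_domN.
Qed.

Lemma ph_formDr x y z : D x -> D y -> D z ->
  << z, x + y >> = << z, x >> + << z, y >>.
Proof.
move=> hx hy hz; have hxy := ph_domD hx hy.
by rewrite (ph_herm hxy hz) ph_formD // conjD (ph_herm hx hz) (ph_herm hy hz).
Qed.

Lemma ph_formZr (c : C) x z : D x -> D z -> << z, c *: x >> = c^* * << z, x >>.
Proof.
move=> hx hz; have hcx := ph_domZ c hx.
by rewrite (ph_herm hcx hz) ph_formZ // conjM (ph_herm hx hz).
Qed.

Lemma ph_formBr x y z : D x -> D y -> D z ->
  << z, x - y >> = << z, x >> - << z, y >>.
Proof.
move=> hx hy hz; rewrite -scaleN1r ph_formDr ?ph_formZr //; last exact: ph_domZ.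
by rewrite conjN conj1 mulN1r.
Qed.

Lemma ph_form0l z : D z -> << 0, z >> = 0.
Proof. by move=> h; rewrite -(scale0r (0 : V)) ph_formZ ?mul0r //; exact: ph_dom0. Qed.

Definition phq x : R := Cre << x, x >>.
Definition phn x : R := Num.sqrt (phq x).

Lemma phqE x : D x -> << x, x >> = rC (phq x).
Proof. by move=> h; rewrite Cre_real //; exact: ph_pos. Qed.

Lemma phq_ge0 x : D x -> 0 <= phq x.
Proof. by move=> h; rewrite -rC_le -phqE // rC0; exact: ph_pos. Qed.

Lemma phn_ge0 x : 0 <= phn x. Proof. exact: sqrtr_ge0. Qed.

Lemma phn_sqr x : D x -> phn x ^+ 2 = phq x.
Proof. by move=> h; rewrite sqr_sqrtr //; exact: phq_ge0. Qed.

(** Positivity of the form at $x-tfy$ with $f=\langle x,y\rangle$, used at the minimizing $t$; if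
    $y$ has norm 0, a large $t$ forces $f=0$. *)
Lemma cauchy_schwarz x y : D x -> D y -> nn << x, y >> <= phn x * phn y.
Proof.
move=> hx hy; pose f := << x, y >>.
have key (t : R) : 0 <= phq x - 2 * t * nn f ^+ 2 + t ^+ 2 * nn f ^+ 2 * phq y.
  have hz : D (x - (rC t * f) *: y) by apply: ph_domB => //; exact: ph_domZ.
  have := phq_ge0 hz; rewrite -rC_le -phqE //.
  rewrite ph_formB ?ph_formBr ?ph_formZ ?ph_formZr //; try exact: ph_domZ.
  rewrite (ph_herm hx hy) -/f conjM rC_conj !phqE //.
  have -> : rC (phq x) - rC t * f^* * f -
      (rC t * f * f^* - rC t * f * (rC t * f^* * rC (phq y))) =
      rC (phq x) - 2 * rC t * (f * f^*) + rC t ^+ 2 * (f * f^*) * rC (phq y).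
    by ring.
  rewrite nn_sqr -!rCX -(rC_nat R 2) -!rCM -rCN -!rCD rC_le.
  by move=> h; apply: (le_trans h); rewrite le_eqVlt; apply/orP; left; apply/eqP; ring.
rewrite -(@ler_pXn2r _ 2) ?nnegrE ?mulr_ge0 ?phn_ge0 ?nn_ge0 //.
rewrite exprMn !phn_sqr //; have q0 := phq_ge0 hy; have p0 := phq_ge0 hx.
have [e|ny] := eqVneq (phq y) 0; last first.
  have qp : 0 < phq y by rewrite lt_neqAle eq_sym ny.
  have := key (phq y)^-1.
  have -> : phq x - 2 * (phq y)^-1 * nn f ^+ 2 + (phq y)^-1 ^+ 2 * nn f ^+ 2 * phq y =
    (phq x * phq y - nn f ^+ 2) / phq y by field.
  by rewrite ler_pdivlMr // mul0r subr_ge0.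
have := key ((phq x + 1) / nn f ^+ 2); rewrite e !mulr0 addr0 -/f.
have [->|nf] := eqVneq (nn f ^+ 2) 0; first by [].
have -> : phq x - 2 * ((phq x + 1) / nn f ^+ 2) * nn f ^+ 2 = - phq x - 2.
  by move: (nn f ^+ 2) nf => r nf; field.
lra.
Qed.

Lemma phnD x y : D x -> D y -> phn (x + y) <= phn x + phn y.
Proof.
move=> hx hy; rewrite -(@ler_pXn2r _ 2) ?nnegrE ?addr_ge0 ?phn_ge0 //.
rewrite phn_sqr; last exact: ph_domD.
rewrite /phq ph_formD ?ph_formDr //; last exact: ph_domD.
rewrite !CreD -!/(phq _) (ph_herm hx hy).
have h1 := le_trans (ler_norm _) (le_trans (Cre_le_nn << x, y >>) (cauchy_schwarz hx hy)).
have h2 : Cre (<< x, y >>^*) <= phn x * phn y.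
  by rewrite (le_trans (ler_norm _)) // (le_trans (Cre_le_nn _)) // nn_conj cauchy_schwarz.
rewrite -!phn_sqr //; move: h1 h2; nra.
Qed.

Lemma phnZ (c : C) x : D x -> phn (c *: x) = nn c * phn x.
Proof.
move=> hx; apply/eqP; rewrite -(@eqrXn2 _ 2) ?mulr_ge0 ?phn_ge0 ?nn_ge0 //.
rewrite exprMn !phn_sqr //; last exact: ph_domZ.
apply/eqP/rC_inj; rewrite -phqE; last exact: ph_domZ.
rewrite ph_formZ ?ph_formZr //; last exact: ph_domZ.
by rewrite mulrA nn_sqr phqE // -rCM.
Qed.

Lemma phn0_form x y : D x -> D y -> phn x = 0 -> << x, y >> = 0.
Proof.
move=> hx hy e; apply: nn0_eq; apply: le_anti; rewrite nn_ge0 andbT.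
by rewrite (le_trans (cauchy_schwarz hx hy)) // e mul0r.
Qed.

Definition maps T := forall x, D x -> D (T x).
Definition bnd T (M : R) := 0 <= M /\ forall x, D x -> phn (T x) <= M * phn x.
Definition isadj T T' := maps T' /\
  forall x y, D x -> D y -> << T x, y >> = << x, T' y >>.
Definition opdom T := [/\ maps T, exists M, bnd T M & exists T', isadj T T'].
Definition opn T : R := inf [set M | bnd T M].

Lemma isadj_sym T T' : maps T -> isadj T T' -> isadj T' T.
Proof.
move=> mT [mT' h]; split=> // x y hx hy.
by rewrite (ph_herm (mT _ hy) hx) h // -(ph_herm hy (mT' _ hx)).
Qed.

(** $\|T'y\|^2=\langle TT'y,y\rangle\le M\|T'y\|\|y\|$. *)
Lemma isadj_bnd T T' M : maps T -> isadj T T' -> bnd T M -> bnd T' M.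
Proof.
move=> mT [mT' h] [M0 hM]; split=> // y hy; have hT'y := mT' _ hy.
have h1 : phn (T' y) ^+ 2 <= phn (T' y) * (M * phn y).
  rewrite phn_sqr // /phq -h //; apply: (le_trans (ler_norm _)).
  apply: (le_trans (Cre_le_nn _)); apply: (le_trans (cauchy_schwarz (mT _ hT'y) hy)).
  by rewrite mulrA [phn (T' y) * M]mulrC ler_wpM2r ?phn_ge0 // hM.
have := phn_ge0 (T' y); rewrite le_eqVlt => /predU1P [<-|h0].
  by rewrite mulr_ge0 ?phn_ge0.
by rewrite -(ler_pM2l h0) -expr2.
Qed.

Section Norm.
Variables (T : ph_car V -> ph_car V) (hT : opdom T).

Lemma opn_set : has_inf [set M | bnd T M].
Proof.
by case: hT => _ [M hM] _; split; [exists M | exists 0 => N []].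
Qed.

Lemma opn_ge0 : 0 <= opn T.
Proof.
by apply: lb_le_inf; [case: opn_set | move=> M []].
Qed.

Lemma opn_le M : bnd T M -> opn T <= M.
Proof. by move=> h; apply: ge_inf => //; case: opn_set. Qed.

Lemma opn_bnd : bnd T (opn T).
Proof.
split; first exact: opn_ge0.
move=> x hx; apply/ler_addgt0Pr => e e0.
have h0 : 0 < phn x + 1 by rewrite ltr_wpDl ?phn_ge0.
have [M hM hM'] := inf_adherent (divr_gt0 e0 h0) opn_set.
case: hM => M0 /(_ x hx) h; apply: (le_trans h).
have : M * phn x <= (opn T + e / (phn x + 1)) * phn x.
  by rewrite ler_wpM2r ?phn_ge0 // ltW.
move/le_trans; apply; rewrite mulrDl lerD2l mulrAC ler_pdivrMr //.
by rewrite ler_wpM2l ?(ltW e0) // lerDl ler01.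
Qed.

End Norm.

(** Adjoints are determined only up to vectors of norm 0, as the form may be degenerate; one of them
    is chosen. *)
Definition adj T : ph_car V -> ph_car V :=
  if pselect (exists T', isadj T T') is left h then sval (cid h) else 0.

Lemma adjP T : opdom T -> isadj T (adj T).
Proof. by case=> _ _ h; rewrite /adj; case: pselect => // h'; case: cid. Qed.

Lemma adj_dom T : opdom T -> opdom (adj T).
Proof.
move=> h; have a := adjP h; case: h => mT [M hM] _; split.
- by case: a.
- by exists M; exact: isadj_bnd hM.
- by exists T; exact: isadj_sym.
Qed.

Lemma opn_adj T : opdom T -> opn (adj T) = opn T.
Proof.
move=> h; have h' := adj_dom h; have a := adjP h.
have m : maps T by case: h.
have m' : maps (adj T) by case: a.
apply: le_anti; rewrite !opn_le //; last exact: isadj_bnd (opn_bnd h).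
exact: isadj_bnd m' (isadj_sym m a) (opn_bnd h').
Qed.

Lemma opdomD S T : opdom S -> opdom T -> opdom (S + T).
Proof.
move=> [mS [M [M0 hM]] [S' [mS' hS]]] [mT [N [N0 hN]] [T' [mT' hT]]]; split.
- by move=> x hx; apply: ph_domD; [exact: mS|exact: mT].
- exists (M + N); split; first exact: addr_ge0.
  move=> x hx; apply: (le_trans (phnD (mS _ hx) (mT _ hx))).
  by rewrite mulrDl lerD ?hM ?hN.
- exists (S' + T'); split=> [x hx|x y hx hy].
    by apply: ph_domD; [exact: mS'|exact: mT'].
  rewrite [LHS]ph_formD; [|exact: mS|exact: mT|by []].
  rewrite [RHS]ph_formDr; [|exact: mS'|exact: mT'|by []].
  by rewrite hS // hT.
Qed.

Lemma opdomZ (c : C) T : opdom T -> opdom (c *: T).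
Proof.
move=> [mT [N [N0 hN]] [T' [mT' hT]]]; split.
- by move=> x hx; apply: ph_domZ; exact: mT.
- exists (nn c * N); split; first by rewrite mulr_ge0 ?nn_ge0.
  move=> x hx; rewrite [phn _](phnZ c (mT _ hx)) -mulrA ler_wpM2l ?nn_ge0 //.
  exact: hN.
- exists (c^* *: T'); split=> [x hx|x y hx hy].
    by apply: ph_domZ; exact: mT'.
  rewrite [LHS]ph_formZ; [|exact: mT|by []].
  rewrite [RHS]ph_formZr; [|exact: mT'|by []].
  by rewrite conjCK hT.
Qed.

Lemma opdom0 : opdom 0.
Proof.
split; [by move=> x _; exact: ph_dom0| |].
  exists 0; split=> // x hx; rewrite mul0r /phn /phq ph_form0l ?sqrtr0 //.
  exact: ph_dom0.
exists 0; split=> [x _|x y hx hy]; first exact: ph_dom0.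
rewrite ph_form0l // (ph_herm (ph_dom0 V) hx) ph_form0l //.
by rewrite conj0.
Qed.

Lemma opdom_comp S T : opdom S -> opdom T -> opdom (S \o T).
Proof.
move=> [mS [M [M0 hM]] [S' [mS' hS]]] [mT [N [N0 hN]] [T' [mT' hT]]]; split.
- by move=> x hx /=; apply: mS; exact: mT.
- exists (M * N); split; first exact: mulr_ge0.
  move=> x hx /=; apply: (le_trans (hM _ (mT _ hx))).
  by rewrite -mulrA ler_wpM2l // hN.
- exists (T' \o S'); split=> [x hx|x y hx hy] /=; first by apply: mT'; exact: mS'.
  rewrite hS // ?hT //; first exact: mS'.
  exact: mT.
Qed.

Lemma opnD S T : opdom S -> opdom T -> opn (S + T) <= opn S + opn T.
Proof.
move=> hS hT; apply: opn_le; first exact: opdomD.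
have [S0 bS] := opn_bnd hS; have [T0 bT] := opn_bnd hT.
have [mS _ _] := hS; have [mT _ _] := hT.
split; first exact: addr_ge0.
move=> x hx; apply: (le_trans (phnD (mS _ hx) (mT _ hx))).
by rewrite mulrDl lerD ?bS ?bT.
Qed.

Lemma opnZ_le (c : C) T : opdom T -> opn (c *: T) <= nn c * opn T.
Proof.
move=> hT; apply: opn_le; first exact: opdomZ.
have [T0 bT] := opn_bnd hT; have [mT _ _] := hT.
split; first by rewrite mulr_ge0 ?nn_ge0.
move=> x hx; rewrite [phn _](phnZ c (mT _ hx)) -mulrA ler_wpM2l ?nn_ge0 //.
exact: bT.
Qed.

Lemma opn0 : opn 0 = 0.
Proof.
apply: le_anti; rewrite (opn_ge0 opdom0) andbT; apply: (opn_le opdom0).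
split=> // x hx; rewrite mul0r /phn /phq ph_form0l ?sqrtr0 //; exact: ph_dom0.
Qed.

Lemma opnZ (c : C) T : opdom T -> opn (c *: T) = nn c * opn T.
Proof.
move=> hT; apply: le_anti; rewrite opnZ_le //=.
have [->|c0] := eqVneq c 0; first by rewrite nn0 mul0r scale0r opn0.
have n0 : 0 < nn c.
  by rewrite lt_neqAle nn_ge0 andbT eq_sym; apply: contra c0 => /eqP /nn0_eq ->.
rewrite -ler_pdivlMl //; have hcT := opdomZ c hT.
have := opnZ_le c^-1 hcT; rewrite scalerA mulVf // scale1r.
suff -> : nn c^-1 = (nn c)^-1 by [].
have n0' : nn c != 0 by rewrite gt_eqF.
by apply: (mulIf n0'); rewrite -nnM !mulVf ?nn1.
Qed.

Lemma opn_comp S T : opdom S -> opdom T -> opn (S \o T) <= opn S * opn T.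
Proof.
move=> hS hT; apply: opn_le; first exact: opdom_comp.
have [S0 bS] := opn_bnd hS; have [T0 bT] := opn_bnd hT.
have [mS _ _] := hS; have [mT _ _] := hT.
split; first exact: mulr_ge0.
move=> x hx /=; apply: (le_trans (bS _ (mT _ hx))).
by rewrite -mulrA ler_wpM2l // bT.
Qed.

(** The $C^*$-identity; the inequality that is not submultiplicativity comes from $\|Tx\|^2=\langle
    x,T^*Tx\rangle\le\|T^*T\|\|x\|^2$. *)
Lemma opn_star T : opdom T -> opn (adj T \o T) = opn T ^+ 2.
Proof.
move=> hT; have hT' := adj_dom hT; have hTT := opdom_comp hT' hT.
apply: le_anti; rewrite expr2 -{1}(opn_adj hT) opn_comp //=.
have m0 := opn_ge0 hTT.
rewrite -(sqr_sqrtr m0) -expr2 ler_pXn2r ?nnegrE ?sqrtr_ge0 ?opn_ge0 //.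
apply: opn_le => //; split; first exact: sqrtr_ge0.
move=> x hx; have [mT _ _] := hT; have [mT' aT] := adjP hT.
rewrite -(@ler_pXn2r _ 2) ?nnegrE ?mulr_ge0 ?sqrtr_ge0 ?phn_ge0 //.
rewrite exprMn (sqr_sqrtr m0) phn_sqr; last exact: mT.
rewrite /phq aT //; last exact: mT.
have := cauchy_schwarz hx (mT' _ (mT _ hx)).
move/(le_trans (Cre_le_nn _))/(le_trans (ler_norm _))/le_trans; apply.
have [_ /(_ x hx) h] := opn_bnd hTT.
by rewrite expr2 mulrCA ler_wpM2l ?phn_ge0.
Qed.

Lemma opn_eq0 S T : opdom S -> opdom T ->
  (forall x y, D x -> D y -> << S x, y >> = << T x, y >>) -> opn (S - T) = 0.
Proof.
move=> hS hT e.
have hST : opdom (S - T) by rewrite -[- T]scaleN1r; apply: opdomD => //; exact: opdomZ.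
have [mS _ _] := hS; have [mT _ _] := hT.
apply: le_anti; rewrite (opn_ge0 hST) andbT; apply: opn_le => //; split=> // x hx.
rewrite mul0r /phn /phq.
have hd := ph_domB (mS _ hx) (mT _ hx).
by rewrite (_ : (S - T) x = S x - T x) // ph_formB ?e ?subrr ?sqrtr0 //;
  first [exact: mT | exact: mS].
Qed.


Lemma opdomB S T : opdom S -> opdom T -> opdom (S - T).
Proof.
by move=> hS hT; rewrite -[- T]scaleN1r; apply: opdomD => //; exact: opdomZ.
Qed.

Lemma opn_tri T S U : opdom S -> opdom T -> opdom U ->
  opn (S - U) <= opn (S - T) + opn (T - U).
Proof.
by move=> hS hT hU; rewrite -[S - U](subrKA T); apply: opnD; exact: opdomB.
Qed.

Lemma opnB S T : opdom S -> opdom T -> opn (S - T) = opn (T - S).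
Proof.
move=> hS hT; rewrite -[S - T]opprB -scaleN1r opnZ ?nnN ?nn1 ?mul1r //.
exact: opdomB.
Qed.

Local Notation W := (nat -> ph_car V -> ph_car V).

(** Elements of the completed operator algebra are represented by norm-Cauchy sequences of
    operators, with the limit of the norms as seminorm. *)
Definition cauchy_op (u : W) := (forall n, opdom (u n)) /\
  forall e : R, 0 < e -> exists N, forall m n, (N <= m)%N -> (N <= n)%N ->
    opn (u m - u n) < e.

Definition oplim (u : W) : R := xget 0 (rlim (fun n => opn (u n))).

Lemma opn_dist S T : opdom S -> opdom T -> `|opn S - opn T| <= opn (S - T).
Proof.
move=> hS hT; rewrite ler_norml lerBlDl; apply/andP; split.
  rewrite lerNl opprB lerBlDl addrC; rewrite (opnB hS hT).
  by rewrite -{1}[T](subrK S) opnD //; exact: opdomB.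
by rewrite -{1}[S](subrK T) addrC opnD //; exact: opdomB.
Qed.

Lemma oplimP u : cauchy_op u -> rlim (fun n => opn (u n)) (oplim u).
Proof.
move=> [hu cu]; have [|l hl] := @rlim_ex R (fun n => opn (u n)).
  move=> e /cu [N hN]; exists N => m n Nm Nn.
  by apply: le_lt_trans (opn_dist (hu m) (hu n)) _; exact: hN.
exact: (xgetPex 0 (ex_intro _ l hl)).
Qed.

Lemma cauchy_opD u v : cauchy_op u -> cauchy_op v -> cauchy_op (u + v).
Proof.
move=> [hu cu] [hv cv]; split=> [n|e e0]; first exact: opdomD.
have e2 : 0 < e / 2 by rewrite divr_gt0.
have [N hN] := cu _ e2; have [N' hN'] := cv _ e2.
exists (maxn N N') => m n; rewrite !geq_max => /andP[h1 h2] /andP[h3 h4].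
have -> : (u + v) m - (u + v) n = (u m - u n) + (v m - v n).
  by rewrite [LHS](_ : _ = (u m + v m) - (u n + v n)) // opprD addrACA.
apply: le_lt_trans (opnD (opdomB _ _) (opdomB _ _)) _ => //.
by rewrite [ltRHS](splitr e) ltrD ?hN ?hN'.
Qed.

Lemma cauchy_opZ (c : C) u : cauchy_op u -> cauchy_op (c *: u).
Proof.
move=> [hu cu]; split=> [n|e e0]; first exact: opdomZ.
have h0 : 0 < nn c + 1 by rewrite ltr_wpDl ?nn_ge0.
have [N hN] := cu _ (divr_gt0 e0 h0); exists N => m n Nm Nn.
have -> : (c *: u) m - (c *: u) n = c *: (u m - u n) by rewrite scalerBr.
rewrite opnZ; last exact: opdomB.
have := hN m n Nm Nn; rewrite ltr_pdivlMr //; apply: le_lt_trans.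
rewrite mulrC ler_wpM2l ?lerDl ?ler01 //; apply: opn_ge0; exact: opdomB.
Qed.

Lemma cauchy_op_const T : opdom T -> cauchy_op (fun=> T).
Proof. by move=> hT; split=> // e e0; exists 0%N => m n _ _; rewrite subrr opn0. Qed.

Lemma cauchy_op_bound u : cauchy_op u ->
  exists2 M : R, 0 < M & forall n, opn (u n) <= M.
Proof.
move=> [hu cu]; have [N hN] := cu 1 ltr01.
pose M := 1 + opn (u N) + \sum_(i < N) opn (u i).
have s0 : 0 <= \sum_(i < N) opn (u i) by rewrite sumr_ge0 // => i _; exact: opn_ge0.
have u0 := opn_ge0 (hu N).
exists M; first by rewrite /M; lra.
move=> n; have [Nn|nN] := leqP N n.
  have := opn_dist (hu n) (hu N); have := hN n N Nn (leqnn N).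
  move=> h1 /le_lt_trans /(_ h1); rewrite ltr_norml => /andP[_ h].
  by rewrite /M; lra.
rewrite /M (bigD1 (Ordinal nN)) //=.
have : 0 <= \sum_(i < N | i != Ordinal nN) opn (u i).
  by rewrite sumr_ge0 // => i _; exact: opn_ge0.
lra.
Qed.

Definition mulW (u v : W) : W := fun n => u n \o v n.
Definition starW (u : W) : W := fun n => adj (u n).

(** Operators are arbitrary maps, and an adjoint makes them linear only up to vectors of norm 0.
    Hence $ST-S'T'=(S-S')T+S'(T-T')$ holds only up to an operator of norm 0, which is checked
    through the form. *)
Lemma comp_bound S T S' T' : opdom S -> opdom T -> opdom S' -> opdom T' ->
  opn ((S \o T) - (S' \o T')) <= opn (S - S') * opn T + opn S' * opn (T - T').
Proof.
move=> hS hT hS' hT'; have hSS := opdomB hS hS'; have hTT := opdomB hT hT'.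
have h1 := opdom_comp hSS hT; have h2 := opdom_comp hS' hTT.
apply: le_trans (lerD (opn_comp hSS hT) (opn_comp hS' hTT)).
apply: le_trans (opnD h1 h2); have h3 := opdom_comp hS hT; have h4 := opdom_comp hS' hT'.
rewrite -[X in opn X <= _](subrK (((S - S') \o T) + (S' \o (T - T')))).
have h12 := opdomD h1 h2; have h34 := opdomB h3 h4.
apply: (le_trans (opnD (opdomB h34 h12) h12)).
rewrite opn_eq0 ?add0r //.
move=> x y hx hy; have [mT _ _] := hT; have [mT' _ _] := hT'.
have [mS _ _] := hS; have [mS' _ [A' [mA aA]]] := hS'.
rewrite [LHS](ph_formB (mS _ (mT _ hx)) (mS' _ (mT' _ hx)) hy).
rewrite [RHS](ph_formD _ _ hy); last 2 first.
- by apply: ph_domB; [exact: mS (mT _ hx)|exact: mS' (mT _ hx)].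
- by apply: mS'; apply: ph_domB; [exact: mT|exact: mT'].
rewrite [X in _ = X + _](ph_formB (mS _ (mT _ hx)) (mS' _ (mT _ hx)) hy).
rewrite [X in _ = _ + X]aA //; last by apply: ph_domB; [exact: mT|exact: mT'].
rewrite (ph_formB (mT _ hx) (mT' _ hx) (mA _ hy)) -!aA //; [|exact: mT'|exact: mT].
by rewrite /= subrKA.
Qed.

Lemma cauchy_opM u v : cauchy_op u -> cauchy_op v -> cauchy_op (mulW u v).
Proof.
move=> cu cv; have [M M0 hM] := cauchy_op_bound cu; have [M' M0' hM'] := cauchy_op_bound cv.
case: cu => hu cu; case: cv => hv cv; split=> [n|e e0]; first exact: opdom_comp.
have h0 : 0 < M + M' by exact: addr_gt0.
have d0 := divr_gt0 e0 h0.
have [N hN] := cu _ d0; have [N' hN'] := cv _ d0.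
exists (maxn N N') => m n; rewrite !geq_max => /andP[h1 h2] /andP[h3 h4].
apply: le_lt_trans (comp_bound (hu m) (hv m) (hu n) (hv n)) _.
have a1 := hN m n h1 h3; have a2 := hN' m n h2 h4.
have a3 := hM n; have a4 := hM' m.
have b1 := opn_ge0 (opdomB (hu m) (hu n)); have b2 := opn_ge0 (opdomB (hv m) (hv n)).
have b3 := opn_ge0 (hu n); have b4 := opn_ge0 (hv m).
have -> : e = (e / (M + M')) * M' + M * (e / (M + M')) by field; rewrite gt_eqF.
move: (opn (u m - u n)) (opn (v m - v n)) (opn (u n)) (opn (v m)) (e / (M + M'))
  a1 a2 a3 a4 b1 b2 b3 b4 d0 => p q r s d *; nra.
Qed.

Lemma adjB_opn S T : opdom S -> opdom T -> opn (adj S - adj T) = opn (S - T).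
Proof.
move=> hS hT; have hST := opdomB hS hT.
rewrite -(opn_adj hST); have hS' := adj_dom hS; have hT' := adj_dom hT.
have e : opn (adj S - adj T - adj (S - T)) = 0.
  apply: opn_eq0; [exact: opdomB|exact: adj_dom|].
  move=> x y hx hy; have [mS aS] := adjP hS; have [mT aT] := adjP hT.
  have [mST aST] := adjP hST; have [nS _ _] := hS; have [nT _ _] := hT.
  rewrite [LHS](ph_formB (mS _ hx) (mT _ hx) hy).
  rewrite (ph_herm hy (mS _ hx)) (ph_herm hy (mT _ hx)) (ph_herm hy (mST _ hx)).
  rewrite -aS // -aT // -aST // [RHS](_ : _ = << S y - T y, x >>^*) //.
  by rewrite ph_formB ?conjD ?conjN //; first [exact: nT | exact: nS].
apply: le_anti; apply/andP; split.
  rewrite -{1}[adj S - adj T](subrK (adj (S - T))).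
  apply: (le_trans (opnD _ _)); rewrite ?e ?add0r //; last exact: adj_dom.
  by apply: opdomB; [exact: opdomB|exact: adj_dom].
rewrite -{1}[adj (S - T)](subrK (adj S - adj T)).
apply: (le_trans (opnD _ _)); [by apply: opdomB; [exact: adj_dom|exact: opdomB]|exact: opdomB|].
by rewrite (opnB (adj_dom hST) (opdomB hS' hT')) e add0r.
Qed.

Lemma cauchy_op_star u : cauchy_op u -> cauchy_op (starW u).
Proof.
move=> [hu cu]; split=> [n|e e0]; first exact: adj_dom.
have [N hN] := cu e e0; exists N => m n Nm Nn.
by rewrite /starW adjB_opn // hN.
Qed.

Lemma oplimD u v : cauchy_op u -> cauchy_op v -> oplim (u + v) <= oplim u + oplim v.
Proof.
move=> cu cv; apply: rlim_le (oplimP (cauchy_opD cu cv)) (rlimD (oplimP cu) (oplimP cv)) _.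
by exists 0%N => n _; case: cu => hu _; case: cv => hv _; exact: opnD.
Qed.

Lemma oplimZ (c : C) u : cauchy_op u -> oplim (c *: u) = nn c * oplim u.
Proof.
move=> cu; apply: rlim_uniq (oplimP (cauchy_opZ c cu)) _.
have := rlimM (rlim_const (nn c)) (oplimP cu); case: cu => hu _.
by move=> h e /h [N hN]; exists N => n /hN; rewrite -opnZ.
Qed.

Lemma oplim_zero u : (forall n, opn (u n) = 0) -> cauchy_op u -> oplim u = 0.
Proof.
move=> h cu; apply: rlim_uniq (oplimP cu) _ => e e0.
by exists 0%N => n _; rewrite h subrr normr0.
Qed.

Lemma cauchy_op0 : cauchy_op 0.
Proof. exact: (cauchy_op_const opdom0). Qed.

Lemma cauchy_opB u v : cauchy_op u -> cauchy_op v -> cauchy_op (u - v).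
Proof.
by move=> cu cv; rewrite -[- v]scaleN1r; apply: cauchy_opD => //; exact: cauchy_opZ.
Qed.

(** A diagonal argument: from the index $N_j$ on, the sequence $u_j$ varies by less than $1/(j+1)$,
    and the limit is $j\mapsto u_j(N_j)$. *)
Lemma oplim_complete (u : nat -> W) : (forall n, cauchy_op (u n)) ->
  (forall e : R, 0 < e -> exists N, forall m n, (N <= m)%N -> (N <= n)%N ->
     oplim (u m - u n) < e) ->
  exists2 l, cauchy_op l & forall e : R, 0 < e -> exists N, forall n,
      (N <= n)%N -> oplim (l - u n) < e.
Proof.
move=> cu pu.
have hd j : exists N, forall m n, (N <= m)%N -> (N <= n)%N ->
    opn (u j m - u j n) < j.+1%:R^-1.
  by case: (cu j) => _ h; apply: h; rewrite invr_gt0.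
have [N hN] := choice hd.
have small (e : R) : 0 < e -> exists N, forall n, (N <= n)%N -> n.+1%:R^-1 < e.
  move=> e0; exists (Num.bound e^-1) => n hn'.
  rewrite -[ltRHS]invrK ltf_pV2 ?posrE ?invr_gt0 //.
  apply: (lt_le_trans (archi_boundP _)); rewrite ?invr_ge0 ?(ltW e0) //.
  by rewrite ler_nat leqW.
have op j n : opdom (u j n) by case: (cu j).
have near i j (e : R) : oplim (u i - u j) < e ->
    exists K, forall n, (K <= n)%N -> opn (u i n - u j n) < e.
  move=> h; have h0 : 0 < e - oplim (u i - u j) by rewrite subr_gt0.
  have [K hK] := oplimP (cauchy_opB (cu i) (cu j)) h0.
  exists K => n /hK; rewrite ltr_norml => /andP[h1 _].
  have -> : u i n - u j n = (u i - u j) n by [].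
  move: h1; lra.
pose l : W := fun j => u j (N j).
have cl : cauchy_op l.
  split=> [n|e e0]; first exact: op.
  have e3 : 0 < e / 3 by rewrite divr_gt0.
  have [K1 h1] := small _ e3; have [K2 h2] := pu _ e3.
  exists (maxn K1 K2) => i j; rewrite !geq_max => /andP[i1 i2] /andP[j1 j2].
  have [K hK] := near i j _ (h2 i j i2 j2).
  pose n := maxn K (maxn (N i) (N j)).
  have Kn : (K <= n)%N by rewrite leq_maxl.
  have Ni : (N i <= n)%N by rewrite !leq_max leqnn orbT.
  have Nj : (N j <= n)%N by rewrite !leq_max leqnn !orbT.
  have b1 := lt_trans (hN i _ _ (leqnn _) Ni) (h1 i i1).
  have b3 := lt_trans (hN j _ _ Nj (leqnn _)) (h1 j j1).
  have b2 := hK n Kn.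
  apply: (le_lt_trans (opn_tri (op _ _) (op i n) (op _ _))).
  apply: (le_lt_trans (lerD (lexx _) (opn_tri (op _ _) (op j n) (op _ _)))).
  by rewrite /l; move: b1 b2 b3; lra.
exists l => // e e0; have e4 : 0 < e / 4 by rewrite divr_gt0.
have [K1 h1] := small _ e4; have [K2 h2] := pu _ e4.
exists (maxn K1 K2) => j; rewrite geq_max => /andP[j1 j2].
suff : oplim (l - u j) <= 3 * (e / 4) by move: e4; lra.
apply: rlim_le (oplimP (cauchy_opB cl (cu j))) (rlim_const _) _.
exists (maxn (maxn K1 K2) (N j)) => i; rewrite !geq_max => /andP[/andP[i1 i2] i3].
have [K hK] := near i j _ (h2 i j i2 j2).
pose n := maxn K (maxn (N i) (N j)).
have Kn : (K <= n)%N by rewrite leq_maxl.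
have Ni : (N i <= n)%N by rewrite !leq_max leqnn orbT.
have Nj : (N j <= n)%N by rewrite !leq_max leqnn !orbT.
have b1 := lt_trans (hN i _ _ (leqnn _) Ni) (h1 i i1).
have b3 := lt_trans (hN j _ _ Nj i3) (h1 j j1).
have b2 := hK n Kn.
have -> : (l - u j) i = u i (N i) - u j i by [].
apply: (le_trans (opn_tri (op _ _) (op i n) (op _ _))).
apply: (le_trans (lerD (lexx _) (opn_tri (op _ _) (op j n) (op _ _)))).
by move: b1 b2 b3; lra.
Qed.

Definition op_space : snspace R := @SNSpace R (nat -> ph_car V -> ph_car V)
  cauchy_op oplim cauchy_op0 cauchy_opD cauchy_opZ oplimD oplimZ oplim_complete.

End PreHilbert.

(** * The $C^*$-algebra of bounded operators *)

Section BoundedOps.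
Variables (R : realType) (V : prehilbert R).
Local Notation C := (Cx R).
Local Notation D := (@ph_dom R V).
Local Notation "<< x , y >>" := (@ph_form R V x y).
Local Notation W := (nat -> ph_car V -> ph_car V).
Local Notation S := (op_space V).
Local Notation Q := (quo_space S).
Implicit Types (u v w : W) (T : ph_car V -> ph_car V).

Lemma pi_eq u v : cauchy_op u -> cauchy_op v ->
  (forall n, opn (u n - v n) = 0) -> qpi (u : S) = qpi (v : S).
Proof.
by move=> cu cv h; apply: qpi_eq => //; apply: oplim_zero => //; exact: cauchy_opB.
Qed.

(** Equality of matrix coefficients is enough; this takes the place of linearity and of uniqueness
    of adjoints in the algebra axioms below. *)
Lemma pi_form u v : cauchy_op u -> cauchy_op v ->
  (forall n x y, D x -> D y -> << u n x, y >> = << v n x, y >>) ->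
  qpi (u : S) = qpi (v : S).
Proof.
move=> cu cv h; apply: pi_eq => // n; apply: opn_eq0.
- by case: cu.
- by case: cv.
- exact: h.
Qed.

Lemma opW u n : cauchy_op u -> opdom (u n). Proof. by case. Qed.

Lemma oplim_comp u v u' v' : cauchy_op u -> cauchy_op v -> cauchy_op u' ->
  cauchy_op v' -> oplim (mulW u v - mulW u' v') <=
    oplim (u - u') * oplim v + oplim u' * oplim (v - v').
Proof.
move=> cu cv cu' cv'.
apply: rlim_le (oplimP (cauchy_opB (cauchy_opM cu cv) (cauchy_opM cu' cv'))) _ _.
  exact: rlimD (rlimM (oplimP (cauchy_opB cu cu')) (oplimP cv))
               (rlimM (oplimP cu') (oplimP (cauchy_opB cv cv'))).
by exists 0%N => n _; apply: comp_bound; exact: opW.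
Qed.

Definition bmul (a b : Q) : Q := qpi (mulW (qrep a) (qrep b) : S).
Definition bstar (a : Q) : Q := qpi (starW (qrep a) : S).

Lemma bmulE u v : cauchy_op u -> cauchy_op v ->
  bmul (qpi (u : S)) (qpi (v : S)) = qpi (mulW u v : S).
Proof.
move=> cu cv; apply: qpi_eq; try exact: cauchy_opM.
  by apply: cauchy_opM; exact: (@qrep_dom R S _).
have [h1 h2 e1] := sn_eq_sym (@qrep_pi R S u cu).
have [h3 h4 e2] := sn_eq_sym (@qrep_pi R S v cv).
apply: le_anti; rewrite (@sn_p_ge0 R S) ?andbT; last first.
  exact: (cauchy_opB (cauchy_opM h1 h3) (cauchy_opM h2 h4)).
apply: (le_trans (oplim_comp h1 h3 h2 h4)).
by rewrite /= in e1 e2; rewrite e1 e2 mul0r mulr0 addr0.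
Qed.

Lemma bstarE u : cauchy_op u -> bstar (qpi (u : S)) = qpi (starW u : S).
Proof.
move=> cu; have [h1 h2 e1] := sn_eq_sym (@qrep_pi R S u cu).
apply: qpi_eq; try exact: cauchy_op_star.
rewrite /= in e1 *; rewrite -[RHS]e1.
apply: rlim_uniq (oplimP (cauchy_opB (cauchy_op_star h1) (cauchy_op_star h2))) _.
move=> e /(oplimP (cauchy_opB h1 h2)) [N hN]; exists N => n /hN.
by rewrite [X in _ - X](_ : _ = opn ((starW (qrep (qpi (u : S))) - starW u) n)) //=;
  rewrite [RHS](adjB_opn (opW n h1) (opW n h2)).
Qed.

Lemma Q_ind (P : Q -> Prop) : (forall u, cauchy_op u -> P (qpi (u : S))) ->
  forall a, P a.
Proof. exact: (@quo_ind R S P). Qed.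

Lemma QD u v : cauchy_op u -> cauchy_op v ->
  (qpi (u : S) : Q) + qpi (v : S) = qpi (u + v : S).
Proof. by move=> cu cv; rewrite -qpiD. Qed.

Lemma QZ (z : C) u : cauchy_op u -> z *: (qpi (u : S) : Q) = qpi (z *: u : S).
Proof. by move=> cu; rewrite -qpiZ. Qed.

Lemma bmulA a b c : bmul a (bmul b c) = bmul (bmul a b) c.
Proof.
move: a b c; apply: Q_ind => u cu; apply: Q_ind => v cv; apply: Q_ind => w cw.
by rewrite !bmulE //; exact: cauchy_opM.
Qed.

Lemma bmulDl a b c : bmul (a + b) c = bmul a c + bmul b c.
Proof.
move: a b c; apply: Q_ind => u cu; apply: Q_ind => v cv; apply: Q_ind => w cw.
rewrite QD // !bmulE ?QD //; try exact: cauchy_opM; last exact: cauchy_opD.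
Qed.

Lemma bmulDr c a b : bmul c (a + b) = bmul c a + bmul c b.
Proof.
move: c a b; apply: Q_ind => w cw; apply: Q_ind => u cu; apply: Q_ind => v cv.
rewrite QD // !bmulE ?QD //; try exact: cauchy_opM; last exact: cauchy_opD.
apply: pi_form; [exact: cauchy_opM cw (cauchy_opD cu cv)|
  exact: cauchy_opD (cauchy_opM cw cu) (cauchy_opM cw cv)|].
move=> n x y hx hy; have [_ _ [w' [mw aw]]] := opW n cw.
have [mW _ _] := opW n cw; have [mU _ _] := opW n cu; have [mV _ _] := opW n cv.
rewrite [RHS](ph_formD (mW _ (mU _ hx)) (mW _ (mV _ hx)) hy).
rewrite [LHS]aw //; last by apply: ph_domD; [exact: mU|exact: mV].
rewrite [LHS](ph_formD (mU _ hx) (mV _ hx) (mw _ hy)).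
by rewrite -!aw //; [exact: mV|exact: mU].
Qed.

Lemma bmulZl (z : C) a b : bmul (z *: a) b = z *: bmul a b.
Proof.
move: a b; apply: Q_ind => u cu; apply: Q_ind => v cv.
rewrite QZ // !bmulE ?QZ //; first exact: cauchy_opM.
exact: cauchy_opZ.
Qed.

Lemma bmulZr (z : C) a b : bmul a (z *: b) = z *: bmul a b.
Proof.
move: a b; apply: Q_ind => u cu; apply: Q_ind => v cv.
rewrite QZ // !bmulE ?QZ //; try exact: cauchy_opM; last exact: cauchy_opZ.
apply: pi_form; [exact: cauchy_opM cu (cauchy_opZ _ cv)|
  exact: cauchy_opZ (cauchy_opM cu cv)|].
move=> n x y hx hy; have [mU _ [u' [mu au]]] := opW n cu; have [mV _ _] := opW n cv.
rewrite [RHS](ph_formZ _ (mU _ (mV _ hx)) hy).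
rewrite [LHS]au //; last by apply: ph_domZ; exact: mV.
rewrite [LHS](ph_formZ _ (mV _ hx) (mu _ hy)) -au //; exact: mV.
Qed.

Lemma adj_form u n x y : cauchy_op u -> D x -> D y ->
  << adj (u n) x, y >> = << u n y, x >>^*.
Proof.
move=> cu hx hy; have [m a] := adjP (opW n cu).
by rewrite (ph_herm hy (m _ hx)) a.
Qed.

Lemma bstarD a b : bstar (a + b) = bstar a + bstar b.
Proof.
move: a b; apply: Q_ind => u cu; apply: Q_ind => v cv.
rewrite QD // !bstarE ?QD //; try exact: cauchy_op_star; last exact: cauchy_opD.
apply: pi_form; [exact: cauchy_op_star (cauchy_opD cu cv)|
  exact: cauchy_opD (cauchy_op_star cu) (cauchy_op_star cv)|].
move=> n x y hx hy; have [mU _ _] := opW n cu; have [mV _ _] := opW n cv.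
have [mU' _] := adjP (opW n cu); have [mV' _] := adjP (opW n cv).
rewrite [LHS](adj_form _ (cauchy_opD cu cv)) //.
rewrite [RHS](ph_formD (mU' _ hx) (mV' _ hx) hy) !adj_form // -conjD.
by congr (_^*); rewrite [LHS](ph_formD (mU _ hy) (mV _ hy) hx).
Qed.

Lemma bstarZ (z : C) a : bstar (z *: a) = z^* *: bstar a.
Proof.
move: a; apply: Q_ind => u cu.
rewrite QZ // !bstarE ?QZ //; try exact: cauchy_op_star; last exact: cauchy_opZ.
apply: pi_form; [exact: cauchy_op_star (cauchy_opZ _ cu)|
  exact: cauchy_opZ (cauchy_op_star cu)|].
move=> n x y hx hy; have [mU _ _] := opW n cu; have [mU' _] := adjP (opW n cu).
rewrite [LHS](adj_form _ (cauchy_opZ z cu)) //.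
rewrite [RHS](ph_formZ _ (mU' _ hx) hy) !adj_form // -conjM.
by congr (_^*); rewrite [LHS](ph_formZ _ (mU _ hy) hx).
Qed.

Lemma bstarM a b : bstar (bmul a b) = bmul (bstar b) (bstar a).
Proof.
move: a b; apply: Q_ind => u cu; apply: Q_ind => v cv.
rewrite bmulE // !bstarE ?bmulE //; try exact: cauchy_op_star; last exact: cauchy_opM.
apply: pi_form; [exact: cauchy_op_star (cauchy_opM cu cv)|
  exact: cauchy_opM (cauchy_op_star cv) (cauchy_op_star cu)|].
move=> n x y hx hy; have [mU _ _] := opW n cu; have [mV _ _] := opW n cv.
have [mU' aU] := adjP (opW n cu); have [mV' _] := adjP (opW n cv).
rewrite [LHS](adj_form _ (cauchy_opM cu cv)) //.
rewrite [RHS](adj_form n cv (mU' _ hx) hy); congr (_^*).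
by rewrite [LHS]aU //; exact: mV.
Qed.

Lemma bstarK a : bstar (bstar a) = a.
Proof.
move: a; apply: Q_ind => u cu; rewrite !bstarE //; last exact: cauchy_op_star.
apply: pi_form => //; first exact: cauchy_op_star (cauchy_op_star cu).
move=> n x y hx hy.
rewrite [LHS](adj_form n (cauchy_op_star cu)) //.
by rewrite [X in X^*](adj_form n cu) // conjCK.
Qed.

Lemma bnormM (a b : Q) : `|bmul a b| <= `|a| * `|b|.
Proof.
move: a b; apply: Q_ind => u cu; apply: Q_ind => v cv.
rewrite bmulE // !nnE -rCM rC_le !nn_qpi //; last exact: cauchy_opM.
apply: rlim_le (oplimP (cauchy_opM cu cv)) (rlimM (oplimP cu) (oplimP cv)) _.
by exists 0%N => n _; apply: opn_comp; exact: opW.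
Qed.

Lemma bnorm_star (a : Q) : `|bmul (bstar a) a| = `|a| ^+ 2.
Proof.
move: a; apply: Q_ind => u cu; have cs := cauchy_op_star cu; have cm := cauchy_opM cs cu.
rewrite bstarE // bmulE // !nnE -rCX !nn_qpi //; congr rC.
apply: rlim_uniq (oplimP cm) _; have := rlimM (oplimP cu) (oplimP cu).
by move=> h e /h [N hN]; exists N => n /hN; rewrite /mulW /starW opn_star ?expr2 //; exact: opW.
Qed.

Definition bounded_ops : cstar_algebra R := @CstarAlgebra R Q bmul bstar
  bmulA bmulDl bmulDr bmulZl bmulZr bstarD bstarZ bstarM bstarK bnormM bnorm_star.

Definition bop T : bounded_ops := qpi ((fun=> T) : S).

Lemma bop_mul T T' : opdom T -> opdom T' -> bop (T \o T') = cmul (bop T) (bop T').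
Proof.
by move=> h h'; rewrite /bop [RHS](bmulE (cauchy_op_const h) (cauchy_op_const h')).
Qed.

Lemma bopD T T' : opdom T -> opdom T' -> bop (T + T') = bop T + bop T'.
Proof.
by move=> h h'; rewrite /bop [RHS](QD (cauchy_op_const h) (cauchy_op_const h')).
Qed.

Lemma bopZ (z : C) T : opdom T -> bop (z *: T) = z *: bop T.
Proof. by move=> h; rewrite /bop [RHS](QZ z (cauchy_op_const h)). Qed.

Lemma bop_form T T' : opdom T -> opdom T' ->
  (forall x y, D x -> D y -> << T x, y >> = << T' x, y >>) -> bop T = bop T'.
Proof.
move=> h h' e; apply: pi_form => [||n]; [exact: cauchy_op_const| |exact: e].
exact: cauchy_op_const.
Qed.

Lemma bop_star T T' : opdom T -> opdom T' -> isadj T T' -> cstar (bop T) = bop T'.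
Proof.
move=> h h' [m a]; rewrite /bop [LHS](bstarE (cauchy_op_const h)).
have cs := cauchy_op_star (cauchy_op_const h).
apply: pi_form => //; first exact: cauchy_op_const.
move=> n x y hx hy; rewrite [LHS](adj_form n (cauchy_op_const h)) //.
by rewrite a // -(ph_herm hy (m _ hx)).
Qed.

Lemma nn_bop T : opdom T -> nn (bop T) = opn T.
Proof.
move=> h; rewrite /bop nn_qpi; last exact: cauchy_op_const.
apply: rlim_uniq (oplimP (cauchy_op_const h)) _; exact: rlim_const.
Qed.

Lemma bop0 : bop 0 = 0.
Proof. by apply: nn0_eq; rewrite nn_bop ?opn0 //; exact: opdom0. Qed.

End BoundedOps.

(** * Matrix units and the norms of their combinations *)

Section MatrixUnits.
Variables (R : realType) (I T : eqType) (s : seq I) (src : I -> T).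
Hypothesis us : uniq s.
Local Notation C := (Cx R).
Local Notation "a ** b" := (cmul a b) (at level 40, left associativity).
Implicit Type A : cstar_algebra R.

(** A direct sum of matrix blocks, one for each value of [src]; [E i j] is constrained only for
    indices in one block. *)
Record matrix_units A (E : I -> I -> A) : Prop := {
  mu_mul : forall i j k l, i \in s -> j \in s -> k \in s -> l \in s ->
    src i = src j -> src k = src l ->
    E i j ** E k l = if j == k then E i l else 0;
  mu_star : forall i j, i \in s -> j \in s -> src i = src j ->
    cstar (E i j) = E j i;
  mu_neq0 : forall i, i \in s -> E i i != 0
}.

Definition mcomb A (E : I -> I -> A) (c : I -> I -> C) : A :=
  \sum_(i <- s) \sum_(j <- s | src j == src i) c i j *: E i j.

Definition mmul (c d : I -> I -> C) : I -> I -> C :=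
  fun i j => \sum_(k <- s | src k == src i) c i k * d k j.

Definition mstar (c : I -> I -> C) : I -> I -> C := fun i j => (c j i)^*.

Lemma mcomb_star A (E : I -> I -> A) c : matrix_units E ->
  mcomb E (mstar c) = cstar (mcomb E c).
Proof.
move=> hE; rewrite /mcomb cstar_sum.
under [RHS]eq_bigr => i _ do rewrite cstar_sum.
rewrite [RHS](exchange_big_dep predT) //=; apply: eq_big_seq => i si.
under eq_bigl => j do rewrite eq_sym.
rewrite big_seq_cond [RHS]big_seq_cond; apply: eq_bigr => j /andP[sj /eqP e].
by rewrite cstarZ (mu_star hE).
Qed.

Lemma mcomb_mul A (E : I -> I -> A) c d : matrix_units E ->
  mcomb E (mmul c d) = mcomb E c ** mcomb E d.
Proof.
move=> hE; rewrite /mcomb cmul_suml; apply: eq_big_seq => i si.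
rewrite cmul_suml.
transitivity (\sum_(j <- s | src j == src i) \sum_(l <- s | src l == src i)
    (c i l * d l j) *: E i j).
  by apply: eq_bigr => j _; rewrite scaler_suml.
rewrite exchange_big /=; rewrite big_seq_cond [RHS]big_seq_cond.
apply: eq_bigr => l /andP[sl /eqP el]; rewrite cmul_sumr (bigD1_seq l) //=.
rewrite [X in _ = _ + X]big1_seq ?addr0; last first.
  move=> m /andP[ml sm]; rewrite cmul_sumr big1_seq // => j /andP[/eqP ej sj].
  by rewrite cmulZl cmulZr (mu_mul hE) // eq_sym (negPf ml) !scaler0.
rewrite cmul_sumr el big_seq_cond [RHS]big_seq_cond; apply: eq_bigr => j /andP[sj /eqP ej].
by rewrite cmulZl cmulZr (mu_mul hE) ?eqxx ?scalerA // el ej.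
Qed.

(** Multiplying by matrix units on both sides isolates one coefficient, so that the norm of a
    combination controls all of them. *)
Lemma mcomb_coef A (E : I -> I -> A) c i j : matrix_units E -> i \in s -> j \in s ->
  src i = src j -> E i i ** mcomb E c ** E j i = c i j *: E i i.
Proof.
move=> hE si sj e; rewrite /mcomb cmul_sumr (bigD1_seq i) //=.
rewrite [X in _ + X]big1_seq ?addr0; last first.
  move=> m /andP[mi sm]; rewrite cmul_sumr big1_seq // => l /andP[/eqP el sl].
  by rewrite cmulZr (mu_mul hE) // eq_sym (negPf mi) scaler0.
rewrite cmul_sumr cmul_suml big_mkcond (bigD1_seq j) //= e eqxx.
rewrite big1_seq ?addr0; last first.
  move=> l /andP[lj sl]; case: eqP => // el.
  rewrite cmulZr (mu_mul hE) // ?eqxx; last by rewrite e el.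
  by rewrite cmulZl (mu_mul hE) // ?(negPf lj) ?scaler0 // e el.
by rewrite cmulZr (mu_mul hE) // eqxx cmulZl (mu_mul hE) // eqxx.
Qed.

Lemma mcomb_coef_le A (E : I -> I -> A) c i j : matrix_units E -> i \in s ->
  j \in s -> src i = src j -> nn (c i j) <= nn (E j i) * nn (mcomb E c).
Proof.
move=> hE si sj e.
have p : 0 < nn (E i i).
  rewrite lt_def nn_ge0 andbT; apply: contra (mu_neq0 hE si) => /eqP h.
  by apply/eqP; exact: nn0_eq.
rewrite -(ler_pM2r p) -nnZ -(mcomb_coef c hE si sj e).
apply: (le_trans (nn_mul _ _)).
rewrite -mulrA [leRHS]mulrC; apply: ler_wpM2r; first exact: nn_ge0.
by rewrite mulrC; exact: nn_mul.
Qed.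

(** The coefficients are bounded by the norm in [B], which bounds the norm in [A] up to a constant.
    As products and adjoints are given by the same formulas in both algebras, [bounded_contr]
    removes the constant. *)
Lemma mcomb_le A (B : cstar_algebra R) (E : I -> I -> A) (E' : I -> I -> B) c : matrix_units E ->
  matrix_units E' -> nn (mcomb E c) <= nn (mcomb E' c).
Proof.
move=> hE hE'; apply: (@bounded_contr R A B _ mmul mstar (mcomb E) (mcomb E') _ _ _ _
  (\sum_(i <- s) \sum_(j <- s | src j == src i) nn (E i j) * nn (E' j i))).
- by move=> a b; exact: (mcomb_mul _ _ hE).
- by move=> a; exact: (mcomb_star _ hE).
- by move=> a b; exact: (mcomb_mul _ _ hE').
- by move=> a; exact: (mcomb_star _ hE').
move=> {}c; rewrite mulr_suml; apply: (le_trans (nn_sum _ _ _)).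
rewrite big_seq [leRHS]big_seq; apply: ler_sum => i si.
rewrite mulr_suml; apply: (le_trans (nn_sum _ _ _)).
rewrite big_seq_cond [leRHS]big_seq_cond; apply: ler_sum => j /andP[sj /eqP e].
rewrite nnZ mulrC -mulrA; apply: ler_wpM2l; first exact: nn_ge0.
exact: mcomb_coef_le.
Qed.

Lemma mcomb_norm A (B : cstar_algebra R) (E : I -> I -> A) (E' : I -> I -> B) c : matrix_units E ->
  matrix_units E' -> nn (mcomb E c) = nn (mcomb E' c).
Proof. by move=> h h'; apply: le_anti; rewrite !mcomb_le. Qed.

End MatrixUnits.

(** * Isometric correspondences and their closures *)

Lemma small_inv (R : realType) (e : R) : 0 < e ->
  exists N, forall n, (N <= n)%N -> n.+1%:R^-1 < e.
Proof.
move=> e0; exists (Num.bound e^-1) => n hn.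
rewrite -[ltRHS]invrK ltf_pV2 ?posrE ?invr_gt0 //.
apply: (lt_le_trans (archi_boundP _)); rewrite ?invr_ge0 ?(ltW e0) //.
by rewrite ler_nat leqW.
Qed.

Lemma closure_seq (R : realType) (V : normedModType (Cx R)) (D : set V) a :
  closure D a -> exists u : nat -> V, (forall n, D (u n)) /\ lim_nn u a.
Proof.
move=> /closure_nn hc.
have hc' n : exists b, D b /\ nn (a - b) < n.+1%:R^-1.
  by have [|b] := hc n.+1%:R^-1; [rewrite invr_gt0 | exists b].
have [u hu] := choice hc'; exists u; split=> [n|e /small_inv [N hN]].
  by case: (hu n).
by exists N => n /hN; case: (hu n) => _ /lt_trans; apply.
Qed.

Lemma lim_closure (R : realType) (V : normedModType (Cx R)) (D : set V) u a :
  (forall n, D (u n)) -> lim_nn u a -> closure D a.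
Proof.
move=> hu h; apply/closure_nn => e /h [N hN].
by exists (u N); [exact: hu | exact: hN].
Qed.

Section IsometricRelation.
Variables (R : realType) (A B : cstar_algebra R) (r : A -> B -> Prop).
Local Notation C := (Cx R).

(** A partial isometric $*$-isomorphism given by its graph: no map has to be defined on combinations
    of generators, and single-valuedness follows from [ir_nn]. *)
Record iso_rel : Prop := {
  ir_D : forall a b a' b', r a b -> r a' b' -> r (a + a') (b + b');
  ir_Z : forall (z : C) a b, r a b -> r (z *: a) (z *: b);
  ir_M : forall a b a' b', r a b -> r a' b' -> r (cmul a a') (cmul b b');
  ir_S : forall a b, r a b -> r (cstar a) (cstar b);
  ir_nn : forall a b, r a b -> nn a = nn b
}.

Definition rel_clo (a : A) (b : B) : Prop := exists (u : nat -> A) (v : nat -> B),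
  [/\ forall n, r (u n) (v n), lim_nn u a & lim_nn v b].

Hypothesis hr : iso_rel.

Lemma ir_B a b a' b' : r a b -> r a' b' -> r (a - a') (b - b').
Proof. by move=> h h'; rewrite -(scaleN1r a') -(scaleN1r b'); apply: ir_D => //; exact: ir_Z. Qed.

Lemma rel_clo_in a b : r a b -> rel_clo a b.
Proof. by move=> h; exists (fun=> a), (fun=> b); split=> //; exact: lim_const. Qed.

Lemma rel_clo_iso : 
  [/\ forall a b a' b', rel_clo a b -> rel_clo a' b' -> rel_clo (a + a') (b + b'),
      forall (z : C) a b, rel_clo a b -> rel_clo (z *: a) (z *: b),
      forall a b a' b', rel_clo a b -> rel_clo a' b' ->
        rel_clo (cmul a a') (cmul b b'),
      forall a b, rel_clo a b -> rel_clo (cstar a) (cstar b) &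
      forall a b, rel_clo a b -> nn a = nn b].
Proof.
split.
- move=> a b a' b' [u [v [h h1 h2]]] [u' [v' [h' h3 h4]]].
  exists (fun n => u n + u' n), (fun n => v n + v' n).
  by split; [move=> n; exact: ir_D|exact: lim_add|exact: lim_add].
- move=> z a b [u [v [h h1 h2]]]; exists (fun n => z *: u n), (fun n => z *: v n).
  by split; [move=> n; exact: ir_Z|exact: lim_scale|exact: lim_scale].
- move=> a b a' b' [u [v [h h1 h2]]] [u' [v' [h' h3 h4]]].
  exists (fun n => cmul (u n) (u' n)), (fun n => cmul (v n) (v' n)).
  by split; [move=> n; exact: ir_M|exact: lim_mul|exact: lim_mul].
- move=> a b [u [v [h h1 h2]]]; exists (fun n => cstar (u n)), (fun n => cstar (v n)).
  by split; [move=> n; exact: ir_S|exact: lim_star|exact: lim_star].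
move=> a b [u [v [h h1 h2]]]; apply: le_anti; apply/andP; split.
  apply/ler_addgt0Pr => e e0; have e2 : 0 < e / 2 by rewrite divr_gt0.
  have [N hN] := h1 _ e2; have [M hM] := h2 _ e2.
  have := hN _ (leq_maxl N M); have := hM _ (leq_maxr N M).
  have := nn_le_tri a (u (maxn N M)); have := nn_le_tri (v (maxn N M)) b.
  by rewrite -(ir_nn hr (h _)) (nnB (v _) b); lra.
apply/ler_addgt0Pr => e e0; have e2 : 0 < e / 2 by rewrite divr_gt0.
have [N hN] := h1 _ e2; have [M hM] := h2 _ e2.
have := hN _ (leq_maxl N M); have := hM _ (leq_maxr N M).
have := nn_le_tri (u (maxn N M)) a; have := nn_le_tri b (v (maxn N M)).
by rewrite -(ir_nn hr (h _)) (nnB (u _) a); lra.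
Qed.

(** By isometry the partners of a convergent sequence form a Cauchy sequence. *)
Lemma rel_clo_dom a : closure [set a | exists b, r a b] a -> exists b, rel_clo a b.
Proof.
move=> /closure_seq [u [hu hl]]; have [v hv] := choice hu.
have [|b hb] := @complete_nn R B v; last by exists b, u, v.
move=> e e0; have e2 : 0 < e / 2 by rewrite divr_gt0.
have [N hN] := hl _ e2; exists N => m n hm hn.
rewrite -(ir_nn hr (ir_B (hv m) (hv n))).
apply: (le_lt_trans (nn_tri a _ _)); rewrite [ltRHS](splitr e) nnB.
by rewrite ltrD // hN.
Qed.

Lemma rel_clo_closure a b : rel_clo a b ->
  closure [set a | exists b, r a b] a /\ closure [set b | exists a, r a b] b.
Proof.
move=> [u [v [h h1 h2]]]; split; [apply: lim_closure h1|apply: lim_closure h2].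
  by move=> n; exists (v n).
by move=> n; exists (u n).
Qed.

Lemma rel_clo_clo a b : (exists (u : nat -> A) (v : nat -> B),
  [/\ forall n, rel_clo (u n) (v n), lim_nn u a & lim_nn v b]) -> rel_clo a b.
Proof.
move=> [u [v [h h1 h2]]].
have hc n : exists p : A * B, [/\ r p.1 p.2, nn (u n - p.1) < n.+1%:R^-1 &
    nn (v n - p.2) < n.+1%:R^-1].
  have n0 : 0 < n.+1%:R^-1 :> R by rewrite invr_gt0.
  have [u' [v' [h' l1 l2]]] := h n.
  have [N hN] := l1 _ n0; have [M hM] := l2 _ n0.
  exists (u' (maxn N M), v' (maxn N M)); split=> //=.
    by apply: hN; exact: leq_maxl.
  by apply: hM; exact: leq_maxr.
have [p hp] := choice hc; exists (fun n => (p n).1), (fun n => (p n).2).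
split=> [n|e e0|e e0]; first by case: (hp n).
  have e2 : 0 < e / 2 by rewrite divr_gt0.
  have [N hN] := h1 _ e2; have [M hM] := small_inv e2.
  exists (maxn N M) => n; rewrite geq_max => /andP[/hN l1 /hM l2].
  have [_ l3 _] := hp n; rewrite (le_lt_trans (nn_tri (u n) _ _)) //.
  by rewrite [ltRHS](splitr e) ltrD // (lt_trans l3).
have e2 : 0 < e / 2 by rewrite divr_gt0.
have [N hN] := h2 _ e2; have [M hM] := small_inv e2.
exists (maxn N M) => n; rewrite geq_max => /andP[/hN l1 /hM l2].
have [_ _ l3] := hp n; rewrite (le_lt_trans (nn_tri (v n) _ _)) //.
by rewrite [ltRHS](splitr e) ltrD // (lt_trans l3).
Qed.

End IsometricRelation.

Lemma iso_rel_clo (R : realType) (A B : cstar_algebra R) (r : A -> B -> Prop) :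
  iso_rel r -> iso_rel (rel_clo r).
Proof. by move=> /rel_clo_iso [? ? ? ? ?]; split. Qed.

Lemma iso_rel_sym (R : realType) (A B : cstar_algebra R) (r : A -> B -> Prop) :
  iso_rel r -> iso_rel (fun b a => r a b).
Proof. by case=> D Z M S N; split=> *; [exact: D|exact: Z|exact: M|exact: S|exact/esym/N]. Qed.

Lemma rel_clo_ran (R : realType) (A B : cstar_algebra R) (r : A -> B -> Prop) b :
  iso_rel r -> closure [set b | exists a, r a b] b -> exists a, rel_clo r a b.
Proof.
move=> /iso_rel_sym h /(rel_clo_dom h) [a [u [v [h1 h2 h3]]]].
by exists a, v, u; split.
Qed.

Lemma iso_rel_uniq (R : realType) (A B : cstar_algebra R) (r : A -> B -> Prop) :
  iso_rel r -> forall a b b', r a b -> r a b' -> b = b'.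
Proof.
move=> hr a b b' h h'; apply/eqP; rewrite -subr_eq0; apply/eqP/nn0_eq.
by rewrite -(ir_nn hr (ir_B hr h h')) subrr nn0.
Qed.

(** * Paths through a given vertex and prefixed paths *)

Section StartingPaths.
Variables (k : nat) (L : kgraph k) (L_regular : regular_kgraph L).

(** Surjectivity of $r$ and $s$ on morphisms of degree $(1,\dots,1)$ extends a vertex step by step
    in both directions. *)
Lemma dpath_through (v : kobj L) : exists x : dpath L, dvert x 0 = v.
Proof.
have fw (u : kobj L) : exists l : kmor L, kdeg l = cstn k 1 /\ kr l = u.
  by have [] := L_regular (cstn k 1) u.
have [f fP] := choice fw; pose b := back L_regular.
pose l j := iter j (fun l => cmp (b (kr l)) (cmp l (f (ks l)))) (kid v).
have fr u : kr (f u) = u by case: (fP u).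
have fd u : kdeg (f u) = cstn k 1 by case: (fP u).
have h1 (m : kmor L) : ks m = kr (f (ks m)) by rewrite fr.
have h2 (m : kmor L) : ks (b (kr m)) = kr (cmp m (f (ks m))).
  by rewrite cmp_r /b back_s.
have ld j : kdeg (l j) = cstn k (j + j).
  elim: j => [|j IH]; first by rewrite /= kdeg_id; zz.
  rewrite /= cmp_deg ?h2 // cmp_deg // -/(l j) IH fd /b back_deg; zz.
have [j|n p|x xP] := @dpath_seq k L l (fun j => - cz k j).
- exists (b (kr (l j))), (f (ks (l j))); split=> //.
  + by rewrite back_s.
  + by rewrite /b back_deg; zz.
- have [i hi] := zle_bound (- n); have [j hj] := zle_bound (n + zvec p).
  exists (maxn i j); rewrite ld; split; zz.
exists x; have := xP 0%N; rewrite /= kdeg_id => e.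
have : dvert x (- cz k 0) = v by rewrite -(sg_r _ _ 0) e kr_id.
by have -> : - cz k 0 = 0 by zz.
Qed.

Lemma opath_from (v : kobj L) : exists w : opath L, overt w 0 = v.
Proof.
by have [x h] := dpath_through v; exists (restr x); rewrite overt_restr.
Qed.

Lemma opre_ex (mu : kmor L) w : exists u, ks mu = overt w 0 ->
  oi u (kdeg mu) = mu /\ oshift (kdeg mu) u = w.
Proof.
have [h|h] := pselect (ks mu = overt w 0); last by exists w.
by have [u hu] := oglue_ex L_regular h; exists u.
Qed.

Definition opre (mu : kmor L) w : opath L := sval (cid (opre_ex mu w)).

Lemma opreP (mu : kmor L) w : ks mu = overt w 0 ->
  oi (opre mu w) (kdeg mu) = mu /\ oshift (kdeg mu) (opre mu w) = w.
Proof. by rewrite /opre; case: cid. Qed.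

Lemma opre_oshift (mu : kmor L) w : oi w (kdeg mu) = mu ->
  ks mu = overt (oshift (kdeg mu) w) 0 /\ opre mu (oshift (kdeg mu) w) = w.
Proof.
move=> h; have e : ks mu = overt (oshift (kdeg mu) w) 0.
  by rewrite overt_shift add0r -oi_s h.
by split=> //; have [a b] := opreP e; apply: (opath_glue_eq (p := kdeg mu)); rewrite ?a ?b.
Qed.

End StartingPaths.

(** * Finitely supported functions and partial bijections *)

Section Ell2.
Variables (R : realType) (X : choiceType).
Local Notation C := (Cx R).
Local Notation W := (X -> (Cx R)^o).
Implicit Types (f g h : W) (x y : X).

Definition fsupp f : seq X := fset_set [set x | f x != 0].
Definition fdom : set W := [set f | finite_set [set x | f x != 0]].
Definition fform f g : C := \sum_(x <- fsupp f) f x * (g x)^*.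

Lemma mem_fsupp f x : fdom f -> (x \in fsupp f) = (f x != 0).
Proof.
move=> h; rewrite in_fset_set //.
by apply/idP/idP => [/set_mem //|n]; exact: mem_set.
Qed.

Lemma fform_seq f g s : fdom f -> uniq s -> (forall x, f x != 0 -> x \in s) ->
  fform f g = \sum_(x <- s) f x * (g x)^*.
Proof.
move=> h us hs; rewrite [RHS](bigID (fun x => f x != 0)) /=.
rewrite [X in _ = _ + X]big1 ?addr0; last first.
  by move=> x /negPn/eqP ->; rewrite mul0r.
rewrite -[RHS]big_filter /fform; apply: perm_big; apply: uniq_perm.
- exact: fset_uniq.
- exact: filter_uniq.
move=> x; rewrite mem_fsupp // mem_filter; case: eqVneq => //= n.
by apply/esym/hs.
Qed.

Lemma fdomD f g : fdom f -> fdom g -> fdom (f + g).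
Proof.
move=> h h'; have hU : finite_set ([set x | f x != 0] `|` [set x | g x != 0]).
  by rewrite finite_setU.
apply: sub_finite_set hU => x /=.
have -> : (f + g) x = f x + g x by [].
by move=> /eqP n; apply: contrapT => /not_orP [/negP/negPn/eqP a /negP/negPn/eqP b];
  apply: n; rewrite a b addr0.
Qed.

Lemma fdomZ (z : C) f : fdom f -> fdom (z *: f).
Proof.
move=> h; apply: sub_finite_set h => x /=.
have -> : (z *: f) x = z * f x by [].
by apply: contra => /eqP ->; rewrite mulr0.
Qed.

Lemma fdom0 : fdom 0.
Proof.
apply: sub_finite_set (finite_set0 X) => x /=.
by have -> : (0 : W) x = 0 by []; rewrite eqxx.
Qed.

Definition ell2 : prehilbert R.
Proof.
refine (@PreHilbert R W fdom fform fdom0 fdomD fdomZ _ _ _ _).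
- move=> f g h hf hg hh; pose s := undup (fsupp f ++ fsupp g).
  have us : uniq s by exact: undup_uniq.
  have sP x : (f x != 0) || (g x != 0) -> x \in s.
    by rewrite mem_undup mem_cat !mem_fsupp.
  rewrite (@fform_seq (f + g) _ s) ?(@fform_seq f _ s) ?(@fform_seq g _ s) //.
  + by rewrite -big_split; apply: eq_bigr => x _; exact: mulrDl.
  + by move=> x n; apply: sP; rewrite n orbT.
  + by move=> x n; apply: sP; rewrite n.
  + exact: fdomD.
  move=> x n; apply: sP; apply: contraNT n.
  rewrite negb_or !negbK => /andP[/eqP a /eqP b].
  by have -> : (f + g) x = f x + g x by []; rewrite a b addr0.
- move=> z f h hf hh; rewrite (@fform_seq (z *: f) _ (fsupp f)).
  + by rewrite mulr_sumr; apply: eq_bigr => x _; rewrite mulrA.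
  + exact: fdomZ.
  + exact: fset_uniq.
  + move=> x; rewrite mem_fsupp // => /eqP n; apply/eqP => e; apply: n.
    by have -> : (z *: f) x = z * f x by []; rewrite e mulr0.
- move=> f g hf hg; pose s := undup (fsupp f ++ fsupp g).
  have us : uniq s by exact: undup_uniq.
  have sP x : (f x != 0) || (g x != 0) -> x \in s.
    by rewrite mem_undup mem_cat !mem_fsupp.
  rewrite !(@fform_seq _ _ s) //.
  + rewrite conj_sum; apply: eq_bigr => x _.
    by rewrite conjM conjCK mulrC.
  + by move=> x n; apply: sP; rewrite n.
  + by move=> x n; apply: sP; rewrite n orbT.
- by move=> f hf; apply: sumr_ge0 => x _; exact: mul_conjC_ge0.
Defined.

(* The operator of a partial bijection g, defined on Q. *)
Definition pull (Q : set X) (g : X -> X) (f : W) : W :=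
  fun x => if `[< Q x >] then f (g x) else 0.

Section Pull.
Variables (P Q : set X) (g h : X -> X).
Hypothesis gP : forall x, Q x -> P (g x) /\ h (g x) = x.
Hypothesis hP : forall y, P y -> Q (h y) /\ g (h y) = y.

Lemma pull_supp f x : fdom f -> pull Q g f x != 0 ->
  x \in [seq h y | y <- fsupp f & `[< P y >]].
Proof.
rewrite /pull; case: asboolP => [Qx|]; last by rewrite eqxx.
have [Pg e] := gP Qx => hf n; apply/mapP; exists (g x) => //.
by rewrite mem_filter asboolT // mem_fsupp.
Qed.

Lemma pull_maps f : fdom f -> fdom (pull Q g f).
Proof.
move=> hf; apply: (sub_finite_set (B := [set` [seq h y | y <- fsupp f & `[< P y >]]])).
  by move=> x /= n; exact: pull_supp.
exact: finite_seq.
Qed.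

Lemma pull_form f f' : fdom f -> fdom f' ->
  fform (pull Q g f) f' = fform f (pull P h f').
Proof.
move=> hf hf'; rewrite (@fform_seq _ _ [seq h y | y <- fsupp f & `[< P y >]]).
- rewrite big_map big_filter /fform [RHS](bigID (fun y => `[< P y >])) /=.
  rewrite [X in _ = _ + X]big1 ?addr0; last first.
    by move=> y np; rewrite /pull (negPf np) conj0 mulr0.
  apply: eq_bigr => y /asboolP Py; have [Qh e] := hP Py.
  by rewrite /pull !asboolT // e.
- exact: pull_maps.
- rewrite map_inj_in_uniq ?filter_uniq ?fset_uniq // => y y'.
  rewrite !mem_filter => /andP[/asboolP Py _] /andP[/asboolP Py' _] e.
  by rewrite -(proj2 (hP Py)) e (proj2 (hP Py')).
- by move=> x; exact: pull_supp.
Qed.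

End Pull.

(** A bijection of [Q] onto [P] reindexes the inner product: the adjoint is the operator of the
    inverse, and $T^*T$ cuts functions down to [P], so the norm is at most 1. *)
Lemma pull_opdom (P Q : set X) (g h : X -> X) :
  (forall x, Q x -> P (g x) /\ h (g x) = x) ->
  (forall y, P y -> Q (h y) /\ g (h y) = y) ->
  @opdom R ell2 (pull Q g) /\ @isadj R ell2 (pull Q g) (pull P h).
Proof.
move=> gP hP; have m := pull_maps gP; have m' := pull_maps hP.
have a : @isadj R ell2 (pull Q g) (pull P h).
  by split; [exact: m'|exact: (pull_form gP hP)].
split=> //; split; [exact: m| |by exists (pull P h)].
exists 1; split=> // f hf; rewrite mul1r.
rewrite -(@ler_pXn2r _ 2) ?nnegrE ?phn_ge0 // !(@phn_sqr R ell2) //; last exact: m.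
rewrite -rC_le -!(@phqE R ell2) //; last exact: m.
rewrite [X in X <= _](pull_form gP hP hf (m _ hf)).
rewrite [X in X <= _](_ : _ = \sum_(x <- fsupp f) if `[< P x >] then f x * (f x)^* else 0).
  apply: ler_sum => x _; case: asboolP => // _; exact: mul_conjC_ge0.
apply: eq_bigr => y _; rewrite {1}/pull; case: asboolP => [Py|]; last by rewrite conj0 mulr0.
by have [Qh e] := hP _ Py; rewrite /pull asboolT // e.
Qed.

End Ell2.

(** * The representation of the Cuntz-Krieger relations on one-sided paths *)

Section PathRepresentation.
Variables (R : realType) (k : nat) (L : kgraph k) (L_regular : regular_kgraph L).
Local Notation C := (Cx R).
Local Notation V := (ell2 R (opath L)).
Local Notation W := (opath L -> (Cx R)^o).
Implicit Types (l m : kmor L) (w : opath L) (f : W).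

(** The operator that sends the point mass at $w$ to the one at $\lambda w$, and to 0 if $\lambda w$
    is not defined. *)
Definition shift_op l : W -> W :=
  pull [set w | oi w (kdeg l) = l] (oshift (kdeg l)).
Definition preq l : set (opath L) := [set w | ks l = overt w 0].
Definition prep_op l : W -> W := pull (preq l) (opre L_regular l).

Lemma shift_opP l : [/\ @opdom R V (shift_op l), @opdom R V (prep_op l) &
  @isadj R V (shift_op l) (prep_op l)].
Proof.
have h1 w : oi w (kdeg l) = l ->
    preq l (oshift (kdeg l) w) /\ opre L_regular l (oshift (kdeg l) w) = w.
  exact: opre_oshift.
have h2 w : preq l w -> oi (opre L_regular l w) (kdeg l) = l /\
    oshift (kdeg l) (opre L_regular l w) = w.
  exact: opreP.
by have [a b] := pull_opdom R h1 h2; have [c _] := pull_opdom R h2 h1.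
Qed.

Lemma shift_opE l f w :
  shift_op l f w = if `[< oi w (kdeg l) = l >] then f (oshift (kdeg l) w) else 0.
Proof. by []. Qed.

Lemma prep_opE l f w :
  prep_op l f w = if `[< ks l = overt w 0 >] then f (opre L_regular l w) else 0.
Proof. by []. Qed.

Lemma shift_prep l f w :
  shift_op l (prep_op l f) w = if `[< oi w (kdeg l) = l >] then f w else 0.
Proof.
rewrite shift_opE; case: asboolP => // /(opre_oshift L_regular) [e1 e2].
by rewrite prep_opE asboolT // e2.
Qed.

Lemma prep_shift l f w :
  prep_op l (shift_op l f) w = if `[< ks l = overt w 0 >] then f w else 0.
Proof.
rewrite prep_opE; case: asboolP => // /(opreP L_regular) [e1 e2].
by rewrite shift_opE asboolT // e2.
Qed.

Lemma shift_kid (v : kobj L) f w :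
  shift_op (kid v) f w = if `[< overt w 0 = v >] then f w else 0.
Proof.
rewrite shift_opE kdeg_id oshift0 oi0; congr (if _ then _ else _).
apply/asboolP/asboolP => [e|->//].
by rewrite -(kr_id (overt w 0)) e kr_id.
Qed.

Lemma shift_comp l m f w : ks l = kr m ->
  shift_op (cmp l m) f w = shift_op l (shift_op m f) w.
Proof.
move=> h; rewrite !shift_opE cmp_deg // oshiftD [kdeg m + _]addrC.
have [h1 e1] := oiD w (kdeg l) (kdeg m).
case: asboolP => [e|n].
  have [a b] := cmp_inj h1 h (oi_deg _ _) (etrans (esym e1) e).
  by rewrite !asboolT.
case: asboolP => // a; case: asboolP => // b; exfalso; apply: n.
by rewrite e1 a b.
Qed.

Definition path_rep l : bounded_ops V := @bop R V (shift_op l).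

Lemma path_rep_star l : cstar (path_rep l) = @bop R V (prep_op l).
Proof. by have [a b c] := shift_opP l; exact: bop_star. Qed.

Lemma bop_ext (S T : W -> W) : (forall f w, S f w = T f w) -> @bop R V S = @bop R V T.
Proof. by move=> h; congr bop; apply: funext => f; apply: funext => w; exact: h. Qed.

Lemma bop_sum (s : seq (kmor L)) (T : kmor L -> W -> W) :
  (forall l, @opdom R V (T l)) ->
  @bop R V (fun f w => \sum_(l <- s) T l f w) = \sum_(l <- s) @bop R V (T l) /\
  @opdom R V (fun f w => \sum_(l <- s) T l f w).
Proof.
move=> hT; elim: s => [|l s [IH hs]].
  have -> : (fun (f : W) w => \sum_(l <- [::]) T l f w) = 0.
    by apply: funext => f; apply: funext => w; rewrite big_nil.
  by rewrite big_nil; split; [exact: bop0 | exact: opdom0].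
have -> : (fun (f : W) w => \sum_(m <- l :: s) T m f w) =
    T l + (fun f w => \sum_(m <- s) T m f w).
  by apply: funext => f; apply: funext => w; rewrite big_cons.
by rewrite big_cons -IH; split; [exact: bopD | exact: opdomD].
Qed.

Lemma path_rep_ck : ck_family path_rep.
Proof.
have o1 l : @opdom R V (shift_op l) by case: (shift_opP l).
have o2 l : @opdom R V (prep_op l) by case: (shift_opP l).
have o3 l : @opdom R V (shift_op l \o prep_op l) by apply: opdom_comp.
split.
- move=> l; rewrite path_rep_star -!bop_mul //; apply: bop_ext => f w /=.
  by rewrite shift_prep !shift_opE; case: asboolP => // h; rewrite ?asboolT ?asboolF.
- move=> v; have e : @bop R V (prep_op (kid v)) = path_rep (kid v).
    apply: bop_ext => f w; rewrite shift_kid prep_opE ks_id.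
    case: asboolP => [e|n]; last by rewrite asboolF // => e; apply: n.
    rewrite asboolT //; congr (f _).
    have [|_] := opreP L_regular (w := w) (mu := kid v); first by rewrite ks_id.
    by rewrite kdeg_id oshift0.
  split; first by rewrite path_rep_star e.
  rewrite -bop_mul //; apply: bop_ext => f w /=.
  by rewrite !shift_kid; case: asboolP => // h; rewrite ?asboolT ?asboolF.
- move=> u v uv; rewrite -bop_mul // -[RHS](bop0 V); apply: bop_ext => f w /=.
  rewrite !shift_kid; case: asboolP => // e; rewrite asboolF // e => e'; exact: uv.
- move=> l m h; rewrite -bop_mul //; apply: bop_ext => f w /=.
  by rewrite -cmpE shift_comp.
- move=> l; rewrite path_rep_star -bop_mul //; apply: bop_ext => f w /=.
  rewrite prep_shift shift_kid; congr (if _ then _ else _).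
  by apply/asboolP/asboolP.
- move=> v n; have [_ _ fin _] := L_regular n v.
  rewrite fsbig_finite //.
  under eq_bigr => l _ do rewrite path_rep_star -bop_mul //.
  rewrite -(proj1 (bop_sum _ o3)); apply: bop_ext => f w.
  rewrite shift_kid.
  under eq_bigr => l _ do rewrite /= shift_prep.
  rewrite big_seq_cond; case: asboolP => [e|ne]; last first.
    rewrite big1 // => l /andP[]; rewrite in_fset_set // => /set_mem [d r] _.
    rewrite asboolF // d => e; apply: ne; rewrite -r -e; exact: esym (oi_r _ _).
  have hl : oi w n \in fset_set [set l | kdeg l = n /\ kr l = v].
    by rewrite in_fset_set //; apply/mem_set; rewrite /= oi_deg oi_r.
  rewrite -big_seq_cond (bigD1_seq (oi w n)) ?fset_uniq //= oi_deg asboolT //.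
  rewrite big_seq_cond big1 ?addr0 // => l /andP[].
  rewrite in_fset_set // => /set_mem [d r] /eqP ne.
  by rewrite asboolF // d => e1; apply: ne.
Qed.

(** The point mass at a path starting at [v] is a nonzero vector fixed by this projection. *)
Lemma path_rep_neq0 v : path_rep (kid v) != 0.
Proof.
have o1 : @opdom R V (shift_op (kid v)) by case: (shift_opP (kid v)).
apply/eqP => e; have : nn (path_rep (kid v)) = 0 by rewrite e nn0.
rewrite nn_bop // => e0; have [_ hb] := opn_bnd o1.
have [w hw] := opath_from L_regular v.
pose f : W := fun w' => if `[< w' = w >] then 1 else 0.
have hf : @ph_dom R V f.
  apply: sub_finite_set (finite_set1 w) => w' /=.
  by rewrite /f; case: asboolP => // _; rewrite eqxx.
have e1 : shift_op (kid v) f = f.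
  apply: funext => w'; rewrite shift_kid; case: asboolP => // n.
  by rewrite /f asboolF // => e'; apply: n; rewrite e'.
have := hb f hf; rewrite e0 mul0r e1 => n0.
have : @phn R V f = 0 by apply: le_anti; rewrite n0 phn_ge0.
move/(congr1 (fun r => r ^+ 2)); rewrite phn_sqr // => /(congr1 (@rC R)).
rewrite -phqE // expr0n rC0 => /eqP.
rewrite /= (@fform_seq R _ f f [:: w]) //; last first.
  by move=> w'; rewrite /f inE; case: asboolP => [->|_]; rewrite ?eqxx.
by rewrite big_seq1 /f asboolT // mul1r conj1 oner_eq0.
Qed.

(** The universal property maps the vertex projection to a nonzero operator on paths. *)
Lemma ck_neq0 (A : cstar_algebra R) (s : kmor L -> A) v :
  is_kgraph_algebra s -> s (kid v) != 0.
Proof.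
move=> [_ _ /(_ _ _ path_rep_ck) [f [[fD fZ _ _] hf]]].
have := path_rep_neq0 v; rewrite -hf; apply: contra => /eqP ->.
by rewrite -(scale0r (0 : A)) fZ scale0r.
Qed.

End PathRepresentation.

(** * Systems of matrix units indexed by morphisms of diagonal degree *)

Section Levels.
Variables (k : nat) (L : kgraph k) (L_regular : regular_kgraph L).
Hypothesis L_finite : finite_set [set: kobj L].

Definition lv (p : NN k) : seq (kmor L) := fset_set [set l | kdeg l = p].
Definition out (p : NN k) (v : kobj L) : seq (kmor L) :=
  fset_set [set l | kdeg l = p /\ kr l = v].

Lemma finite_degree (p : NN k) : finite_set [set l : kmor L | kdeg l = p].
Proof.
apply: (@sub_finite_set _ _ (\bigcup_(v in [set: kobj L]) [set l | kdeg l = p /\ kr l = v])).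
  by move=> l h; exists (kr l).
by apply: bigcup_finite => // v _; case: (L_regular p v).
Qed.

Lemma mem_lv p l : (l \in lv p) = (kdeg l == p).
Proof.
rewrite in_fset_set; last exact: finite_degree.
by apply/idP/eqP => [/set_mem|h] //; exact: mem_set.
Qed.

Lemma uniq_lv p : uniq (lv p). Proof. exact: fset_uniq. Qed.

Lemma mem_out p v l : (l \in out p v) = (kdeg l == p) && (kr l == v).
Proof.
rewrite in_fset_set; last by case: (L_regular p v).
apply/idP/andP => [/set_mem [h h']|[/eqP h /eqP h']]; first by rewrite h h' !eqxx.
exact: mem_set.
Qed.

Lemma uniq_out p v : uniq (out p v). Proof. exact: fset_uniq. Qed.
End Levels.

Section UnitSystem.
Variables (R : realType) (k : nat) (L : kgraph k) (L_regular : regular_kgraph L).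
Hypothesis L_finite : finite_set [set: kobj L].
Local Notation C := (Cx R).
Local Notation lvn n := (@lv k L (cstn k n)).
Local Notation src := (@ks k L).
Implicit Types A B : cstar_algebra R.

(** Level $n$ is indexed by the morphisms of degree $(n,\dots,n)$, with blocks given by their
    sources, and [us_ref] embeds it in level $n+1$. This is the common presentation of
    $C^*(\Lambda)^\alpha$ and of the corner of $S$. *)
Record unit_system A (E : nat -> kmor L -> kmor L -> A) : Prop := {
  us_units : forall n, matrix_units (lvn n) src (E n);
  us_ref : forall n l m, l \in lvn n -> m \in lvn n -> ks l = ks m ->
    E n l m = \sum_(a <- out (cstn k 1) (ks l)) E n.+1 (cmp l a) (cmp m a)
}.

Section Compare.
Variables (A B : cstar_algebra R).
Variables (E : nat -> kmor L -> kmor L -> A) (E' : nat -> kmor L -> kmor L -> B).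
Hypotheses (hE : unit_system E) (hE' : unit_system E').

Definition level_rel n (a : A) (b : B) : Prop := exists c,
  a = mcomb (lvn n) src (E n) c /\ b = mcomb (lvn n) src (E' n) c.

Definition unit_rel (a : A) (b : B) : Prop := exists n, level_rel n a b.

Lemma level_relD n a b a' b' : level_rel n a b -> level_rel n a' b' ->
  level_rel n (a + a') (b + b').
Proof.
move=> [c [-> ->]] [c' [-> ->]]; exists (fun i j => c i j + c' i j).
by split; rewrite /mcomb -big_split; apply: eq_bigr => i _;
  rewrite -big_split; apply: eq_bigr => j _; rewrite scalerDl.
Qed.

Lemma level_relZ n (z : C) a b : level_rel n a b -> level_rel n (z *: a) (z *: b).
Proof.
move=> [c [-> ->]]; exists (fun i j => z * c i j).
by split; rewrite /mcomb scaler_sumr; apply: eq_bigr => i _;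
  rewrite scaler_sumr; apply: eq_bigr => j _; rewrite scalerA.
Qed.

Lemma level_rel0 n : level_rel n 0 0.
Proof.
exists (fun _ _ => 0); split; rewrite /mcomb big1 // => i _; rewrite big1 // => j _;
  by rewrite scale0r.
Qed.

Lemma level_rel_sum n (I : eqType) (s : seq I) (P : pred I) (f : I -> A) (g : I -> B) :
  (forall i, i \in s -> P i -> level_rel n (f i) (g i)) ->
  level_rel n (\sum_(i <- s | P i) f i) (\sum_(i <- s | P i) g i).
Proof.
elim: s => [|i s IH] h; first by rewrite !big_nil; exact: level_rel0.
have hs : level_rel n (\sum_(i <- s | P i) f i) (\sum_(i <- s | P i) g i).
  by apply: IH => j sj; apply: h; rewrite inE sj orbT.
rewrite !big_cons; case: ifP => // Pi; apply: level_relD => //.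
by apply: h => //; rewrite mem_head.
Qed.

Lemma mcomb_delta (F : cstar_algebra R) (U : kmor L -> kmor L -> F) n l m :
  l \in lvn n -> m \in lvn n -> ks l = ks m ->
  mcomb (lvn n) src U (fun i j => ((i == l) && (j == m))%:R) = U l m.
Proof.
move=> sl sm e; rewrite /mcomb (bigD1_seq l) ?uniq_lv //= [X in _ + X]big1 ?addr0; last first.
  by move=> i il; rewrite big1 // => j _; rewrite (negPf il) scale0r.
rewrite big_mkcond (bigD1_seq m) ?uniq_lv //= -e eqxx !eqxx scale1r big1 ?addr0 //.
by move=> j jm; rewrite (negPf jm) scale0r; case: ifP.
Qed.

Lemma level_rel_unit n l m : l \in lvn n -> m \in lvn n -> ks l = ks m ->
  level_rel n (E n l m) (E' n l m).
Proof.
by move=> sl sm e; exists (fun i j => ((i == l) && (j == m))%:R); rewrite !mcomb_delta.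
Qed.

(** Both systems refine by the same rule, so corresponding elements still have equal coefficients
    one level higher. *)
Lemma level_relS n a b : level_rel n a b -> level_rel n.+1 a b.
Proof.
move=> [c [-> ->]]; apply: level_rel_sum => l sl _; apply: level_rel_sum => m sm /eqP e.
apply: level_relZ; rewrite (us_ref hE) // (us_ref hE') //.
apply: level_rel_sum => i; rewrite mem_out // => /andP[/eqP di /eqP ri] _.
move: sl sm; rewrite !mem_lv // => /eqP dl /eqP dm.
apply: level_rel_unit; rewrite ?mem_lv ?cmp_deg ?ri ?cmp_s ?ri // ?dl ?dm ?di -?cstnD ?addn1 //.
Qed.

Lemma level_rel_le n n' a b : (n <= n')%N -> level_rel n a b -> level_rel n' a b.
Proof. by move=> /subnK <-; elim: (n' - n)%N => // i IH /IH /level_relS. Qed.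

(** Any two related pairs live in a common level, where combinations multiply by the same formulas
    and have equal norms by [mcomb_norm]. *)
Lemma unit_rel_iso : iso_rel unit_rel.
Proof.
have up a b a' b' : unit_rel a b -> unit_rel a' b' ->
    exists n, level_rel n a b /\ level_rel n a' b'.
  move=> [n h] [n' h']; exists (maxn n n').
  by split; [exact: level_rel_le (leq_maxl _ _) h|exact: level_rel_le (leq_maxr _ _) h'].
split.
- by move=> a b a' b' h h'; have [n [? ?]] := up _ _ _ _ h h'; exists n; exact: level_relD.
- by move=> z a b [n h]; exists n; exact: level_relZ.
- move=> a b a' b' h h'; have [n [[c [-> ->]] [c' [-> ->]]]] := up _ _ _ _ h h'.
  exists n, (mmul (lvn n) src c c').
  by rewrite !(mcomb_mul (uniq_lv _ _) _ _ (us_units _ n)).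
- move=> a b [n [c [-> ->]]]; exists n, (mstar c).
  by rewrite !(mcomb_star _ (us_units _ n)).
- move=> a b [n [c [-> ->]]].
  exact: (mcomb_norm (uniq_lv _ _) c (us_units hE n) (us_units hE' n)).
Qed.

End Compare.
End UnitSystem.

(** * Cuntz-Krieger families and the span of $s_\lambda s_\mu^*$ *)

Section ClosureSubalgebra.
Variables (R : realType) (A : cstar_algebra R).

Lemma closure_star_subalgebra (D : set A) :
  star_subalgebra D -> star_subalgebra (closure D).
Proof.
move=> [D0 DD DZ DM DS]; split.
- exact: subset_closure.
- move=> a b /closure_seq [u [hu lu]] /closure_seq [v [hv lv]].
  by apply: lim_closure (lim_add lu lv) => n; exact: DD.
- move=> z a /closure_seq [u [hu lu]].
  by apply: lim_closure (lim_scale z lu) => n; exact: DZ.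
- move=> a b /closure_seq [u [hu lu]] /closure_seq [v [hv lv]].
  by apply: lim_closure (lim_mul lu lv) => n; exact: DM.
- move=> a /closure_seq [u [hu lu]].
  by apply: lim_closure (lim_star lu) => n; exact: DS.
Qed.

End ClosureSubalgebra.

Section CuntzKrieger.
Variables (R : realType) (k : nat) (L : kgraph k) (L_regular : regular_kgraph L).
Hypothesis L_finite : finite_set [set: kobj L].
Variables (A : cstar_algebra R) (s : kmor L -> A).
Hypotheses (hs : ck_family s) (s0 : forall v, s (kid v) != 0).
Local Notation C := (Cx R).
Local Notation "a ** b" := (cmul a b) (at level 40, left associativity).
Local Notation "a ^#" := (cstar a) (at level 2, format "a ^#").
Local Notation src := (@ks k L).
Local Notation lvn n := (@lv k L (cstn k n)).
Implicit Types (l m : kmor L) (p q : NN k).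

Lemma ck_cmp l m : ks l = kr m -> s (cmp l m) = s l ** s m.
Proof. by move=> h; rewrite (cmpE h) (ck_comp hs). Qed.

Lemma ck_idl l : s (kid (kr l)) ** s l = s l.
Proof. by rewrite -ck_cmp ?cmp_idl // ks_id. Qed.

Lemma ck_idr l : s l ** s (kid (ks l)) = s l.
Proof. by rewrite -ck_cmp ?cmp_idr // kr_id. Qed.

Lemma ck_kid_star v : (s (kid v))^# = s (kid v).
Proof. by have [] := ck_proj hs v. Qed.

Lemma ck_idl_star l : (s l)^# ** s (kid (kr l)) = (s l)^#.
Proof. by rewrite -{2}(ck_idl l) cstarM ck_kid_star. Qed.

Lemma ck_idr_star l : s (kid (ks l)) ** (s l)^# = (s l)^#.
Proof. by rewrite -{2}(ck_idr l) cstarM ck_kid_star. Qed.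

Lemma ck_sum p v : \sum_(l <- out p v) (s l ** (s l)^#) = s (kid v).
Proof.
by rewrite (ck_range hs v p) fsbig_finite //; case: (L_regular p v).
Qed.

(** With a common range, the projections $s_\lambda s_\lambda^*$ of one degree sum to a projection
    and are orthogonal by [proj_sum_orth]; with different ranges, the vertex projections are
    orthogonal. *)
Lemma ck_orthogonal l m : kdeg l = kdeg m ->
  (s l)^# ** s m = if l == m then s (kid (ks l)) else 0.
Proof.
move=> e; case: eqVneq => [<-|lm]; first exact: ck_source.
have [r|r] := eqVneq (kr l) (kr m); last first.
  rewrite -(ck_idl_star l) -(ck_idl m) cmulA -(cmulA _ (s (kid (kr l)))).
  by rewrite (ck_orth hs) ?cmul0r ?cmul0l //; exact/eqP.
have pp i : i \in out (kdeg l) (kr l) -> (s i ** (s i)^#)^# = s i ** (s i)^# /\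
    s i ** (s i)^# ** (s i ** (s i)^#) = s i ** (s i)^#.
  by move=> _; rewrite cstarM cstarK cmulA (ck_pi hs).
have pq i : i \in out (kdeg l) (kr l) -> s i ** (s i)^# ** s (kid (kr l)) = s i ** (s i)^#.
  by rewrite mem_out // => /andP[_ /eqP <-]; rewrite -cmulA ck_idl_star.
have hl : l \in out (kdeg l) (kr l) by rewrite mem_out // !eqxx.
have hm : m \in out (kdeg l) (kr l) by rewrite mem_out // e r !eqxx.
have o := proj_sum_orth (uniq_out _ _) pp (ck_sum _ _) pq hl hm lm.
have -> : (s l)^# = (s l)^# ** (s l ** (s l)^#).
  by rewrite -[in LHS](ck_pi hs l) !cstarM cstarK.
rewrite -[s m in LHS](ck_pi hs m) -cmulA (cmulA (s l ** _)).
by rewrite o cmul0l cmul0r.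
Qed.

Definition ck_unit l m : A := s l ** (s m)^#.

Lemma ck_neq0_arr l : s l != 0.
Proof.
apply: contra (s0 (ks l)) => /eqP e.
by rewrite -(ck_source hs) e cmul0r.
Qed.

(** Insert $s_v=\sum_a s_as_a^*$ between the two factors. *)
Lemma ck_unit_refine l m p : ks l = ks m ->
  ck_unit l m = \sum_(a <- out p (ks l)) ck_unit (cmp l a) (cmp m a).
Proof.
move=> e; rewrite /ck_unit -{1}(ck_idr l) -(ck_sum p) cmul_sumr cmul_suml.
rewrite big_seq [RHS]big_seq; apply: eq_bigr => a.
rewrite mem_out // => /andP[_ /eqP r].
by rewrite !ck_cmp ?r // cstarM !cmulA.
Qed.

Lemma ck_unit_eq0 l m : ks l <> ks m -> ck_unit l m = 0.
Proof.
move=> e; rewrite /ck_unit -(ck_idr l) -(ck_idr_star m) cmulA -(cmulA (s l)).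
by rewrite (ck_orth hs) // cmul0r cmul0l.
Qed.

Lemma ck_unit_system : unit_system (fun=> ck_unit).
Proof.
split=> [n|n l m _ _ e]; last exact: ck_unit_refine.
split.
- move=> i j a b; rewrite !mem_lv // => _ /eqP dj /eqP da _ e e'.
  rewrite /ck_unit cmulA -(cmulA (s i)) ck_orthogonal ?dj ?da //.
  case: eqP => _; last by rewrite cmul0r cmul0l.
  by rewrite -e ck_idr.
- by move=> i j _ _ _; rewrite /ck_unit cstarM cstarK.
- move=> i _; apply: contra (ck_neq0_arr i) => /eqP h.
  have : (s i)^# = 0 by apply: star_eq0; rewrite cstarK.
  by move=> /(congr1 (@cstar R A)); rewrite cstarK cstar0 => ->.
Qed.

Definition ck_lin (T : seq (C * (kmor L * kmor L))) : A :=
  \sum_(t <- T) t.1 *: ck_unit t.2.1 t.2.2.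
Definition ck_span : set A := [set a | exists T, a = ck_lin T].

Lemma ck_spanD a b : ck_span a -> ck_span b -> ck_span (a + b).
Proof. by move=> [T ->] [T' ->]; exists (T ++ T'); rewrite /ck_lin big_cat. Qed.

Lemma ck_spanZ (z : C) a : ck_span a -> ck_span (z *: a).
Proof.
move=> [T ->]; exists [seq (z * t.1, t.2) | t <- T].
by rewrite /ck_lin big_map scaler_sumr; apply: eq_bigr => t _; rewrite scalerA.
Qed.

Lemma ck_span0 : ck_span 0.
Proof. by exists [::]; rewrite /ck_lin big_nil. Qed.

Lemma ck_span_unit l m : ck_span (ck_unit l m).
Proof. by exists [:: (1, (l, m))]; rewrite /ck_lin big_seq1 scale1r. Qed.

Lemma ck_span_sum (I : eqType) (r : seq I) (f : I -> A) :
  (forall i, i \in r -> ck_span (f i)) -> ck_span (\sum_(i <- r) f i).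
Proof.
elim: r => [|i r IH] h; first by rewrite big_nil; exact: ck_span0.
rewrite big_cons; apply: ck_spanD; first by apply: h; rewrite mem_head.
by apply: IH => j hj; apply: h; rewrite inE hj orbT.
Qed.

Lemma ck_expand l p : s l = \sum_(a <- out p (ks l)) s (cmp l a) ** (s a)^#.
Proof.
rewrite -{1}(ck_idr l) -(ck_sum p) cmul_sumr.
rewrite big_seq [RHS]big_seq; apply: eq_bigr => a.
by rewrite mem_out // => /andP[_ /eqP r]; rewrite ck_cmp ?r // cmulA.
Qed.

(** Extending $l$ by the degree of $m$ and $m$ by the degree of $l$ produces morphisms of one
    degree, whose partial isometries are orthogonal or equal. *)
Lemma ck_span_starmul l m : ck_span ((s l)^# ** s m).
Proof.
rewrite (ck_expand l (kdeg m)) (ck_expand m (kdeg l)) cstar_sum cmul_suml.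
apply: ck_span_sum => a; rewrite mem_out // => /andP[/eqP da /eqP ra].
rewrite cmul_sumr; apply: ck_span_sum => b; rewrite mem_out // => /andP[/eqP db /eqP rb].
rewrite cstarM cstarK cmulA -(cmulA (s a)) ck_orthogonal; last first.
  by rewrite !cmp_deg ?ra ?rb // da db addrC.
case: eqP => _; last by rewrite cmul0r cmul0l; exact: ck_span0.
by rewrite cmp_s ?ra // ck_idr; exact: ck_span_unit.
Qed.

Lemma ck_span_sandwich l m x : ck_span x -> ck_span (s l ** x ** (s m)^#).
Proof.
move=> [T ->]; rewrite /ck_lin cmul_sumr cmul_suml; apply: ck_span_sum => t _.
rewrite cmulZr cmulZl; apply: ck_spanZ.
have [h|h] := pselect (ks l = kr t.2.1); last first.
  rewrite /ck_unit -(ck_idr l) -(ck_idl t.2.1).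
  rewrite cmulA cmulA -(cmulA (s l)) (ck_orth hs) // !(cmul0r, cmul0l); exact: ck_span0.
have [h'|h'] := pselect (ks m = kr t.2.2); last first.
  rewrite /ck_unit -(ck_idr_star m) -(ck_idl_star t.2.2).
  rewrite !cmulA -(cmulA _ (s (kid _)) (s (kid _))) (ck_orth hs); last first.
    by move=> e; apply: h'.
  by rewrite !(cmul0r, cmul0l); exact: ck_span0.
have := ck_span_unit (cmp l t.2.1) (cmp m t.2.2).
by rewrite /ck_unit !ck_cmp // cstarM !cmulA.
Qed.

Lemma ck_span_subalgebra : star_subalgebra ck_span.
Proof.
split; [exact: ck_span0|exact: ck_spanD|exact: ck_spanZ| |].
- move=> a b [T ->] [T' ->]; rewrite /ck_lin cmul_suml; apply: ck_span_sum => t _.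
  rewrite cmul_sumr; apply: ck_span_sum => t' _; rewrite cmulZl cmulZr.
  apply: ck_spanZ; apply: ck_spanZ.
  have := ck_span_sandwich t.2.1 t'.2.2 (ck_span_starmul t.2.2 t'.2.1).
  by rewrite /ck_unit !cmulA.
- move=> a [T ->]; rewrite /ck_lin cstar_sum; apply: ck_span_sum => t _.
  rewrite cstarZ; apply: ck_spanZ; rewrite /ck_unit cstarM cstarK; exact: ck_span_unit.
Qed.

Lemma ck_span_dense : generates (range s) -> closure ck_span = setT.
Proof.
apply; first exact: closed_closure.
  exact: closure_star_subalgebra ck_span_subalgebra.
move=> _ [l _ <-]; apply: subset_closure.
have := ck_span_unit l (kid (ks l)).
by rewrite /ck_unit ck_kid_star ck_idr.
Qed.

End CuntzKrieger.

(** * The fixed points of the gauge action *)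

Section Gauge.
Variables (R : realType) (k : nat) (L : kgraph k) (L_regular : regular_kgraph L).
Hypothesis L_finite : finite_set [set: kobj L].
Variables (A : cstar_algebra R) (s : kmor L -> A).
Hypotheses (hs : ck_family s) (s0 : forall v, s (kid v) != 0).
Hypothesis hgen : generates (range s).
Variable alpha : ('I_k -> Cx R) -> A -> A.
Hypothesis ha : is_gauge_action s alpha.
Local Notation C := (Cx R).
Local Notation "a ** b" := (cmul a b) (at level 40, left associativity).
Local Notation "a ^#" := (cstar a) (at level 2, format "a ^#").
Local Notation lvn n := (@lv k L (cstn k n)).
Local Notation E := (ck_unit s).
Implicit Types (l m : kmor L) (p q : NN k) (z : 'I_k -> C).

Lemma torus_pow_conj z p : torus z -> torus_pow z p * (torus_pow z p)^* = 1.
Proof.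
move=> hz; rewrite nn_sqr; have -> : nn (torus_pow z p) = 1; last by rewrite expr1n.
apply: rC_inj; rewrite -nnE normr_prod big1 // => i _.
by rewrite normrX hz expr1n.
Qed.

Lemma gauge_unit z l m : torus z ->
  alpha z (E l m) = (torus_pow z (kdeg l) * (torus_pow z (kdeg m))^*) *: E l m.
Proof.
move=> hz; have [[_ aZ aM aS] _ as_] := ha hz.
by rewrite /ck_unit aM aS !as_ cstarZ cmulZl cmulZr scalerA.
Qed.

Lemma gauge_hom z : torus z -> [/\ forall a b, alpha z (a + b) = alpha z a + alpha z b,
  forall (c : C) a, alpha z (c *: a) = c *: alpha z a &
  forall a, nn (alpha z a) <= nn a].
Proof.
move=> hz; have [[aD aZ aM aS] _ _] := ha hz; split=> // a.
exact: (@star_hom_contr R A A setT (alpha z)).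
Qed.

Lemma gauge_sum z (I : Type) (r : seq I) (f : I -> A) : torus z ->
  alpha z (\sum_(i <- r) f i) = \sum_(i <- r) alpha z (f i).
Proof.
move=> /gauge_hom [aD aZ _]; elim: r => [|i r IH]; last by rewrite !big_cons aD IH.
by rewrite !big_nil -(scale0r (0 : A)) aZ !scale0r.
Qed.

(* A root of -1 of order the difference of the degrees in one coordinate. *)
Lemma gauge_flip p q : p <> q -> exists z, torus z /\
  torus_pow z p * (torus_pow z q)^* = -1.
Proof.
move=> pq; have [i hi] : exists i, p i <> q i.
  by apply: contrapT => h; apply: pq; apply/ffunP => i; apply: contrapT => n; apply: h; exists i.
have w d : (0 < d)%N -> exists w : C, `|w| = 1 /\ w ^+ d = -1.
  move=> d0; exists (d.-root (-1)); rewrite rootCK //; split=> //.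
  by rewrite norm_rootC normrN1 rootC1.
have tp (w' : C) r : torus_pow (fun j => if j == i then w' else 1) r = w' ^+ r i.
  rewrite /torus_pow (bigD1 i) //= eqxx big1 ?mulr1 // => j /negPf ->.
  by rewrite expr1n.
have tor (w' : C) : `|w'| = 1 -> torus (fun j : 'I_k => if j == i then w' else 1).
  by move=> h j; case: eqP => // _; rewrite normr1.
have cc (w' : C) n : `|w'| = 1 -> w' ^+ n * (w' ^+ n)^* = 1.
  by move=> h; rewrite -normCK normrX h !expr1n.
case: (ltngtP (p i) (q i)) => // h.
  have [w' [n1 e]] := w (q i - p i)%N ltac:(by rewrite subn_gt0).
  exists (fun j => if j == i then w' else 1); split; first exact: tor.
  rewrite !tp -(subnKC (ltnW h)) exprD conjM mulrA cc // mul1r e.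
  by rewrite conjN conj1.
have [w' [n1 e]] := w (p i - q i)%N ltac:(by rewrite subn_gt0).
exists (fun j => if j == i then w' else 1); split; first exact: tor.
by rewrite !tp -(subnKC (ltnW h)) exprD mulrAC cc // mul1r e.
Qed.

(** Instead of integrating over the torus, choose $z$ that changes the sign of the first term and
    average with $\alpha_z$: this removes the term, rescales the others, fixes $a$ and $b_0$, and
    does not increase the norm. Induct on the number of terms. *)
Lemma gauge_kill (a b0 : A) (r : R) (T : seq (C * (kmor L * kmor L))) :
  (forall z, torus z -> alpha z a = a) -> (forall z, torus z -> alpha z b0 = b0) ->
  (forall t, t \in T -> kdeg t.2.1 <> kdeg t.2.2) ->
  nn (a - (b0 + ck_lin s T)) <= r -> nn (a - b0) <= r.
Proof.
move=> fa fb; have [n] := ubnP (size T); elim: n T => // n IH [|t T] /= hn hT h.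
  by move: h; rewrite /ck_lin big_nil addr0.
have [z [hz hz1]] := gauge_flip (hT t (mem_head _ _)).
have [aD aZ aC] := gauge_hom hz.
(* Averaging multiplies the coefficient of the term [u] by [c u], which is 0 for the removed term
   [t]. *)
pose c (u : C * (kmor L * kmor L)) : C :=
  (1 + torus_pow z (kdeg u.2.1) * (torus_pow z (kdeg u.2.2))^*) / 2.
apply: (IH [seq (c u * u.1, u.2) | u <- T]); rewrite ?size_map //.
  by move=> _ /mapP [u hu ->] /=; apply: hT; rewrite inE hu orbT.
have aN (x : A) : alpha z (- x) = - alpha z x by rewrite -scaleN1r aZ scaleN1r.
set d := a - (b0 + ck_lin s (t :: T)) in h.
suff -> : a - (b0 + ck_lin s [seq (c u * u.1, u.2) | u <- T]) = 2^-1 *: (d + alpha z d).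
  rewrite nnZ; have := nnD d (alpha z d); have := aC d.
  have -> : nn (2^-1 : C) = 2^-1.
    by rewrite -(rC_nat R 2) -rCV nn_rC ger0_norm ?invr_ge0.
  lra.
have e : alpha z (ck_lin s (t :: T)) = - (t.1 *: E t.2.1 t.2.2) +
    \sum_(u <- T) (2 * c u - 1) *: (u.1 *: E u.2.1 u.2.2).
  rewrite gauge_sum // big_cons aZ gauge_unit // hz1 scaleN1r scalerN; congr (_ + _).
  apply: eq_bigr => u _; rewrite aZ gauge_unit // !scalerA; congr (_ *: _).
  by rewrite /c; field.
have e2 : ck_lin s [seq (c u * u.1, u.2) | u <- T] =
    2^-1 *: (ck_lin s T + \sum_(u <- T) (2 * c u - 1) *: (u.1 *: E u.2.1 u.2.2)).
  rewrite /ck_lin big_map -big_split scaler_sumr; apply: eq_bigr => u _.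
  rewrite -[X in _ *: (X + _)]scale1r -scalerDl !scalerA /=; congr (_ *: _).
  by field.
have e3 : ck_lin s (t :: T) = t.1 *: E t.2.1 t.2.2 + ck_lin s T by rewrite /ck_lin big_cons.
rewrite /d !(aD, aN) fa // fb // e e2 e3.
lmod (Cx R) (csort A).
Qed.

Lemma ck_unit_level l m : kdeg l = kdeg m -> exists n,
  level_rel (fun=> E) (fun=> E) n (E l m) (E l m).
Proof.
move=> d; have [n hn] := nle_bound (kdeg l); exists n.
have [e|e] := pselect (ks l = ks m); last first.
  by rewrite ck_unit_eq0 //; exact: level_rel0.
have [p hp] : exists p, kdeg l + p = cstn k n.
  exists [ffun i => n - kdeg l i]%N; apply/NN_eqP => i.
  by move/NN_leP: hn => /(_ i); rewrite !coordE !ffunE => h; rewrite subnKC.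
rewrite (ck_unit_refine L_regular hs p e); apply: level_rel_sum => a.
rewrite mem_out // => /andP[/eqP da /eqP ra] _.
by apply: level_rel_unit => //; rewrite ?mem_lv ?cmp_deg ?cmp_s ?ra // -?d da hp.
Qed.

(** The terms with $d(\lambda)\ne d(\mu)$ of an approximation are dropped by [gauge_kill]; the
    remaining ones are refined to a common diagonal degree. *)
Lemma gauge_dense a (e : R) : fixed_points alpha a -> 0 < e ->
  exists n c, nn (a - mcomb (lvn n) (@ks k L) E c) < e.
Proof.
move=> fa e0; have : closure (ck_span s) a by rewrite (ck_span_dense L_regular hs hgen).
move/closure_nn => /(_ (e / 2)) []; first by rewrite divr_gt0.
move=> _ [T ->] hT.
pose T0 := [seq t <- T | kdeg t.2.1 == kdeg t.2.2].
pose T1 := [seq t <- T | kdeg t.2.1 != kdeg t.2.2].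
have eT : ck_lin s T = ck_lin s T0 + ck_lin s T1.
  by rewrite /ck_lin (bigID (fun t => kdeg t.2.1 == kdeg t.2.2)) /= !big_filter.
have : nn (a - ck_lin s T0) <= e / 2.
  apply: (@gauge_kill a (ck_lin s T0) _ T1) => //.
  - move=> z hz; have [aD aZ _] := gauge_hom hz.
    rewrite /ck_lin gauge_sum //; apply: eq_big_seq => t.
    rewrite mem_filter => /andP[/eqP d _].
    by rewrite aZ gauge_unit // d torus_pow_conj // scale1r.
  - by move=> t; rewrite mem_filter => /andP[/eqP].
  - by rewrite -eT ltW.
have [n [c [-> _]]] : exists n, level_rel (fun=> E) (fun=> E) n (ck_lin s T0) (ck_lin s T0).
  have : forall t, t \in T0 -> kdeg t.2.1 = kdeg t.2.2.
    by move=> t; rewrite mem_filter => /andP[/eqP].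
  elim: T0 {eT} => [|t T' IH] h.
    by exists 0%N; rewrite /ck_lin big_nil; exact: level_rel0.
  have [|n hn] := IH; first by move=> u hu; apply: h; rewrite inE hu orbT.
  have [m hm] := ck_unit_level (h t (mem_head _ _)).
  have us := ck_unit_system L_regular L_finite hs s0.
  exists (maxn n m); rewrite /ck_lin big_cons; apply: level_relD.
    exact/level_relZ/(level_rel_le L_regular L_finite us us (leq_maxr _ _) hm).
  exact: (level_rel_le L_regular L_finite us us (leq_maxl _ _) hn).
move=> h; exists n, c; apply: (le_lt_trans h).
by rewrite ltr_pdivrMr // mulr_natr mulr2n ltrDl.
Qed.

Lemma gauge_level_fixed n c : fixed_points alpha (mcomb (lvn n) (@ks k L) E c).
Proof.
move=> z hz; have [aD aZ _] := gauge_hom hz.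
rewrite /mcomb gauge_sum //; apply: eq_big_seq => l hl.
rewrite -big_filter gauge_sum //; apply: eq_big_seq => m.
rewrite mem_filter => /andP[_ hm]; move: hl hm; rewrite !mem_lv // => /eqP dl /eqP dm.
by rewrite aZ gauge_unit // dl dm torus_pow_conj // scale1r.
Qed.

Lemma fixed_points_closed : closed (fixed_points alpha).
Proof.
apply: closed_limP => u a hu hl z hz; have [aD aZ aC] := gauge_hom hz.
have aN (x : A) : alpha z (- x) = - alpha z x by rewrite -scaleN1r aZ scaleN1r.
apply: (@lim_nn_uniq _ _ u) => // e /hl [N hN]; exists N => n /hN h.
by apply: le_lt_trans h; rewrite -[u n in leLHS](hu n z hz) -aN -aD.
Qed.

End Gauge.

(** * Integrals of simple functions *)

Section SimpleIntegral.
Variables (R : realType) (d : measure_display) (T : measurableType d).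
Variables (mu : {measure set T -> \bar R}) (I : eqType) (r : seq I).
Variables (Z : I -> set T) (w : I -> R).
Hypotheses (mZ : forall i, i \in r -> measurable (Z i))
           (wZ : forall i, i \in r -> mu (Z i) = (w i)%:E).

Lemma integral_simple (c : I -> R) :
  mu.-integrable setT (fun x => (\sum_(i <- r) c i * \1_(Z i) x)%:E) /\
  (\int[mu]_x (\sum_(i <- r) c i * \1_(Z i) x)%:E = (\sum_(i <- r) c i * w i)%:E)%E.
Proof.
elim: r mZ wZ => [|i s IH] hm hw.
  have -> : (fun x : T => (\sum_(i <- [::]) c i * \1_(Z i) x)%:E) = cst 0%E.
    by apply: funext => x; rewrite big_nil.
  by rewrite big_nil integral0; split=> //; exact: integrable0.
have [||h1 h2] := IH.
- by move=> j hj; apply: hm; rewrite inE hj orbT.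
- by move=> j hj; apply: hw; rewrite inE hj orbT.
have mi := hm i (mem_head _ _); have wi := hw i (mem_head _ _).
have g1 : mu.-integrable setT (fun x => (\1_(Z i) x)%:E).
  apply/integrableP; split; first exact/measurable_EFinP.
  rewrite (eq_integral (fun x => (\1_(Z i) x)%:E)).
    by rewrite integral_indic // setIT wi ltry.
  by move=> t _; rewrite gee0_abs // lee_fin.
have g2 : mu.-integrable setT (fun x => (c i * \1_(Z i) x)%:E).
  by under eq_fun do rewrite EFinM; exact: integrableZl.
have e : (fun x : T => (\sum_(j <- i :: s) c j * \1_(Z j) x)%:E) =
    (fun x => (c i * \1_(Z i) x)%:E + (\sum_(j <- s) c j * \1_(Z j) x)%:E)%E.
  by apply: funext => x; rewrite big_cons EFinD.
rewrite e big_cons; split; first exact: integrableD.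
rewrite integralD // h2; under eq_integral do rewrite EFinM.
by rewrite integralZl // integral_indic // setIT wi -EFinM -EFinD.
Qed.

End SimpleIntegral.

(** * Functions on the stable groupoid that depend on finitely many steps *)

Section Windows.
Variables (k : nat) (L : kgraph k) (L_regular : regular_kgraph L).
Hypothesis L_finite : finite_set [set: kobj L].
Local Notation cstn := (cstn k).
Local Notation cz := (cz k).
Implicit Types (x y z : dpath L) (g h : stab L) (l m : kmor L) (n p q : nat).

(** The last [p] diagonal steps of [x] before time [cz n]. *)
Definition win x n p : kmor L := sg x (cz n - cz p) (cstn p).
Definition level n g : Prop := agree (cz n) (stab_r g) (stab_s g).

Lemma win_deg x n p : kdeg (win x n p) = cstn p. Proof. exact: sg_deg. Qed.

Lemma win_lv x n p : win x n p \in lv L (cstn p).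
Proof. by rewrite mem_lv // win_deg. Qed.

Lemma win_s x n p : ks (win x n p) = dvert x (cz n).
Proof. by rewrite sg_s subrK. Qed.

Lemma win_src x y n p q : agree (cz n) x y -> ks (win x n p) = ks (win y n q).
Proof.
move=> /agreeP /(_ 0) h; rewrite !win_s.
by rewrite -(sg_r x _ 0) h sg_r.
Qed.

Lemma win_dglue x n p l : ks l = dvert x (cz n) -> kdeg l = cstn p ->
  win (dglue L_regular (cz n) x l) n p = l.
Proof. by move=> e d; rewrite /win -d -[X in _ - X]/(zvec (cstn p)) -d dglue_sg. Qed.

Lemma win_near j x y n p : (n <= j)%N -> (p <= j)%N -> DB j x y -> win x n p = win y n p.
Proof. by move=> nj pj; apply: DB_sg; zz. Qed.

Lemma level_near j g h n : (n <= j)%N -> SB j g h -> level n g <-> level n h.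
Proof.
move=> nj [a b c d]; split=> H; first exact: (agree_near nj a b H d).
exact: (agree_near nj (esym a) (esym b) H c).
Qed.

Lemma level_le n n' g : (n <= n')%N -> level n g -> level n' g.
Proof. by move=> h; apply: agree_le; exact: cz_le. Qed.

(** As $\Lambda^0$ is finite, only finitely many windows from [- cz n] to [cz n] exist, so an
    ultrafilter on the level concentrates on one compact ball. *)
Lemma level_compact n : compact (level n).
Proof.
apply: ultra_compactP => F FU Fn.
pose f g := (sg (stab_r g) (- cz n) (cstn (n + n)), sg (stab_s g) (- cz n) (cstn (n + n))).
have [||v [_ Fv]] := @ultra_finite _ _ F FU f
  ([set l | kdeg l = cstn (n + n)] `*` [set l | kdeg l = cstn (n + n)]).
- by apply: finite_setX; exact: finite_degree.
- by apply: filterS filterT => g _; split; rewrite /= sg_deg.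
have [g [hg eg]] := filter_ex (filterI Fn Fv).
have FS : F (SB n g).
  apply: filterS (filterI Fn Fv) => h [hh eh]; split=> //.
    by have := etrans eg (esym eh) => -[].
  by have := etrans eg (esym eh) => -[].
have := @SB_compact k L L_regular n g; rewrite compact_ultra => /(_ F FU FS) [x [Kx hx]].
by exists x; split=> //; case: Kx.
Qed.

Section MatrixFunctions.
Variable R : realType.
Local Notation C := (Cx R).
Local Notation Fun := (stab L -> C).
Implicit Types (F G : kmor L -> kmor L -> C).

(* The function on pairs agreeing from [cz n] on whose value is read off from the
   last [p], resp. [q], steps before [cz n] of the two paths. *)
Definition mf n p q F : Fun := fun g =>
  if `[< level n g >] then F (win (stab_r g) n p) (win (stab_s g) n q) else 0.

Lemma mf_in n p q F g : level n g ->
  mf n p q F g = F (win (stab_r g) n p) (win (stab_s g) n q).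
Proof. by move=> h; rewrite /mf asboolT. Qed.

Lemma mf_out n p q F g : ~ level n g -> mf n p q F g = 0.
Proof. by move=> h; rewrite /mf asboolF. Qed.

(** The sub-morphism described by [issub] as a total function; the default [l] is never reached for
    windows that fit. *)
Definition ssub l (c m : ZZ k) (p : NN k) : kmor L := xget l (issub l c m p).

Lemma ssub_sg x (c m : ZZ k) (p r : NN k) : zle c m -> zle (m + zvec r) (c + zvec p) ->
  ssub (sg x c p) c m r = sg x m r.
Proof.
move=> h1 h2; have h := sg_issub x h1 h2; apply: issub_uniq (h).
exact: (@xgetPex _ _ (issub (sg x c p) c m r)) (ex_intro _ _ h).
Qed.

(** The coefficients of the same function read at the later level [n'] with longer windows: the pair
    lies in level [n] exactly when the steps between [cz n] and [cz n'] coincide. *)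
Definition mraise n p q n' p' q' F : kmor L -> kmor L -> C := fun l m =>
  let: c := cz n' - cz p' in let: c' := cz n' - cz q' in
  if ssub l c (cz n) (cstn (n' - n)) == ssub m c' (cz n) (cstn (n' - n))
  then F (ssub l c (cz n - cz p) (cstn p)) (ssub m c' (cz n - cz q) (cstn q))
  else 0.

Lemma level_split n n' g : (n <= n')%N -> level n' g ->
  (level n g <-> sg (stab_r g) (cz n) (cstn (n' - n)) =
                 sg (stab_s g) (cz n) (cstn (n' - n))).
Proof.
move=> nn h'; split=> [/agreeP -> //|e]; apply: (@agree_ext _ _ (cz n) (cstn (n' - n))) => //.
by have -> : cz n + zvec (cstn (n' - n)) = cz n' by zz.
Qed.

Lemma mf_raise n p q n' p' q' F : (n <= n')%N -> (p + (n' - n) <= p')%N ->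
  (q + (n' - n) <= q')%N -> mf n p q F = mf n' p' q' (mraise n p q n' p' q' F).
Proof.
move=> hn hp hq; apply: funext => g.
have [h'|h'] := pselect (level n' g); last first.
  by rewrite !mf_out // => h; apply: h'; exact: level_le h.
rewrite [RHS]mf_in // /mraise /win !ssub_sg; try by zz.
have [h|h] := pselect (level n g).
  by rewrite mf_in // (proj1 (level_split hn h') h) eqxx.
by rewrite mf_out //; case: eqP => // e; case: h; exact/(level_split hn h').
Qed.

Lemma mf_ext n p q F G :
  (forall l m, l \in lv L (cstn p) -> m \in lv L (cstn q) -> ks l = ks m -> F l m = G l m) ->
  mf n p q F = mf n p q G.
Proof.
move=> h; apply: funext => g; have [hg|hg] := pselect (level n g); last by rewrite !mf_out.
by rewrite !mf_in // h ?win_lv //; exact: win_src.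
Qed.

Lemma mf_near n p q F j g h : (n <= j)%N -> (p <= j)%N -> (q <= j)%N ->
  SB j g h -> mf n p q F g = mf n p q F h.
Proof.
move=> nj pj qj s; have e := level_near nj s; case: s => a b _ _.
have [hg|hg] := pselect (level n g); last by rewrite !mf_out // -e.
by rewrite !mf_in ?(win_near nj pj a) ?(win_near nj qj b) // -e.
Qed.

Lemma mf_Cc n p q F : Cc (R := R) (mf n p q F).
Proof.
split; last first.
  by exists (level n); split; [exact: level_compact|move=> g; exact: mf_out].
apply/(@continuous_nn R C^o) => g e e0.
have [j [hj hg]] := lb_at (SB_lbase L) g (maxn n (maxn p q)).
have : nbhs g (SB j g) by exact: (lb_ball (SB_lbase L)).
apply: filterS => h hh; rewrite (mf_near F (g := g) (h := h) (j := j)) ?subrr ?nn0 //; lia.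
Qed.

Lemma mf_add n p q F G : mf n p q F \+ mf n p q G = mf n p q (fun l m => F l m + G l m).
Proof.
apply: funext => g /=; have [h|h] := pselect (level n g); last by rewrite !mf_out // addr0.
by rewrite !mf_in.
Qed.

Lemma mf_scale n p q F (z : C) :
  (fun g => z * mf n p q F g) = mf n p q (fun l m => z * F l m).
Proof.
apply: funext => g /=; have [h|h] := pselect (level n g); last by rewrite !mf_out // mulr0.
by rewrite !mf_in.
Qed.

Lemma mf_involution n p q F :
  involution (G := stable_groupoid L) (mf n p q F) = mf n q p (fun l m => (F m l)^*).
Proof.
apply: funext => g; rewrite /involution /=.
have e : level n (stab_inv g) <-> level n g.
  by split=> h m hm; rewrite /= h.
have [h|h] := pselect (level n g); last by rewrite !mf_out ?conj0 // e.
by rewrite !mf_in // e.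
Qed.

End MatrixFunctions.
End Windows.

(** * The Haar system and convolution of window functions *)

Section Convolution.
Variables (R : realType) (k : nat) (L : kgraph k) (L_regular : regular_kgraph L).
Hypothesis L_finite : finite_set [set: kobj L].
Local Notation C := (Cx R).
Local Notation cstn := (cstn k).
Local Notation cz := (cz k).
Local Notation G := (stable_groupoid L).
Implicit Types (x y z u : dpath L) (g h : stab L) (l m v : kmor L) (n p q : nat).
Implicit Types (F : kmor L -> kmor L -> C).
Variables (t : 'I_k -> R) (a : kobj L -> R).
Hypotheses (t0 : forall i, 0 < t i) (a0 : forall w : kobj L, 0 < a w).
Variables (mu : forall x : dpath L, {measure set (borel x) -> \bar R})
  (haar : forall x : gobj G, {measure set (borel (gid x)) -> \bar R}).
Hypotheses (hmu : is_past_measure t a mu) (hhaar : is_stable_haar t mu haar).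

(** The Haar mass of the arrows of level [n] with a fixed range whose source has the window [v] of
    length [p]; see [zbox_measure]. *)
Definition wt n p v : R := tpow t (cstn n) * ((tpow t (cstn p))^-1 * a (kr v)).

Lemma tpow_gt0 (p : NN k) : 0 < tpow t p.
Proof. by apply: prodr_gt0 => i _; rewrite exprn_gt0. Qed.

Lemma wt_gt0 n p v : 0 < wt n p v.
Proof. by rewrite !mulr_gt0 ?invr_gt0 ?tpow_gt0. Qed.

Lemma wt_diag n v : wt n n v = a (kr v).
Proof. by rewrite /wt mulrA divff ?mul1r // gt_eqF ?tpow_gt0. Qed.

Definition zbox u n p v : set (stab L) :=
  [set g | [/\ stab_r g = u, level n g & win (stab_s g) n p = v]].

Definition pbox u n p v : set (dpath L) :=
  [set z | agree (cz n) u z /\ win z n p = v].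

Lemma agree_closed (m : ZZ k) x : closed (agree m x).
Proof.
move=> z hz; apply/agreeP => p; have [j [h1 h2]] := seg_bound m p.
have [|y [/agreeP e hy]] := hz (DB j z); first exact: (lb_ball (DB_lbase L)).
by rewrite e; exact: esym (DB_sg h1 h2 hy).
Qed.

Lemma closed_borel (T : topologicalType) (t1 : T) (A : set T) :
  closed A -> measurable (A : set (borel t1)).
Proof.
move=> cA; rewrite -[A]setCK; apply: measurableC; apply: borel_open.
exact: closed_openC.
Qed.

Lemma pbox_borel u n p v : <<s @open (dpath L) >> (pbox u n p v).
Proof.
have -> : pbox u n p v = agree (cz n) u `&` [set z | win z n p = v] by [].
have o : open [set z | win z n p = v].
  rewrite openE => z hz; apply/(lb_nbhs (DB_lbase L)); exists (maxn n p); split=> // y hy.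
  by rewrite /= -hz; apply/esym; apply: win_near hy; lia.
pose x0 := u.
have mA : measurable (agree (cz n) u : set (borel x0)) by apply: closed_borel; exact: agree_closed.
have mB : measurable ([set z | win z n p = v] : set (borel x0)) by exact: borel_open.
exact: measurableI mA mB.
Qed.

Lemma borel_measurable_fun (T U : topologicalType) (t1 : T) (u1 : U) (f : T -> U) :
  continuous f -> measurable_fun setT (f : borel t1 -> borel u1).
Proof.
move=> cf; apply: (@measurability _ _ (borel t1) (borel u1) setT f (@open U) erefl).
by move=> _ [B oB <-]; rewrite setTI; apply: borel_open; exact: continuous_lb.
Qed.

Lemma stab_preimage_measurable u (f : stab L -> dpath L) (A : set (dpath L)) :
  continuous f -> <<s @open (dpath L) >> A ->
  measurable (f @^-1` A : set (borel (@gid G u))).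
Proof.
move=> cf mA; have := @borel_measurable_fun _ _ (@gid G u) u f cf.
by move=> /(_ measurableT _ mA); rewrite setTI.
Qed.

Lemma future_setP x y : future_set x y <-> agree 0 x y.
Proof.
split=> [h n hn|h m n hmn m0]; first by apply/esym/h; zz.
have /agreeP e := agree_le m0 h; by rewrite !darr_sg e.
Qed.

Lemma agree_dshift (m i : ZZ k) x y :
  agree i (dshift m x) (dshift m y) <-> agree (i + m) x y.
Proof.
by split=> /agreeP h; apply/agreeP => p; have := h p; rewrite !sg_shift.
Qed.

(** Shifting by [cz n] turns the set of sources into a cylinder among the paths with a prescribed
    future, whose measure is given, and the Haar system contributes the factor $t^{(n,\dots,n)}$.
    Fixing the range costs nothing, since the complement of the fibre is null. *)
Lemma zbox_measure u n p v : kdeg v = cstn p -> ks v = dvert u (cz n) ->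
  measurable (zbox u n p v : set (borel (@gid G u))) /\
  haar u (zbox u n p v) = (wt n p v)%:E.
Proof.
move=> dv sv; have [h1 h2] := hhaar u.
have cs := @stab_s_continuous k L; have cr := @stab_r_continuous k L.
have mV := stab_preimage_measurable (u := u) cs (pbox_borel u n p v).
have bu : <<s @open (dpath L) >> [set u].
  have cu : closed [set u].
    by apply: accessible_closed_set1; apply: hausdorff_accessible; exact: dpath_hausdorff.
  exact: (closed_borel (t1 := u) cu).
have mr := stab_preimage_measurable (u := u) cr bu.
have e : zbox u n p v = (@stab_s k L @^-1` pbox u n p v) `&` (@stab_r k L @^-1` [set u]).
  by apply/seteqP; split=> g; [move=> [<- b c]; split; [split|]|move=> [[b c] e]; rewrite -e in b; split].
have mZ : measurable (zbox u n p v : set (borel (@gid G u))) by rewrite e; exact: measurableI.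
split=> //.
have hV : haar u (@stab_s k L @^-1` pbox u n p v) = (wt n p v)%:E.
  have sub : pbox u n p v `<=` stable_piece u (cstn n).
    move=> z [hz _]; exists (dshift (cz n) z); last by rewrite dshiftK.
    by apply/future_setP/agree_dshift; rewrite add0r.
  rewrite [LHS](h2 (cstn n) _ (pbox_borel u n p v) sub).
  have [_ hm] := hmu (dshift (zvec (cstn n)) u).
  have e2 : dshift (zvec (cstn n)) @` pbox u n p v =
      future_set (dshift (zvec (cstn n)) u) `&` dcyl v (- zvec (kdeg v)).
    have cyl z : dcyl v (- zvec (kdeg v)) (dshift (zvec (cstn n)) z) <-> win z n p = v.
      change (sg (dshift (cz n) z) (- zvec (kdeg v)) (kdeg v) = v <-> win z n p = v).
      by rewrite sg_shift /win dv addrC.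
    apply/seteqP; split=> [_ [z [hz hw] <-]|z' [hf hc]].
      split; last exact/cyl.
      by apply/future_setP/agree_dshift; rewrite add0r.
    exists (dshift (- zvec (cstn n)) z'); last exact: dshiftNK.
    split; last by apply/cyl; rewrite dshiftNK.
    move/future_setP: hf; rewrite -{1}(dshiftNK (cz n) z') => /agree_dshift.
    by rewrite add0r.
  rewrite e2 hm ?sv //=; last by rewrite add0r.
  by rewrite dv -EFinM.
rewrite -hV [in RHS](_ : _ @^-1` _ = zbox u n p v `|`
    ((@stab_s k L @^-1` pbox u n p v) `&` ~` (@stab_r k L @^-1` [set u]))).
  rewrite measureU0 //; first by apply: measurableI => //; exact: measurableC.
  apply: (subset_measure0 _ _ _ h1); last by move=> g [_].
    by apply: measurableI => //; exact: measurableC.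
  exact: measurableC.
by rewrite e -setIUr setUCr setIT.
Qed.

Definition src_lv x n p : seq (kmor L) :=
  [seq v <- lv L (cstn p) | ks v == dvert x (cz n)].

Lemma box_sum (K : pzRingType) u n p (c : kmor L -> K) (e : stab L) :
  \sum_(v <- src_lv u n p) c v * \1_(zbox u n p v) e =
  if `[< stab_r e = u /\ level n e >] then c (win (stab_s e) n p) else 0.
Proof.
case: asboolP => [[er el]|ne]; last first.
  rewrite big1 // => v _; rewrite indicE memNset ?mulr0 // => -[h1 h2 _].
  exact: ne.
have hw : win (stab_s e) n p \in src_lv u n p.
  rewrite mem_filter win_lv // andbT win_s -er.
  by move/agreeP: el => /(_ 0) h; rewrite -(sg_r _ _ 0) -h sg_r eqxx.
rewrite (bigD1_seq _ hw) ?filter_uniq ?uniq_lv //= big1 ?addr0.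
  by rewrite indicE mem_set ?mulr1.
by move=> v /eqP nv; rewrite indicE memNset ?mulr0 // => -[_ _ h]; apply: nv.
Qed.

Lemma box_integral u n p (c : kmor L -> R) (f : stab L -> R) :
  (forall e, f e = if `[< stab_r e = u /\ level n e >]
                   then c (win (stab_s e) n p) else 0) ->
  (haar u).-integrable setT (fun e : borel (@gid G u) => (f e)%:E) /\
  (\int[haar u]_e (f e)%:E = (\sum_(v <- src_lv u n p) wt n p v * c v)%:E)%E.
Proof.
move=> hf; have hz v : v \in src_lv u n p ->
    measurable (zbox u n p v : set (borel (@gid G u))) /\
    haar u (zbox u n p v) = (wt n p v)%:E.
  rewrite mem_filter mem_lv // => /andP[/eqP sv /eqP dv].
  exact: zbox_measure.
have [h' h] := @integral_simple R _ (borel (@gid G u)) (haar u) _ (src_lv u n p)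
  (zbox u n p) (wt n p) (fun v hv => (hz v hv).1) (fun v hv => (hz v hv).2) c.
rewrite (eq_bigr (fun v => c v * wt n p v)) -?h; last by move=> v _; rewrite mulrC.
have -> : (fun e : borel (@gid G u) => (f e)%:E) = (fun e : borel (@gid G u) =>
    (\sum_(v <- src_lv u n p) c v * \1_(zbox u n p v) e)%:E).
  by apply: funext => e; rewrite hf box_sum.
by split.
Qed.

Lemma box_cint u n p (c : kmor L -> C) (f : stab L -> C) :
  (forall e, f e = if `[< stab_r e = u /\ level n e >]
                   then c (win (stab_s e) n p) else 0) ->
  cint (haar u) f = \sum_(v <- src_lv u n p) rC (wt n p v) * c v.
Proof.
move=> hf; rewrite /cint /Rintegral.
rewrite (@box_integral u n p (fun v => Cre (c v)) _ _).2; last by move=> e; rewrite hf; case: ifP.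
rewrite (@box_integral u n p (fun v => Cim (c v)) _ _).2; last by move=> e; rewrite hf; case: ifP.
rewrite /fine; elim: (src_lv u n p) => [|v r IH]; first by rewrite !big_nil.
rewrite !big_cons -IH; apply: Ceq; rewrite ?CreD ?CimD; congr (_ + _).
  by case: (c v) => x y; rewrite /Cre /= mul0r subr0.
by case: (c v) => x y; rewrite /Cim /= mul0r addr0.
Qed.

(** Matrix multiplication weighted by the Haar masses of the intermediate windows [v]; only windows
    ending at the vertex where the paths join occur. *)
Definition wmul n q F F' : kmor L -> kmor L -> C := fun l m =>
  \sum_(v <- lv L (cstn q) | ks v == ks l) rC (wt n q v) * (F l v * F' v m).

Definition integrand (f f' : stab L -> C) (c e : stab L) : C :=
  if pselect (@gs G c = @gr G e) is left h then f (@gmul G c e h) * f' (@ginv G e) else 0.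

Definition wprod n p q r F F' c v : C := if `[< level n c >]
  then F (win (stab_r c) n p) v * F' v (win (stab_s c) n r) else 0.

Lemma integrand_mf n p q r F F' c e : integrand (mf n p q F) (mf n q r F') c e =
  if `[< stab_r e = stab_s c /\ level n e >]
  then wprod n p q r F F' c (win (stab_s e) n q) else 0.
Proof.
rewrite /integrand /=.
case: pselect => [h|h]; last by rewrite asboolF // => -[e1 _]; apply: h.
have h1 : stab_s c = stab_r e := h.
have [he|he] := pselect (level n e); last first.
  rewrite asboolF; last by case.
  rewrite [X in _ * X]mf_out ?mulr0 // => h'; apply: he => m hm.
  by have := h' m hm; rewrite /= => ->.
rewrite asboolT; last by split=> //; exact: esym h1.
have hi : level n (stab_inv e) by move=> m hm; rewrite /= he.
rewrite [X in _ * X](mf_in _ _ _ hi) /= /wprod.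
have hm : level n (stab_mul h) <-> level n c.
  split=> h' m hm; first by have := h' m hm; rewrite /= -he // h1.
  by have := h' m hm; rewrite /= => ->; rewrite -he // h1.
have [hc|hc] := pselect (level n c); last by rewrite asboolF // mf_out ?mul0r // hm.
by rewrite asboolT // (mf_in _ _ _ (hm.2 hc)) /= h1.
Qed.

(** The integrand lives on the arrows of level [n] and depends only on the window of their source,
    so the integral is a finite weighted sum. *)
Lemma convolution_mf n p q r F F' :
  convolution haar (mf n p q F) (mf n q r F') = mf n p r (wmul n q F F').
Proof.
apply: funext => c; rewrite /convolution /=.
rewrite (box_cint (integrand_mf n p q r F F' c)) /wprod.
have [h|h] := pselect (level n c); last first.
  by rewrite asboolF // mf_out // big1 // => v _; rewrite mulr0.
rewrite asboolT // mf_in // /wmul /src_lv big_filter.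
apply: eq_bigl => v; congr (_ == _); rewrite win_s.
by move/agreeP: h => /(_ 0) h; rewrite -!(sg_r _ _ 0) h.
Qed.

Lemma Cc_nn_measurable u (f : stab L -> C) : continuous f ->
  measurable_fun setT (fun c : borel (@gid G u) => (Cre `|f c|)%:E).
Proof.
move=> cf; apply/measurable_EFinP.
apply: (@borel_continuous R (stab L) (@gid G u) (fun c => nn (f c))) => c A /nbhs_ballP [e /= e0 sA].
have /(@continuous_nn R C^o) /(_ c e e0) := cf.
apply: filterS => d hd; apply: sA; rewrite /ball /=; apply: le_lt_trans hd.
by rewrite ler_norml; have := nn_le_tri (f c) (f d); have := nn_le_tri (f d) (f c);
  rewrite (nnB (f d)); lra.
Qed.

(** The function is dominated by [r] on level [n] and by 0 elsewhere; windows of length 0 are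
    vertices, so the sum bounds the mass of level [n] in every fibre. *)
Lemma Inorm_le (f : stab L -> C) n (r : R) : continuous f -> 0 <= r ->
  (forall g, ~ level n g -> f g = 0) -> (forall g, nn (f g) <= r) ->
  (Inorm haar f <= (r * \sum_(v <- lv L (cstn 0)) wt n 0 v)%:E)%E.
Proof.
move=> cf r0 hf hr.
have key u (f' : stab L -> C) : continuous f' -> (forall g, ~ level n g -> f' g = 0) ->
   (forall g, nn (f' g) <= r) ->
   (\int[haar u]_c (Cre `|f' c|)%:E <= (r * \sum_(v <- lv L (cstn 0)) wt n 0 v)%:E)%E.
  move=> cf' hf' hr'.
  pose b (e : stab L) := if `[< stab_r e = u /\ level n e >] then r else 0.
  have [ib eb] := @box_integral u n 0 (fun=> r) b (fun=> erefl).
  apply: (@le_trans _ _ (\int[haar u]_c (b c)%:E)%E).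
    apply: ae_ge0_le_integral => //.
    - by move=> c _; rewrite lee_fin; exact: (nn_ge0 (f' c)).
    - exact: Cc_nn_measurable.
    - by move=> c _; rewrite lee_fin /b; case: ifP.
    - exact: (measurable_int _ ib).
    (* Domination by [b] holds on the range fibre of [u] only, so the comparison is almost
       everywhere. *)
    have [h1 _] := hhaar u.
    exists [set g : borel (@gid G u) | gr (g : garr G) <> u]; split=> //.
      have cr := @stab_r_continuous k L.
      have cu : closed [set u].
        by apply: accessible_closed_set1; apply: hausdorff_accessible; exact: dpath_hausdorff.
      have := stab_preimage_measurable (u := u) cr (closed_borel (t1 := u) cu).
      exact: measurableC.
    move=> c /= hc e; apply: hc => _; rewrite lee_fin.
    have [h|h] := pselect (level n c).
      by rewrite /b asboolT //; exact: hr'.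
    have z0 : nn (f' c) = 0 by rewrite hf' // nn0.
    have b0 : nn (f' c) <= b c by rewrite z0 /b; case: ifP.
    exact: b0.
  rewrite eb lee_fin mulr_sumr /src_lv big_filter big_mkcond /=.
  by apply: ler_sum => v _; case: ifP => _; rewrite mulrC // mulr_ge0 // ltW // wt_gt0.
rewrite /Inorm ge_max; apply/andP; split; apply: ge_ereal_sup => _ [u _ <-].
  exact: key.
apply: (key u (fun g => f (stab_inv g))) => [|g hg|g]; last exact: hr.
  have [_ _ _ _ _ ci _] := stab_lchg L_regular.
  by move=> g; apply: continuous_comp; [exact: ci|exact: cf].
by apply: hf => h; apply: hg => m hm; rewrite (h m hm).
Qed.

End Convolution.

(** * Approximation of $C_c(G_s)$ by window functions *)

Section Approximation.
Variables (R : realType) (k : nat) (L : kgraph k) (L_regular : regular_kgraph L).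
Hypothesis L_finite : finite_set [set: kobj L].
Local Notation C := (Cx R).
Implicit Types (g h : stab L) (f : stab L -> C) (n : nat).

Lemma Cc_level f : Cc (R := R) f -> exists n, forall g, ~ level n g -> f g = 0.
Proof.
move=> [_ [K [/compact_level [n hn] hK]]]; exists n => g hg.
by apply: hK => /hn.
Qed.

(** Uniform continuity with respect to the balls [SB]. Off [K] the function vanishes, and balls are
    symmetric, so it suffices that one of the two arrows lies in [K]. *)
Lemma Cc_uniform f (e : R) : Cc (R := R) f -> 0 < e ->
  exists N, forall i g h, (N <= i)%N -> SB i g h -> nn (f g - f h) < e.
Proof.
move=> [cf [K [cK hK]]] e0.
pose P i g := forall h, SB i g h -> nn (f g - f h) < e.
have [|N _ hN] := (compact_near_coveringP K).1 cK nat \oo P _.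
  move=> g _; have e2 : 0 < e / 2 by rewrite divr_gt0.
  have /(@continuous_nn R C^o) /(_ g _ e2) := cf.
  move/(lb_nbhs (SB_lbase L)) => [j [hj sj]].
  exists (SB j g, [set i | (j <= i)%N]) => /=.
    by split; [exact: (lb_ball (SB_lbase L) hj) | exists j].
  move=> [h i] /= [gh ji] h' hh'.
  have jj : SB j h h by exact: SB_trans (SB_sym gh) gh.
  have gh' : SB j g h' by exact: SB_trans gh (SB_mono ji jj hh').
  apply: (le_lt_trans (nn_tri (f g : C^o) _ _)); rewrite [ltRHS](splitr e) ltrD //.
    by rewrite nnB; exact: sj.
  exact: sj.
exists N => i g h Ni s; have hP := hN i Ni.
have [Kg|Kg] := pselect (K g); first exact: (hP g Kg).
have [Kh|Kh] := pselect (K h); first by rewrite nnB; apply: (hP h Kh); exact: SB_sym.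
by rewrite !hK // subrr nn0.
Qed.

Lemma SB_win N g h : level N g -> level N h ->
  win (stab_r g) N (N + N) = win (stab_r h) N (N + N) ->
  win (stab_s g) N (N + N) = win (stab_s h) N (N + N) -> SB N g h.
Proof.
have e : cz k N - cz k (N + N) = - cz k N by zz.
by move=> hg hh; rewrite /win e => h1 h2; split.
Qed.

(** Sample [f] at one arrow for each pair of windows. Windows of length [N + N] before [cz N] reach
    back to [- cz N], so arrows with equal windows lie in one ball [SB N]; balls do not leave level
    [n], so vanishing off it is preserved. *)
Lemma mf_approx f n (e : R) : Cc (R := R) f -> (forall g, ~ level n g -> f g = 0) ->
  0 < e -> exists N F, [/\ (n <= N)%N,
    forall g, nn (f g - mf N (N + N) (N + N) F g) <= e &
    forall g, ~ level n g -> mf N (N + N) (N + N) F g = 0].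
Proof.
move=> cf hf e0; have [N0 hN] := Cc_uniform cf e0; pose N := maxn n N0.
pose Q l m g := [/\ level N g, win (stab_r g) N (N + N) = l & win (stab_s g) N (N + N) = m].
pose F l m : C := if pselect (exists g, Q l m g) is left h then f (sval (cid h)) else 0.
have FP g : level N g -> exists g', SB N g g' /\
    mf N (N + N) (N + N) F g = f g'.
  move=> hg; rewrite mf_in // /F; case: pselect => [h|[]]; last by exists g.
  case: cid => g' [h1 h2 h3] /=; exists g'; split=> //; exact: SB_win.
have nN : (n <= N)%N by exact: leq_maxl.
exists N, F; split=> // g.
  have [hg|hg] := pselect (level N g).
    by have [g' [s ->]] := FP g hg; apply/ltW/(hN N) => //; exact: leq_maxr.
  rewrite mf_out // hf ?subrr ?nn0 ?ltW // => h; apply: hg; exact: level_le h.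
move=> ng; have [hg|hg] := pselect (level N g); last by rewrite mf_out.
have [g' [s ->]] := FP g hg; apply: hf => h; apply: ng.
exact/(level_near nN s).
Qed.

End Approximation.

Section CcAlgebra.
Variables (R : realType) (T : topologicalType).
Local Notation C := (Cx R).
Implicit Types f g : T -> C.

Lemma continuous_addC f g : continuous f -> continuous g -> continuous (f \+ g).
Proof.
move=> cf cg; apply/(@continuous_nn R C^o) => x e e0; have e2 : 0 < e / 2 by rewrite divr_gt0.
have /(@continuous_nn R C^o) /(_ x _ e2) h1 := cf.
have /(@continuous_nn R C^o) /(_ x _ e2) h2 := cg.
apply: filterS (filterI h1 h2) => y [h3 h4].
have -> : (f \+ g) x - (f \+ g) y = (f x - f y : C^o) + (g x - g y).
  by rewrite /= opprD addrACA.
by apply: (le_lt_trans (nnD _ _)); rewrite [ltRHS](splitr e) ltrD.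
Qed.

Lemma Cc_add f g : Cc (R := R) f -> Cc (R := R) g -> Cc (R := R) (f \+ g).
Proof.
move=> [cf [K [cK hK]]] [cg [K' [cK' hK']]]; split; first exact: (continuous_addC cf cg).
exists (K `|` K'); split; first exact: compactU.
by move=> x hx /=; rewrite hK ?hK' ?addr0 // => h; apply: hx; [right|left].
Qed.

Lemma Cc_scale (z : C) f : Cc (R := R) f -> Cc (R := R) (fun x => z * f x).
Proof.
move=> [cf [K [cK hK]]]; split; last first.
  by exists K; split=> // x hx; rewrite hK // mulr0.
apply/(@continuous_nn R C^o) => x e e0.
have M0 : 0 < nn z + 1 by rewrite ltr_wpDl // nn_ge0.
have /(@continuous_nn R C^o) /(_ x _ (divr_gt0 e0 M0)) h1 := cf.
apply: filterS h1 => y; rewrite ltr_pdivlMr // => h.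
rewrite -mulrBr nnM; apply: le_lt_trans h; rewrite mulrC ler_wpM2l ?nn_ge0 //.
by rewrite lerDl ler01.
Qed.

End CcAlgebra.

(** * The image of window functions in $S$ and the AF property *)

Section GroupoidAlgebraLevels.
Variables (R : realType) (k : nat) (L : kgraph k) (L_regular : regular_kgraph L).
Hypothesis L_finite : finite_set [set: kobj L].
Local Notation C := (Cx R).
Local Notation cstn := (cstn k).
Local Notation cz := (cz k).
Local Notation G := (stable_groupoid L).
Local Notation "a ** b" := (cmul a b) (at level 40, left associativity).
Local Notation "a ^#" := (cstar a) (at level 2, format "a ^#").
Implicit Types (f g : stab L -> C) (l m v : kmor L) (n p q : nat).
Implicit Types (F : kmor L -> kmor L -> C).
Variables (t : 'I_k -> R) (a : kobj L -> R).
Hypotheses (t0 : forall i, 0 < t i) (a0 : forall w : kobj L, 0 < a w).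
Variables (mu : forall x : dpath L, {measure set (borel x) -> \bar R})
  (haar : forall x : gobj G, {measure set (borel (gid x)) -> \bar R}).
Hypotheses (hmu : is_past_measure t a mu) (hhaar : is_stable_haar t mu haar).
Variables (S : cstar_algebra R) (iota : (stab L -> C) -> S).
Hypothesis hiota : is_groupoid_algebra haar iota.
Local Notation wmul n q := (wmul t a n q).

Definition iota_mf n p q F : S := iota (mf n p q F).
Local Notation um := iota_mf.

Lemma iotaD f g : Cc (R := R) f -> Cc (R := R) g -> iota (f \+ g) = iota f + iota g.
Proof. by have [[h _ _ _ _] _ _] := hiota; exact: h. Qed.

Lemma iotaZ (z : C) f : Cc (R := R) f -> iota (fun c => z * f c) = z *: iota f.
Proof. by have [[_ h _ _ _] _ _] := hiota; exact: h. Qed.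

Lemma iotaB f g : Cc (R := R) f -> Cc (R := R) g ->
  iota (f \+ (fun c => -1 * g c)) = iota f - iota g.
Proof.
move=> hf hg; rewrite iotaD ?iotaZ ?scaleN1r //; exact: Cc_scale.
Qed.

Lemma iota_le f (r : R) : Cc (R := R) f -> (Inorm haar f <= r%:E)%E -> nn (iota f) <= r.
Proof.
move=> hf h; have [[_ _ _ _ hI] _ _] := hiota.
by rewrite -lee_fin; apply: le_trans h; exact: hI.
Qed.

Let cmf n p q F := mf_Cc (R := R) L_regular L_finite n p q F.

Lemma umD n p q F F' : um n p q F + um n p q F' = um n p q (fun l m => F l m + F' l m).
Proof. by rewrite /iota_mf -mf_add iotaD. Qed.

Lemma umZ n p q (z : C) F : z *: um n p q F = um n p q (fun l m => z * F l m).
Proof. by rewrite /iota_mf -mf_scale iotaZ. Qed.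

Lemma um_mul n p q r F F' : um n p q F ** um n q r F' = um n p r (wmul n q F F').
Proof.
have [[_ _ h _ _] _ _] := hiota.
by rewrite /iota_mf -h // (convolution_mf L_regular L_finite hmu hhaar).
Qed.

Lemma um_star n p q F : (um n p q F)^# = um n q p (fun l m => (F m l)^*).
Proof. by have [[_ _ _ h _] _ _] := hiota; rewrite /iota_mf -h // mf_involution. Qed.

Lemma um_raise n p q n' p' q' F : (n <= n')%N -> (p + (n' - n) <= p')%N ->
  (q + (n' - n) <= q')%N -> um n p q F = um n' p' q' (mraise n p q n' p' q' F).
Proof. by move=> *; rewrite /iota_mf -mf_raise. Qed.

Lemma um_ext n p q F F' :
  (forall l m, l \in lv L (cstn p) -> m \in lv L (cstn q) -> ks l = ks m ->
     F l m = F' l m) -> um n p q F = um n p q F'.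
Proof. by move=> h; rewrite /iota_mf (mf_ext L_regular L_finite n h). Qed.

Lemma um0 n p q : um n p q (fun _ _ => 0) = 0.
Proof.
have h := umZ n p q 0 (fun _ _ => 0); rewrite scale0r in h; rewrite [RHS]h.
by apply: um_ext => l m _ _ _; rewrite mul0r.
Qed.

Lemma um_sum n p q (I : Type) (s : seq I) (P : pred I) (F : I -> kmor L -> kmor L -> C) :
  \sum_(i <- s | P i) um n p q (F i) = um n p q (fun l m => \sum_(i <- s | P i) F i l m).
Proof.
elim: s => [|i s IH].
  by rewrite big_nil -(um0 n p q); apply: um_ext => l m _ _ _; rewrite big_nil.
rewrite big_cons IH; case: ifP => hi; last first.
  by apply: um_ext => l m _ _ _; rewrite big_cons hi.
by rewrite umD; apply: um_ext => l m _ _ _; rewrite big_cons hi.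
Qed.

Lemma um_delta_sum n p q F : um n p q F = \sum_(l <- lv L (cstn p))
  \sum_(m <- lv L (cstn q)) F l m *: um n p q (fun i j => ((i == l) && (j == m))%:R).
Proof.
under eq_bigr => l _ do (under eq_bigr => m _ do rewrite umZ; rewrite um_sum).
rewrite um_sum; apply: um_ext => i j hi hj _.
rewrite (bigD1_seq i) ?uniq_lv //= [X in _ = _ + X]big1 ?addr0; last first.
  by move=> l li; rewrite big1 // => m _; rewrite eq_sym (negPf li) mulr0.
rewrite (bigD1_seq j) ?uniq_lv //= !eqxx mulr1 big1 ?addr0 // => m mj.
by rewrite [j == m]eq_sym (negPf mj) andbF mulr0.
Qed.

(** The $I$-norm bounds the norm of $S$, and on functions supported in one level it is controlled by
    the supremum. *)
Lemma um_dense x (e : R) : 0 < e ->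
  exists N F, nn (x - um N (N + N) (N + N) F) < e.
Proof.
move=> e0; have [_ hd _] := hiota.
have : closure (iota @` @Cc R (garr G)) x by rewrite hd.
move/closure_nn => /(_ (e / 2)) []; first by rewrite divr_gt0.
move=> _ [f cf <-] h; have [n hn] := Cc_level cf.
(* [M] bounds the fibre mass of the level of [f] and does not depend on the finer level [N] of the
   approximation. *)
pose M := \sum_(v <- lv L (cstn 0)) wt t a n 0 v.
have M0 : 0 <= M by apply: sumr_ge0 => v _; rewrite ltW // wt_gt0.
have M1 : 0 < M + 1 by rewrite ltr_wpDl.
have [|N [F [nN h1 h2]]] := mf_approx cf hn (e := e / 2 / (M + 1)).
  by rewrite !divr_gt0.
exists N, F; apply: (le_lt_trans (nn_tri (iota f) _ _)); rewrite [ltRHS](splitr e).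
apply: ltr_leD => //; rewrite -iotaB //.
have cB : Cc (R := R) (f \+ (fun c => -1 * mf N (N + N) (N + N) F c)).
  by apply: Cc_add => //; exact: Cc_scale.
apply: iota_le => //.
apply: (le_trans (Inorm_le L_regular L_finite t0 a0 hmu hhaar (n := n)
  (r := e / 2 / (M + 1)) _ _ _ _)).
- by case: cB.
- by rewrite ltW // !divr_gt0.
- by move=> g hg /=; rewrite hn // h2 // mulr0 addr0.
- by move=> g /=; rewrite mulN1r; exact: h1.
rewrite lee_fin -/M mulrAC ler_pdivrMr //; apply: ler_wpM2l; first by rewrite ltW // divr_gt0.
by rewrite lerDl.
Qed.

(** Windows from [- cz n] to [cz n] are finite in number, so the functions of level [n] read off
    from them form a finite-dimensional algebra; the algebras increase by [um_raise] and are dense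
    together by [um_dense]. *)
Lemma groupoid_algebra_AF : AF_algebra S.
Proof.
exists (fun n => [set x | exists F, x = um n (n + n) (n + n) F]); split.
- move=> n; split; first split.
  + by exists (fun _ _ => 0); rewrite um0.
  + by move=> _ _ [F ->] [F' ->]; rewrite umD; eexists.
  + by move=> z _ [F ->]; rewrite umZ; eexists.
  + by move=> _ _ [F ->] [F' ->]; rewrite um_mul; eexists.
  + by move=> _ [F ->]; rewrite um_star; eexists.
  pose s := [seq (l, m) | l <- lv L (cstn (n + n)), m <- lv L (cstn (n + n))].
  exists (size s), (fun i => um n (n + n) (n + n)
    (fun l m => ((l == (tnth (in_tuple s) i).1) && (m == (tnth (in_tuple s) i).2))%:R)).
  move=> _ [F ->]; exists (fun i => F (tnth (in_tuple s) i).1 (tnth (in_tuple s) i).2).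
  rewrite um_delta_sum -[RHS](big_tuple _ _ (in_tuple s) xpredT (fun lm => F lm.1 lm.2 *:
    um n (n + n) (n + n) (fun l m => ((l == lm.1) && (m == lm.2))%:R))) /=.
  by rewrite /s big_allpairs_dep.
- by move=> n _ [F ->]; eexists; apply: um_raise; lia.
apply/seteqP; split=> // x _; apply/closure_nn => e e0.
by have [N [F h]] := um_dense x e0; exists (um N (N + N) (N + N) F) => //; exists N => //; exists F.
Qed.

End GroupoidAlgebraLevels.

(** * Passing convolution to uniform limits of window functions *)

Lemma Rintegral_bound (R : realType) d (T : measurableType d)
    (mu : {measure set T -> \bar R}) (g B : T -> R) (e : R) :
  mu.-integrable setT (fun x => (g x)%:E) -> mu.-integrable setT (fun x => (B x)%:E) ->
  (forall x, `|g x| <= e * B x) -> `|\int[mu]_x g x| <= e * \int[mu]_x B x.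
Proof.
move=> ig iB h.
have := @le_normr_Rintegral _ T R mu setT g measurableT ig.
move/le_trans; apply.
rewrite -RintegralZl //; apply: le_Rintegral => //; first exact: integrable_norm ig.
have := @integrableZl _ T R mu setT measurableT e _ iB.
by apply: eq_integrable => // x _; rewrite /= EFinM.
Qed.

Section UniformLimit.
Variables (R : realType) (d : measure_display) (T : measurableType d).
Variables (mu : {measure set T -> \bar R}) (g B : T -> R) (s : nat -> T -> R).
Hypotheses (is_ : forall i, mu.-integrable setT (fun x => (s i x)%:E))
  (iB : mu.-integrable setT (fun x => (B x)%:E))
  (B0 : forall x, 0 <= B x)
  (hs : forall e : R, 0 < e -> exists N, forall i, (N <= i)%N ->
     forall x, `|g x - s i x| <= e * B x).

(** The error is measured against the integrable weight [B], so [g] is dominated by [B] plus the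
    modulus of one approximant. *)
Lemma uniform_limit_integrable : mu.-integrable setT (fun x => (g x)%:E).
Proof.
have mg : measurable_fun setT g.
  apply: (@measurable_fun_cvg _ _ _ setT s) => [i|x _].
    by apply/measurable_EFinP; exact: measurable_int (is_ i).
  apply/cvgrPdist_le => e e0.
  have M0 : 0 < B x + 1 by rewrite ltr_wpDl.
  have [N hN] := hs (divr_gt0 e0 M0).
  exists N => // i /= Ni; apply: (le_trans (hN i Ni x)).
  by rewrite mulrAC ler_pdivrMr // ler_wpM2l ?(ltW e0) // lerDl.
have [N hN] := hs ltr01; have {}hN := hN N (leqnn N).
apply: (@le_integrable _ _ _ _ _ _ _ (fun x => (`|s N x| + B x)%:E)) => //.
- exact/measurable_EFinP.
- move=> x _; rewrite /= lee_fin.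
  rewrite [leRHS]ger0_norm; last by rewrite addr_ge0.
  have := hN x; rewrite mul1r => h; apply: le_trans (lerD (lexx _) h).
  by have := ler_normD (s N x) (g x - s N x); rewrite addrC subrK.
- under eq_fun do rewrite EFinD.
  by apply: integrableD => //; exact: integrable_norm (is_ N).
Qed.

End UniformLimit.

Section LocalFunctions.
Variables (R : realType) (k : nat) (L : kgraph k) (L_regular : regular_kgraph L).
Hypothesis L_finite : finite_set [set: kobj L].
Local Notation C := (Cx R).
Local Notation cstn := (cstn k).
Local Notation cz := (cz k).
Local Notation G := (stable_groupoid L).
Implicit Types (f b u v : stab L -> C) (g : stab L) (n p q N : nat).
Implicit Types (F : kmor L -> kmor L -> C).
Variables (t : 'I_k -> R) (a : kobj L -> R).
Hypotheses (t0 : forall i, 0 < t i) (a0 : forall w : kobj L, 0 < a w).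
Variables (mu : forall x : dpath L, {measure set (borel x) -> \bar R})
  (haar : forall x : gobj G, {measure set (borel (gid x)) -> \bar R}).
Hypotheses (hmu : is_past_measure t a mu) (hhaar : is_stable_haar t mu haar).
Local Notation conv := (@convolution R G haar).
Local Notation inv := (@involution R G).

Definition mf2 N F := mf N (N + N) (N + N) F.
Definition loc f := exists N F, f = mf2 N F.

Lemma mf2_up N N' F : (N <= N')%N -> exists F', mf2 N F = mf2 N' F'.
Proof. by move=> h; eexists; apply: mf_raise; lia. Qed.

Lemma loc_mf n p q F : loc (mf n p q F).
Proof. by exists (n + p + q)%N; eexists; apply: mf_raise; lia. Qed.

Lemma loc_common f (g : stab L -> C) : loc f -> loc g -> exists N F F', f = mf2 N F /\ g = mf2 N F'.
Proof.
move=> [N [F ->]] [N' [F' ->]]; exists (maxn N N').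
have [F1 ->] := mf2_up F (leq_maxl N N'); have [F2 ->] := mf2_up F' (leq_maxr N N').
by exists F1, F2.
Qed.

Lemma loc_common3 f (g h : stab L -> C) : loc f -> loc g -> loc h ->
  exists N F F' F'', [/\ f = mf2 N F, g = mf2 N F' & h = mf2 N F''].
Proof.
move=> hf hg [N' [H ->]]; have [N [F [F' [-> ->]]]] := loc_common hf hg.
exists (maxn N N').
have [F1 ->] := mf2_up F (leq_maxl N N'); have [F2 ->] := mf2_up F' (leq_maxl N N').
by have [F3 ->] := mf2_up H (leq_maxr N N'); exists F1, F2, F3.
Qed.

Lemma locD f (g : stab L -> C) : loc f -> loc g -> loc (f \+ g).
Proof.
by move=> h h'; have [N [F [F' [-> ->]]]] := loc_common h h'; rewrite mf_add; exact: loc_mf.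
Qed.

Lemma locZ (z : C) f : loc f -> loc (fun c => z * f c).
Proof. by move=> [N [F ->]]; rewrite mf_scale; exact: loc_mf. Qed.

Lemma conv_mf2 N F F' : conv (mf2 N F) (mf2 N F') = mf2 N (wmul t a N (N + N) F F').
Proof. exact: (convolution_mf L_regular L_finite hmu hhaar). Qed.

Lemma loc_conv f (g : stab L -> C) : loc f -> loc g -> loc (conv f g).
Proof.
by move=> h h'; have [N [F [F' [-> ->]]]] := loc_common h h'; rewrite conv_mf2; exact: loc_mf.
Qed.

Lemma loc_inv f : loc f -> loc (inv f).
Proof. by move=> [N [F ->]]; rewrite mf_involution; exact: loc_mf. Qed.

Lemma loc_Cc f : loc f -> Cc (R := R) f.
Proof. by move=> [N [F ->]]; exact: (mf_Cc L_regular L_finite). Qed.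

Lemma mf_bounded n p q F : exists K, forall g, nn (mf n p q F g) <= K.
Proof.
exists (\sum_(l <- lv L (cstn p)) \sum_(m <- lv L (cstn q)) nn (F l m)) => g.
have K0 : 0 <= \sum_(l <- lv L (cstn p)) \sum_(m <- lv L (cstn q)) nn (F l m).
  by apply: sumr_ge0 => l _; apply: sumr_ge0 => m _; exact: nn_ge0.
have [h|h] := pselect (level n g); last by rewrite mf_out // nn0.
rewrite mf_in // (bigD1_seq (win (stab_r g) n p)) ?uniq_lv ?win_lv //=.
rewrite (bigD1_seq (win (stab_s g) n q)) ?uniq_lv ?win_lv //=.
rewrite -addrA lerDl addr_ge0 //.
  by apply: sumr_ge0 => m _; exact: nn_ge0.
by apply: sumr_ge0 => l _; apply: sumr_ge0 => m _; exact: nn_ge0.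
Qed.

Definition bmass n : R := \sum_(v <- lv L (cstn 0)) wt t a n 0 v.

Lemma bmass_ge0 n : 0 <= bmass n.
Proof. by apply: sumr_ge0 => v _; rewrite ltW // wt_gt0. Qed.

Definition box1 (x : dpath L) n (e : stab L) : R :=
  if `[< stab_r e = x /\ level n e >] then 1 else 0.

Lemma box1_integral x n :
  (haar x).-integrable setT (fun e : borel (@gid G x) => (box1 x n e)%:E) /\
  \int[haar x]_e box1 x n e <= bmass n.
Proof.
have [h1 h2] := box_integral L_regular L_finite hmu hhaar (u := x) (n := n) (p := 0)
  (c := fun=> 1) (f := box1 x n) (fun=> erefl).
split=> //; rewrite /Rintegral h2 /= /src_lv big_filter big_mkcond /=.
by apply: ler_sum => v _; case: ifP => _; rewrite ?mulr1 // ltW // wt_gt0.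
Qed.

Lemma cint_bound x n (f : stab L -> C) (r : R) : 0 <= r ->
  (haar x).-integrable setT (fun e : borel (@gid G x) => (Cre (f e))%:E) ->
  (haar x).-integrable setT (fun e : borel (@gid G x) => (Cim (f e))%:E) ->
  (forall e, nn (f e) <= r * box1 x n e) -> nn (cint (haar x) f) <= r * bmass n *+ 2.
Proof.
move=> r0 i1 i2 h; have [iB hB] := box1_integral x n.
apply: (le_trans (nn_le_ReIm _)); rewrite mulr2n; apply: lerD.
  apply: (le_trans (Rintegral_bound i1 iB (e := r) _)); last exact: ler_wpM2l.
  by move=> e; apply: le_trans (h e); exact: Cre_le_nn.
apply: (le_trans (Rintegral_bound i2 iB (e := r) _)); last exact: ler_wpM2l.
by move=> e; apply: le_trans (h e); exact: Cim_le_nn.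
Qed.

(** Uniform convergence with a common level and a common bound: exactly what is stable under
    convolution. *)
Definition apx b (u : nat -> stab L -> C) : Prop :=
  [/\ forall i, loc (u i),
      exists n, (forall g, ~ level n g -> b g = 0) /\
                (forall i g, ~ level n g -> u i g = 0),
      exists K, forall i g, nn (u i g) <= K &
      forall e : R, 0 < e -> exists N, forall i, (N <= i)%N ->
        forall g, nn (b g - u i g) <= e].

Lemma apx_bound b (u : nat -> stab L -> C) : apx b u -> exists K, [/\ 0 <= K, (forall g, nn (b g) <= K) &
  forall i g, nn (u i g) <= K].
Proof.
move=> [_ _ [K hK] h]; exists (Num.max 0 K); split; first by rewrite le_max lexx.
  move=> g; apply/ler_addgt0Pr => e e0; have [N hN] := h e e0.
  apply: (le_trans (nn_le_tri _ (u N g : C^o))); rewrite lerD ?hN // le_max.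
  by rewrite hK orbT.
by move=> i g; rewrite le_max hK orbT.
Qed.

Lemma apx_Cc b : Cc (R := R) b -> exists u : nat -> stab L -> C, apx b u.
Proof.
move=> cb; have [n hn] := Cc_level cb.
have h i : exists u, [/\ loc u, (forall g, nn (b g - u g) <= i.+1%:R^-1) &
    forall g, ~ level n g -> u g = 0].
  have [|N [F [nN h1 h2]]] := mf_approx cb hn (e := i.+1%:R^-1); first by rewrite invr_gt0.
  by exists (mf2 N F); split=> //; exists N, F.
have [u hu] := choice h; have [N0 [F0 e0]] : loc (u 0%N) by case: (hu 0%N).
have [K hK] := mf_bounded N0 (N0 + N0) (N0 + N0) F0.
have hb g : nn (b g) <= K + 1.
  apply: (le_trans (nn_le_tri _ (u 0%N g : C^o))); rewrite lerD //.
    by rewrite e0; exact: hK.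
  by have [_ /(_ g) + _] := hu 0%N; rewrite invr1.
exists u; split.
- by move=> i; case: (hu i).
- by exists n; split=> // i g; case: (hu i) => _ _; apply.
- exists (K + 1 + 1) => i g; apply: (le_trans (nn_le_tri _ (b g : C^o))).
  rewrite lerD // nnB; case: (hu i) => _ /(_ g) h1 _; apply: (le_trans h1).
  by rewrite invf_le1 // ler1n.
move=> e /small_inv [N hN]; exists N => i /hN hi g.
by case: (hu i) => _ /(_ g) h1 _; apply: (le_trans h1); exact: ltW.
Qed.

Lemma apxD b b' (u v : nat -> stab L -> C) : apx b u -> apx b' v -> apx (b \+ b') (fun i => u i \+ v i).
Proof.
move=> hb hb'; have [K [K0 _ hK]] := apx_bound hb; have [K' [K'0 _ hK']] := apx_bound hb'.
case: hb => l1 [n [h1 h2]] _ c1; case: hb' => l2 [n' [h3 h4]] _ c2; split.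
- by move=> i; exact: locD.
- exists (maxn n n'); split=> [g hg|i g hg] /=.
    rewrite h1 ?h3 ?addr0 // => h; apply: hg.
      exact: (level_le (leq_maxr n n') h).
    exact: (level_le (leq_maxl n n') h).
  rewrite h2 ?h4 ?addr0 // => h; apply: hg.
    exact: (level_le (leq_maxr n n') h).
  exact: (level_le (leq_maxl n n') h).
- by exists (K + K') => i g; apply: (le_trans (nnD (u i g : C^o) _)); exact: lerD.
move=> e e0; have e2 : 0 < e / 2 by rewrite divr_gt0.
have [N hN] := c1 _ e2; have [N' hN'] := c2 _ e2.
exists (maxn N N') => i; rewrite geq_max => /andP[/hN a1 /hN' a2] g.
have -> : (b \+ b') g - (u i \+ v i) g = (b g - u i g : C^o) + (b' g - v i g).
  by rewrite /= opprD addrACA.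
by apply: (le_trans (nnD _ _)); rewrite [leRHS](splitr e) lerD.
Qed.

Lemma apxZ (z : C) b (u : nat -> stab L -> C) : apx b u -> apx (fun g => z * b g) (fun i g => z * u i g).
Proof.
move=> hb; have [K [K0 _ hK]] := apx_bound hb.
case: hb => l1 [n [h1 h2]] _ c1; split.
- by move=> i; exact: locZ.
- by exists n; split=> [g hg|i g hg]; rewrite ?h1 ?h2 // mulr0.
- by exists (nn z * K) => i g; rewrite nnM ler_wpM2l ?nn_ge0.
move=> e e0; have M0 : 0 < nn z + 1 by rewrite ltr_wpDl // nn_ge0.
have [N hN] := c1 _ (divr_gt0 e0 M0); exists N => i /hN hi g.
rewrite -mulrBr nnM; apply: (@le_trans _ _ ((nn z + 1) * nn (b g - u i g))).
  by rewrite ler_wpM2r ?nn_ge0 // lerDl.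
by rewrite mulrC -ler_pdivlMr.
Qed.

Lemma level_inv n g : level n (stab_inv g) <-> level n g.
Proof. by split=> h m hm; rewrite (h m hm). Qed.

Lemma apx_inv b (u : nat -> stab L -> C) : apx b u -> apx (inv b) (fun i => inv (u i)).
Proof.
move=> hb; have [K [K0 _ hK]] := apx_bound hb.
case: hb => l1 [n [h1 h2]] _ c1; split.
- by move=> i; exact: loc_inv.
- exists n; split=> [g hg|i g hg]; rewrite /involution ?h1 ?h2 ?conj0 //;
    by move/(level_inv n g).
- by exists K => i g; rewrite /involution nn_conj.
move=> e /c1 [N hN]; exists N => i /hN hi g.
by rewrite /involution -conjN -conjD nn_conj; exact: hi.
Qed.

Section ConvolutionLimit.
Variables (b b' : stab L -> C) (u v : nat -> stab L -> C).
Hypotheses (hb : apx b u) (hb' : apx b' v).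

Lemma integrand_integrable i c :
  (haar (@gs G c)).-integrable setT
    (fun e : borel (@gid G (@gs G c)) => (Cre (integrand (u i) (v i) c e))%:E) /\
  (haar (@gs G c)).-integrable setT
    (fun e : borel (@gid G (@gs G c)) => (Cim (integrand (u i) (v i) c e))%:E).
Proof.
case: hb => /(_ i) l1 _ _ _; case: hb' => /(_ i) l2 _ _ _.
have [N [F [F' [-> ->]]]] := loc_common l1 l2; split.
  apply: (box_integral L_regular L_finite hmu hhaar (u := stab_s c) (n := N) (p := (N + N)%N)
    (c := fun w => Cre (wprod N (N + N) (N + N) (N + N) F F' c w)) _).1.
  by move=> e; rewrite integrand_mf; case: ifP.
apply: (box_integral L_regular L_finite hmu hhaar (u := stab_s c) (n := N) (p := (N + N)%N)
  (c := fun w => Cim (wprod N (N + N) (N + N) (N + N) F F' c w)) _).1.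
by move=> e; rewrite integrand_mf; case: ifP.
Qed.

(** From $bb'-uv=(b-u)b'+u(b'-v)$ the integrands converge uniformly relative to the indicator of one
    common level, whose mass is bounded over all fibres. *)
Lemma apx_conv : apx (conv b b') (fun i => conv (u i) (v i)).
Proof.
have [K [K0 hbK hK]] := apx_bound hb; have [K' [K'0 hbK' hK']] := apx_bound hb'.
have [l1 [n1 [h1 h2]] _ c1] := hb; have [l2 [n2 [h3 h4]] _ c2] := hb'.
pose n := maxn n1 n2.
have {}h1 g : ~ level n g -> b g = 0.
  by move=> hg; apply: h1 => h; apply: hg; exact: (level_le (leq_maxl _ _) h).
have {}h2 i g : ~ level n g -> u i g = 0.
  by move=> hg; apply: h2 => h; apply: hg; exact: (level_le (leq_maxl _ _) h).
have {}h3 g : ~ level n g -> b' g = 0.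
  by move=> hg; apply: h3 => h; apply: hg; exact: (level_le (leq_maxr _ _) h).
have {}h4 i g : ~ level n g -> v i g = 0.
  by move=> hg; apply: h4 => h; apply: hg; exact: (level_le (leq_maxr _ _) h).
have van f f' : (forall g, ~ level n g -> f g = 0) -> (forall g, ~ level n g -> f' g = 0) ->
    forall c, ~ level n c -> conv f f' c = 0.
  move=> hf hf' c hc; rewrite /convolution.
  rewrite (box_cint L_regular L_finite hmu hhaar (u := stab_s c) (n := 0) (p := 0)
    (c := fun=> 0)); first by rewrite big1 // => w _; rewrite mulr0.
  move=> e; rewrite if_same; case: pselect => // h.
  have h1' : stab_s c = stab_r e := h.
  have [he|he] := pselect (level n e); last first.
    by rewrite hf' ?mulr0 // => /level_inv.
  rewrite hf ?mul0r // => hm; apply: hc => m hmm.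
  by have := hm m hmm; rewrite /= => ->; rewrite -he // h1'.
have box f f' (r : R) : 0 <= r -> (forall g, ~ level n g -> f g = 0) ->
    (forall g, ~ level n g -> f' g = 0) -> 
    forall c e, (integrand f f' c e = 0) \/ (exists h : @gs G c = @gr G e,
       box1 (stab_s c) n e = 1 /\ integrand f f' c e = f (@gmul G c e h) * f' (@ginv G e)).
  move=> r0 hf hf' c e; rewrite /integrand; case: pselect => h; last by left.
  have h1' : stab_s c = stab_r e := h.
  have [he|he] := pselect (level n e); last first.
    by left; rewrite [f' _]hf' ?mulr0 // => /level_inv.
  by right; exists h; split=> //; rewrite /box1 asboolT.
have diff (r : R) i : 0 <= r -> (forall g, nn (b g - u i g) <= r) ->
    (forall g, nn (b' g - v i g) <= r) -> forall c e,
    nn (integrand b b' c e - integrand (u i) (v i) c e) <= r * (K + K') * box1 (stab_s c) n e.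
  move=> r0 d1 d2 c e; rewrite /integrand; case: pselect => h; last first.
    by rewrite subrr nn0 mulr_ge0 ?mulr_ge0 ?addr_ge0 // /box1; case: ifP.
  have h1' : stab_s c = stab_r e := h.
  have [he|he] := pselect (level n e); last first.
    rewrite [b' _]h3 ?[v i _]h4 ?mulr0 ?subrr ?nn0; try by move/level_inv.
    by rewrite mulr_ge0 ?mulr_ge0 ?addr_ge0 // /box1; case: ifP.
  rewrite /box1 asboolT // mulr1.
  move: (d1 (@gmul G c e h)) (d2 (@ginv G e)) (hbK' (@ginv G e)) (hK i (@gmul G c e h)).
  set x := @gmul G c e h; set y := @ginv G e => q1 q2 q3 q4.
  have -> : b x * b' y - u i x * v i y = ((b x - u i x) * b' y : C^o) + u i x * (b' y - v i y).
    by ring.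
  apply: (le_trans (nnD _ _)); rewrite !nnM mulrDr addrC; apply: lerD.
    by rewrite mulrC; apply: ler_pM; rewrite ?nn_ge0.
  by apply: ler_pM; rewrite ?nn_ge0.
have KK : 0 < K + K' + 1 by rewrite ltr_wpDl // addr_ge0.
have lim c (e : R) : 0 < e -> exists N, forall i, (N <= i)%N -> forall x,
    nn (integrand b b' c x - integrand (u i) (v i) c x) <= e * box1 (stab_s c) n x.
  move=> e0; have [N hN] := c1 _ (divr_gt0 e0 KK); have [N' hN'] := c2 _ (divr_gt0 e0 KK).
  exists (maxn N N') => i; rewrite geq_max => /andP[/hN a1 /hN' a2] x.
  apply: (le_trans (diff _ i _ a1 a2 c x)); first by rewrite ltW // divr_gt0.
  apply: ler_wpM2r; first by rewrite /box1; case: ifP.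
  by rewrite mulrAC ler_pdivrMr // ler_wpM2l ?(ltW e0) // lerDl.
have int c : (haar (@gs G c)).-integrable setT
      (fun e : borel (@gid G (@gs G c)) => (Cre (integrand b b' c e))%:E) /\
    (haar (@gs G c)).-integrable setT
      (fun e : borel (@gid G (@gs G c)) => (Cim (integrand b b' c e))%:E).
  have [iB _] := box1_integral (stab_s c) n.
  have B0 x : 0 <= box1 (stab_s c) n x by rewrite /box1; case: ifP.
  split.
    apply: (@uniform_limit_integrable R _ _ (haar (@gs G c)) _ (box1 (stab_s c) n)
      (fun i e => Cre (integrand (u i) (v i) c e))) => //.
      by move=> i; case: (integrand_integrable i c).
    move=> e e0; have [N hN] := lim c e e0; exists N => i /hN hi x.
    by rewrite -CreN -CreD; apply: le_trans (hi x); exact: Cre_le_nn.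
  apply: (@uniform_limit_integrable R _ _ (haar (@gs G c)) _ (box1 (stab_s c) n)
    (fun i e => Cim (integrand (u i) (v i) c e))) => //.
    by move=> i; case: (integrand_integrable i c).
  move=> e e0; have [N hN] := lim c e e0; exists N => i /hN hi x.
  by rewrite -CimN -CimD; apply: le_trans (hi x); exact: Cim_le_nn.
have near c i (r : R) : 0 <= r -> (forall x, nn (integrand b b' c x -
      integrand (u i) (v i) c x) <= r * box1 (stab_s c) n x) ->
    nn (conv b b' c - conv (u i) (v i) c) <= r * bmass n *+ 2.
  move=> r0 h; have [i1 i2] := int c; have [j1 j2] := integrand_integrable i c.
  have d1 : (haar (@gs G c)).-integrable setT (fun e : borel (@gid G (@gs G c)) =>
      (Cre (integrand b b' c e - integrand (u i) (v i) c e))%:E).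
    by under eq_fun do rewrite CreD CreN EFinB; exact: integrableB.
  have d2 : (haar (@gs G c)).-integrable setT (fun e : borel (@gid G (@gs G c)) =>
      (Cim (integrand b b' c e - integrand (u i) (v i) c e))%:E).
    by under eq_fun do rewrite CimD CimN EFinB; exact: integrableB.
  have := cint_bound r0 d1 d2 h; congr (nn _ <= _).
  rewrite /convolution /cint; apply: Ceq; rewrite ?CreD ?CreN ?CimD ?CimN.
    rewrite [LHS](_ : _ = \int[haar (@gs G c)]_x (Cre (integrand b b' c x) -
      Cre (integrand (u i) (v i) c x))); first by rewrite RintegralB.
    by apply: eq_Rintegral => x _; rewrite CreD CreN.
  rewrite [LHS](_ : _ = \int[haar (@gs G c)]_x (Cim (integrand b b' c x) -
    Cim (integrand (u i) (v i) c x))); first by rewrite RintegralB.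
  by apply: eq_Rintegral => x _; rewrite CimD CimN.
split.
- by move=> i; exact: loc_conv.
- exists n; split=> [g|i g]; first exact: (van _ _ h1 h3).
  exact: (van _ _ (h2 i) (h4 i)).
- exists (K * K' * bmass n *+ 2) => i c.
  have [j1 j2] := integrand_integrable i c.
  apply: (@cint_bound (stab_s c) n (integrand (u i) (v i) c)) => //; first exact: mulr_ge0.
  move=> e; have [->|[h [-> ->]]] := box (u i) (v i) 1 ler01 (h2 i) (h4 i) c e.
    by rewrite nn0 !mulr_ge0 // /box1; case: ifP.
  by rewrite mulr1 nnM; apply: ler_pM; rewrite ?nn_ge0.
move=> e e0; have M0 : 0 < bmass n *+ 2 + 1 by rewrite ltr_wpDl // mulrn_wge0 // bmass_ge0.
have [N hN] : exists N, forall i, (N <= i)%N -> forall c x,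
    nn (integrand b b' c x - integrand (u i) (v i) c x) <=
    e / (bmass n *+ 2 + 1) * box1 (stab_s c) n x.
  have e1 : 0 < e / (bmass n *+ 2 + 1) by rewrite divr_gt0.
  have [N hN] := c1 _ (divr_gt0 e1 KK); have [N' hN'] := c2 _ (divr_gt0 e1 KK).
  exists (maxn N N') => i; rewrite geq_max => /andP[/hN a1 /hN' a2] c x.
  apply: (le_trans (diff _ i _ a1 a2 c x)); first by rewrite ltW // divr_gt0.
  apply: ler_wpM2r; first by rewrite /box1; case: ifP.
  by rewrite mulrAC ler_pdivrMr // ler_wpM2l ?(ltW e1) // lerDl.
exists N => i /hN hi c; apply: (le_trans (near c i _ _ (hi c))).
  by rewrite ltW // divr_gt0.
rewrite -mulrnAr mulrAC ler_pdivrMr // ler_wpM2l ?(ltW e0) //.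
by rewrite lerDl.
Qed.

End ConvolutionLimit.
End LocalFunctions.

(** * The Schur test *)

Section Schur.
Variables (R : realType) (I : eqType) (s : seq I).

Lemma sum_cauchy (c x : I -> R) : (forall i, 0 <= c i) ->
  (\sum_(i <- s) c i * x i) ^+ 2 <= (\sum_(i <- s) c i) * \sum_(i <- s) c i * x i ^+ 2.
Proof.
move=> c0; elim: s => [|i r IH]; first by rewrite !big_nil mul0r expr0n.
rewrite !big_cons; move: IH.
have : 0 <= \sum_(j <- r) c j by apply: sumr_ge0.
have : 0 <= \sum_(j <- r) c j * x j ^+ 2.
  by apply: sumr_ge0 => j _; rewrite mulr_ge0 // sqr_ge0.
move: (\sum_(j <- r) c j) (\sum_(j <- r) c j * x j ^+ 2) (\sum_(j <- r) c j * x j) => A B D.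
move=> B0 A0 h; have ci := c0 i; set y := x i; set d := c i in ci *.
suff : 0 <= B + A * y ^+ 2 - 2 * D * y by nra.
have [A1|A1] := eqVneq A 0.
  have : D = 0 by apply/eqP; rewrite -sqrf_eq0; apply/eqP/le_anti; rewrite sqr_ge0 andbT (le_trans h) // A1 mul0r.
  by move=> ->; rewrite A1 !(mulr0, mul0r) subr0 addr0.
have Ap : 0 < A by rewrite lt_neqAle eq_sym A1.
rewrite -(pmulr_rge0 _ Ap).
have -> : A * (B + A * y ^+ 2 - 2 * D * y) = (A * B - D ^+ 2) + (D - A * y) ^+ 2 by ring.
by rewrite addr_ge0 ?sqr_ge0 // subr_ge0.
Qed.

(** Weighted Cauchy-Schwarz in each row with the row bound, then an exchange of sums and the column
    bound. *)
Lemma schur_test (w x : I -> R) (K : I -> I -> R) (r : R) :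
  (forall i, 0 <= w i) -> (forall i j, 0 <= K i j) -> 0 <= r ->
  (forall i, i \in s -> \sum_(j <- s) w j * K i j <= r) ->
  (forall j, j \in s -> \sum_(i <- s) w i * K i j <= r) ->
  \sum_(i <- s) w i * (\sum_(j <- s) w j * K i j * x j) ^+ 2 <=
  r ^+ 2 * \sum_(i <- s) w i * x i ^+ 2.
Proof.
move=> w0 K0 r0 hrow hcol.
apply: (@le_trans _ _ (\sum_(i <- s) w i * (r * \sum_(j <- s) w j * K i j * x j ^+ 2))).
  rewrite big_seq [leRHS]big_seq; apply: ler_sum => i si; apply: ler_wpM2l => //.
  apply: (le_trans (sum_cauchy _ _)); first by move=> j; rewrite mulr_ge0.
  apply: ler_wpM2r; last exact: hrow.
  by apply: sumr_ge0 => j _; rewrite mulr_ge0 ?sqr_ge0 // mulr_ge0.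
rewrite (eq_bigr (fun i => \sum_(j <- s) r * (w j * x j ^+ 2 * (w i * K i j)))); last first.
  by move=> i _; rewrite mulrCA mulr_sumr mulr_sumr; apply: eq_bigr => j _; ring.
rewrite exchange_big /= mulr_sumr big_seq [leRHS]big_seq; apply: ler_sum => j sj.
rewrite -mulr_sumr -mulr_sumr [r ^+ 2]expr2 -[r * r * _]mulrA; apply: ler_wpM2l => //.
by rewrite mulrC; apply: ler_wpM2r; [rewrite mulr_ge0 // sqr_ge0|exact: hcol].
Qed.

End Schur.

(** * The regular representation on window functions *)

Section LocalHilbert.
Variables (R : realType) (k : nat) (L : kgraph k) (L_regular : regular_kgraph L).
Hypothesis L_finite : finite_set [set: kobj L].
Local Notation C := (Cx R).
Local Notation cstn := (cstn k).
Local Notation cz := (cz k).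
Local Notation G := (stable_groupoid L).
Local Notation W := (stab L -> (Cx R)^o).
Implicit Types (f b : W) (g : stab L) (n p q N : nat).
Implicit Types (F : kmor L -> kmor L -> C).
Variables (t : 'I_k -> R) (a : kobj L -> R).
Hypotheses (t0 : forall i, 0 < t i) (a0 : forall w : kobj L, 0 < a w).
Variables (mu : forall x : dpath L, {measure set (borel x) -> \bar R})
  (haar : forall x : gobj G, {measure set (borel (gid x)) -> \bar R}).
Hypotheses (hmu : is_past_measure t a mu) (hhaar : is_stable_haar t mu haar).
Variable x0 : dpath L.
Local Notation conv := (@convolution R G haar).
Local Notation inv := (@involution R G).
Local Notation loc := (@loc R k L).

(** The inner product of the regular representation at [x0], written as the value of the convolution
    of $f'^*$ and $f$ at the unit of [x0]. *)
Definition lform (f f' : W) : C := conv (inv f') f (@gid G x0).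

Definition colsum n p q F F' : C :=
  \sum_(v <- lv L (cstn p) | ks v == ks (win x0 n q))
    rC (wt t a n p v) * (F v (win x0 n q) * (F' v (win x0 n q))^*).

Lemma lform_mf n p q F F' : lform (mf n p q F) (mf n p q F') = colsum n p q F F'.
Proof.
rewrite /lform mf_involution (convolution_mf L_regular L_finite hmu hhaar).
have h : level n (@gid G x0) by [].
rewrite (mf_in _ _ _ h) /wmul /colsum.
by apply: eq_bigr => v _; rewrite [_^* * _]mulrC.
Qed.

Lemma mf2D N F F' : (mf2 N F : W) + mf2 N F' = mf2 N (fun l m => F l m + F' l m).
Proof. exact: mf_add. Qed.

Lemma mf2Z N (z : C) F : z *: (mf2 N F : W) = mf2 N (fun l m => z * F l m).
Proof. exact: mf_scale. Qed.

Definition local_space : prehilbert R.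
Proof.
refine (@PreHilbert R W loc lform _ _ _ _ _ _ _).
- exists 0%N, (fun _ _ => 0); apply: funext => g.
  by have [h|h] := pselect (level 0 g); [rewrite /mf2 mf_in|rewrite /mf2 mf_out].
- by move=> f f' h h'; exact: locD.
- by move=> z f h; exact: locZ.
- move=> f f' f'' h h' h''; have [N [F [F' [F'' [-> -> ->]]]]] := loc_common3 h h' h''.
  rewrite mf2D !lform_mf /colsum -big_split; apply: eq_bigr => v _.
  by rewrite /= mulrDl mulrDr.
- move=> z f f' h h'; have [N [F [F' [-> ->]]]] := loc_common h h'.
  rewrite mf2Z !lform_mf /colsum mulr_sumr; apply: eq_bigr => v _.
  by rewrite -mulrA mulrCA.
- move=> f f' h h'; have [N [F [F' [-> ->]]]] := loc_common h h'.
  rewrite !lform_mf /colsum conj_sum; apply: eq_bigr => v _.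
  by rewrite !conjM rC_conj conjCK [_^* * _]mulrC.
- move=> f [N [F ->]]; rewrite lform_mf; apply: sumr_ge0 => v _.
  by rewrite mulr_ge0 ?mul_conjC_ge0 // -rC0 rC_le ltW // wt_gt0.
Defined.

Local Notation V := local_space.

Lemma local_form f f' : @ph_form R V f f' = lform f f'. Proof. by []. Qed.

Lemma local_phq N F : @phq R V (mf2 N F) =
  \sum_(v <- src_lv x0 N (N + N)) wt t a N (N + N) v * nn (F v (win x0 N (N + N))) ^+ 2.
Proof.
rewrite /phq local_form lform_mf /colsum /src_lv big_filter -(win_s x0 N (N + N)).
apply: rC_inj; rewrite Cre_real; last first.
  apply: sumr_ge0 => v _.
  by rewrite mulr_ge0 ?mul_conjC_ge0 // -rC0 rC_le ltW // wt_gt0.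
by rewrite rC_sum; apply: eq_bigr => v _; rewrite rCM nn_sqr.
Qed.

Lemma path_with_past n p l : kdeg l = cstn p -> exists y : dpath L, win y n p = l.
Proof.
move=> dl; have [x hx] := dpath_through L_regular (ks l).
exists (dglue L_regular (cz n) (dshift (- cz n) x) l); apply: win_dglue => //.
by rewrite /= addrN hx.
Qed.

Lemma integral_row n p q F y :
  ((\sum_(v <- lv L (cstn q) | ks v == ks (win y n p))
     wt t a n q v * nn (F (win y n p) v))%:E <=
  \int[haar y]_c (Cre `|mf n p q F c|)%:E)%E.
Proof.
pose c v := nn (F (win y n p) v).
pose f (e : stab L) := if `[< stab_r e = y /\ level n e >] then c (win (stab_s e) n q) else 0.
have [i1 i2] := box_integral L_regular L_finite hmu hhaar (u := y) (n := n) (p := q)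
  (c := c) (f := f) (fun=> erefl).
move: i2; rewrite /src_lv big_filter -(win_s y n p) => <-.
apply: ge0_le_integral => //.
- by move=> e _; rewrite lee_fin /f; case: ifP => // _; exact: nn_ge0.
- exact: (measurable_int _ i1).
- by apply: Cc_nn_measurable; case: (mf_Cc (R := R) L_regular L_finite n p q F).
- move=> e _; rewrite lee_fin /f; case: asboolP => [[er el]|_]; last exact: (nn_ge0 (mf n p q F e)).
  suff : c (win (stab_s e) n q) <= nn (mf n p q F e) by [].
  by rewrite mf_in // er.
Qed.

(** Every morphism is the window of some path [y], so its row sum is bounded by the integral over
    the fibre of [y]. Columns are treated through the inverse. *)
Lemma Inorm_row n p q F (r : R) l : (Inorm haar (mf n p q F) <= r%:E)%E ->
  l \in lv L (cstn p) ->
  \sum_(v <- lv L (cstn q) | ks v == ks l) wt t a n q v * nn (F l v) <= r.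
Proof.
move=> hI; rewrite mem_lv // => /eqP /(path_with_past n) [y <-].
rewrite -lee_fin; apply: (le_trans (integral_row _ _ _ _ _)); apply: le_trans hI.
by rewrite /Inorm le_max; apply/orP; left; apply: ereal_sup_ubound; exists y.
Qed.

Lemma Inorm_col n p q F (r : R) l : (Inorm haar (mf n p q F) <= r%:E)%E ->
  l \in lv L (cstn q) ->
  \sum_(v <- lv L (cstn p) | ks v == ks l) wt t a n p v * nn (F v l) <= r.
Proof.
move=> hI; rewrite mem_lv // => /eqP /(path_with_past n) [y <-].
rewrite -lee_fin; apply: (le_trans (integral_row n q p (fun l m => F m l) y)).
apply: le_trans hI.
rewrite /Inorm le_max; apply/orP; right; apply: ereal_sup_ubound; exists y => //.
apply: eq_integral => c _; congr (Cre `| _ |)%:E.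
have [h|h] := pselect (level n (c : stab L)).
  have h' : level n (stab_inv c) by apply/level_inv.
  by rewrite (mf_in _ _ _ h) (mf_in _ _ _ h').
by rewrite (mf_out _ _ _ h) mf_out // => /level_inv.
Qed.

(** On coefficients, convolution is a weighted matrix acting on the column of the window of [x0];
    the $I$-norm bounds its rows and columns, so [schur_test] applies. *)
Lemma conv_bnd f (r : R) : loc f -> 0 <= r -> (Inorm haar f <= r%:E)%E ->
  @bnd R V (conv f) r.
Proof.
move=> hf r0 hI; split=> // f' hf'.
have [N [F [F' [e e']]]] := loc_common hf hf'; rewrite {}e {}e' in hI *.
rewrite (conv_mf2 L_regular L_finite hmu hhaar) -(@ler_pXn2r _ 2) ?nnegrE ?mulr_ge0 ?phn_ge0 //.
rewrite exprMn !(@phn_sqr R V); try by exact: loc_mf.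
rewrite !local_phq; set m0 := win x0 N (N + N); set s := src_lv _ _ _.
apply: le_trans (@schur_test R _ s (wt t a N (N + N)) (fun v => nn (F' v m0))
  (fun i j => nn (F i j)) r _ _ r0 _ _).
- rewrite big_seq [leRHS]big_seq; apply: ler_sum => v sv.
  apply: ler_wpM2l; first by rewrite ltW // wt_gt0.
  rewrite ler_pXn2r ?nnegrE ?nn_ge0 //; last first.
    by apply: sumr_ge0 => j _; rewrite mulr_ge0 ?nn_ge0 // mulr_ge0 ?nn_ge0 // ltW // wt_gt0.
  have sv' : ks v = dvert x0 (cz N) by move: sv; rewrite mem_filter => /andP[/eqP].
  rewrite /wmul /s /src_lv big_filter -sv'.
  apply: (le_trans (@nn_sum R C^o _ _ _ _)); apply: ler_sum => j _.
  rewrite !nnM nn_rC ger0_norm; last by rewrite ltW // wt_gt0.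
  by rewrite mulrA.
- by move=> i; rewrite ltW // wt_gt0.
- by move=> i j; exact: nn_ge0.
- move=> i; rewrite mem_filter => /andP[/eqP si li].
  by rewrite /s /src_lv big_filter -si; exact: Inorm_row hI li.
- move=> i; rewrite mem_filter => /andP[/eqP si li].
  by rewrite /s /src_lv big_filter -si; exact: Inorm_col hI li.
Qed.

Lemma conv_assoc f f' f'' : loc f -> loc f' -> loc f'' ->
  conv f (conv f' f'') = conv (conv f f') f''.
Proof.
move=> h h' h''; have [N [F [F' [F'' [-> -> ->]]]]] := loc_common3 h h' h''.
rewrite !(conv_mf2 L_regular L_finite hmu hhaar); congr mf; apply: funext => l; apply: funext => m.
rewrite /wmul; under eq_bigr => v _ do rewrite !mulr_sumr.
under [RHS]eq_bigr => v _ do rewrite mulr_suml mulr_sumr.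
rewrite (exchange_big_dep (fun v => ks v == ks l)) /=; last first.
  by move=> i j /eqP <- /eqP ->.
apply: eq_bigr => j /eqP ej; apply: eq_big => [i|i _]; last by ring.
by rewrite ej [ks l == _]eq_sym andbb.
Qed.
End LocalHilbert.

(** * Extending the regular representation to $C_c(G_s)$ *)

Section LocalRepresentation.
Variables (R : realType) (k : nat) (L : kgraph k) (L_regular : regular_kgraph L).
Hypothesis L_finite : finite_set [set: kobj L].
Local Notation C := (Cx R).
Local Notation cstn := (cstn k).
Local Notation cz := (cz k).
Local Notation G := (stable_groupoid L).
Local Notation W := (stab L -> (Cx R)^o).
Implicit Types (f b : W) (g : stab L) (n p q N : nat).
Implicit Types (F : kmor L -> kmor L -> C).
Variables (t : 'I_k -> R) (a : kobj L -> R).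
Hypotheses (t0 : forall i, 0 < t i) (a0 : forall w : kobj L, 0 < a w).
Variables (mu : forall x : dpath L, {measure set (borel x) -> \bar R})
  (haar : forall x : gobj G, {measure set (borel (gid x)) -> \bar R}).
Hypotheses (hmu : is_past_measure t a mu) (hhaar : is_stable_haar t mu haar).
Variable x0 : dpath L.
Local Notation conv := (@convolution R G haar).
Local Notation inv := (@involution R G).
Local Notation loc := (@loc R k L).
Local Notation V := (local_space L_regular L_finite t0 a0 hmu hhaar x0).
Local Notation S := (op_space V).

Let conv2 := conv_mf2 L_regular L_finite hmu hhaar.

Lemma Inorm_fin f : loc f -> exists2 r, 0 <= r & (Inorm haar f <= r%:E)%E.
Proof.
move=> h; case: (h) => N [F e]; have [K hK] := mf_bounded L_regular L_finite N (N + N) (N + N) F.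
exists (Num.max 0 K * bmass t a N).
  by rewrite mulr_ge0 ?le_max ?lexx // bmass_ge0.
apply: (Inorm_le L_regular L_finite t0 a0 hmu hhaar).
- by case: (loc_Cc L_regular L_finite h).
- by rewrite le_max lexx.
- by move=> g hg; rewrite e /mf2 mf_out.
- by move=> g; rewrite e le_max hK orbT.
Qed.

Lemma convDl f f' f'' : loc f -> loc f' -> loc f'' ->
  conv (f \+ f') f'' = conv f f'' \+ conv f' f''.
Proof.
move=> h h' h''; have [N [F [F' [F'' [-> -> ->]]]]] := loc_common3 h h' h''.
rewrite [mf2 N F \+ _]mf_add !conv2 [RHS]mf_add; congr mf; apply: funext => l; apply: funext => m.
by rewrite /wmul -big_split; apply: eq_bigr => v _; rewrite /= mulrDl mulrDr.
Qed.

Lemma convZl (z : C) f f' : loc f -> loc f' ->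
  conv (fun c => z * f c) f' = fun c => z * conv f f' c.
Proof.
move=> h h'; have [N [F [F' [-> ->]]]] := loc_common h h'.
rewrite [fun c => z * mf2 N F c]mf_scale !conv2 [RHS]mf_scale.
congr mf; apply: funext => l; apply: funext => m.
by rewrite /wmul mulr_sumr; apply: eq_bigr => v _; rewrite /= -mulrA mulrCA.
Qed.

Lemma invK : involutive inv.
Proof.
move=> f; apply: funext => c; rewrite /involution conjCK; congr f.
exact: stab_eq.
Qed.

Lemma inv_conv f f' : loc f -> loc f' -> inv (conv f f') = conv (inv f') (inv f).
Proof.
move=> h h'; have [N [F [F' [-> ->]]]] := loc_common h h'.
rewrite conv2 /mf2 !mf_involution [RHS]conv2.
apply: (mf_ext L_regular L_finite) => l m _ _ e; rewrite /wmul conj_sum e.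
by apply: eq_bigr => v _; rewrite !conjM rC_conj [_^* * _^*]mulrC.
Qed.

Lemma conv_isadj f : loc f -> @isadj R V (conv f) (conv (inv f)).
Proof.
move=> hf; split=> [x hx|x y hx hy].
  by apply: (loc_conv L_regular L_finite hmu hhaar) => //; exact: loc_inv.
rewrite !local_form /lform inv_conv // ?invK; last exact: loc_inv.
by rewrite (conv_assoc L_regular L_finite hmu hhaar) //; exact: loc_inv.
Qed.

Lemma conv_opdom f : loc f -> @opdom R V (conv f).
Proof.
move=> hf; split.
- by move=> x hx; exact: (loc_conv L_regular L_finite hmu hhaar).
- have [r r0 hr] := Inorm_fin hf; exists r; exact: conv_bnd.
- by exists (conv (inv f)); exact: conv_isadj.
Qed.

(** The difference of uniformly close functions supported in one level has small $I$-norm, which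
    bounds its operator norm. *)
Lemma conv_near f f' n (r : R) : loc f -> loc f' -> 0 <= r ->
  (forall g, ~ level n g -> f g = 0) -> (forall g, ~ level n g -> f' g = 0) ->
  (forall g, nn (f g - f' g) <= r) ->
  @opn R V ((conv f : W -> W) - conv f') <= r * bmass t a n.
Proof.
move=> hf hf' r0 vf vf' h.
have hd : loc (f \+ (fun c => -1 * f' c)) by apply: locD => //; exact: locZ.
have hI : (Inorm haar (f \+ (fun c => (-1) * f' c))%R <= (r * bmass t a n)%:E)%E.
  apply: (Inorm_le L_regular L_finite t0 a0 hmu hhaar) => //.
  - by case: (loc_Cc L_regular L_finite hd).
  - by move=> g hg /=; rewrite vf // vf' // mulr0 addr0.
  - by move=> g /=; rewrite mulN1r; exact: h.
have [B0 hB] := conv_bnd L_regular L_finite t0 a0 hmu hhaar x0 hd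
  (mulr_ge0 r0 (bmass_ge0 t0 a0 n)) hI.
apply: opn_le; first by apply: opdomB; exact: conv_opdom.
split=> // x hx; apply: le_trans (hB x hx); rewrite le_eqVlt; apply/orP; left; apply/eqP.
congr phn; rewrite (convDl hf (locZ (-1) hf') hx) (convZl _ hf' hx).
by apply: funext => c /=; rewrite mulN1r.
Qed.

Lemma apx_near b u v : apx b u -> apx b v -> exists n, forall e : R, 0 < e ->
  exists N, forall i j, (N <= i)%N -> (N <= j)%N ->
  @opn R V ((conv (u i) : W -> W) - conv (v j)) <= e * bmass t a n.
Proof.
move=> [l1 [n1 [_ h1]] _ c1] [l2 [n2 [_ h2]] _ c2].
exists (maxn n1 n2) => e e0; have e2 : 0 < e / 2 by rewrite divr_gt0.
have [N hN] := c1 _ e2; have [N' hN'] := c2 _ e2.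
exists (maxn N N') => i j; rewrite !geq_max => /andP[/hN q1 _] /andP[_ /hN' q2].
apply: conv_near => //.
- exact: ltW.
- by move=> g hg; apply: h1 => h; apply: hg; exact: level_le (leq_maxl _ _) h.
- by move=> g hg; apply: h2 => h; apply: hg; exact: level_le (leq_maxr _ _) h.
move=> g; apply: (le_trans (@nn_tri R C^o (b g) _ _)).
by rewrite [leRHS](splitr e) lerD // nnB.
Qed.

Lemma bmass_small n (e : R) : 0 < e -> exists2 r, 0 < r & r * bmass t a n < e.
Proof.
move=> e0; have M0 : 0 < bmass t a n + 1 by rewrite ltr_wpDl // bmass_ge0.
exists (e / (bmass t a n + 1)); first by rewrite divr_gt0.
by rewrite mulrAC ltr_pdivrMr // ltr_pM2l // ltrDl.
Qed.

Lemma apx_cauchy b u : apx b u -> @cauchy_op R V (fun i => conv (u i)).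
Proof.
move=> h; split=> [i|e e0]; first by apply: conv_opdom; case: h.
have [n hn] := apx_near h h; have [r r0 hr] := bmass_small n e0.
have [N hN] := hn _ r0; exists N => i j hi hj.
exact: le_lt_trans (hN i j hi hj) hr.
Qed.

Lemma apx_uniq b u v : apx b u -> apx b v ->
  qpi ((fun i => conv (u i)) : S) = qpi ((fun i => conv (v i)) : S).
Proof.
move=> h h'; have hc := apx_cauchy h; have hc' := apx_cauchy h'.
apply: (@qpi_eq R S _ _ hc hc'); apply: (rlim_uniq (oplimP (cauchy_opB hc hc'))) => e e0.
have [n hn] := apx_near h h'; have [r r0 hr] := bmass_small n e0.
have [N hN] := hn _ r0; exists N => i hi.
have o : @opdom R V ((conv (u i) : W -> W) - conv (v i)).
  by apply: opdomB; apply: conv_opdom; [case: h|case: h'].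
have h2 : `|0 - @opn R V ((conv (u i) : W -> W) - conv (v i))| < e.
  by rewrite sub0r normrN ger0_norm ?(opn_ge0 o) //; exact: le_lt_trans (hN i i hi hi) hr.
exact: h2.
Qed.

(** Convolution by a general [b] need not preserve the window functions, so its operator is the
    limit along a chosen approximation; [apx_uniq] makes the choice immaterial. *)
Definition conv_rep b : bounded_ops V :=
  qpi ((fun i => conv (xget (fun _ _ => 0) (apx b) i)) : S).

Lemma conv_repE b u : apx b u -> conv_rep b = qpi ((fun i => conv (u i)) : S).
Proof. by move=> h; apply: apx_uniq (h); exact: (@xgetPex _ _ (apx b)) (ex_intro _ _ h). Qed.

Lemma Inorm_tri f f' : continuous f -> continuous f' ->
  (Inorm haar (f \+ f')%R <= Inorm haar f + Inorm haar f')%E.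
Proof.
move=> cf cf'; have [_ _ _ _ _ ci _] := stab_lchg L_regular.
have key x (h h' : W) : continuous h -> continuous h' ->
    (\int[haar x]_c (Cre `|(h \+ h')%R c|)%:E <=
     \int[haar x]_c (Cre `|h c|)%:E + \int[haar x]_c (Cre `|h' c|)%:E)%E.
  move=> ch ch'.
  have m1 := Cc_nn_measurable (u := x) ch; have m2 := Cc_nn_measurable (u := x) ch'.
  have p (h1 : W) e : (0 <= (Cre `|h1 e|)%:E)%E by rewrite lee_fin; exact: (nn_ge0 (h1 e)).
  rewrite -ge0_integralD //; try by move=> e _; exact: p.
  apply: ge0_le_integral => //.
  - exact: (Cc_nn_measurable (continuous_addC ch ch')).
  - exact: emeasurable_funD.
  - by move=> e _; rewrite -EFinD lee_fin; exact: (@nnD R C^o).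
have cfi (h : W) : continuous h -> continuous (fun g => h (stab_inv g)).
  by move=> ch g; apply: continuous_comp; [exact: ci|exact: ch].
rewrite {1}/Inorm ge_max; apply/andP; split; apply: ge_ereal_sup => _ [x _ <-].
  apply: (le_trans (key x _ _ cf cf')); apply: leeD; rewrite /Inorm le_max; apply/orP; left;
    by apply: ereal_sup_ubound; exists x.
apply: (le_trans (key x _ _ (cfi _ cf) (cfi _ cf'))); apply: leeD; rewrite /Inorm le_max;
  apply/orP; right; by apply: ereal_sup_ubound; exists x.
Qed.

Lemma conv_rep_bound b : Cc (R := R) b -> ((Cre `|conv_rep b|)%:E <= Inorm haar b)%E.
Proof.
move=> cb; have [u hu] := apx_Cc L_regular L_finite cb.
have [l1 [n [vb vu]] _ c1] := hu; have hc := apx_cauchy hu.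
have I0 : (0 <= Inorm haar b)%E.
  rewrite /Inorm le_max; apply/orP; left.
  apply: (@le_trans _ _ (\int[haar x0]_c (Cre `|b c|)%:E)%E).
    by apply: integral_ge0 => e _; rewrite lee_fin; exact: (nn_ge0 (b e)).
  by apply: ereal_sup_ubound; exists x0.
rewrite (conv_repE hu).
case E : (Inorm haar b) I0 => [I| |] // I0; last exact: leey.
rewrite lee_fin in I0 *; change (nn (qpi ((fun i => conv (u i)) : S)) <= I).
rewrite nn_qpi //; apply/ler_addgt0Pr => e e0.
have [r r0 hr] := bmass_small n e0; have [N hN] := c1 _ r0.
apply: (rlim_le (oplimP hc) (rlim_const (I + e))); exists N => i /hN hi.
apply: opn_le; first exact: conv_opdom.
apply: conv_bnd => //; first by rewrite addr_ge0 // ltW.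
(* Splitting off [b] leaves a remainder of small $I$-norm, so the approximating operators are
   bounded by [I + e]. *)
have -> : u i = b \+ (u i \+ (fun c => -1 * b c)).
  by apply: funext => c /=; rewrite mulN1r addrCA subrr addr0.
have cd : Cc (R := R) (u i \+ (fun c => -1 * b c)).
  by apply: Cc_add; [exact: loc_Cc|exact: Cc_scale].
have [cb1 _] := cb; have [cd1 _] := cd.
apply: (le_trans (Inorm_tri cb1 cd1)); rewrite E EFinD leeD2l //.
apply: (@le_trans _ _ (r * bmass t a n)%:E); last by rewrite lee_fin ltW.
apply: (Inorm_le L_regular L_finite t0 a0 hmu hhaar) => //.
- exact: ltW.
- by move=> g hg /=; rewrite vb // vu // mulr0 addr0.
- by move=> g /=; rewrite mulN1r (@nnB R C^o); exact: hi.
Qed.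

Lemma conv_rep_Cc : Cc_representation haar conv_rep.
Proof.
split; last exact: conv_rep_bound.
- move=> b b' /(apx_Cc L_regular L_finite) [u hu] /(apx_Cc L_regular L_finite) [v hv].
  have hs := apxD hu hv; rewrite (conv_repE hs) (conv_repE hu) (conv_repE hv).
  rewrite [RHS](QD (apx_cauchy hu) (apx_cauchy hv)); apply: pi_form.
  + exact: apx_cauchy hs.
  + exact: (@cauchy_opD R V _ _ (apx_cauchy hu) (apx_cauchy hv)).
  move=> i x y hx hy.
  by case: hu => l1 _ _ _; case: hv => l2 _ _ _;
    exact: (congr1 (fun z => @ph_form R V z y) (convDl (l1 i) (l2 i) hx)).
- move=> z b /(apx_Cc L_regular L_finite) [u hu].
  have hs := apxZ z hu; rewrite (conv_repE hs) (conv_repE hu).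
  rewrite [RHS](QZ z (apx_cauchy hu)); apply: pi_form.
  + exact: apx_cauchy hs.
  + exact: (@cauchy_opZ R V _ _ (apx_cauchy hu)).
  move=> i x y hx hy.
  by case: hu => l1 _ _ _;
    exact: (congr1 (fun f => @ph_form R V f y) (convZl z (l1 i) hx)).
- move=> b b' /(apx_Cc L_regular L_finite) [u hu] /(apx_Cc L_regular L_finite) [v hv].
  have hs := apx_conv L_regular L_finite t0 a0 hmu hhaar hu hv.
  rewrite (conv_repE hs) (conv_repE hu) (conv_repE hv).
  rewrite [RHS](bmulE (apx_cauchy hu) (apx_cauchy hv)); apply: pi_form.
  + exact: apx_cauchy hs.
  + exact: (@cauchy_opM R V _ _ (apx_cauchy hu) (apx_cauchy hv)).
  move=> i x y hx hy.
  case: hu => l1 _ _ _; case: hv => l2 _ _ _.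
  exact: (congr1 (fun f => @ph_form R V f y)
    (esym (conv_assoc L_regular L_finite hmu hhaar (l1 i) (l2 i) hx))).
move=> b /(apx_Cc L_regular L_finite) [u hu].
have hs := apx_inv hu; rewrite (conv_repE hs) (conv_repE hu).
rewrite [RHS](bstarE (apx_cauchy hu)); apply: pi_form.
- exact: apx_cauchy hs.
- exact: (@cauchy_op_star R V _ (apx_cauchy hu)).
move=> i x y hx hy; have [l1 _ _ _] := hu.
rewrite [RHS](adj_form i (apx_cauchy hu) hx hy).
have [m aa] := conv_isadj (l1 i).
by rewrite [X in X^*](aa y x hy hx) -(ph_herm hy (m _ hx)).
Qed.

End LocalRepresentation.

(** * Matrix units and the projection in $S$ *)

Section StableUnits.
Variables (R : realType) (k : nat) (L : kgraph k) (L_regular : regular_kgraph L).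
Hypothesis L_finite : finite_set [set: kobj L].
Local Notation C := (Cx R).
Local Notation cstn := (cstn k).
Local Notation cz := (cz k).
Local Notation G := (stable_groupoid L).
Local Notation "a ** b" := (cmul a b) (at level 40, left associativity).
Local Notation "a ^#" := (cstar a) (at level 2, format "a ^#").
Implicit Types (i j l m v : kmor L) (n p q : nat).
Implicit Types (F : kmor L -> kmor L -> C).
Variables (t : 'I_k -> R) (a : kobj L -> R).
Hypotheses (t0 : forall i : 'I_k, 0 < t i) (a0 : forall w : kobj L, 0 < a w).
Variables (mu : forall x : dpath L, {measure set (borel x) -> \bar R})
  (haar : forall x : gobj G, {measure set (borel (gid x)) -> \bar R}).
Hypotheses (hmu : is_past_measure t a mu) (hhaar : is_stable_haar t mu haar).
Variables (S : cstar_algebra R) (iota : (stab L -> C) -> S).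
Hypothesis hiota : is_groupoid_algebra haar iota.
Local Notation wm := (wmul t a).
Local Notation um := (@iota_mf R k L S iota).

Let uM := um_mul L_regular L_finite hmu hhaar hiota.
Let uS := um_star L_regular L_finite hiota.
Let uZ := umZ L_regular L_finite hiota.
Let uE := um_ext L_regular L_finite iota.

Definition dl i j : kmor L -> kmor L -> C := fun l m => ((l == i) && (m == j))%:R.

Lemma wmul_delta n q i j j' l (x y : kmor L) : j \in lv L (cstn q) -> ks j = ks x ->
  wm n q (dl i j) (dl j' l) x y = (if j == j' then rC (wt t a n q j) else 0) * dl i l x y.
Proof.
move=> hj e; rewrite /wmul big_mkcond (bigD1_seq j) ?uniq_lv //= [X in _ + X]big1 ?addr0.
  rewrite e eqxx /dl; have [_|_] := eqVneq j j'; last by rewrite !(mulr0, mul0r).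
  by rewrite eqxx andbT -natrM mulnb.
by move=> v vj; rewrite /dl (negPf vj) andbF mul0r mulr0; case: ifP.
Qed.

Lemma um_delta_mul n p q r i j j' l : j \in lv L (cstn q) -> ks i = ks j ->
  um n p q (dl i j) ** um n q r (dl j' l) =
  (if j == j' then rC (wt t a n q j) else 0) *: um n p r (dl i l).
Proof.
move=> hj e; rewrite uM uZ; apply: uE => x y hx hy exy.
have [xi|xi] := eqVneq x i.
  by rewrite wmul_delta // -e xi.
rewrite [dl i l x y]/dl (negPf xi) mulr0 /wmul big1 // => v _.
by rewrite /dl (negPf xi) mul0r mulr0.
Qed.

(** $S$ dominates the regular representation at a path [y] with window [l]. There, convolution by
    the function [b] sends [b] to a positive multiple of itself, whose inner product with itself is
    not 0. *)
Lemma um_delta_neq0 n l : kdeg l = cstn n -> um n n n (dl l l) != 0.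
Proof.
move=> dl_; have [y hy] := path_with_past L_regular n dl_.
have hr := conv_rep_Cc L_regular L_finite t0 a0 hmu hhaar y.
have [_ _ hu] := hiota.
pose b := mf n n n (dl l l).
have cb : Cc (R := R) b := mf_Cc L_regular L_finite n n n (dl l l).
apply/eqP => h0; have lb : loc b by exact: loc_mf.
have := hu _ _ hr b cb; rewrite [iota b]h0 normr0 nnE -rC0 rC_le => h.
have hcu : apx b (fun=> b).
  split=> //.
  - by exists n; split=> [g|_ g]; rewrite /b => hg; rewrite mf_out.
  - have [K hK] := mf_bounded L_regular L_finite n n n (dl l l).
    by exists K => _ g; exact: hK.
  by move=> e e0; exists 0%N => _ _ g; rewrite subrr nn0 ltW.
move: h; rewrite (conv_repE L_regular L_finite t0 a0 hmu hhaar y hcu).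
have od := conv_opdom L_regular L_finite t0 a0 hmu hhaar y lb.
set V := local_space _ _ _ _ _ _ _ in od *.
rewrite (nn_bop od : nn (qpi ((fun=> convolution haar b) : op_space V)) = _) => h.
have e0 : opn (V := V) (convolution haar b) = 0.
  by apply: le_anti; rewrite h (opn_ge0 od).
have [_ /(_ b lb)] := opn_bnd od; rewrite e0 mul0r => h1.
have ec : convolution haar b b = mf n n n (wm n n (dl l l) (dl l l)).
  exact: (convolution_mf L_regular L_finite hmu hhaar).
have lc : loc (convolution haar b b) by rewrite ec; exact: loc_mf.
have h2 : phn (V := V) (convolution haar b b) = 0 by apply: le_anti; rewrite h1 phn_ge0.
have : @ph_form R V (convolution haar b b) (convolution haar b b) = 0.
  by rewrite (phqE (V := V)) // -phn_sqr // h2 expr0n rC0.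
have hl : l \in lv L (cstn n) by rewrite mem_lv // dl_.
rewrite local_form ec (lform_mf L_regular L_finite hmu hhaar) /colsum hy.
rewrite big_mkcond (bigD1_seq l) ?uniq_lv //= eqxx big1 ?addr0; last first.
  move=> v vl; case: eqP => // e; rewrite wmul_delta //.
  by rewrite /dl (negPf vl) mulr0 mul0r mulr0.
rewrite wmul_delta // eqxx /dl !eqxx mulr1 rC_conj -!rCM.
move: (wt t a n n l) (wt_gt0 t0 a0 n n l) => w w0 /eqP.
by rewrite rC_eq0 !mulf_eq0 !orbb gt_eqF.
Qed.

(** When the window length equals the level, the powers of $t$ cancel and the weight is $a(r(v))$,
    which does not change when $v$ is extended on the right. Dividing by these square roots
    therefore normalizes all levels compatibly. *)
Definition qa l : R := Num.sqrt (a (kr l)).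

Lemma qa_gt0 l : 0 < qa l. Proof. by rewrite sqrtr_gt0. Qed.

Lemma qa_sqr l : qa l * qa l = a (kr l).
Proof. by rewrite -expr2 sqr_sqrtr // ltW. Qed.

Definition su n l m : S := rC (qa l * qa m)^-1 *: um n n n (dl l m).

Lemma winS (x : dpath L) n :
  win x n.+1 n.+1 = cmp (win x n n) (sg x (cz n) (cstn 1)) /\
  ks (win x n n) = kr (sg x (cz n) (cstn 1)).
Proof.
split; last by rewrite win_s sg_r.
rewrite /win; have -> : cz n.+1 - cz n.+1 = cz n - cz n by zz.
have -> : cstn n.+1 = cstn n + cstn 1 by zz.
by rewrite sgD subrr add0r.
Qed.

(** A pair of level [n] with pasts [l] and [m] takes a common next step [i], so at level [n.+1] its
    pasts are the composites with [i]. *)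
Lemma dl_refine n l m : l \in lv L (cstn n) -> m \in lv L (cstn n) -> ks l = ks m ->
  mf n n n (dl l m) =
  mf n.+1 n.+1 n.+1 (fun x y => \sum_(i <- out (cstn 1) (ks l)) dl (cmp l i) (cmp m i) x y).
Proof.
rewrite !mem_lv // => /eqP dl_ /eqP dm e; apply: funext => g.
have [h'|h'] := pselect (level n.+1 g); last first.
  by rewrite !mf_out // => h; apply: h'; exact: level_le (leqnSn n) h.
rewrite [RHS]mf_in //.
have [e1 r1] := winS (stab_r g) n; have [e2 r2] := winS (stab_s g) n.
rewrite e1 e2; have dg1 : kdeg (win (stab_r g) n n) = kdeg l by rewrite win_deg.
have dg2 : kdeg (win (stab_s g) n n) = kdeg m by rewrite win_deg.
have key i : i \in out (cstn 1) (ks l) ->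
    dl (cmp l i) (cmp m i) (cmp (win (stab_r g) n n) (sg (stab_r g) (cz n) (cstn 1)))
      (cmp (win (stab_s g) n n) (sg (stab_s g) (cz n) (cstn 1))) =
    [&& win (stab_r g) n n == l, win (stab_s g) n n == m,
        sg (stab_r g) (cz n) (cstn 1) == i & sg (stab_s g) (cz n) (cstn 1) == i]%:R.
  rewrite mem_out // => /andP[_ /eqP ri]; rewrite /dl; congr (_%:R); congr nat_of_bool.
  apply/andP/and4P => [[/eqP h1 /eqP h2]|[/eqP -> /eqP -> /eqP -> /eqP ->]]; last by [].
  have [-> ->] := cmp_inj r1 (esym ri) dg1 h1.
  have [-> ->] := cmp_inj r2 (etrans (esym e) (esym ri)) dg2 h2.
  by rewrite !eqxx.
rewrite (eq_big_seq _ key).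
have hl := level_split (leqnSn n) h'; rewrite subSnn in hl.
have [h|h] := pselect (level n g); last first.
  rewrite mf_out // big1_seq // => i _; case: and4P => // -[_ _ /eqP q1 /eqP q2].
  by case: h; apply/hl; rewrite q1 q2.
have es := hl.1 h; rewrite mf_in // /dl.
case: eqP => [w1|_] /=; last by rewrite big1.
case: eqP => [w2|_] /=; last by rewrite big1.
have hi : sg (stab_r g) (cz n) (cstn 1) \in out (cstn 1) (ks l).
  by rewrite mem_out // sg_deg -r1 w1 !eqxx.
rewrite (bigD1_seq _ hi) ?uniq_out //= -es !eqxx big1 ?addr0 // => i.
by rewrite eq_sym => /negPf ->.
Qed.

Lemma su_system : unit_system su.
Proof.
split=> [n|n l m hl hm e]; last first.
  rewrite /su {1}/iota_mf (dl_refine hl hm e) -/(um n.+1 n.+1 n.+1 _).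
  rewrite -(um_sum L_regular L_finite hiota n.+1 n.+1 n.+1 _ xpredT) scaler_sumr.
  by apply: eq_bigr => i _; rewrite /qa !cmp_r.
split.
- move=> i j x y hi hj hx hy e e'; rewrite /su cmulZl cmulZr um_delta_mul // scalerA scalerA.
  case: eqP => [<-|_]; last by rewrite mulr0 scale0r.
  rewrite -!rCM wt_diag // -qa_sqr; congr (rC _ *: _).
  have := qa_gt0 i; have := qa_gt0 j; have := qa_gt0 y => ? ? ?.
  by field; rewrite !gt_eqF.
- move=> i j hi hj e; rewrite /su cstarZ rC_conj uS mulrC; congr (_ *: _).
  by apply: uE => x y _ _ _; rewrite /dl andbC conjC_nat.
- move=> i; rewrite mem_lv // => /eqP hi; rewrite /su scaler_eq0 negb_or um_delta_neq0 // andbT.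
  by rewrite rC_eq0 invr_eq0 mulf_eq0 orbb gt_eqF // qa_gt0.
Qed.

Lemma su_mcomb n c : mcomb (lv L (cstn n)) (@ks k L) (su n) c =
  um n n n (fun l m => rC (qa l * qa m)^-1 * c l m).
Proof.
rewrite /mcomb; under eq_bigr => l _ do (under eq_bigr => m _ do rewrite /su scalerA uZ;
  rewrite (um_sum L_regular L_finite hiota)).
rewrite (um_sum L_regular L_finite hiota); apply: uE => x y hx hy exy.
rewrite (bigD1_seq x) ?uniq_lv //= [X in _ + X]big1 ?addr0; last first.
  by move=> i ix; rewrite big1 // => j _; rewrite /dl eq_sym (negPf ix) mulr0.
rewrite big_mkcond (bigD1_seq y) ?uniq_lv //= -exy eqxx big1 ?addr0; last first.
  by move=> j jy; rewrite /dl [y == j]eq_sym (negPf jy) andbF mulr0; case: ifP.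
by rewrite /dl !eqxx mulr1 mulrC.
Qed.

Lemma su_level n F : um n n n F =
  mcomb (lv L (cstn n)) (@ks k L) (su n) (fun l m => rC (qa l * qa m) * F l m).
Proof.
rewrite su_mcomb; apply: uE => x y _ _ _; rewrite mulrA -rCM mulVf ?mul1r ?rC1 ?mul1r //.
by rewrite gt_eqF // mulr_gt0 // qa_gt0.
Qed.

(* The projection onto pairs that agree from 0 on, weighted to be idempotent. *)
Definition ecoef : kmor L -> kmor L -> C := fun l m => rC (a (kr l))^-1 * (l == m)%:R.
Definition sproj : S := um 0 0 0 ecoef.

Lemma ecoef_next n : mf n n n ecoef = mf n.+1 n.+1 n.+1 ecoef.
Proof.
apply: funext => g.
have [h'|h'] := pselect (level n.+1 g); last first.
  by rewrite !mf_out // => h; apply: h'; exact: level_le (leqnSn n) h.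
rewrite [RHS]mf_in //.
have [e1 r1] := winS (stab_r g) n; have [e2 r2] := winS (stab_s g) n.
have hl := level_split (leqnSn n) h'; rewrite subSnn in hl.
rewrite e1 e2 /ecoef cmp_r.
have [h|h] := pselect (level n g).
  rewrite mf_in //; congr (_ * (nat_of_bool _)%:R); rewrite (hl.1 h).
  apply/eqP/eqP => [->//|e].
  have dd : kdeg (win (stab_r g) n n) = kdeg (win (stab_s g) n n) by rewrite !win_deg.
  by rewrite (hl.1 h) in r1; case: (cmp_inj r1 r2 dd e).
rewrite mf_out //; case: eqP => [e|_]; last by rewrite mulr0.
have dd : kdeg (win (stab_r g) n n) = kdeg (win (stab_s g) n n) by rewrite !win_deg.
by case: h; apply/hl; case: (cmp_inj r1 r2 dd e).
Qed.

(** Paths agree from 0 on iff they agree on the window back to 0 and from [cz n] on. So at every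
    level the projection is, up to weights, the identity matrix on windows reaching back to 0, and
    it acts as a unit on such windows. *)
Lemma sprojE n : sproj = um n n n ecoef.
Proof. by elim: n => // n IH; rewrite IH /iota_mf ecoef_next. Qed.

Lemma ecoef_wmul_l n l m F : l \in lv L (cstn n) ->
  wm n n ecoef F l m = F l m.
Proof.
move=> hl; rewrite /wmul big_mkcond (bigD1_seq l) ?uniq_lv //= eqxx big1 ?addr0.
  rewrite /ecoef eqxx mulr1 mulrA -rCM wt_diag // divff ?mul1r ?rC1 ?mul1r //.
  by rewrite gt_eqF.
by move=> v vl; rewrite /ecoef [l == v]eq_sym (negPf vl) mulr0 mul0r mulr0; case: ifP.
Qed.

Lemma ecoef_wmul_r n l m F : m \in lv L (cstn n) -> ks l = ks m ->
  wm n n F ecoef l m = F l m.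
Proof.
move=> hm e; rewrite /wmul big_mkcond (bigD1_seq m) ?uniq_lv //= e eqxx big1 ?addr0.
  rewrite /ecoef eqxx mulr1 mulrCA -rCM wt_diag // divff ?rC1 ?mulr1 //.
  by rewrite gt_eqF.
by move=> v vl; rewrite /ecoef (negPf vl) !mulr0; case: ifP.
Qed.

Lemma um_sproj_r n p F : um n p n F ** sproj = um n p n F.
Proof.
by rewrite (sprojE n) uM; apply: uE => l m hl hm e; rewrite ecoef_wmul_r.
Qed.

Lemma um_sproj_l n q F : sproj ** um n n q F = um n n q F.
Proof. by rewrite (sprojE n) uM; apply: uE => l m hl hm e; rewrite ecoef_wmul_l. Qed.

Lemma sproj_star : sproj^# = sproj.
Proof.
rewrite /sproj uS; apply: uE => l m _ _ _; rewrite /ecoef conjM rC_conj conjC_nat.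
by rewrite eq_sym; case: eqP => [->|]; rewrite ?mulr0.
Qed.

Lemma sproj_idem : sproj ** sproj = sproj.
Proof. by rewrite {1}/sproj um_sproj_r. Qed.

(** Multiplication by the projection shortens the source window to the part after time 0. *)
Lemma um_cut_r n p q F : (n <= q)%N -> exists F', um n p q F ** sproj = um n p n F'.
Proof.
move=> h; rewrite (sprojE n).
have -> : um n n n ecoef = um n q n (mraise n n n n q n ecoef) by apply: um_raise; lia.
by rewrite uM; eexists.
Qed.

Lemma um_cut_l n p q F : (n <= p)%N -> exists F', sproj ** um n p q F = um n n q F'.
Proof.
move=> h; rewrite (sprojE n).
have -> : um n n n ecoef = um n n p (mraise n n n n n p ecoef) by apply: um_raise; lia.
by rewrite uM; eexists.
Qed.

End StableUnits.

(** * Morita equivalence with a full corner *)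

Section Corner.
Variables (R : realType) (S F : cstar_algebra R) (e : S) (psi : F -> S).
Local Notation C := (Cx R).
Local Notation "a ** b" := (cmul a b) (at level 40, left associativity).
Local Notation "a ^#" := (cstar a) (at level 2, format "a ^#").
Hypotheses (es : e^# = e) (ee : e ** e = e) (hpsi : star_hom psi)
  (psi_nn : forall b, nn (psi b) = nn b)
  (psi_im : forall x, (exists b, x = psi b) <-> e ** x = x /\ x ** e = x).

Lemma left_ideal_complete (u : nat -> S) : (forall n, u n ** e = u n) ->
  (forall d : R, 0 < d -> exists N, forall m n, (N <= m)%N -> (N <= n)%N ->
     nn (u m - u n) < d) ->
  exists2 l, l ** e = l & forall d : R, 0 < d -> exists N, forall n,
    (N <= n)%N -> nn (l - u n) < d.
Proof.
move=> hu cu; have [l hl] := @complete_nn R S u cu; exists l => //.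
apply: (lim_nn_uniq (u := u)) => //.
by apply: lim_ext (lim_mul hl (lim_const e)).
Qed.

(** The seminorm is already a norm on $Se$; the general quotient is used only to obtain $Se$ as a
    Banach space. *)
Definition left_ideal : snspace R.
Proof.
refine (@SNSpace R S [set x | x ** e = x] (@nn R S) _ _ _ _ _ left_ideal_complete).
- by rewrite /= cmul0l.
- by move=> x y /= hx hy; rewrite cmulDl hx hy.
- by move=> z x /= hx; rewrite cmulZl hx.
- by move=> x y _ _; exact: nnD.
- by move=> z x _; exact: nnZ.
Defined.

Local Notation X := (quo_space left_ideal).
Local Notation "[ 'pi' x ]" := (@qpi R left_ideal x) (at level 0, x at level 99).
Let rep (x : X) : S := qrep x.

Lemma rep_e x : rep x ** e = rep x.
Proof. exact: (@qrep_dom R left_ideal x). Qed.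

Lemma rep_pi x : x ** e = x -> rep [pi x] = x.
Proof.
move=> hx; have [_ _ h] := @qrep_pi R left_ideal x hx.
by apply/esym/eqP; rewrite -subr_eq0; apply/eqP/nn0_eq.
Qed.

Lemma pi_rep x : [pi (rep x)] = x. Proof. exact: (@qrepK R left_ideal). Qed.

Lemma rep_inj x y : rep x = rep y -> x = y.
Proof. by move=> h; rewrite -(pi_rep x) h pi_rep. Qed.

Lemma repD x y : rep (x + y) = rep x + rep y.
Proof.
rewrite -{1}(pi_rep x) -{1}(pi_rep y) -(@qpiD R left_ideal); try exact: rep_e.
by rewrite rep_pi // cmulDl !rep_e.
Qed.

Lemma repZ (z : C) x : rep (z *: x) = z *: rep x.
Proof.
rewrite -{1}(pi_rep x) -(@qpiZ R left_ideal); last exact: rep_e.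
by rewrite rep_pi // cmulZl rep_e.
Qed.

Lemma rep_nn x : nn x = nn (rep x).
Proof. by rewrite -{1}(pi_rep x) (@nn_qpi R left_ideal) //; exact: rep_e. Qed.

Let psiD a b : psi (a + b) = psi a + psi b. Proof. by case: hpsi. Qed.
Let psiZ z a : psi (z *: a) = z *: psi a. Proof. by case: hpsi. Qed.
Let psiM a b : psi (cmul a b) = psi a ** psi b. Proof. by case: hpsi. Qed.
Let psiS a : psi (cstar a) = (psi a)^#. Proof. by case: hpsi. Qed.

Lemma psi_inj a b : psi a = psi b -> a = b.
Proof.
move=> h; apply/eqP; rewrite -subr_eq0; apply/eqP/nn0_eq.
by rewrite -psi_nn -scaleN1r psiD psiZ scaleN1r h subrr nn0.
Qed.

Lemma psi_e b : e ** psi b = psi b /\ psi b ** e = psi b.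
Proof. by apply/psi_im; exists b. Qed.

Lemma rip_ex (x y : X) : exists b, psi b = (rep x)^# ** rep y.
Proof.
have [|b hb] := (psi_im ((rep x)^# ** rep y)).2; last by exists b.
split; last by rewrite -cmulA rep_e.
by rewrite cmulA -{1}es -cstarM rep_e.
Qed.

Definition crip (x y : X) : F := sval (cid (rip_ex x y)).
Lemma cripP x y : psi (crip x y) = (rep x)^# ** rep y.
Proof. by rewrite /crip; case: cid. Qed.

Definition clip (x y : X) : S := rep x ** (rep y)^#.
Definition cla (a : S) (x : X) : X := [pi (a ** rep x)].
Definition cra (x : X) (b : F) : X := [pi (rep x ** psi b)].

Lemma rep_la a x : rep (cla a x) = a ** rep x.
Proof. by apply: rep_pi; rewrite -cmulA rep_e. Qed.

Lemma rep_ra x b : rep (cra x b) = rep x ** psi b.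
Proof. by apply: rep_pi; rewrite -cmulA (psi_e b).2. Qed.

Hypothesis full : forall (a : S) (d : R), 0 < d -> exists n (x y : 'I_n -> S),
  (forall i, x i ** e = x i /\ y i ** e = y i) /\
  nn (a - \sum_(i < n) x i ** (y i)^#) < d.
(** Positivity in [F] requires a square root in the corner itself, while [x] only lies in $Se$;
    [left_gram_le] and [corner_sqrt] supply it. *)
Hypothesis pos : forall x, x ** e = x -> exists b, x^# ** x = psi (cmul (cstar b) b).

(** The bimodule is $Se$ with inner products $xy^*$ in $S$ and $x^*y$ in $eSe$, the latter
    identified with [F] by [psi]; all axioms become associativity in $S$ except fullness and
    positivity. *)
Lemma corner_morita : strongly_morita_equivalent S F.
Proof.
exists X, cla, cra, clip, crip; split.
- by move=> a a' x; apply: rep_inj; rewrite repD !rep_la cmulDl.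
- by move=> a x x'; apply: rep_inj; rewrite !(repD, rep_la) cmulDr.
- by move=> z a x; apply: rep_inj; rewrite !(repZ, rep_la) cmulZl.
- by move=> z a x; apply: rep_inj; rewrite !(repZ, rep_la) cmulZr.
- by move=> a a' x; apply: rep_inj; rewrite !rep_la cmulA.
- by move=> x x' b; apply: rep_inj; rewrite !(repD, rep_ra) cmulDl.
- by move=> x b b'; apply: rep_inj; rewrite !(repD, rep_ra) psiD cmulDr.
- by move=> z x b; apply: rep_inj; rewrite !(repZ, rep_ra) cmulZl.
- by move=> z x b; apply: rep_inj; rewrite !(repZ, rep_ra) psiZ cmulZr.
- by move=> x b b'; apply: rep_inj; rewrite !rep_ra psiM cmulA.
- by move=> a x b; apply: rep_inj; rewrite !(rep_ra, rep_la) cmulA.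
- by move=> x x' y; rewrite /clip repD cmulDl.
- by move=> z x y; rewrite /clip repZ cmulZl.
- by move=> x y; rewrite /clip cstarM cstarK.
- by move=> a x y; rewrite /clip rep_la cmulA.
- by move=> x; exists (rep x)^#; rewrite /clip cstarK.
- apply/seteqP; split=> // a _; apply/closure_nn => d d0.
  have [n [x [y [hxy h]]]] := full a d0.
  exists (\sum_(i < n) x i ** (y i)^#) => //.
  exists n, (fun i => [pi (x i)]), (fun i => [pi (y i)]).
  by apply: eq_bigr => i _; case: (hxy i) => h1 h2; rewrite /clip !rep_pi.
- by move=> x; rewrite !nnE /clip nn_starr -rep_nn rCX.
- by move=> x y y'; apply: psi_inj; rewrite psiD !cripP repD cmulDr.
- by move=> z x y; apply: psi_inj; rewrite psiZ !cripP repZ cmulZr.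
- by move=> x y; apply: psi_inj; rewrite psiS !cripP cstarM cstarK.
- by move=> x y b; apply: psi_inj; rewrite psiM !cripP rep_ra cmulA.
- move=> x; have [b hb] := pos (rep_e x); exists b; apply: psi_inj.
  by rewrite cripP hb.
- apply/seteqP; split=> // b _; apply: subset_closure.
  exists 1%N, (fun=> [pi e]), (fun=> [pi (psi b)]); rewrite big_ord1; apply: psi_inj.
  by rewrite cripP !rep_pi ?es ?(psi_e b).1 // (psi_e b).2.
- by move=> x; rewrite !nnE -psi_nn cripP nn_starl -rep_nn rCX.
- by move=> a x y; apply: psi_inj; rewrite !cripP !rep_la cstarM !cmulA.
- by move=> x b y; rewrite /clip !rep_ra psiS cstarM cstarK cmulA.
- by move=> x y z; apply: rep_inj; rewrite rep_la rep_ra cripP /clip cmulA.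
Qed.

End Corner.

(** * Positive operators *)

Section PositiveOperators.
Variables (R : realType) (V : prehilbert R).
Local Notation C := (Cx R).
Local Notation B := (bounded_ops V).
Local Notation D := (@ph_dom R V).
Local Notation "<< x , y >>" := (@ph_form R V x y).
Local Notation "a ** b" := (cmul a b) (at level 40, left associativity).
Local Notation "a ^#" := (cstar a) (at level 2, format "a ^#").
Implicit Types (T : ph_car V -> ph_car V) (b : B).

(** Elements given by one operator, not merely by a Cauchy sequence of operators; for them
    positivity can be expressed by the form. *)
Definition is_op b := exists2 T, @opdom R V T & b = bop T.
Definition psd b := exists T, [/\ @opdom R V T, b = bop T, isadj T T &
  forall x, D x -> 0 <= << T x, x >>].

Lemma opdom_id : @opdom R V id.
Proof.
split=> //; last by exists id; split.
by exists 1; split=> // x _; rewrite mul1r.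
Qed.

Lemma is_opD b b' : is_op b -> is_op b' -> is_op (b + b').
Proof. by move=> [T hT ->] [T' hT' ->]; exists (T + T'); [exact: opdomD|rewrite bopD]. Qed.

Lemma is_opZ (z : C) b : is_op b -> is_op (z *: b).
Proof. by move=> [T hT ->]; exists (z *: T); [exact: opdomZ|rewrite bopZ]. Qed.

Lemma is_op0 : is_op 0.
Proof. by exists 0; [exact: opdom0|rewrite bop0]. Qed.

Lemma is_op_sum (I : Type) (s : seq I) (P : pred I) (f : I -> B) :
  (forall i, is_op (f i)) -> is_op (\sum_(i <- s | P i) f i).
Proof.
move=> h; elim: s => [|i s IH]; first by rewrite big_nil; exact: is_op0.
by rewrite big_cons; case: ifP => // _; exact: is_opD.
Qed.

Lemma is_op_star b : is_op b -> is_op b^#.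
Proof.
move=> [T hT ->]; have h' := adj_dom hT; exists (adj T) => //.
exact: bop_star hT h' (adjP hT).
Qed.

Lemma psdD b b' : psd b -> psd b' -> psd (b + b').
Proof.
move=> [T [hT -> [m s] pT]] [T' [hT' -> [m' s'] pT']]; exists (T + T').
split; [exact: opdomD|by rewrite bopD| |move=> x hx].
  split=> [x hx|x y hx hy]; first by apply: ph_domD; [exact: m|exact: m'].
  rewrite [LHS](ph_formD (m _ hx) (m' _ hx) hy) [RHS](ph_formDr (m _ hy) (m' _ hy) hx).
  by rewrite s // s'.
by rewrite [X in 0 <= X](ph_formD (m _ hx) (m' _ hx) hx) addr_ge0 ?pT ?pT'.
Qed.

Lemma psd0 : psd 0.
Proof.
have e x : D x -> << (0 : ph_car V -> ph_car V) x, x >> = 0 by move=> hx; exact: ph_form0l.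
exists 0; split; [exact: opdom0|by rewrite bop0| |by move=> x hx; rewrite e].
split=> [x hx|x y hx hy]; first exact: ph_dom0.
rewrite [LHS](ph_form0l hy) [RHS](ph_herm (ph_dom0 V) hx).
by rewrite [X in X^*](ph_form0l hx) conj0.
Qed.

Lemma psd_sum (I : Type) (s : seq I) (f : I -> B) :
  (forall i, psd (f i)) -> psd (\sum_(i <- s) f i).
Proof.
move=> h; elim: s => [|i s IH]; first by rewrite big_nil; exact: psd0.
by rewrite big_cons; exact: psdD.
Qed.

Lemma psd_star_mul b : is_op b -> psd (b^# ** b).
Proof.
move=> [T hT ->]; have h' := adj_dom hT; have [m _ _] := hT.
have [ma sa] := adjP hT; have [_ aa] := isadj_sym m (adjP hT).
exists (adj T \o T); split; first exact: opdom_comp.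
- by rewrite (bop_star hT h' (adjP hT)) bop_mul.
- split=> [x hx|x y hx hy]; first exact/ma/m.
  by rewrite [LHS](aa _ _ (m _ hx) hy) [LHS](sa _ _ hx (m _ hy)).
move=> x hx.
by rewrite [X in 0 <= X](aa _ _ (m _ hx) hx); apply: ph_pos; exact: m.
Qed.

(* Cauchy-Schwarz for the form <x, (1 - T) y>, which is positive as 0 <= T <= 1. *)
Lemma psd_contr b : psd b -> nn b <= 1 -> nn (bop id - b : B) <= 1.
Proof.
move=> [T [hT -> [m s] pT]]; rewrite nn_bop // => h1.
have [_ hb] := opn_bnd hT.
have hb1 x : D x -> phn (T x) <= phn x.
  move=> hx; apply: (le_trans (hb x hx)); rewrite -[leRHS]mul1r.
  by apply: ler_wpM2r => //; exact: phn_ge0.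
have oid := opdom_id.
pose q x y : C := << x, y >> - << x, T y >>.
have qpos x : D x -> 0 <= q x x.
  move=> hx; have p : 0 <= << x, T x >> by rewrite -s // pT.
  rewrite /q subr_ge0 -(ger0_norm p) phqE // nnE rC_le.
  apply: (le_trans (cauchy_schwarz hx (m _ hx))).
  by rewrite -phn_sqr // expr2 ler_wpM2l ?phn_ge0 ?hb1.
have qle x : D x -> Cre (q x x) <= phq x.
  move=> hx; have p : 0 <= << x, T x >> by rewrite -s // pT.
  by rewrite /q CreD CreN gerDl oppr_le0 -rC_le Cre_real // rC0.
have qD x y z : D x -> D y -> D z -> q (x + y) z = q x z + q y z.
  move=> hx hy hz; rewrite /q !ph_formD //; last exact: m.
  by rewrite opprD addrACA.
have qZ (c : C) x z : D x -> D z -> q (c *: x) z = c * q x z.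
  by move=> hx hz; rewrite /q !ph_formZ ?mulrBr //; exact: m.
have qH x y : D x -> D y -> q y x = (q x y)^*.
  move=> hx hy; rewrite /q conjD conjN -(ph_herm hx hy) -(ph_herm hx (m _ hy)).
  by rewrite s.
pose V' := @PreHilbert R (ph_car V) D q (@ph_dom0 R V) (@ph_domD R V) (@ph_domZ R V)
  qD qZ qH qpos.
have oB : @opdom R V (id + (-1 : C) *: T) by apply: opdomD => //; exact: opdomZ.
have -> : bop id - bop T = bop (id + (-1 : C) *: T) :> B.
  by rewrite (bopD oid (opdomZ (-1) hT)) (bopZ (-1) hT) scaleN1r.
rewrite nn_bop //; apply: opn_le => //; split=> // x hx; rewrite mul1r.
have -> : (id + (-1 : C) *: T) x = x - T x by rewrite -scaleN1r.
set y := x - T x; have hy : D y by apply: ph_domB => //; exact: m.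
have e : << y, y >> = q x y by rewrite {1}/y ph_formB ?s //; exact: m.
have h2 : phn y ^+ 2 <= phn x * phn y.
  rewrite phn_sqr // /phq e; apply: (le_trans (ler_norm _)); apply: (le_trans (Cre_le_nn _)).
  apply: (le_trans (@cauchy_schwarz R V' x y hx hy)).
  by apply: ler_pM; rewrite ?phn_ge0 // /phn ler_wsqrtr // ?qle.
have := phn_ge0 y; rewrite le_eqVlt => /predU1P [<-|h0]; first exact: phn_ge0.
by rewrite -(ler_pM2r h0) -expr2.
Qed.

End PositiveOperators.

(** * Gram matrices *)

Section Gram.
Variables (R : realType) (k : nat) (L : kgraph k) (L_regular : regular_kgraph L).
Hypothesis L_finite : finite_set [set: kobj L].
Local Notation C := (Cx R).
Local Notation cstn := (cstn k).
Local Notation B := (bounded_ops (ell2 R (opath L))).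
Local Notation s := (@path_rep R k L).
Local Notation E := (ck_unit s).
Local Notation src := (@ks k L).
Local Notation "a ** b" := (cmul a b) (at level 40, left associativity).
Local Notation "a ^#" := (cstar a) (at level 2, format "a ^#").
Implicit Types (l m v : kmor L) (n p q : nat) (c d : kmor L -> kmor L -> C).

Lemma mcombB (A : cstar_algebra R) (r : seq (kmor L)) (U : kmor L -> kmor L -> A) c d :
  mcomb r src U c - mcomb r src U d = mcomb r src U (fun l m => c l m - d l m).
Proof.
rewrite /mcomb -sumrB; apply: eq_bigr => l _; rewrite -sumrB.
by apply: eq_bigr => m _; rewrite scalerBl.
Qed.

(** The coefficients of $c^*c$ for a rectangular matrix [c] whose rows are morphisms of degree
    $(p,\dots,p)$. *)
Definition gram p c : kmor L -> kmor L -> C := fun l m =>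
  \sum_(v <- lv L (cstn p) | ks v == ks l) (c v l)^* * c v m.

Section GramSum.
Variables (A : cstar_algebra R) (s : kmor L -> A).

Definition gvec n c v : A := \sum_(m <- lv L (cstn n) | ks m == ks v) c v m *: (s m)^#.

(** Each row of [c] contributes an element of the form $g^*g$, so in the path representation the
    combination is a positive operator. *)
Lemma gram_sum n p c : mcomb (lv L (cstn n)) src (ck_unit s) (gram p c) =
  \sum_(v <- lv L (cstn p)) (gvec n c v)^# ** gvec n c v.
Proof.
under [RHS]eq_bigr => v _ do rewrite {1}/gvec cstar_sum cmul_suml.
rewrite (exchange_big_dep xpredT) //=; apply: eq_bigr => l _.
transitivity (\sum_(v <- lv L (cstn p) | ks l == ks v)
  \sum_(m <- lv L (cstn n) | ks m == ks l) ((c v l)^* * c v m) *: ck_unit s l m).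
  rewrite exchange_big /=; apply: eq_bigr => m _; rewrite /gram scaler_suml.
  by apply: eq_bigl => v; rewrite eq_sym.
apply: eq_bigr => v /eqP e; rewrite cstarZ cstarK /gvec cmul_sumr -e.
by apply: eq_bigr => m _; rewrite cmulZl cmulZr scalerA.
Qed.

End GramSum.

Lemma path_rep_is_op l : is_op (s l).
Proof. by exists (shift_op l) => //; case: (shift_opP R L_regular l). Qed.

Lemma delta_mmul n c l m : l \in lv L (cstn n) ->
  mmul (lv L (cstn n)) src (fun l m => (l == m)%:R) c l m = c l m.
Proof.
move=> hl; rewrite /mmul big_mkcond (bigD1_seq l) ?uniq_lv //= !eqxx mul1r big1 ?addr0 //.
by move=> v vl; rewrite [l == v]eq_sym (negPf vl) mul0r; case: ifP.
Qed.

Lemma mcomb_ext (A : cstar_algebra R) n (U : kmor L -> kmor L -> A) c d :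
  (forall l m, l \in lv L (cstn n) -> m \in lv L (cstn n) -> ks l = ks m -> c l m = d l m) ->
  mcomb (lv L (cstn n)) src U c = mcomb (lv L (cstn n)) src U d.
Proof.
move=> h; rewrite /mcomb; apply: eq_big_seq => l hl.
rewrite big_seq_cond [RHS]big_seq_cond; apply: eq_bigr => m /andP[hm /eqP e].
by rewrite h.
Qed.

(** Norms of combinations do not depend on the algebra, so the estimate is made in the path
    representation. There the Gram element $T$ satisfies $0\le T\le1$, hence $\|1-T\|\le1$, and the
    identity matrix $P$ of the level gives $P-T=P(1-T)$. *)
Lemma gram_contr (A : cstar_algebra R) (U : nat -> kmor L -> kmor L -> A) n p c :
  unit_system U -> nn (mcomb (lv L (cstn n)) src (U n) (gram p c)) <= 1 ->
  nn (mcomb (lv L (cstn n)) src (U n) (fun l m => (l == m)%:R) -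
      mcomb (lv L (cstn n)) src (U n) (gram p c)) <= 1.
Proof.
move=> hU; have us := ck_unit_system L_regular L_finite (path_rep_ck R L_regular)
  (path_rep_neq0 R L_regular).
have hE := us_units us n; have hU' := us_units hU n.
rewrite mcombB !(mcomb_norm (uniq_lv _ _) _ hU' hE) -mcombB => h1.
set P := mcomb _ _ _ (fun l m => _); set T := mcomb _ _ _ (gram p c) in h1 *.
have Ps : P^# = P.
  rewrite -(mcomb_star _ hE); apply: mcomb_ext => l m _ _ _.
  by rewrite /mstar conjC_nat eq_sym.
have Pm d : P ** mcomb (lv L (cstn n)) src E d = mcomb (lv L (cstn n)) src E d.
  rewrite -(mcomb_mul (uniq_lv _ _) _ _ hE); apply: mcomb_ext => l m hl _ _.
  exact: delta_mmul.
have [P0 hP0 eP] : is_op P.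
  apply: is_op_sum => l; apply: is_op_sum => m; apply: is_opZ.
  have [S hS eS] := path_rep_is_op l; have [S' hS' eS'] := is_op_star (path_rep_is_op m).
  by exists (S \o S'); [exact: opdom_comp|rewrite bop_mul // -eS -eS'].
have Pi : P ** bop id = P.
  by rewrite eP -bop_mul //; exact: opdom_id.
have pT : psd T.
  rewrite /T gram_sum; apply: psd_sum => v; apply: psd_star_mul.
  apply: is_op_sum => m; apply: is_opZ; exact/is_op_star/path_rep_is_op.
have -> : P - T = P ** (bop id - T) by rewrite cmulBr Pi Pm.
apply: (le_trans (nn_mul _ _)); rewrite -[leRHS]mulr1.
apply: ler_pM; [exact: nn_ge0|exact: nn_ge0| |exact: psd_contr].
by apply: nn_proj => //; exact: Pm.
Qed.

End Gram.

(** * Positivity of the inner products $x^*x$ on $Se$ *)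

Section StablePositivity.
Variables (R : realType) (k : nat) (L : kgraph k) (L_regular : regular_kgraph L).
Hypothesis L_finite : finite_set [set: kobj L].
Local Notation C := (Cx R).
Local Notation cstn := (cstn k).
Local Notation G := (stable_groupoid L).
Local Notation "a ** b" := (cmul a b) (at level 40, left associativity).
Local Notation "a ^#" := (cstar a) (at level 2, format "a ^#").
Implicit Types (l m v : kmor L) (n p q : nat) (F X : kmor L -> kmor L -> C).
Variables (t : 'I_k -> R) (a : kobj L -> R).
Hypotheses (t0 : forall i : 'I_k, 0 < t i) (a0 : forall w : kobj L, 0 < a w).
Variables (mu : forall x : dpath L, {measure set (borel x) -> \bar R})
  (haar : forall x : gobj G, {measure set (borel (gid x)) -> \bar R}).
Hypotheses (hmu : is_past_measure t a mu) (hhaar : is_stable_haar t mu haar).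
Variables (S : cstar_algebra R) (iota : (stab L -> C) -> S).
Hypothesis hiota : is_groupoid_algebra haar iota.
Local Notation um := (@iota_mf R k L S iota).
Local Notation e := (@sproj R k L a S iota).
Local Notation su := (@su R k L a S iota).

Let uM := um_mul L_regular L_finite hmu hhaar hiota.
Let uS := um_star L_regular L_finite hiota.
Let uZ := umZ L_regular L_finite hiota.
Let uE := um_ext L_regular L_finite iota.
Let us := su_system L_regular L_finite t0 a0 hmu hhaar hiota.

Lemma sproj_mcomb n :
  e = mcomb (lv L (cstn n)) (@ks k L) (su n) (fun l m => (l == m)%:R).
Proof.
rewrite (su_mcomb L_regular L_finite a hiota) (sprojE a iota n).
apply: uE => l m _ _ _; rewrite /ecoef; case: eqP => [<-|]; last by rewrite !mulr0.
by rewrite (qa_sqr a0).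
Qed.

(** Absorbing the square roots of the weights into the coefficients turns the weighted product into
    a Gram matrix over the matrix units [su n]. *)
Lemma um_gram_le1 n p X : nn ((um n p n X)^# ** um n p n X) <= 1 ->
  nn (e - (um n p n X)^# ** um n p n X) <= 1.
Proof.
pose c v m : C := rC (Num.sqrt (wt t a n p v) * qa a m) * X v m.
have -> : (um n p n X)^# ** um n p n X = mcomb (lv L (cstn n)) (@ks k L) (su n) (gram p c).
  rewrite uS uM (su_level L_regular L_finite a0 hiota); apply: mcomb_ext => l m _ _ _.
  rewrite /wmul /gram mulr_sumr; apply: eq_bigr => v _.
  rewrite /c conjM rC_conj.
  have -> : rC (wt t a n p v) = rC (Num.sqrt (wt t a n p v)) * rC (Num.sqrt (wt t a n p v)).
    by rewrite -rCM -expr2 sqr_sqrtr // ltW // wt_gt0.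
  by rewrite !rCM; ring.
by rewrite (sproj_mcomb n); exact: gram_contr.
Qed.

Lemma um_gram_le n p X (r : R) : 0 < r -> nn ((um n p n X)^# ** um n p n X) <= r ->
  nn (rC r *: e - (um n p n X)^# ** um n p n X) <= r.
Proof.
move=> r0 h; pose z : C := rC (Num.sqrt r)^-1.
have s0 : 0 < Num.sqrt r by rewrite sqrtr_gt0.
have zz' : z^* * z = rC r^-1.
  rewrite /z rC_conj -rCM; congr rC; rewrite -invfM; congr (_^-1).
  by rewrite -expr2 sqr_sqrtr // ltW.
have := @um_gram_le1 n p (fun l m => z * X l m).
rewrite -uZ cstarZ cmulZl cmulZr scalerA zz'.
set y := (um n p n X)^# ** um n p n X in h *.
rewrite nnZ nn_rC ger0_norm ?invr_ge0 ?(ltW r0) // => h1.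
have {}h1 : nn (e - rC r^-1 *: y) <= 1.
  by apply: h1; rewrite mulrC ler_pdivrMr // mul1r.
have -> : rC r *: e - y = rC r *: (e - rC r^-1 *: y).
  by rewrite scalerBr scalerA -rCM divff ?rC1 ?scale1r // gt_eqF.
by rewrite nnZ nn_rC ger0_norm ?(ltW r0) // -[leRHS]mulr1 ler_wpM2l // ltW.
Qed.

Lemma left_dense x (d : R) : x ** e = x -> 0 < d ->
  exists n p X, nn (x - um n p n X) < d.
Proof.
move=> hx d0; have [N [F h]] := um_dense L_regular L_finite t0 a0 hmu hhaar hiota x d0.
have [|F' hF'] := um_cut_r L_regular L_finite hmu hhaar hiota (n := N)
  (q := (N + N)%N) (N + N)%N F; first by rewrite leq_addr.
exists N, (N + N)%N, F'; rewrite -hF' -hx -cmulBl.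
apply: le_lt_trans h; apply: (le_trans (nn_mul _ _)); rewrite -[leRHS]mulr1.
apply: ler_wpM2l; first exact: nn_ge0.
apply: nn_proj; first exact: (sproj_star L_regular L_finite a hiota).
exact: (sproj_idem L_regular L_finite t0 a0 hmu hhaar hiota).
Qed.

(** Approximate [x] by window functions in $Se$. The summand 1 leaves room for their squares to have
    norm at most [r] eventually, and the estimate of [um_gram_le] passes to the limit. *)
Lemma left_gram_le x : x ** e = x ->
  nn (rC (nn x ^+ 2 + 1) *: e - x^# ** x) <= nn x ^+ 2 + 1.
Proof.
move=> hx; set r := nn x ^+ 2 + 1.
have r0 : 0 < r by rewrite ltr_wpDl // sqr_ge0.
have hk i : exists y, [/\ nn (x - y) < i.+1%:R^-1 & exists n p X, y = um n p n X].
  have [|n [p [X h]]] := left_dense hx (d := i.+1%:R^-1); first by rewrite invr_gt0.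
  by exists (um n p n X); split=> //; exists n, p, X.
have [y hy] := choice hk.
have ly : lim_nn y x.
  move=> d /small_inv [N hN]; exists N => i /hN hi; case: (hy i) => h _.
  exact: lt_trans hi.
have lyy : lim_nn (fun i => (y i)^# ** y i) (x^# ** x) := lim_mul (lim_star ly) ly.
have [N hN] := lyy 1 ltr01.
have bnd i : (N <= i)%N -> nn ((y i)^# ** y i) <= r.
  move=> /hN hi; apply: (le_trans (nn_le_tri _ (x^# ** x))); rewrite /r lerD //.
    by rewrite nn_starl.
  by rewrite nnB ltW.
apply: (@lim_le R S (fun i => rC r *: e - (y (i + N)%N)^# ** y (i + N)%N)).
  apply: lim_add; first exact: lim_const.
  apply: lim_opp => d /lyy [M hM]; exists M => i hi; apply: hM.
  exact: leq_trans (leq_addr _ _).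
move=> i; have := bnd (i + N)%N (leq_addl _ _).
by case: (hy (i + N)%N) => _ [n [p [X ->]]]; exact: um_gram_le.
Qed.

End StablePositivity.

(** * The inclusion of the fixed point algebra is isometric *)

Section InjectiveIsometric.
Variables (R : realType) (k : nat) (L : kgraph k) (A F : cstar_algebra R).
Variables (s : kmor L -> A) (alpha : ('I_k -> Cx R) -> A -> A) (j : F -> A).
Hypotheses (ha : is_gauge_action s alpha) (hj : is_fixed_point_algebra alpha j).

Lemma fixed_points_subalgebra : star_subalgebra (fixed_points alpha).
Proof.
split=> [z hz|x y hx hy z hz|c x hx z hz|x y hx hy z hz|x hx z hz];
  have [[aD aZ aM aS] _ _] := ha hz.
- by rewrite -(scale0r (0 : A)) aZ !scale0r.
- by rewrite aD hx ?hy.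
- by rewrite aZ hx.
- by rewrite aM hx ?hy.
- by rewrite aS hx.
Qed.

(** Both the embedding and its inverse on the closed $*$-subalgebra of fixed points are
    $*$-homomorphisms, hence contractive. *)
Lemma fixed_embedding_isometric f : nn (j f) = nn f.
Proof.
have [[jD jZ jM jS] ji jr] := hj.
apply: le_anti; apply/andP; split.
  exact: (@star_hom_contr R F A setT j).
pose g (x : A) : F := xget 0 [set f | j f = x].
have jg x : fixed_points alpha x -> j (g x) = x.
  rewrite -jr => -[f' _ hf']; exact: (@xgetPex _ 0 [set f | j f = x]) (ex_intro _ f' hf').
have gj f' : g (j f') = f'.
  apply: ji; apply: jg; by rewrite -jr; exists f'.
have [D0 DD DZ DM DS] := fixed_points_subalgebra.
rewrite -{1}(gj f); apply: (@star_hom_contr R A F (fixed_points alpha) g) => //.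
- exact: (fixed_points_closed ha).
- by move=> x y hx hy; apply: ji; rewrite jD !jg //; exact: DD.
- by move=> c x hx; apply: ji; rewrite jZ !jg //; exact: DZ.
- by move=> x y hx hy; apply: ji; rewrite jM !jg //; exact: DM.
- by move=> x hx; apply: ji; rewrite jS !jg //; exact: DS.
by rewrite -jr; exists f.
Qed.

End InjectiveIsometric.

(** * Identification of $C^*(\Lambda)^\alpha$ with a full corner of $S$ *)

Section Assembly.
Variables (R : realType) (k : nat) (L : kgraph k) (L_regular : regular_kgraph L).
Hypothesis L_finite : finite_set [set: kobj L].
Local Notation C := (Cx R).
Local Notation cstn := (cstn k).
Local Notation G := (stable_groupoid L).
Local Notation "a ** b" := (cmul a b) (at level 40, left associativity).
Local Notation "a ^#" := (cstar a) (at level 2, format "a ^#").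
Implicit Types (l m v : kmor L) (n p q : nat) (W X : kmor L -> kmor L -> C).
Variables (t : 'I_k -> R) (a : kobj L -> R).
Hypotheses (t0 : forall i : 'I_k, 0 < t i) (a0 : forall w : kobj L, 0 < a w).
Variables (mu : forall x : dpath L, {measure set (borel x) -> \bar R})
  (haar : forall x : gobj G, {measure set (borel (gid x)) -> \bar R}).
Hypotheses (hmu : is_past_measure t a mu) (hhaar : is_stable_haar t mu haar).
Variables (S : cstar_algebra R) (iota : (stab L -> C) -> S).
Hypothesis hiota : is_groupoid_algebra haar iota.
Local Notation um := (@iota_mf R k L S iota).
Local Notation e := (@sproj R k L a S iota).
Local Notation su := (@su R k L a S iota).
Let hS := su_system L_regular L_finite t0 a0 hmu hhaar hiota.
Let uM := um_mul L_regular L_finite hmu hhaar hiota.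
Let es : e^# = e := sproj_star L_regular L_finite a hiota.
Let ee : e ** e = e := sproj_idem L_regular L_finite t0 a0 hmu hhaar hiota.
Let eul n q W : e ** um n n q W = um n n q W :=
  um_sproj_l L_regular L_finite t0 a0 hmu hhaar hiota n q W.
Let eur n p W : um n p n W ** e = um n p n W :=
  um_sproj_r L_regular L_finite t0 a0 hmu hhaar hiota n p W.

Definition rank_sum (z : S) : Prop := exists T : seq (S * S),
  (forall u, u \in T -> u.1 ** e = u.1 /\ u.2 ** e = u.2) /\
  z = \sum_(u <- T) u.1 ** u.2^#.

Lemma rank_sumD z z' : rank_sum z -> rank_sum z' -> rank_sum (z + z').
Proof.
move=> [T [h ->]] [T' [h' ->]]; exists (T ++ T'); rewrite big_cat; split=> // u.
by rewrite mem_cat => /orP[/h|/h'].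
Qed.

Lemma rank_sum0 : rank_sum 0.
Proof. by exists [::]; rewrite big_nil. Qed.

Lemma rank_sum1 x y : x ** e = x -> y ** e = y -> rank_sum (x ** y^#).
Proof.
by move=> hx hy; exists [:: (x, y)]; rewrite big_seq1; split=> // u; rewrite inE => /eqP ->.
Qed.

Lemma rank_sum_sum (I : eqType) (r : seq I) (f : I -> S) :
  (forall i, i \in r -> rank_sum (f i)) -> rank_sum (\sum_(i <- r) f i).
Proof.
elim: r => [|i r IH] h; first by rewrite big_nil; exact: rank_sum0.
rewrite big_cons; apply: rank_sumD; first by apply: h; rewrite mem_head.
by apply: IH => j hj; apply: h; rewrite inE hj orbT.
Qed.

(** A matrix unit with rows [l] and columns [m] factors through a window [i] of length [n] with the
    same source, which exists as $s$ is surjective; windows of length [n] are absorbed by the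
    projection. If the sources of [l] and [m] differ, the function is 0. *)
Lemma um_rank_sum n p q W : rank_sum (um n p q W).
Proof.
rewrite (um_delta_sum L_regular L_finite hiota).
apply: rank_sum_sum => l hl; apply: rank_sum_sum => m hm.
rewrite -[fun i j => _]/(dl R l m).
have [lm|lm] := pselect (ks l = ks m); last first.
  have -> : um n p q (dl R l m) = um n p q (fun _ _ => 0).
    apply: um_ext => // x y _ _ exy; rewrite /dl; case: eqP => //= ex; case: eqP => //= ey.
    by case: lm; rewrite -ex -ey.
  by rewrite (um0 L_regular L_finite hiota) scaler0; exact: rank_sum0.
have [_ [i [di si]] _ _] := L_regular (cstn n) (ks l).
have hi : i \in lv L (cstn n) by rewrite mem_lv // di.
have w0 : rC (wt t a n n i) != 0 by rewrite rC_eq0 gt_eqF // wt_gt0.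
have -> : W l m *: um n p q (dl R l m) = ((W l m / rC (wt t a n n i)) *: um n p n (dl R l i)) **
    (um n q n (dl R m i))^#.
  rewrite (um_star L_regular L_finite hiota).
  have -> : um n n q (fun x y => (dl R m i y x)^*) = um n n q (dl R i m).
    by apply: um_ext => // x y _ _ _; rewrite /dl conjC_nat andbC.
  rewrite cmulZl (um_delta_mul L_regular L_finite hmu hhaar hiota) // ?si // eqxx.
  by rewrite scalerA divfK.
by apply: rank_sum1; rewrite ?cmulZl eur.
Qed.

Lemma rank_sum_full x (d : R) : 0 < d -> exists n (y z : 'I_n -> S),
  (forall i, y i ** e = y i /\ z i ** e = z i) /\
  nn (x - \sum_(i < n) y i ** (z i)^#) < d.
Proof.
move=> d0; have [N [W]] := um_dense L_regular L_finite t0 a0 hmu hhaar hiota x d0.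
have [T [hT ->]] := um_rank_sum N (N + N) (N + N) W => h.
exists (size T), (fun i => (tnth (in_tuple T) i).1), (fun i => (tnth (in_tuple T) i).2).
split=> [i|]; first by apply: hT; exact: mem_tnth.
by move: h; rewrite (big_tuple _ _ (in_tuple T) xpredT (fun u => u.1 ** u.2^#)).
Qed.

Section FixedPoints.
Variables (A F : cstar_algebra R) (s : kmor L -> A) (alpha : ('I_k -> Cx R) -> A -> A).
Variable j : F -> A.
Hypotheses (hs : is_kgraph_algebra s) (ha : is_gauge_action s alpha)
  (hj : is_fixed_point_algebra alpha j).

Let s0 (v : kobj L) : s (kid v) != 0 := ck_neq0 L_regular v hs.
Let hck : ck_family s. Proof. by case: hs. Qed.
Let hgen : generates (range s). Proof. by case: hs. Qed.
Let hA := ck_unit_system L_regular L_finite hck s0.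
(** Relates the combinations of $s_\lambda s_\mu^*$ and of [su] with equal coefficients; its closure
    [r] is the graph of the isomorphism of the fixed points with the corner. *)
Let ur := unit_rel (fun=> ck_unit s) su.
Let iso : iso_rel ur := unit_rel_iso L_regular L_finite hA hS.
Let r := rel_clo ur.
Let ir : iso_rel r := iso_rel_clo iso.

Lemma corner_rel_dom x : fixed_points alpha x -> exists y, r x y.
Proof.
move=> fx; apply: (rel_clo_dom iso); apply/closure_nn => d d0.
have [n [c h]] := gauge_dense L_regular L_finite hck s0 hgen ha fx d0.
exists (mcomb (lv L (cstn n)) (@ks k L) (ck_unit s) c) => //=.
by exists (mcomb (lv L (cstn n)) (@ks k L) (su n) c), n, c.
Qed.

Lemma corner_rel_fixed x y : r x y -> fixed_points alpha x.
Proof.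
move=> /rel_clo_closure [h _]; apply: (fixed_points_closed ha).
apply: closureS h => x' [y' [n [c [-> _]]]].
exact: gauge_level_fixed.
Qed.

Lemma corner_closed : closed [set y : S | e ** y = y /\ y ** e = y].
Proof.
apply: closed_limP => u y hu hl; split; apply: (lim_nn_uniq (u := u)) => //.
  by apply: lim_ext (lim_mul (lim_const e) hl) => n; case: (hu n).
by apply: lim_ext (lim_mul hl (lim_const e)) => n; case: (hu n).
Qed.

Lemma corner_rel_corner x y : r x y -> e ** y = y /\ y ** e = y.
Proof.
move=> /rel_clo_closure [_ h]; apply: corner_closed.
apply: closureS h => y' [x' [n [c [_ ->]]]].
by rewrite (su_mcomb L_regular L_finite a hiota); split; [exact: eul|exact: eur].
Qed.

(** Cutting an approximation of [y] by the projection on both sides leaves windows reaching exactly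
    back to 0, that is a combination of the units [su], and does not increase the error. *)
Lemma corner_rel_ran y : e ** y = y -> y ** e = y -> exists x, r x y.
Proof.
move=> h1 h2; apply: (rel_clo_ran iso); apply/closure_nn => d d0.
have [N [W h]] := um_dense L_regular L_finite t0 a0 hmu hhaar hiota y d0.
have [|W1 hW1] := um_cut_r L_regular L_finite hmu hhaar hiota (n := N)
  (q := (N + N)%N) (N + N)%N W; first by rewrite leq_addr.
have [|W2 hW2] := um_cut_l L_regular L_finite hmu hhaar hiota (n := N)
  (p := (N + N)%N) N W1; first by rewrite leq_addr.
exists (um N N N W2).
  rewrite (su_level L_regular L_finite a0 hiota) /=.
  by eexists; exists N; eexists; split; first reflexivity.
rewrite -hW2 -hW1 -h1 -h2 -cmulBr -cmulBl; apply: le_lt_trans h.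
have e1 : nn e <= 1 by exact: nn_proj.
apply: (le_trans (nn_mul _ _)); rewrite -[leRHS]mul1r; apply: ler_pM; rewrite ?nn_ge0 //.
apply: (le_trans (nn_mul _ _)); rewrite -[leRHS]mulr1; apply: ler_pM; rewrite ?nn_ge0 //.
Qed.

(** Composing the embedding [j] with the relation [r] gives an isometric $*$-isomorphism of [F] onto
    the corner, and the corner is full by [rank_sum_full]. *)
Lemma stable_morita_fixed : strongly_morita_equivalent S F.
Proof.
have [[jD jZ jM jS] ji jr] := hj.
have jfix b : fixed_points alpha (j b) by rewrite -jr; exists b.
have [psi hpsi] := choice (fun b => corner_rel_dom (jfix b)).
have un := iso_rel_uniq ir.
have [rD rZ rM rS rN] := ir.
have psi_im x : (exists b, x = psi b) <-> e ** x = x /\ x ** e = x.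
  split=> [[b ->]|[h1 h2]]; first exact: corner_rel_corner (hpsi b).
  have [y hy] := corner_rel_ran h1 h2.
  have := corner_rel_fixed hy; rewrite -jr => -[b _ hb].
  by exists b; apply: (un y) => //; rewrite -hb.
have psi_hom : star_hom psi.
  split.
  - by move=> b b'; apply: (un (j (b + b'))) => //; rewrite jD; exact: rD.
  - by move=> z b; apply: (un (j (z *: b))) => //; rewrite jZ; exact: rZ.
  - by move=> b b'; apply: (un (j (cmul b b'))) => //; rewrite jM; exact: rM.
  - by move=> b; apply: (un (j (cstar b))) => //; rewrite jS; exact: rS.
have psi_nn b : nn (psi b) = nn b.
  by rewrite -(rN _ _ (hpsi b)) (fixed_embedding_isometric ha hj).
apply: (corner_morita es ee psi_hom psi_nn psi_im); first by move=> x d; exact: rank_sum_full.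
move=> x hx; have hg := left_gram_le L_regular L_finite t0 a0 hmu hhaar hiota hx.
set q := nn x ^+ 2 + 1 in hg; have q0 : 0 < q by rewrite ltr_wpDl // sqr_ge0.
(* After rescaling by [q] the element $x^*x$ is within distance 1 of the unit of the corner, so it
   has a self-adjoint square root there. *)
pose h := rC q^-1 *: (x^# ** x).
have ex : e ** x^# = x^# by rewrite -{1}es -cstarM hx.
have eh : e ** h = h by rewrite /h cmulZr cmulA ex.
have he : h ** e = h by rewrite /h cmulZl -cmulA hx.
have hsa : h^# = h by rewrite /h cstarZ rC_conj cstarM cstarK.
have h1 : nn (e - h) <= 1.
  have -> : e - h = rC q^-1 *: (rC q *: e - x^# ** x).
    by rewrite scalerBr scalerA -rCM mulVf ?rC1 ?scale1r // gt_eqF.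
  rewrite nnZ nn_rC ger0_norm ?invr_ge0 ?(ltW q0) //.
  by rewrite mulrC ler_pdivrMr // mul1r.
have [||||||||||||d [dD ds dd]] := @corner_sqrt R S [set y | e ** y = y /\ y ** e = y] e h.
- exact: corner_closed.
- by rewrite /= cmul0l cmul0r.
- by [].
- by [].
- by move=> u v [u1 u2] [v1 v2] /=; rewrite cmulDl cmulDr u1 u2 v1 v2.
- by move=> z u [u1 u2] /=; rewrite cmulZl cmulZr u1 u2.
- by move=> u v [u1 u2] [v1 v2] /=; rewrite cmulA u1 -cmulA v2.
- exact: es.
- exact: ee.
- exact: hsa.
- exact: eh.
- exact: h1.
have [b hb] := (psi_im d).2 dD; exists (rC (Num.sqrt q) *: b).
have [psiD psiZ psiM psiS] := psi_hom.
rewrite psiM psiS psiZ -hb cstarZ rC_conj ds cmulZl cmulZr dd !scalerA -!rCM.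
rewrite -expr2 sqr_sqrtr ?(ltW q0) // divff ?rC1 ?scale1r // gt_eqF //.
Qed.

End FixedPoints.
End Assembly.

Theorem theorem5p3 (R : realType) (k : nat) (k_gt0 : (0 < k)%N)
    (L : kgraph k) (L_regular : regular_kgraph L) :
  [/\ @groupoid_equivalence (stable_groupoid L) (tail_groupoid L) (zspace L)
        (@zrho k L) (@zsig k L) (@zlact k L) (@zract k L),
      amenable R (stable_groupoid L) &
      irreducible_kgraph L -> finite_set [set: kobj L] ->
      forall (t : 'I_k -> R) (a b : kobj L -> R),
        perron_frobenius t a b ->
      forall (mu : forall x : dpath L, {measure set (borel x) -> \bar R})
             (haar : forall x : gobj (stable_groupoid L),
                       {measure set (borel (gid x)) -> \bar R}),
        is_past_measure t a mu -> is_stable_haar t mu haar ->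
      forall (S : cstar_algebra R)
             (iota : (garr (stable_groupoid L) -> Cx R) -> S),
        is_groupoid_algebra haar iota ->
        (forall (A : cstar_algebra R) (s : kmor L -> A)
                (alpha : ('I_k -> Cx R) -> A -> A)
                (F : cstar_algebra R) (j : F -> A),
           is_kgraph_algebra s -> is_gauge_action s alpha ->
           is_fixed_point_algebra alpha j ->
           strongly_morita_equivalent S F) /\
        AF_algebra S].
Proof.
split; [exact: equivalence_z|exact: amenable_stable|].
move=> _ L_finite t a b [t0 ab0 _ _ _] mu haar hmu hhaar S iota hiota.
have a0 v : 0 < a v by case: (ab0 v).
split; last exact: (groupoid_algebra_AF L_regular L_finite t0 a0 hmu hhaar hiota).
move=> A s alpha F j hs ha hj.
exact: (stable_morita_fixed L_regular L_finite t0 a0 hmu hhaar hiota hs ha hj).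
Qed.
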